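(* There is a universal constant $C$ (independent of the dimension $n$, of $\mu$ and of $F$) such that the following holds. Let $\mu = e^{-V}dx$ be a probability measure on $\mathbb{R}^n$ with $\operatorname{Hess} V \geq \mathrm{I}_n$. For any $1$-Lipschitz function $F : \mathbb{R}^n \to \mathbb{R}$, there exist a direction $\sigma = \sigma(F) \in \mathbb{S}^{n-1}$ and a vector $p = p(F) \in \operatorname{Span}(\sigma)$ such that $$W_1(\mu, \gamma_{p,\sigma} \otimes \bar{\mu}) \leq C \sqrt{\operatorname{Var}_\mu(F)^{-1} - 1},$$ where $\gamma_{p,\sigma}$ is the standard Gaussian measure on $\operatorname{Span}(\sigma)$ with barycenter $p$, and $\bar{\mu}$ is the marginal distribution of $\mu$ on $\operatorname{Span}(\sigma)^{\perp}$. (If $\operatorname{Var}_\mu(F) = 0$, the right-hand side is read as $+\infty$.)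
   Context: Under the hypothesis $\operatorname{Hess} V \geq \mathrm{I}_n$ one has $\operatorname{Var}_\mu(F) \leq 1$ for every $1$-Lipschitz $F$. $W_1$ is the $L^1$ Kantorovich-Wasserstein distance (Euclidean cost). The standard Gaussian measure on the line $\operatorname{Span}(\sigma)$ with barycenter $p$ has mean $p$ and unit variance. The product $\gamma_{p,\sigma} \otimes \bar{\mu}$ is viewed as a measure on $\mathbb{R}^n = \operatorname{Span}(\sigma) \oplus \operatorname{Span}(\sigma)^{\perp}$. *)

(* Defs.v *)
From HB Require Import structures.
From mathcomp Require Import all_boot all_order all_algebra.
From mathcomp Require Import all_classical all_reals all_analysis.
From mathcomp Require Import measurable_realfun.

Set Implicit Arguments.
Unset Strict Implicit.
Unset Printing Implicit Defensive.

Import Order.TTheory GRing.Theory Num.Def Num.Theory.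
Import numFieldNormedType.Exports.

Local Open Scope classical_set_scope.
Local Open Scope ring_scope.

(* R^n is the type 'rV[R]_n.  It carries the product sigma-algebra, generated
   by the coordinates exactly as for n.-tuple R; it coincides with the Borel
   sigma-algebra. *)
Definition measure_rV_display : measure_display -> measure_display.
Proof. exact. Qed.

Section measurable_rV.
Context {d} {T : measurableType d}.
Variable n : nat.

Let coors : 'I_n -> 'rV[T]_n -> T := fun i x => x ord0 i.

Let rV_set0 : g_sigma_preimage coors set0.
Proof. exact: sigma_algebra0. Qed.

Let rV_setC A : g_sigma_preimage coors A -> g_sigma_preimage coors (~` A).
Proof. exact: sigma_algebraC. Qed.

Let rV_bigcup (F : _^nat) : (forall i, g_sigma_preimage coors (F i)) ->
  g_sigma_preimage coors (\bigcup_i (F i)).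
Proof. exact: sigma_algebra_bigcup. Qed.

HB.instance Definition _ := @isMeasurable.Build (measure_rV_display d)
  'rV[T]_n (g_sigma_preimage coors) rV_set0 rV_setC rV_bigcup.

End measurable_rV.

Lemma measurable_coord d (T : measurableType d) n (i : 'I_n) :
  measurable_fun [set: 'rV[T]_n] (fun x => x ord0 i).
Proof.
move=> _ Y mY; rewrite setTI; apply: sub_sigma_algebra => /=.
rewrite -bigcup_seq/=; exists i => /=; first by rewrite mem_index_enum.
by exists Y => //; rewrite setTI.
Qed.

Lemma measurable_fun_rVP d1 d2 (T1 : measurableType d1)
    (T2 : measurableType d2) n (f : T1 -> 'rV[T2]_n) :
  (forall i, measurable_fun [set: T1] (fun x => f x ord0 i)) ->
  measurable_fun [set: T1] f.
Proof.
move=> mf _ A mA; rewrite setTI.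
suff : g_sigma_preimage (fun i x => f x ord0 i) `<=` @measurable _ T1.
  apply; rewrite (_ : (fun i x => _) =
    (fun i => (fun y : 'rV[T2]_n => y ord0 i) \o f))//.
  by rewrite g_sigma_preimage_comp; exists A => //; rewrite setTI.
apply: smallest_sub; first exact: sigma_algebra_measurable.
rewrite -bigcup_seq => B [i _ [C mC <-]].
exact: mf.
Qed.

Section lebesgue_measure_rV.
Context {R : realType}.
Local Open Scope ereal_scope.

Definition cons_rV n (z : R * 'rV[R]_n) : 'rV[R]_n.+1 := row_mx (z.1)%:M z.2.

Definition uncons_rV n (x : 'rV[R]_n.+1) : R * 'rV[R]_n :=
  (x ord0 ord0, \row_i x ord0 (lift ord0 i)).

Lemma cons_rV0 n z : @cons_rV n z ord0 ord0 = z.1.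
Proof.
have <- : lshift n (ord0 : 'I_1) = ord0 by exact/val_inj.
apply: etrans (row_mxEl (z.1)%:M z.2 ord0 ord0) _.
by rewrite mxE eqxx mulr1n.
Qed.

Lemma cons_rVS n z i : @cons_rV n z ord0 (lift ord0 i) = z.2 ord0 i.
Proof.
have <- : rshift 1 i = lift ord0 i by exact/val_inj.
exact: (row_mxEr (z.1)%:M z.2 ord0 i).
Qed.

Lemma cons_rVK n : cancel (@cons_rV n) (@uncons_rV n).
Proof.
move=> [x v]; rewrite /uncons_rV cons_rV0; congr pair.
by apply/rowP => i; rewrite mxE cons_rVS.
Qed.

Lemma measurable_cons_rV n : measurable_fun setT (@cons_rV n).
Proof.
apply: measurable_fun_rVP => i.
have [j ->|->] := unliftP ord0 i.
  rewrite (_ : (fun _ => _) = (fun v : 'rV[R]_n => v ord0 j) \o snd).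
    by apply: measurableT_comp => //; exact: measurable_coord.
  by apply/funext => z; rewrite cons_rVS.
rewrite (_ : (fun _ => _) = fst)//.
by apply/funext => z; rewrite cons_rV0.
Qed.

HB.instance Definition _ n :=
  @isMeasurableFun.Build _ _ _ _ (@cons_rV n) (@measurable_cons_rV n).

Lemma measurable_uncons_rV n : measurable_fun setT (@uncons_rV n).
Proof.
apply/measurable_fun_pairP; split; first exact: measurable_coord.
apply: measurable_fun_rVP => i.
rewrite (_ : (fun _ => _) = fun x : 'rV[R]_n.+1 => x ord0 (lift ord0 i)).
  exact: measurable_coord.
by apply/funext => x; rewrite mxE.
Qed.

Section lebesgue_cons.
Variables (n : nat) (m : {sigma_finite_measure set 'rV[R]_n -> \bar R}).

Definition lebesgue_cons : set 'rV[R]_n.+1 -> \bar R :=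
  pushforward (lebesgue_measure \x m) (@cons_rV n).

Let lebesgue_cons0 : lebesgue_cons set0 = 0.
Proof. by rewrite /lebesgue_cons /pushforward preimage_set0 measure0. Qed.

Let lebesgue_cons_ge0 A : 0 <= lebesgue_cons A.
Proof. exact: (measure_ge0 (lebesgue_measure \x m)). Qed.

Let lebesgue_cons_sigma_additive : semi_sigma_additive lebesgue_cons.
Proof.
move=> F mF tF mUF.
have mcF k : measurable (@cons_rV n @^-1` F k).
  by rewrite -[X in measurable X]setTI; exact: measurable_cons_rV.
rewrite /lebesgue_cons /pushforward preimage_bigcup.
apply: (@measure_semi_sigma_additive _ _ _ (lebesgue_measure \x m)) => //.
- apply/trivIsetP => i j _ _ ij; rewrite -preimage_setI.
  by move/trivIsetP : tF => /(_ _ _ _ _ ij) ->//; rewrite preimage_set0.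
- exact: bigcupT_measurable.
Qed.

HB.instance Definition _ := isMeasure.Build _ _ _ lebesgue_cons
  lebesgue_cons0 lebesgue_cons_ge0 lebesgue_cons_sigma_additive.

Let sigma_finite_lebesgue_cons : sigma_finite setT lebesgue_cons.
Proof.
have /sigma_finiteP[F [FT ndF Foo]] := sigma_finiteT (@lebesgue_measure R).
have /sigma_finiteP[G [GT ndG Goo]] := sigma_finiteT m.
exists (fun k => @uncons_rV n @^-1` (F k `*` G k)).
  rewrite -preimage_bigcup (_ : \bigcup_k _ = setT) ?preimage_setT//.
  apply/seteqP; split => // -[x v] _.
  have [i _ Fix] : (\bigcup_k F k) x by rewrite -FT.
  have [j _ Gjv] : (\bigcup_k G k) v by rewrite -GT.
  exists (maxn i j) => //; split => /=.
    by move: x Fix; exact/subsetPset/ndF/leq_maxl.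
  by move: v Gjv; exact/subsetPset/ndG/leq_maxr.
move=> k; have [mF Fk] := Foo k; have [mG Gk] := Goo k; split.
  rewrite -[X in measurable X]setTI; apply: measurable_uncons_rV => //.
  exact: measurableX.
rewrite /lebesgue_cons /pushforward -comp_preimage.
rewrite (_ : _ \o _ = id) ?preimage_id//; last first.
  by apply/funext => z /=; rewrite cons_rVK.
by rewrite product_measure1E// lte_mul_pinfty// ge0_fin_numE.
Qed.

HB.instance Definition _ := @Measure_isSigmaFinite.Build _ _ _
  lebesgue_cons sigma_finite_lebesgue_cons.

End lebesgue_cons.

Fixpoint lebesgue_rV n : {sigma_finite_measure set 'rV[R]_n -> \bar R} :=
  if n is k.+1 then lebesgue_cons (lebesgue_rV k) else \d_(0%R : 'rV[R]_0).

End lebesgue_measure_rV.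

Section euclidean.
Context {R : realType} {n : nat}.
Implicit Types x y : 'rV[R]_n.

Definition dotrV x y : R := \sum_i x ord0 i * y ord0 i.

(* The library's norm `|x| on 'rV[R]_n is the sup norm. *)
Definition enorm x : R := Num.sqrt (dotrV x x).

Definition lipschitz1 (F : 'rV[R]_n -> R) :=
  forall x y, `|F x - F y| <= enorm (x - y).

End euclidean.

Section hessian.
Context {R : realType} {n : nat}.
Implicit Types V : 'rV[R]_n -> R.

Definition partial i V : 'rV[R]_n -> R := 'D_(delta_mx ord0 i) V.

Definition twice_differentiable V :=
  (forall x, differentiable V x) /\
  (forall i x, differentiable (partial i V) x).

Definition hessian V (x : 'rV[R]_n) : 'M[R]_n :=
  \matrix_(i, j) partial i (partial j V) x.

(* Loewner order: A <= B when B - A is a nonnegative quadratic form. *)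
Definition loewner_le (A B : 'M[R]_n) :=
  forall v : 'rV[R]_n, (v *m A *m v^T) ord0 ord0 <= (v *m B *m v^T) ord0 ord0.

End hessian.

Section wasserstein.
Context {R : realType} {n : nat}.
Local Open Scope ereal_scope.

Definition couplings (mu nu : set 'rV[R]_n -> \bar R) :
    set (probability ('rV[R]_n * 'rV[R]_n)%type R) :=
  [set pi | forall A, measurable A ->
    pushforward pi fst A = mu A /\ pushforward pi snd A = nu A].

Definition W1 (mu nu : set 'rV[R]_n -> \bar R) : \bar R :=
  ereal_inf [set \int[pi]_z (enorm (z.1 - z.2)%R)%:E | pi in couplings mu nu].

End wasserstein.

Section gaussian_tensor_marginal.
Context {R : realType} {n : nat}.
Variable sigma : 'rV[R]_n.
Local Open Scope ereal_scope.

Definition line (p : 'rV[R]_n) (t : measurableTypeR R) : 'rV[R]_n :=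
  (p + t *: sigma)%R.

Lemma measurable_line p : measurable_fun setT (line p).
Proof.
apply: measurable_fun_rVP => i; rewrite /line.
under eq_fun do rewrite !mxE.
by apply: measurable_funD => //; exact: measurable_funM.
Qed.

HB.instance Definition _ p :=
  @isMeasurableFun.Build _ _ _ _ (line p) (measurable_line p).

(* For a unit vector sigma and p in Span(sigma), this is the image of the
   standard Gaussian of R under the isometry t |-> p + t sigma onto
   Span(sigma). *)
Definition gauss_line p : probability 'rV[R]_n R :=
  distribution (normal_prob 0 1) (line p).

(* For a unit vector sigma, the orthogonal projection onto its orthogonal
   complement. *)
Definition proj_perp (x : 'rV[R]_n) : 'rV[R]_n := (x - dotrV x sigma *: sigma)%R.

Lemma measurable_proj_perp : measurable_fun setT proj_perp.
Proof.
apply: measurable_fun_rVP => i; rewrite /proj_perp.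
under eq_fun do rewrite !mxE.
apply: measurable_funB; first exact: measurable_coord.
apply: measurable_funM => //; apply: measurable_sum => j.
by apply: measurable_funM => //; exact: measurable_coord.
Qed.

HB.instance Definition _ :=
  @isMeasurableFun.Build _ _ _ _ proj_perp measurable_proj_perp.

Definition marginal_perp (mu : probability 'rV[R]_n R) : probability 'rV[R]_n R :=
  distribution mu proj_perp.

End gaussian_tensor_marginal.

Section direct_sum.
Context {R : realType} {n : nat}.
Local Open Scope ereal_scope.

Definition add_rV (z : 'rV[R]_n * 'rV[R]_n) : 'rV[R]_n := (z.1 + z.2)%R.

Lemma measurable_add_rV : measurable_fun setT add_rV.
Proof.
apply: measurable_fun_rVP => i; rewrite /add_rV.
under eq_fun do rewrite !mxE.
have mc := @measurable_coord _ R n i.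
by apply: measurable_funD; [exact: (measurableT_comp mc measurable_fst)|
                            exact: (measurableT_comp mc measurable_snd)].
Qed.

HB.instance Definition _ :=
  @isMeasurableFun.Build _ _ _ _ add_rV measurable_add_rV.

(* The product of measures carried by complementary subspaces E and E', viewed
   as a measure on R^n through the identification (u, v) |-> u + v of the
   product of E and E' with their direct sum. *)
Definition tensor_sum (mu nu : probability 'rV[R]_n R) : probability 'rV[R]_n R :=
  distribution (mu \x nu) add_rV.

End direct_sum.

(* Main.v *)
(* Write [Q f = int |grad f|^2 dmu - Var f].  By the Poincare inequality [Q] is a
   nonnegative quadratic form, and [Q F <= 1 - Var F] for a 1-Lipschitz [F].
   Running the Langevin dynamics of mu for a while replaces [F] by [u = P^j F],
   for which [Q u] is still small and, by an improved Poincare inequality on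
   path space, whose gradient is nearly a constant vector [a].  Hence
   [Q (a . x) <= 2 Q u + 2 Q (a . x - u)] is small: for [sigma = a / |a|] one gets
   [1 - Var (sigma . x) <= 40 (1 - Var F)].  Only discrete objects are needed: the
   dynamics is an Euler scheme driven by random signs, the path space is a
   discrete cube, and mu is reached through potentials [|x|^2/2 + W] with [W] the
   log-sum-exp of finitely many affine functions.

   Then a direction of almost maximal variance is almost Gaussian and independent
   of the rest, by a Stein-type argument.  Rotate the pair (component of [x] along
   [sigma], centered; an independent standard Gaussian) by an angle th from 0 to
   pi/2: the expectation of a 1-Lipschitz [f] moves from [mu] to the Gaussian
   product.  Integrating by parts in the Gaussian variable, its derivative in th
   is [int d_sigma h - (sigma . x - c) h] for some 1-Lipschitz [h], and
   perturbing the Poincare inequality at [sigma . x] in the direction [h] bounds it by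
   [sqrt (1 - Var (sigma . x))].  Kantorovich-Rubinstein duality, reduced to finite
   linear programming duality by a countable partition of the space, concludes. *)

From HB Require Import structures.
Require Import Defs.
From mathcomp Require Import all_boot all_order all_algebra.
From mathcomp Require Import all_classical all_reals all_analysis.
From mathcomp Require Import measurable_realfun.
From mathcomp Require Import ring lra.

Set Implicit Arguments.
Unset Strict Implicit.
Unset Printing Implicit Defensive.

Import Order.TTheory GRing.Theory Num.Theory.
Import numFieldNormedType.Exports.

Local Open Scope classical_set_scope.
Local Open Scope ring_scope.

(** The obstacle is that the Hessian of [V] is only bounded below: it may be discontinuous and
    unbounded. Quantitative work is therefore done for Lipschitz perturbations of [|x|^2/2], whose
    constants [K], [B] and the dimension [n] enter only through errors that vanish with the time
    step. The limits are taken in this order: time step to 0, regular potential to [V], smooth test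
    function to [F]; what survives is free of the dimension. Derivatives of test functions are
    replaced by first-order Taylor bounds with quadratic remainder ([sm]), a class stable under the
    drift, averaging and log-sum-exp. Where a second derivative would be called for, one of the two
    differences is moved onto the density. The direction finally kept maximizes the variance of
    [sigma . x], so it depends on [mu] only, and compactness is used once, on the sphere. The
    constant 40 is [(2 * 1 + 2 * 4) / (1/4)]: defects [d] and [4 d] for [Q u] and for the gradient,
    and [|a|^2 >= 1/4]. *)

Notation "x '*d' y" := (dotrV x y) (at level 40, left associativity).
Notation "⟦ x ⟧" := (enorm x) (at level 0, x at level 99, format "⟦ x ⟧").

(** * The Euclidean norm and functions with quadratic Taylor remainder *)

Section euclid.
Context {R : realType} {n : nat}.
Implicit Types x y z v w : 'rV[R]_n.

Lemma dotrVC x y : x *d y = y *d x.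
Proof. by apply: eq_bigr => i _; rewrite mulrC. Qed.

Lemma dotrVDl x y z : (x + y) *d z = x *d z + y *d z.
Proof. by rewrite /dotrV -big_split; apply: eq_bigr => i _; rewrite mxE mulrDl. Qed.

Lemma dotrVZl a x y : (a *: x) *d y = a * (x *d y).
Proof. by rewrite /dotrV mulr_sumr; apply: eq_bigr => i _; rewrite mxE mulrA. Qed.

Lemma dotrVNl x y : (- x) *d y = - (x *d y).
Proof. by rewrite -scaleN1r dotrVZl mulN1r. Qed.

Lemma dotrVDr x y z : z *d (x + y) = z *d x + z *d y.
Proof. by rewrite dotrVC dotrVDl !(dotrVC z). Qed.

Lemma dotrVZr a x y : x *d (a *: y) = a * (x *d y).
Proof. by rewrite dotrVC dotrVZl dotrVC. Qed.

Lemma dotrVNr x y : x *d (- y) = - (x *d y).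
Proof. by rewrite dotrVC dotrVNl dotrVC. Qed.

Lemma dotrV0l x : 0 *d x = 0.
Proof. by rewrite -(scale0r 0) dotrVZl mul0r. Qed.

Lemma dotrV0r x : x *d 0 = 0.
Proof. by rewrite dotrVC dotrV0l. Qed.

Definition dotrVE := (dotrVDl, dotrVDr, dotrVNl, dotrVNr, dotrVZl, dotrVZr,
  dotrV0l, dotrV0r).

Lemma dotrV_suml I (r : seq I) (P : pred I) (F : I -> 'rV[R]_n) z :
  (\sum_(i <- r | P i) F i) *d z = \sum_(i <- r | P i) (F i *d z).
Proof.
elim/big_ind2 : _ => //; first exact: dotrV0l.
by move=> x1 a x2 b <- <-; rewrite dotrVDl.
Qed.

Lemma dotrV_ge0 x : 0 <= x *d x.
Proof. by apply: sumr_ge0 => i _; rewrite -expr2 sqr_ge0. Qed.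

Lemma dotrV_eq0 x : (x *d x == 0) = (x == 0).
Proof.
apply/idP/eqP => [|->]; last by rewrite dotrV0l.
rewrite psumr_eq0 => [|i _]; last by rewrite -expr2 sqr_ge0.
move/allP => h; apply/rowP => i; rewrite mxE.
have := h i (mem_index_enum _); rewrite -expr2 sqrf_eq0 => /eqP.
by rewrite (ord1 ord0).
Qed.

Lemma dotrV_delta x i : delta_mx ord0 i *d x = x ord0 i.
Proof.
rewrite /dotrV (bigD1 i)//= big1 ?addr0 => [|j ji]; rewrite !mxE ?eqxx/= ?mul1r//.
by rewrite (negbTE ji) mul0r.
Qed.

Lemma enorm_ge0 x : 0 <= ⟦x⟧.
Proof. exact: sqrtr_ge0. Qed.
Hint Resolve enorm_ge0 : core.

Lemma enorm_sqr x : ⟦x⟧ ^+ 2 = x *d x.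
Proof. by rewrite sqr_sqrtr// dotrV_ge0. Qed.

Lemma enorm_eq0 x : (⟦x⟧ == 0) = (x == 0).
Proof. by rewrite -dotrV_eq0 -enorm_sqr sqrf_eq0. Qed.

Lemma enorm0 : ⟦0 : 'rV[R]_n⟧ = 0.
Proof. by apply/eqP; rewrite enorm_eq0. Qed.

Lemma enormZ a x : ⟦a *: x⟧ = `|a| * ⟦x⟧.
Proof.
apply/eqP; rewrite -(eqrXn2 (n := 2))// ?mulr_ge0//.
by rewrite exprMn !enorm_sqr !dotrVE mulrA -expr2 real_normK ?num_real.
Qed.

Lemma enormN x : ⟦- x⟧ = ⟦x⟧.
Proof. by rewrite -scaleN1r enormZ normrN1 mul1r. Qed.

Lemma enormB x y : ⟦x - y⟧ = ⟦y - x⟧.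
Proof. by rewrite -opprB enormN. Qed.

Lemma dotrV_le x y : x *d y <= ⟦x⟧ * ⟦y⟧.
Proof.
have [->|x0] := eqVneq x 0; first by rewrite dotrV0l enorm0 mul0r.
have [->|y0] := eqVneq y 0; first by rewrite dotrV0r enorm0 mulr0.
have a0 : 0 < ⟦x⟧ by rewrite lt0r enorm_ge0 enorm_eq0 x0.
have b0 : 0 < ⟦y⟧ by rewrite lt0r enorm_ge0 enorm_eq0 y0.
have := dotrV_ge0 (⟦y⟧ *: x - ⟦x⟧ *: y).
rewrite !dotrVE -!enorm_sqr (dotrVC y x) => h.
have ab : 0 < ⟦x⟧ * ⟦y⟧ by exact: mulr_gt0.
rewrite -(ler_pM2l ab); nra.
Qed.

Lemma normr_dotrV_le x y : `|x *d y| <= ⟦x⟧ * ⟦y⟧.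
Proof.
rewrite ler_norml dotrV_le andbT lerNl -dotrVNl.
by rewrite (le_trans (dotrV_le _ _))// enormN.
Qed.

Lemma ler_enormD x y : ⟦x + y⟧ <= ⟦x⟧ + ⟦y⟧.
Proof.
rewrite -(ler_pXn2r (n := 2)) ?nnegrE ?addr_ge0//.
rewrite enorm_sqr !dotrVE (dotrVC y x) sqrrD !enorm_sqr.
by have := dotrV_le x y; lra.
Qed.

Lemma ler_enormB x y : ⟦x - y⟧ <= ⟦x⟧ + ⟦y⟧.
Proof. by rewrite (le_trans (ler_enormD _ _))// enormN. Qed.

Lemma ler_enorm_dist x y z : ⟦x - z⟧ <= ⟦x - y⟧ + ⟦y - z⟧.
Proof. by rewrite (le_trans _ (ler_enormD _ _))// addrA subrK. Qed.

Lemma ler_dist_enorm x y : `|⟦x⟧ - ⟦y⟧| <= ⟦x - y⟧.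
Proof.
rewrite ler_norml; have := ler_enormD (x - y) y; have := ler_enormD (y - x) x.
by rewrite !subrK (enormB y x); lra.
Qed.

Lemma ler_enorm_sum I (r : seq I) (P : pred I) (F : I -> 'rV[R]_n) :
  ⟦\sum_(i <- r | P i) F i⟧ <= \sum_(i <- r | P i) ⟦F i⟧.
Proof.
elim/big_ind2 : _ => //; first by rewrite enorm0.
move=> x1 a x2 b h1 h2; apply: (le_trans (ler_enormD _ _)); exact: lerD.
Qed.

Lemma ler_coord_enorm x i : `|x ord0 i| <= ⟦x⟧.
Proof.
rewrite -(ler_pXn2r (n := 2)) ?nnegrE// real_normK ?num_real// enorm_sqr.
rewrite /dotrV (bigD1 i)//= -expr2 lerDl sumr_ge0// => j _.
by rewrite -expr2 sqr_ge0.
Qed.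

Lemma enorm_le_sum x : ⟦x⟧ <= \sum_i `|x ord0 i|.
Proof.
have {1}-> : x = \sum_i x ord0 i *: delta_mx ord0 i by exact: row_sum_delta.
rewrite (le_trans (ler_enorm_sum _ _ _))// ler_sum// => i _.
rewrite enormZ -[leRHS]mulr1 ler_wpM2l//.
have : ⟦delta_mx ord0 i : 'rV[R]_n⟧ ^+ 2 = 1.
  by rewrite enorm_sqr dotrV_delta mxE !eqxx.
by move/eqP; rewrite sqrf_eq1 => /orP[] /eqP ->.
Qed.

(** Along [y = x + t u] with [t] small the quadratic term is negligible, so only the first-order
    constant survives. Bounds on gradients are deduced in this way from bounds on increments. *)
Lemma enorm_le_of_small (u : 'rV[R]_n) (x : 'rV[R]_n) a b :
  (forall y, u *d (y - x) <= a * ⟦y - x⟧ + b * ⟦y - x⟧ ^+ 2) -> 0 <= a ->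
  ⟦u⟧ <= a.
Proof.
move=> h a0; have [->|u0] := eqVneq u 0; first by rewrite enorm0.
have up : 0 < ⟦u⟧ by rewrite lt0r enorm_eq0 u0 enorm_ge0.
rewrite leNgt; apply/negP => au.
(* With this [t], the quadratic term divided by [t |u|], namely [(|b| + 1) t |u|], is half the gap
   [|u| - a]. *)
pose t := (⟦u⟧ - a) / (⟦u⟧ * (`|b| + 1)) / 2.
have b1 : 0 < `|b| + 1 by rewrite ltr_wpDl.
have t0 : 0 < t.
  rewrite /t divr_gt0// divr_gt0//; first by rewrite subr_gt0.
  exact: mulr_gt0.
have := h (x + t *: u); rewrite addrAC subrr add0r enormZ (gtr0_norm t0) dotrVE.
rewrite -enorm_sqr => h2.
have h3 : t * ⟦u⟧ ^+ 2 <= t * ⟦u⟧ * (a + (`|b| + 1) * (t * ⟦u⟧)).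
  apply: (le_trans h2); rewrite exprMn.
  have := ler_norm b => hb.
  have : 0 <= (`|b| + 1 - b) * (t * ⟦u⟧) ^+ 2.
    by rewrite mulr_ge0 ?sqr_ge0//; lra.
  rewrite exprMn; nra.
have : ⟦u⟧ <= a + (`|b| + 1) * (t * ⟦u⟧).
  by rewrite -(ler_pM2l (mulr_gt0 t0 up)) (le_trans _ h3)// expr2 mulrA.
have -> : (`|b| + 1) * (t * ⟦u⟧) = (⟦u⟧ - a) / 2.
  by rewrite /t; field; rewrite (gt_eqF b1) (gt_eqF up).
lra.
Qed.

End euclid.
#[global] Hint Resolve enorm_ge0 : core.
#[global] Hint Extern 0 (is_true (0 <= enorm _)) => exact: enorm_ge0 : core.

Section smooth.
Context {R : realType} {n : nat}.
Local Notation E := 'rV[R]_n.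
Implicit Types (x y z v : E) (f : E -> R) (w : E -> E) (L B M : R).

Definition lip (L : R) f := forall x y, `|f y - f x| <= L * ⟦y - x⟧.

(* [w] plays the role of the gradient of the [L]-Lipschitz function [f], with a
   quadratic Taylor remainder; no differentiability is ever invoked. *)
Definition sm (L B : R) f w :=
  (forall x, ⟦w x⟧ <= L) /\
  (forall x y, `|f y - f x - w x *d (y - x)| <= B * ⟦y - x⟧ ^+ 2).

(** Cut the segment into [N + 1] equal pieces: the first-order terms add up to at most [L |y - x|],
    the remainders to [B |y - x|^2 / (N + 1)], which vanishes as [N] grows. This plays the part of
    the mean value inequality. *)
Lemma sm_lip L B f w : sm L B f w -> lip L f.
Proof.
move=> [wL fB] x y.
have key (N : nat) : `|f y - f x| <= L * ⟦y - x⟧ + B * ⟦y - x⟧ ^+ 2 / N.+1%:R.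
  pose p (k : nat) : E := x + (k%:R / N.+1%:R) *: (y - x).
  have step k : `|f (p k.+1) - f (p k)| <=
      L * ⟦y - x⟧ / N.+1%:R + B * ⟦y - x⟧ ^+ 2 / N.+1%:R ^+ 2.
    have pp : p k.+1 - p k = N.+1%:R^-1 *: (y - x).
      rewrite /p opprD addrACA subrr add0r -scalerBl; congr (_ *: _).
      by rewrite -mulrBl -addn1 natrD addrAC subrr add0r mul1r.
    have i0 : 0 <= N.+1%:R^-1 :> R by rewrite invr_ge0.
    have := fB (p k) (p k.+1); rewrite pp dotrVE enormZ (ger0_norm i0).
    have := wL (p k); set A := f _ - f _; move=> h1 h2.
    have h3 : `|w (p k) *d (y - x)| <= L * ⟦y - x⟧.
      by rewrite (le_trans (normr_dotrV_le _ _))// ler_wpM2r.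
    rewrite -(subrK (N.+1%:R^-1 * (w (p k) *d (y - x))) A).
    rewrite (le_trans (ler_normD _ _))// addrC lerD//.
      by rewrite normrM (ger0_norm i0) mulrC ler_wpM2r.
    by rewrite (le_trans h2)// exprMn mulrA exprVn mulrAC.
  have tele : `|f (p N.+1) - f (p 0%N)| <= \sum_(k < N.+1)
      (L * ⟦y - x⟧ / N.+1%:R + B * ⟦y - x⟧ ^+ 2 / N.+1%:R ^+ 2).
    have -> : f (p N.+1) - f (p 0%N) = \sum_(k < N.+1) (f (p k.+1) - f (p k)).
      by rewrite -(big_mkord xpredT (fun k => f (p k.+1) - f (p k))) telescope_sumr.
    apply: (le_trans (ler_norm_sum _ _ _)); apply: ler_sum => k _; exact: step.
  have pN : p N.+1 = y by rewrite /p divff ?pnatr_eq0// scale1r addrC subrK.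
  have p0 : p 0%N = x by rewrite /p mul0r scale0r addr0.
  move: tele; rewrite pN p0 sumr_const card_ord => /le_trans; apply.
  rewrite -mulr_natr le_eqVlt; apply/orP; left; apply/eqP; field.
  by rewrite addrC natr1 pnatr_eq0.
rewrite leNgt; apply/negP => h.
pose e := `|f y - f x| - L * ⟦y - x⟧.
have e0 : 0 < e by rewrite subr_gt0.
pose N := Num.truncn (`|B * ⟦y - x⟧ ^+ 2| / e).
have hN : `|B * ⟦y - x⟧ ^+ 2| / e < N.+1%:R by exact: truncnS_gt.
have := key N; rewrite leNgt => /negP; apply; rewrite addrC -ltrBDr -/e.
rewrite ltr_pdivrMr ?ltr0Sn// (le_lt_trans (ler_norm _))//.
by rewrite [e * _]mulrC -ltr_pdivrMr.
Qed.

(** Expand [f (y + u)] from [x] and from [y], and [f y] from [x], where [u] has length [|x - y|] and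
    the direction of [w x - w y]: the remainders are [4 B], [B] and [B] times [|x - y|^2]. *)
Lemma sm_grad_lip L B f w : sm L B f w -> forall x y, ⟦w x - w y⟧ <= 6 * B * ⟦x - y⟧.
Proof.
move=> [_ fB] x y.
have [->|d0] := eqVneq (w x) (w y).
  rewrite subrr enorm0; have := fB x y; rewrite enormB.
  move/(le_trans (normr_ge0 _)).
  have := enorm_ge0 (x - y); rewrite le_eqVlt => /predU1P[<-|r0].
    by rewrite mulr0.
  by rewrite pmulr_lge0 ?exprn_gt0// => B0; rewrite !mulr_ge0.
set d := w x - w y; have dp : 0 < ⟦d⟧ by rewrite lt0r enorm_eq0 subr_eq0 d0 enorm_ge0.
have [xy|xy] := eqVneq x y; first by rewrite /d xy subrr eqxx in d0 *.
have : 0 < ⟦x - y⟧ by rewrite lt0r enorm_eq0 subr_eq0 xy enorm_ge0.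
set r := ⟦x - y⟧ => rp; have r0 := ltW rp.
pose u := (r / ⟦d⟧) *: d; have ur : ⟦u⟧ = r.
  by rewrite enormZ ger0_norm ?divr_ge0// divfK// gt_eqF.
have h1 := fB x (y + u); have h2 := fB y (y + u); have h3 := fB x y.
have e1 : w x *d (y + u - x) = w x *d u + w x *d (y - x).
  by rewrite !dotrVE; ring.
have e2 : y + u - y = u by rewrite addrAC subrr add0r.
have e3 : ⟦y + u - x⟧ <= 2 * r.
  rewrite addrAC (le_trans (ler_enormD _ _))// ur enormB -/r; lra.
have B0 : 0 <= B.
  have := le_trans (normr_ge0 _) h3; rewrite pmulr_lge0// exprn_gt0//.
  by rewrite enormB.
have e4 : ⟦y + u - x⟧ ^+ 2 <= 4 * r ^+ 2.
  have -> : 4 * r ^+ 2 = (2 * r) ^+ 2 by rewrite exprMn; ring.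
  by rewrite ler_pXn2r ?nnegrE// mulr_ge0// ltW.
have h1' := le_trans h1 (ler_wpM2l B0 e4).
move: h1' h2 h3; rewrite e1 e2 ur (enormB y x) -/r !ler_norml.
move=> /andP[p1 _] /andP[_ p2] /andP[_ p3].
have : d *d u <= 6 * B * r ^+ 2.
  rewrite {1}/d dotrVDl dotrVNl; lra.
rewrite /u dotrVE -enorm_sqr.
have -> : r / ⟦d⟧ * ⟦d⟧ ^+ 2 = ⟦d⟧ * r by field; rewrite gt_eqF.
by rewrite expr2 mulrA ler_pM2r.
Qed.

Lemma sm_lin v c : sm ⟦v⟧ 0 (fun x => v *d x + c) (fun _ => v).
Proof.
split=> // x y; rewrite mul0r !dotrVE.
have -> : v *d y + c - (v *d x + c) - (v *d y - v *d x) = 0 by ring.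
by rewrite normr0.
Qed.

Lemma sm_opp L B f w : sm L B f w -> sm L B (fun x => - f x) (fun x => - w x).
Proof.
move=> [h1 h2]; split=> [x|x y]; first by rewrite enormN.
by rewrite dotrVNl -!opprD normrN.
Qed.

Lemma sm_scale L B f w c : sm L B f w ->
  sm (`|c| * L) (`|c| * B) (fun x => c * f x) (fun x => c *: w x).
Proof.
move=> [h1 h2]; split=> [x|x y]; first by rewrite enormZ ler_wpM2l.
by rewrite dotrVZl -!mulrBr normrM -mulrA ler_wpM2l.
Qed.

Lemma sm_add L1 B1 f1 w1 L2 B2 f2 w2 : sm L1 B1 f1 w1 -> sm L2 B2 f2 w2 ->
  sm (L1 + L2) (B1 + B2) (fun x => f1 x + f2 x) (fun x => w1 x + w2 x).
Proof.
move=> [h1 h2] [h3 h4]; split=> [x|x y].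
  by rewrite (le_trans (ler_enormD _ _))// lerD.
rewrite mulrDl (le_trans _ (lerD (h2 x y) (h4 x y)))//.
apply: le_trans (ler_normD _ _); rewrite le_eqVlt; apply/orP; left; apply/eqP.
by congr `|_|; rewrite !dotrVE; ring.
Qed.

Lemma sm_weaken L B L' B' f w : sm L B f w -> L <= L' -> B <= B' -> sm L' B' f w.
Proof.
move=> [h1 h2] LL BB; split=> [x|x y]; first exact: le_trans LL.
by rewrite (le_trans (h2 x y))// ler_wpM2r// sqr_ge0.
Qed.

Lemma sm_shift L B f w v : sm L B f w -> sm L B (fun x => f (x + v)) (fun x => w (x + v)).
Proof.
move=> [h1 h2]; split=> // x y; have := h2 (x + v) (y + v).
by rewrite opprD addrACA subrr addr0.
Qed.

Lemma sm_sqr L B f w M : 0 <= L -> (forall x, `|f x| <= M) -> sm L B f w ->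
  sm (2 * M * L) (2 * M * B + L ^+ 2) (fun x => f x ^+ 2) (fun x => (2 * f x) *: w x).
Proof.
move=> L0 fM hf; have hl := sm_lip hf; case: hf => h1 h2; split=> [x|x y].
  by rewrite enormZ ler_pM// normrM ger0_norm// ler_wpM2l.
rewrite dotrVZl.
have -> : f y ^+ 2 - f x ^+ 2 - 2 * f x * (w x *d (y - x)) =
  2 * f x * (f y - f x - w x *d (y - x)) + (f y - f x) ^+ 2 by ring.
rewrite (le_trans (ler_normD _ _))// [leRHS]mulrDl lerD//.
  rewrite normrM -mulrA ler_pM// ?h2//.
  by rewrite normrM ger0_norm// ler_wpM2l.
rewrite normrX -exprMn ler_pXn2r ?nnegrE//.
by rewrite mulr_ge0.
Qed.

(** With [A] the square root and [d = y - x], the Taylor remainder times [2 A x] equals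
    [|d|^2 - (A y - A x)^2], and Cauchy-Schwarz makes it nonnegative. The function is a smooth
    stand-in for the distance to [y0], off by at most [s]. *)
Lemma sm_sqrt (s : R) y0 : 0 < s ->
  sm 1 (s^-1) (fun x => Num.sqrt (⟦x - y0⟧ ^+ 2 + s ^+ 2))
     (fun x => (Num.sqrt (⟦x - y0⟧ ^+ 2 + s ^+ 2))^-1 *: (x - y0)).
Proof.
move=> s0; pose A x := Num.sqrt (⟦x - y0⟧ ^+ 2 + s ^+ 2).
have A2 x : A x ^+ 2 = ⟦x - y0⟧ ^+ 2 + s ^+ 2.
  by rewrite sqr_sqrtr// addr_ge0// sqr_ge0.
have A0 x : 0 <= A x by exact: sqrtr_ge0.
have As x : s <= A x.
  by rewrite -(ler_pXn2r (n := 2)) ?nnegrE// ?A2 ?lerDr ?sqr_ge0// ltW.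
have Ap x : 0 < A x by exact: lt_le_trans (As x).
have Ad x : ⟦x - y0⟧ <= A x.
  by rewrite -(ler_pXn2r (n := 2)) ?nnegrE// A2 lerDl sqr_ge0.
split=> [x|x y]; rewrite -?/(A _).
  rewrite enormZ ger0_norm ?invr_ge0//.
  by rewrite mulrC ler_pdivrMr// mul1r.
rewrite dotrVZl; set d := y - x.
have yE : y - y0 = (x - y0) + d by rewrite /d [RHS]addrC addrA subrK.
clearbody d.
have Ay : A y ^+ 2 = A x ^+ 2 + 2 * ((x - y0) *d d) + ⟦d⟧ ^+ 2.
  by rewrite !A2 !enorm_sqr yE !dotrVE (dotrVC d x) (dotrVC d y0); ring.
set p := (x - y0) *d d in Ay *.
have up : 0 <= 2 * A x * ((A y - A x - (A x)^-1 * p)).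
  have -> : 2 * A x * (A y - A x - (A x)^-1 * p) = 2 * (A x * A y - (A x ^+ 2 + p)).
    by field; rewrite gt_eqF.
  rewrite pmulr_rge0// subr_ge0.
  have -> : A x ^+ 2 + p = s ^+ 2 + (x - y0) *d (y - y0).
    by rewrite A2 enorm_sqr yE (dotrVDr (x - y0)) /p; ring.
  have cs := dotrV_le (x - y0) (y - y0).
  have := dotrV_ge0 (⟦y - y0⟧ *: (x - y0) - ⟦x - y0⟧ *: (y - y0)) => _.
  have h1 : 0 <= s ^+ 2 + ⟦x - y0⟧ * ⟦y - y0⟧.
    by rewrite addr_ge0 ?sqr_ge0 ?mulr_ge0.
  apply: (@le_trans _ _ (s ^+ 2 + ⟦x - y0⟧ * ⟦y - y0⟧)); first by rewrite lerD2l.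
  rewrite -(ler_pXn2r (n := 2)) ?nnegrE ?mulr_ge0// exprMn !A2.
  have := sqr_ge0 (s * ⟦x - y0⟧ - s * ⟦y - y0⟧); nra.
have lo : 2 * A x * ((A y - A x - (A x)^-1 * p)) <= ⟦d⟧ ^+ 2.
  have -> : 2 * A x * (A y - A x - (A x)^-1 * p) = ⟦d⟧ ^+ 2 - (A y - A x) ^+ 2.
    by apply/eqP; rewrite eq_sym subr_eq -subr_eq0; apply/eqP;
      rewrite (_ : ⟦d⟧ ^+ 2 = A y ^+ 2 - A x ^+ 2 - 2 * p); [field; rewrite gt_eqF|lra].
  by rewrite gerBl sqr_ge0.
rewrite pmulr_rge0 ?mulr_gt0// in up.
rewrite ger0_norm//.
have A20 : 0 < 2 * A x by rewrite mulr_gt0.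
rewrite -(ler_pM2l A20) (le_trans lo)// mulrA ler_peMl ?sqr_ge0//.
rewrite ler_pdivlMr// mul1r; have := As x; have := Ap x; lra.
Qed.

End smooth.

(** * Log-sum-exp as a smooth maximum, with Taylor bounds *)

Section exp_ineq.
Context {R : realType}.

(** From [exp (- t / 2) >= 1 - t / 2] comes [exp t <= (1 - t / 2)^-2], and this rational function
    stays below [1 + t + 2 t^2] on [[-1, 1]]. *)
Lemma expR_sub1_le (t : R) : `|t| <= 1 -> `|expR t - 1 - t| <= 2 * t ^+ 2.
Proof.
move=> t1; have h1 := expR_ge1Dx t.
move: (t1); rewrite ler_norml => /andP[ta tb].
rewrite ger0_norm; last by lra.
have h3 : expR t * (1 - t / 2) ^+ 2 <= 1.
  have h := expR_ge1Dx (- (t / 2)).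
  have e1 : expR (t / 2) * expR (- (t / 2)) = 1 by rewrite -expRD subrr expR0.
  have h5 : expR (t / 2) ^+ 2 = expR t by rewrite expr2 -expRD -splitr.
  have h6 : expR (t / 2) * (1 - t / 2) <= 1 by rewrite -[leRHS]e1 ler_wpM2l// expR_ge0.
  have h7 : 0 <= expR (t / 2) * (1 - t / 2) by rewrite mulr_ge0 ?expR_ge0//; lra.
  by rewrite -h5 -exprMn; apply: exprn_ile1.
have h4 : 1 <= (1 - t / 2) ^+ 2 * (1 + t + 2 * t ^+ 2).
  have : 0 <= t ^+ 2 * (1 - t) * (5 / 4 - t / 2) by apply: mulr_ge0; [apply: mulr_ge0; [exact: sqr_ge0|lra]|lra].
  nra.
have h5 : 0 < (1 - t / 2) ^+ 2 by rewrite exprn_gt0//; lra.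
have : (1 - t / 2) ^+ 2 * expR t <= (1 - t / 2) ^+ 2 * (1 + t + 2 * t ^+ 2).
  by rewrite (le_trans _ h4)// mulrC.
rewrite ler_pM2l//; lra.
Qed.

End exp_ineq.

(* Log-sum-exp: a smooth convex substitute for the maximum of finitely many
   functions, whose gradient is a convex combination of the gradients. *)
Section lse.
Context {R : realType} {n : nat}.
Local Notation E := 'rV[R]_n.
Variables (N : nat) (beta L B : R) (f : 'I_N.+1 -> E -> R) (w : 'I_N.+1 -> E -> E).
Hypothesis beta0 : 0 < beta.
Hypothesis L0 : 0 <= L.
Hypothesis fw : forall j, sm L B (f j) (w j).

Definition sexp (x : E) : R := \sum_j expR (beta * f j x).
Definition lse (x : E) : R := beta^-1 * ln (sexp x).
Definition softp j (x : E) : R := expR (beta * f j x) / sexp x.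
Definition lse_grad (x : E) : E := \sum_j softp j x *: w j x.

Lemma sexp_gt0 x : 0 < sexp x.
Proof.
by rewrite /sexp big_ord_recl ltr_pwDl ?expR_gt0// sumr_ge0.
Qed.

Lemma softp_ge0 j x : 0 <= softp j x.
Proof. by rewrite divr_ge0 ?expR_ge0// ltW// sexp_gt0. Qed.

Lemma softp_sum x : \sum_j softp j x = 1.
Proof. by rewrite -mulr_suml divff// gt_eqF// sexp_gt0. Qed.

Lemma softp_le1 j x : softp j x <= 1.
Proof.
rewrite -(softp_sum x) (bigD1 j)//= lerDl sumr_ge0// => i _; exact: softp_ge0.
Qed.

Let avg_le (F : 'I_N.+1 -> R) M x :
  (forall j, F j <= M) -> \sum_j softp j x * F j <= M.
Proof.
move=> FM; rewrite -[leRHS]mul1r -(softp_sum x) mulr_suml ler_sum// => j _.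
by rewrite ler_wpM2l ?softp_ge0.
Qed.

Lemma lse_ge j x : f j x <= lse x.
Proof.
rewrite /lse mulrC ler_pdivlMr// mulrC -[leLHS]expRK ler_ln ?posrE ?expR_gt0 ?sexp_gt0//.
by rewrite /sexp (bigD1 j)//= lerDl sumr_ge0// => i _; exact: expR_ge0.
Qed.

Lemma lse_le x M : (forall j, f j x <= M) -> lse x <= M + ln N.+1%:R / beta.
Proof.
move=> fM.
rewrite /lse mulrC ler_pdivrMr// mulrDl divfK ?gt_eqF// -[M * beta]expRK.
rewrite -lnM ?posrE ?expR_gt0 ?ltr0n// ler_ln ?posrE ?sexp_gt0 ?mulr_gt0 ?expR_gt0 ?ltr0n//.
rewrite /sexp mulr_natr -[X in _ *+ X]card_ord -sumr_const ler_sum// => j _.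
by rewrite ler_expR mulrC ler_wpM2r// ltW.
Qed.

Let D j (x y : E) := f j y - f j x.
Let T (x y : E) := beta * (L * ⟦y - x⟧).

Let DT j x y : `|beta * D j x y| <= T x y.
Proof. by rewrite normrM gtr0_norm// ler_wpM2l ?(ltW beta0)// (sm_lip (fw j)). Qed.

Let T_ge0 x y : 0 <= T x y.
Proof. by rewrite !mulr_ge0// ltW. Qed.

(** First variation of [beta * lse]: the softmax average at [x] of the increments of the [beta f j].
    The increments are kept exact, so that the convexity of [lse] is handled separately from the
    Taylor errors of the [f j]. *)
Definition smean x y := \sum_j softp j x * (beta * D j x y).

Let smeanT x y : `|smean x y| <= T x y.
Proof.
rewrite (le_trans (ler_norm_sum _ _ _))// -[leRHS]mul1r -(softp_sum x) mulr_suml.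
rewrite ler_sum// => j _; rewrite normrM (ger0_norm (softp_ge0 _ _)).
by rewrite ler_wpM2l ?softp_ge0.
Qed.

Let lse_diff x y : beta * (lse y - lse x) =
  ln (\sum_j softp j x * expR (beta * D j x y)).
Proof.
have -> : \sum_j softp j x * expR (beta * D j x y) = sexp y / sexp x.
  rewrite /sexp mulr_suml; apply: eq_bigr => j _.
  rewrite /softp mulrAC -expRD; congr (expR _ / _); rewrite /D; ring.
rewrite /lse -mulrBr mulrA divff ?gt_eqF// mul1r ln_div//; exact: sexp_gt0.
Qed.

Let Eg0 x y (c : R) : 0 < \sum_j softp j x * expR (beta * D j x y - c).
Proof.
have h j : 0 <= softp j x * expR (beta * D j x y - c).
  by rewrite mulr_ge0 ?softp_ge0 ?expR_ge0.
rewrite big_ord_recl ltr_pwDl// ?sumr_ge0//.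
by rewrite mulr_gt0 ?expR_gt0// divr_gt0 ?expR_gt0// sexp_gt0.
Qed.

Let lse_diff_c x y c : beta * (lse y - lse x) - c =
  ln (\sum_j softp j x * expR (beta * D j x y - c)).
Proof.
have -> : \sum_j softp j x * expR (beta * D j x y - c) =
    (\sum_j softp j x * expR (beta * D j x y)) * expR (- c).
  by rewrite mulr_suml; apply: eq_bigr => j _; rewrite expRD mulrA.
rewrite lnM ?posrE ?expR_gt0 ?expRK ?lse_diff//.
have := Eg0 x y 0; under eq_bigr do rewrite subr0; by [].
Qed.

Let smean_centered x y :
  \sum_j softp j x * (beta * D j x y - smean x y) = 0.
Proof.
by under eq_bigr do rewrite mulrBr; rewrite sumrB -mulr_suml softp_sum mul1r subrr.
Qed.

Lemma lse_jensen x y : smean x y <= beta * (lse y - lse x).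
Proof.
rewrite -subr_ge0 lse_diff_c ln_ge0//.
have {1}-> : 1 = \sum_j (softp j x + softp j x * (beta * D j x y - smean x y)).
  by rewrite big_split/= smean_centered addr0 softp_sum.
apply: ler_sum => j _; by rewrite -{1}[softp j x]mulr1 -mulrDr ler_wpM2l ?softp_ge0// expR_ge1Dx.
Qed.

Let lse_T x y : `|beta * (lse y - lse x)| <= T x y.
Proof.
have up x' y' : beta * (lse y' - lse x') <= T x' y'.
  rewrite -subr_le0 lse_diff_c ln_le0// -(softp_sum x') ler_sum// => j _.
  rewrite -[leRHS]mulr1 ler_wpM2l ?softp_ge0// -expR0 ler_expR subr_le0.
  by rewrite (le_trans (ler_norm _)).
rewrite ler_norml up andbT lerNl -mulrN opprB (le_trans (up _ _))//.
by rewrite /T enormB.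
Qed.

(** Subtracting [smean] centers the exponents: the linear terms of the exponentials cancel in the
    average, and [ln u <= u - 1] leaves only second-order ones. When [2 T > 1] the bounds by [T] on
    both terms suffice, since [2 T <= 4 T^2]. *)
Lemma lse_taylor x y :
  `|beta * (lse y - lse x) - smean x y| <= 8 * T x y ^+ 2.
Proof.
rewrite ger0_norm ?subr_ge0 ?lse_jensen//.
have [T2|T2] := leP (2 * T x y) 1; last first.
  have := lse_T x y; have := smeanT x y; rewrite !ler_norml.
  move=> /andP[? ?] /andP[? ?]; nra.
have cT j : `|beta * D j x y - smean x y| <= 2 * T x y.
  rewrite (le_trans (ler_normB _ _))//.
  by have := DT j x y; have := smeanT x y; lra.
rewrite lse_diff_c -[X in ln X](subrK 1) addrC (le_trans (le_ln1Dx _))//.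
  by rewrite ltrBrDl subrr Eg0.
have -> : \sum_j softp j x * expR (beta * D j x y - smean x y) - 1 =
    \sum_j softp j x * (expR (beta * D j x y - smean x y) - 1
       - (beta * D j x y - smean x y)).
  apply/esym; rewrite (eq_bigr (fun j => softp j x * expR (beta * D j x y - smean x y)
     - softp j x - softp j x * (beta * D j x y - smean x y))).
    by rewrite !sumrB smean_centered softp_sum subr0.
  by move=> j _; ring.
apply: avg_le => j; rewrite (le_trans (ler_norm _))//.
rewrite (le_trans (expR_sub1_le _))// ?(le_trans (cT j))//.
have -> : 8 * T x y ^+ 2 = 2 * (2 * T x y) ^+ 2 by ring.
rewrite ler_pM2l// -[leLHS]real_normK ?num_real// ler_pXn2r ?nnegrE//.
by rewrite mulr_ge0.
Qed.

Lemma smean_grad x y :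
  `|smean x y - beta * (lse_grad x *d (y - x))| <= beta * B * ⟦y - x⟧ ^+ 2.
Proof.
rewrite /smean /lse_grad dotrV_suml mulr_sumr -sumrB.
rewrite (le_trans (ler_norm_sum _ _ _))// -[leRHS]mul1r -(softp_sum x) mulr_suml.
rewrite ler_sum// => j _; rewrite dotrVZl.
have -> : softp j x * (beta * D j x y) - beta * (softp j x * (w j x *d (y - x))) =
  softp j x * (beta * (D j x y - w j x *d (y - x))) by ring.
rewrite normrM (ger0_norm (softp_ge0 _ _)) ler_wpM2l ?softp_ge0//.
rewrite normrM (gtr0_norm beta0) -mulrA ler_pM2l//.
by have [_ h] := fw j; exact: h.
Qed.

Lemma sm_lse : sm L (B + 8 * beta * L ^+ 2) lse lse_grad.
Proof.
split=> [x|x y].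
  rewrite (le_trans (ler_enorm_sum _ _ _))// -[leRHS]mul1r -(softp_sum x) mulr_suml.
  rewrite ler_sum// => j _; rewrite enormZ (ger0_norm (softp_ge0 _ _)).
  by rewrite ler_wpM2l ?softp_ge0//; have [h _] := fw j; exact: h.
rewrite -(ler_pM2l beta0) -{1}(gtr0_norm beta0) -normrM mulrBr.
rewrite -[X in `|X - _|](subrK (smean x y)) -addrA (le_trans (ler_normD _ _))//.
rewrite (le_trans (lerD (lse_taylor x y) (smean_grad x y)))//.
by rewrite /T !exprMn le_eqVlt; apply/orP; left; apply/eqP; ring.
Qed.

(** Between [x] and [y] the weight is multiplied by [exp t], with [t] the increment of
    [beta (f j - lse)]. Expanding this exponential gives the derivative of the weights, from which
    the Hessian of [lse] is read off. *)
Lemma softp_taylor j x y :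
  `|softp j y - softp j x - softp j x * (beta * D j x y - smean x y)| <= 16 * T x y ^+ 2.
Proof.
pose t := beta * D j x y - beta * (lse y - lse x).
have tT : `|t| <= 2 * T x y.
  rewrite (le_trans (ler_normB _ _))//; have := DT j x y; have := lse_T x y; lra.
have py : softp j y = softp j x * expR t.
  have pE z : softp j z = expR (beta * f j z - beta * lse z).
    by rewrite expRD expRN /lse mulrA divff ?gt_eqF// mul1r lnK ?posrE ?sexp_gt0.
  by rewrite !pE -expRD; congr expR; rewrite /t /D; ring.
have t2 : t ^+ 2 <= 4 * T x y ^+ 2.
  have -> : 4 * T x y ^+ 2 = (2 * T x y) ^+ 2 by ring.
  rewrite -[leLHS]real_normK ?num_real// ler_pXn2r ?nnegrE//.
  by rewrite mulr_ge0.
have main : `|softp j y - softp j x - softp j x * t| <= 2 * t ^+ 2.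
  have p0 := softp_ge0 j x; have p1 := softp_le1 j x.
  have q0 := softp_ge0 j y; have q1 := softp_le1 j y.
  have [t1|t1] := leP `|t| 1.
    have -> : softp j y - softp j x - softp j x * t = softp j x * (expR t - 1 - t).
      by rewrite py; ring.
    rewrite normrM ger0_norm// -[leRHS]mul1r ler_pM//; exact: expR_sub1_le.
  have h : `|softp j y - softp j x| <= 1 by rewrite ler_norml; lra.
  have h2 : `|softp j x * t| <= `|t|.
    by rewrite normrM ger0_norm// ler_piMl.
  have h3 : `|t| ^+ 2 = t ^+ 2 by rewrite real_normK ?num_real.
  rewrite (le_trans (ler_normB _ _))//; nra.
have h := lse_taylor x y.
have -> : softp j y - softp j x - softp j x * (beta * D j x y - smean x y) =
  (softp j y - softp j x - softp j x * t)
   - softp j x * (beta * (lse y - lse x) - smean x y) by rewrite /t; ring.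
rewrite (le_trans (ler_normB _ _))//.
have h2 : `|softp j x * (beta * (lse y - lse x) - smean x y)| <= 8 * T x y ^+ 2.
  by rewrite normrM (ger0_norm (softp_ge0 _ _)) -[leRHS]mul1r ler_pM ?softp_ge0 ?softp_le1.
lra.
Qed.

Lemma softp_lip j x y : `|softp j y - softp j x| <= 8 * beta * L * ⟦y - x⟧.
Proof.
have -> : 8 * beta * L * ⟦y - x⟧ = 8 * T x y by rewrite /T; ring.
have p0 := softp_ge0 j x; have p1 := softp_le1 j x.
have [h|h] := leP (8 * T x y) 1; last first.
  rewrite (le_trans _ (ltW h))// ler_norml.
  have := softp_ge0 j y; have := softp_le1 j y; lra.
have h1 := softp_taylor j x y; have T0 := T_ge0 x y.
have h2 : `|softp j x * (beta * D j x y - smean x y)| <= 2 * T x y.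
  rewrite normrM (ger0_norm p0) -[leRHS]mul1r ler_pM//.
  rewrite (le_trans (ler_normB _ _))//.
  by have := DT j x y; have := smeanT x y; lra.
rewrite -[X in `|X|](subrK (softp j x * (beta * D j x y - smean x y))).
rewrite (le_trans (ler_normD _ _))//; nra.
Qed.

End lse.

(** * Poincare inequalities on the discrete cube *)

Section cube.
Context {R : realType} {I : eqType}.
Local Notation cube := (I -> bool).
Implicit Types (z : cube) (G H : cube -> R) (i j : I) (s : seq I).

(* [av i] averages over the fair coin [z i], [df i] is the discrete derivative and
   [Ex s] integrates out the coins in [s]. *)
Definition upd z i b : cube := fun j => if j == i then b else z j.

Definition av i G : cube -> R := fun z => (G (upd z i true) + G (upd z i false)) / 2.
Definition df i G : cube -> R := fun z => (G (upd z i true) - G (upd z i false)) / 2.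

Fixpoint Ex s G : cube -> R := if s is i :: s' then Ex s' (av i G) else G.

Lemma upd_upd z i b c : upd (upd z i b) i c = upd z i c.
Proof. by apply/funext => j; rewrite /upd; case: eqP. Qed.

Lemma updC z i j b c : i != j -> upd (upd z i b) j c = upd (upd z j c) i b.
Proof.
move=> ij; apply/funext => k; rewrite /upd.
by have [->|//] := eqVneq k j; rewrite eq_sym (negbTE ij).
Qed.

Lemma av_le i G H : (forall z, G z <= H z) -> forall z, av i G z <= av i H z.
Proof. by move=> GH z; rewrite /av ler_wpM2r// lerD. Qed.

Lemma avD i G H : av i (fun z => G z + H z) = (fun z => av i G z + av i H z).
Proof. by apply/funext => z; rewrite /av; field. Qed.

Lemma avZ i c G : av i (fun z => c * G z) = (fun z => c * av i G z).
Proof. by apply/funext => z; rewrite /av; field. Qed.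

Lemma av_cst i c : av i (fun=> c) = (fun=> c).
Proof. by apply/funext => z; rewrite /av; field. Qed.

Lemma av_df i G : av i (df i G) = df i G.
Proof. by apply/funext => z; rewrite /av /df !upd_upd; field. Qed.

Lemma df_av i j G : i != j -> df j (av i G) = av i (df j G).
Proof.
by move=> ij; apply/funext => z; rewrite /av /df !(updC _ _ _ ij); field.
Qed.

Lemma df_df i j G : i != j -> df j (df i G) = df i (df j G).
Proof. by move=> ij; apply/funext => z; rewrite /df !(updC _ _ _ ij); field. Qed.

Lemma av_sqr i G : av i (fun z => G z ^+ 2) = (fun z => av i G z ^+ 2 + df i G z ^+ 2).
Proof. by apply/funext => z; rewrite /av /df; field. Qed.

Lemma Ex_le s G H : (forall z, G z <= H z) -> forall z, Ex s G z <= Ex s H z.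
Proof. by elim: s G H => [//|i s IH] G H GH z /=; apply: IH; exact: av_le. Qed.

Lemma ExD s G H : Ex s (fun z => G z + H z) = (fun z => Ex s G z + Ex s H z).
Proof. by elim: s G H => [//|i s IH] G H /=; rewrite avD IH. Qed.

Lemma ExZ s c G : Ex s (fun z => c * G z) = (fun z => c * Ex s G z).
Proof. by elim: s G => [//|i s IH] G /=; rewrite avZ IH. Qed.

Lemma Ex_cst s c : Ex s (fun=> c) = (fun=> c).
Proof. by elim: s => [//|i s IH] /=; rewrite av_cst IH. Qed.

Lemma ExN s G : Ex s (fun z => - G z) = (fun z => - Ex s G z).
Proof.
have := ExZ s (-1) G; under [X in Ex _ X = _]eq_fun do rewrite mulN1r.
by move=> ->; apply/funext => z; rewrite mulN1r.
Qed.

Lemma ExB s G H : Ex s (fun z => G z - H z) = (fun z => Ex s G z - Ex s H z).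
Proof. by rewrite ExD ExN. Qed.

Lemma Ex_sum s T (r : seq T) (P : pred T) (G : T -> cube -> R) :
  Ex s (fun z => \sum_(t <- r | P t) G t z) = (fun z => \sum_(t <- r | P t) Ex s (G t) z).
Proof.
elim: r => [|t r IH].
  under [X in Ex _ X]eq_fun do rewrite big_nil.
  by rewrite Ex_cst; apply/funext => z; rewrite big_nil.
under [X in Ex _ X]eq_fun do rewrite big_cons.
under [RHS]eq_fun do rewrite big_cons.
by case: (P t) => //; rewrite ExD IH.
Qed.

Lemma Ex_cat s1 s2 G : Ex (s1 ++ s2) G = Ex s2 (Ex s1 G).
Proof. by elim: s1 G => [//|i s1 IH] G /=; rewrite IH. Qed.

Lemma Ex_ub s G z c : (forall z, G z <= c) -> Ex s G z <= c.
Proof. by move=> Gc; rewrite -[leRHS](_ : Ex s (fun=> c) z = c) ?Ex_le ?Ex_cst. Qed.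

Lemma Ex_abs s G z : `|Ex s G z| <= Ex s (fun z => `|G z|) z.
Proof.
rewrite ler_norml Ex_le ?andbT; last by move=> ?; exact: ler_norm.
have := congr1 (@^~ z) (ExN s (fun z => `|G z|)) => /= <-.
by apply: Ex_le => z'; rewrite lerNl -normrN ler_norm.
Qed.

Lemma Ex_jensen s G z : (Ex s G z) ^+ 2 <= Ex s (fun z => G z ^+ 2) z.
Proof.
elim: s G => [//|i s IH] G /=; rewrite (le_trans (IH _))// av_sqr.
by apply: Ex_le => z'; rewrite lerDl sqr_ge0.
Qed.

Lemma df_Ex i s G : i \notin s -> df i (Ex s G) = Ex s (df i G).
Proof.
elim: s G => [//|j s IH] G /=; rewrite inE negb_or => /andP[ij si].
by rewrite IH// df_av// eq_sym.
Qed.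

(** Induction on the coins: by [av_sqr], averaging one coin splits a second moment into that of the
    average and that of the derivative, and averaging can only decrease the other squared
    derivatives. *)
Lemma poincare_cube s G z : uniq s ->
  Ex s (fun z => G z ^+ 2) z - (Ex s G z) ^+ 2 <=
  \sum_(i <- s) Ex s (fun z => df i G z ^+ 2) z.
Proof.
elim: s G => [|c s IH] G; first by rewrite big_nil subrr.
rewrite [uniq _]/= => /andP[cs us]; rewrite big_cons /= av_sqr ExD.
have -> : av c (fun z => df c G z ^+ 2) = (fun z => df c G z ^+ 2).
  rewrite av_sqr av_df; apply/funext => z'.
  by rewrite {2}/df /df !upd_upd subrr mul0r expr0n addr0.
rewrite addrAC [leRHS]addrC lerD2r (le_trans (IH _ us))//.
rewrite !big_seq; apply: ler_sum => i si; apply: Ex_le => z'.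
have ci : c != i by apply: contra cs => /eqP ->.
by rewrite df_av// av_sqr lerDl sqr_ge0.
Qed.

(* On the Walsh basis the two sides weigh the level-k part by 1 and by
   k/2 + [k = 1]/2. *)
Lemma improved_poincare_cube s G z : uniq s ->
  2 * (Ex s (fun z => G z ^+ 2) z - (Ex s G z) ^+ 2) <=
  \sum_(i <- s) Ex s (fun z => df i G z ^+ 2) z + \sum_(i <- s) (Ex s (df i G) z) ^+ 2.
Proof.
elim: s G => [|c s IH] G; first by rewrite !big_nil subrr mulr0 addr0.
rewrite [uniq _]/= => /andP[cs us]; rewrite !big_cons /= av_sqr ExD av_df.
have -> : av c (fun z => df c G z ^+ 2) = (fun z => df c G z ^+ 2).
  rewrite av_sqr av_df; apply/funext => z'.
  by rewrite {2}/df /df !upd_upd subrr mul0r expr0n addr0.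
(* The induction hypothesis serves the average over the new coin, the plain inequality its
   derivative [df c G]; the mixed derivatives needed by the latter are supplied by [e1]. *)
have h0 := IH (av c G) us; have h1 := poincare_cube (df c G) z us.
have e1 : \sum_(i <- s) Ex s (av c (fun z => df i G z ^+ 2)) z =
  \sum_(i <- s) Ex s (fun z => df i (av c G) z ^+ 2) z +
  \sum_(i <- s) Ex s (fun z => df i (df c G) z ^+ 2) z.
  rewrite -big_split/= !big_seq; apply: eq_bigr => i si.
  have ci : c != i by apply: contra cs => /eqP ->.
  by rewrite df_av// df_df// av_sqr ExD.
have e2 : \sum_(i <- s) (Ex s (av c (df i G)) z) ^+ 2 =
  \sum_(i <- s) (Ex s (df i (av c G)) z) ^+ 2.
  rewrite !big_seq; apply: eq_bigr => i si.
  have ci : c != i by apply: contra cs => /eqP ->.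
  by rewrite df_av.
rewrite e1 e2; lra.
Qed.

Lemma Ex_invar s (t : seq I) G z z' :
  (forall z z', (forall i, i \notin t -> z i = z' i) -> G z = G z') ->
  (forall i, i \notin s ++ t -> z i = z' i) -> Ex s G z = Ex s G z'.
Proof.
elim: s t G => [|c s IH] t G Gt zz /=; first exact: Gt.
apply: (IH (c :: t)) => [y y' yy|i hi]; last first.
  by apply: zz; move: hi; rewrite !mem_cat !inE orbCA orbA.
rewrite /av; congr ((_ + _) / _); apply: Gt => i it; rewrite /upd;
  by case: eqP => // /eqP ic; apply: yy; rewrite inE negb_or ic.
Qed.

Lemma Ex_full s G z z' : (forall i, i \in s) -> Ex s G z = Ex s G z'.
Proof.
move=> hs; apply: (@Ex_invar s [::]) => [y y' yy|i]; last by rewrite cats0 hs.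
by congr G; apply/funext => i; exact: yy.
Qed.

End cube.

Lemma Ex_reindex {R : realType} {I J : eqType} (h : J -> I) (s : seq J) T
    (c : (I -> bool) -> T) (G : (I -> bool) -> R) (G' : T -> (J -> bool) -> R) z :
  injective h ->
  (forall z i b, c (upd z (h i) b) = c z) ->
  (forall z, G z = G' (c z) (z \o h)) ->
  Ex (map h s) G z = Ex s (G' (c z)) (z \o h).
Proof.
move=> hi ch; have uh y j b : upd y (h j) b \o h = upd (y \o h) j b.
  by apply/funext => k /=; rewrite /upd/= (inj_eq hi).
elim: s G G' => [|j s IH] G G' GG' /=; first exact: GG'.
rewrite (IH _ (fun t => av j (G' t)))// => y.
by rewrite /av !GG' !ch !uh.
Qed.

(** * Regular potentials and the Euler scheme *)

Section regular.
Context {R : realType} {n : nat}.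
Local Notation E := 'rV[R]_n.

(* [W] is a convex potential with bounded gradient [g]; [H x v] stands for the
   Hessian of [W] at [x] applied to [v]. *)
Record regular (K : R) (W : E -> R) (g : E -> E) (H : E -> E -> E) : Prop := Regular {
  regK : 1 <= K ;
  regW : sm K K W g ;
  reg_lip : forall x y, ⟦g y - g x⟧ <= K * ⟦y - x⟧ ;
  reg_mono : forall x y, 0 <= (g y - g x) *d (y - x) ;
  reg_hess : forall x y v, `|v *d (g y - g x) - H x v *d (y - x)| <=
      K * ⟦v⟧ * ⟦y - x⟧ ^+ 2 }.

Lemma regular_lse N (beta : R) (a : 'I_N.+1 -> E) (c : 'I_N.+1 -> R) : 0 < beta ->
  exists K g H, regular K (lse beta (fun j x => a j *d x + c j)) g H.
Proof.
move=> b0; pose f j (x : E) := a j *d x + c j; pose w j (x : E) := a j.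
pose S := \sum_j ⟦a j⟧; pose L := S + 1.
have S0 : 0 <= S by exact: sumr_ge0.
have L0 : 0 <= L by rewrite addr_ge0.
have aS j : ⟦a j⟧ <= S by rewrite /S (bigD1 j)//= lerDl sumr_ge0.
have fw j : sm L 0 (f j) (w j).
  by apply: (sm_weaken (sm_lin (a j) (c j))) => //; have := aS j; rewrite /L; lra.
pose g := lse_grad beta f w; pose p := softp beta f.
(* The Hessian of log-sum-exp is [beta] times the covariance of the slopes [a j] under the softmax
   weights. *)
pose H (x v : E) : E := \sum_j (v *d a j * (p j x * beta)) *: (a j - g x).
pose K := 1 + L + 8 * beta * L ^+ 2 + S * (8 * beta * L) + S * 16 * beta ^+ 2 * L ^+ 2.
have t1 : 0 <= 8 * beta * L ^+ 2 by rewrite !mulr_ge0 ?exprn_ge0// ltW.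
have t2 : 0 <= S * (8 * beta * L) by rewrite !mulr_ge0// ltW.
have t3 : 0 <= S * 16 * beta ^+ 2 * L ^+ 2 by rewrite !mulr_ge0 ?exprn_ge0// ltW.
have smW := sm_lse b0 L0 fw.
have gE x y : g y - g x = \sum_j (p j y - p j x) *: a j.
  by rewrite /g /lse_grad -sumrB; apply: eq_bigr => j _; rewrite scalerBl.
have tan x y : g x *d (y - x) <= lse beta f y - lse beta f x.
  rewrite -(ler_pM2l b0); apply: (le_trans _ (lse_jensen f b0 x y)).
  rewrite /smean /g /lse_grad dotrV_suml mulr_sumr ler_sum// => j _.
  by rewrite dotrVZl /f /w /p !dotrVE le_eqVlt; apply/orP; left; apply/eqP; ring.
exists K, g, H; split.
- by rewrite /K; lra.
- by apply: (sm_weaken smW); rewrite /K; lra.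
- move=> x y; rewrite gE (le_trans (ler_enorm_sum _ _ _))//.
  apply: (@le_trans _ _ (\sum_j (8 * beta * L * ⟦y - x⟧) * ⟦a j⟧)).
    apply: ler_sum => j _; rewrite enormZ ler_wpM2r//.
    exact: (softp_lip b0 L0 fw j x y).
  rewrite -mulr_sumr -/S.
  have -> : 8 * beta * L * ⟦y - x⟧ * S = S * (8 * beta * L) * ⟦y - x⟧ by ring.
  by rewrite ler_wpM2r// /K; lra.
- move=> x y; have := tan x y; have := tan y x.
  by rewrite !dotrVE; lra.
- move=> x y v.
  have smeanE : smean beta f x y = beta * (g x *d (y - x)).
    rewrite /smean /g /lse_grad dotrV_suml mulr_sumr; apply: eq_bigr => j _.
    by rewrite dotrVZl /f /w /p !dotrVE; ring.
  have -> : v *d (g y - g x) - H x v *d (y - x) = \sum_j (v *d a j) *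
      (p j y - p j x - p j x * (beta * (f j y - f j x) - smean beta f x y)).
    rewrite gE dotrVC dotrV_suml /H dotrV_suml -sumrB; apply: eq_bigr => j _.
    by rewrite smeanE !dotrVE /f (dotrVC (a j) v); ring.
  rewrite (le_trans (ler_norm_sum _ _ _))//.
  apply: (@le_trans _ _ (\sum_j (⟦v⟧ * ⟦a j⟧) * (16 * (beta * (L * ⟦y - x⟧)) ^+ 2))).
    apply: ler_sum => j _; rewrite normrM ler_pM ?normr_dotrV_le//.
    exact: (softp_taylor b0 L0 fw j x y).
  rewrite -mulr_suml -mulr_sumr -/S.
  have -> : ⟦v⟧ * S * (16 * (beta * (L * ⟦y - x⟧)) ^+ 2) =
    (S * 16 * beta ^+ 2 * L ^+ 2) * (⟦v⟧ * ⟦y - x⟧ ^+ 2) by ring.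
  by rewrite -[leRHS]mulrA ler_wpM2r ?mulr_ge0 ?exprn_ge0// /K; lra.
Qed.

End regular.

Section chain.
Context {R : realType} {n : nat}.
Local Notation E := 'rV[R]_n.
Variables (K : R) (W : E -> R) (g : E -> E) (H : E -> E -> E).
Hypothesis reg : regular K W g H.
Variable eta : R.
Hypothesis eta0 : 0 < eta.
Hypothesis eta1 : eta * (1 + K) ^+ 2 <= 1.

(* The Euler scheme of the Langevin dynamics of [|x|^2/2 + W]: a contraction [phi]
   of rate [rho], and noise uniform on [nstep * {-1, 1}^n]. *)
Definition phi (x : E) : E := x - eta *: (x + g x).
Definition rho : R := Num.sqrt (1 - 2 * eta + eta ^+ 2 * (1 + K) ^+ 2).
Definition nstep : R := Num.sqrt (2 * eta).
Local Notation s := nstep.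

Let K1 : 1 <= K. Proof. by case: reg. Qed.
Let K0 : 0 <= K. Proof. exact: le_trans K1. Qed.

Lemma nstep_sqr : s ^+ 2 = 2 * eta.
Proof. by rewrite sqr_sqrtr// mulr_ge0// ltW. Qed.

Lemma nstep_gt0 : 0 < s. Proof. by rewrite sqrtr_gt0 mulr_gt0. Qed.

Let s0 := nstep_gt0.

Let eta_half : eta <= 2^-1.
Proof.
have : 2 <= (1 + K) ^+ 2 by have := K1; nra.
by move=> h; have := eta1; nra.
Qed.

Lemma rho_sqr : rho ^+ 2 = 1 - 2 * eta + eta ^+ 2 * (1 + K) ^+ 2.
Proof.
rewrite sqr_sqrtr// addr_ge0//; first by have := eta_half; lra.
by rewrite mulr_ge0 ?sqr_ge0.
Qed.

Lemma rho_ge0 : 0 <= rho. Proof. exact: sqrtr_ge0. Qed.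

Lemma rho_sqr_le : rho ^+ 2 <= 1 - eta.
Proof. by rewrite rho_sqr; have := eta1; have := eta0; nra. Qed.

Lemma rho_sqr_ge : 1 - 2 * eta <= rho ^+ 2.
Proof. by rewrite rho_sqr lerDl mulr_ge0 ?sqr_ge0. Qed.

Lemma rho_le : rho <= 1 - eta / 2.
Proof.
have := eta_half => eh; have e0 := eta0.
rewrite -(ler_pXn2r (n := 2)) ?nnegrE ?rho_ge0//; last by lra.
rewrite (le_trans rho_sqr_le)//; nra.
Qed.

Lemma rho_le1 : rho <= 1.
Proof. by rewrite (le_trans rho_le)//; have := eta0; lra. Qed.

(** The unit convexity of [|x|^2/2] enters here: with [d] the displacement and [e] that of [g], the
    square is [(1 - 2 eta) |d|^2 - 2 eta (e . d) + eta^2 |d + e|^2], and [e . d >= 0] by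
    monotonicity. *)
Lemma phi_lip x y : ⟦phi y - phi x⟧ <= rho * ⟦y - x⟧.
Proof.
rewrite -(ler_pXn2r (n := 2)) ?nnegrE ?mulr_ge0 ?rho_ge0// exprMn rho_sqr.
set d := y - x; set e := g y - g x.
have -> : phi y - phi x = d - eta *: (d + e).
  by apply/rowP => i; rewrite /phi /d /e !mxE; ring.
have m := reg_mono reg x y; have l := reg_lip reg x y.
rewrite -/d -/e in m l.
have q : ⟦d + e⟧ ^+ 2 <= (1 + K) ^+ 2 * ⟦d⟧ ^+ 2.
  rewrite -exprMn ler_pXn2r ?nnegrE ?mulr_ge0 ?addr_ge0//.
  by rewrite (le_trans (ler_enormD _ _))//; lra.
have -> : ⟦d - eta *: (d + e)⟧ ^+ 2 =
   ⟦d⟧ ^+ 2 - 2 * eta * ⟦d⟧ ^+ 2 - 2 * eta * (e *d d) + eta ^+ 2 * ⟦d + e⟧ ^+ 2.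
  by clearbody d e; rewrite !enorm_sqr !dotrVE (dotrVC d e); ring.
have h1 : 0 <= eta * (e *d d) by rewrite mulr_ge0// ltW.
have h2 : eta ^+ 2 * ⟦d + e⟧ ^+ 2 <= eta ^+ 2 * ((1 + K) ^+ 2 * ⟦d⟧ ^+ 2).
  by rewrite ler_wpM2l ?sqr_ge0.
lra.
Qed.

(** Chain rule for [f] composed with [phi]: the symmetric derivative [1 - eta (1 + H x)] of [phi],
    applied to [w (phi x)]. *)
Definition cgrad (w : E -> E) (x : E) : E :=
  w (phi x) - eta *: (w (phi x) + H x (w (phi x))).

Lemma phi_taylor v x y :
  `|v *d (phi y - phi x) - (v - eta *: (v + H x v)) *d (y - x)| <=
  eta * K * ⟦v⟧ * ⟦y - x⟧ ^+ 2.
Proof.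
have := reg_hess reg x y v; rewrite -(ler_pM2l eta0) -{1}(gtr0_norm eta0) -normrM.
rewrite -!mulrA; apply: le_trans; rewrite le_eqVlt; apply/orP; left; apply/eqP.
by rewrite -normrN; congr `|_|; rewrite /phi !dotrVE; ring.
Qed.

Lemma cgrad_taylor L B f w x y : sm L B f w -> 0 <= B ->
  `|f (phi y) - f (phi x) - cgrad w x *d (y - x)| <=
  (rho ^+ 2 * B + eta * K * ⟦w (phi x)⟧) * ⟦y - x⟧ ^+ 2.
Proof.
move=> [_ h] B0; have h1 := h (phi x) (phi y); have h2 := phi_taylor (w (phi x)) x y.
rewrite -[X in `|X - _|](subrK (w (phi x) *d (phi y - phi x))) -addrA.
rewrite (le_trans (ler_normD _ _))// mulrDl lerD// (le_trans h1)//.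
rewrite (mulrC (rho ^+ 2)) -mulrA ler_wpM2l// -exprMn ler_pXn2r ?nnegrE ?mulr_ge0 ?rho_ge0//.
exact: phi_lip.
Qed.

(** A contraction has a contracting derivative: the operator [1 - eta (1 + H x)] is not estimated
    itself, its first-order action is compared with the Lipschitz bound on [phi]. *)
Lemma cgrad_le w x : ⟦cgrad w x⟧ <= rho * ⟦w (phi x)⟧.
Proof.
apply: (@enorm_le_of_small _ _ _ x _ (eta * K * ⟦w (phi x)⟧)); last first.
  by rewrite mulr_ge0 ?rho_ge0.
move=> y; have := phi_taylor (w (phi x)) x y; rewrite ler_norml => /andP[h2 _].
have h3 : w (phi x) *d (phi y - phi x) <= rho * ⟦w (phi x)⟧ * ⟦y - x⟧.
  by rewrite (le_trans (dotrV_le _ _))// (mulrC rho) -mulrA ler_wpM2l// phi_lip.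
move: h2; rewrite -/(cgrad w x); lra.
Qed.

(** The remainder constant becomes [rho^2 B + eta K L <= (1 - eta) B + eta B]. This is the purpose
    of the condition [K * L <= B]: the same [B] then survives any number of steps. *)
Lemma sm_cgrad L B f w : sm L B f w -> 0 <= B -> K * L <= B ->
  sm (rho * L) B (f \o phi) (cgrad w).
Proof.
move=> fw B0 KLB; have [wL _] := fw.
split=> [x|x y]; first by rewrite (le_trans (cgrad_le _ _))// ler_wpM2l ?rho_ge0.
rewrite (le_trans (cgrad_taylor x y fw B0))// ler_wpM2r ?sqr_ge0//.
have h1 : eta * (K * ⟦w (phi x)⟧) <= eta * (K * L).
  by rewrite ler_wpM2l ?(ltW eta0)// ler_wpM2l.
have h2 := rho_sqr_le.
have h3 : rho ^+ 2 * B <= (1 - eta) * B by rewrite ler_wpM2r.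
have h4 : eta * (K * L) <= eta * B by rewrite ler_wpM2l ?(ltW eta0).
rewrite -mulrA; lra.
Qed.

Definition signs {I : eqType} (h : 'I_n -> I) (z : I -> bool) : E :=
  \row_i (-1) ^+ (~~ z (h i)).

Local Notation sgn := (signs id).
Local Notation Exn := (@Ex R 'I_n (enum 'I_n)).
Let zt : 'I_n -> bool := fun=> true.

Lemma enorm_signs (I : eqType) (h : 'I_n -> I) z : ⟦signs h z⟧ ^+ 2 = n%:R.
Proof.
rewrite enorm_sqr /dotrV (eq_bigr (fun=> 1)) => [|i _].
  by rewrite sumr_const card_ord.
by rewrite !mxE -expr2 sqrr_sign.
Qed.

Definition step (f : E -> R) (x : E) : R :=
  Exn (fun z => f (phi (x + s *: sgn z))) zt.

Definition step_grad (w : E -> E) (x : E) : E :=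
  \row_i Exn (fun z => cgrad w (x + s *: sgn z) ord0 i) zt.

Lemma step_le (f1 f2 : E -> R) : (forall x, f1 x <= f2 x) -> forall x, step f1 x <= step f2 x.
Proof. by move=> h x; apply: Ex_le => z; exact: h. Qed.

Lemma stepD (f1 f2 : E -> R) : step (fun x => f1 x + f2 x) = (fun x => step f1 x + step f2 x).
Proof. by apply/funext => x; rewrite /step ExD. Qed.

Lemma stepZ c (f : E -> R) : step (fun x => c * f x) = (fun x => c * step f x).
Proof. by apply/funext => x; rewrite /step ExZ. Qed.

Lemma step_cst c : step (fun=> c) = (fun=> c).
Proof. by apply/funext => x; rewrite /step Ex_cst. Qed.

Lemma stepB (f1 f2 : E -> R) : step (fun x => f1 x - f2 x) = (fun x => step f1 x - step f2 x).
Proof. by apply/funext => x; rewrite /step ExB. Qed.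

Lemma step_grad_dot w x v :
  step_grad w x *d v = Exn (fun z => cgrad w (x + s *: sgn z) *d v) zt.
Proof.
rewrite /dotrV Ex_sum; apply: eq_bigr => i _; rewrite mxE.
under [in RHS]eq_fun do rewrite mulrC.
by rewrite ExZ mulrC.
Qed.

Lemma sm_step L B f w : sm L B f w -> 0 <= B -> K * L <= B ->
  sm (rho * L) B (step f) (step_grad w).
Proof.
move=> fw B0 KLB; have [h1 h2] := sm_cgrad fw B0 KLB.
split=> [x|x y].
  apply: (@enorm_le_of_small _ _ _ 0 _ 0).
    move=> y; rewrite subr0 mul0r addr0 step_grad_dot.
    by apply: Ex_ub => z; rewrite (le_trans (dotrV_le _ _))// ler_wpM2r.
  by rewrite (le_trans _ (h1 0)).
rewrite /step step_grad_dot.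
pose G z := f (phi (y + s *: sgn z)) - f (phi (x + s *: sgn z)) -
  cgrad w (x + s *: sgn z) *d (y - x).
have -> : Exn (fun z => f (phi (y + s *: sgn z))) zt -
   Exn (fun z => f (phi (x + s *: sgn z))) zt -
   Exn (fun z => cgrad w (x + s *: sgn z) *d (y - x)) zt = Exn G zt.
  by rewrite /G !ExB.
rewrite (le_trans (Ex_abs _ _ _))//.
apply: Ex_ub => z; rewrite /G.
by have := h2 (x + s *: sgn z) (y + s *: sgn z); rewrite opprD addrACA subrr addr0.
Qed.

(** Discrete form of the commutation bound [|grad P_t f|^2 <= exp (- 2 t) P_t |grad f|^2], with
    [rho^2] in place of the exponential. *)
Lemma step_grad_sqr w x : ⟦step_grad w x⟧ ^+ 2 <=
  rho ^+ 2 * step (fun x => ⟦w x⟧ ^+ 2) x.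
Proof.
rewrite enorm_sqr.
apply: (@le_trans _ _ (Exn (fun z => ⟦cgrad w (x + s *: sgn z)⟧ ^+ 2) zt)).
  have -> : Exn (fun z => ⟦cgrad w (x + s *: sgn z)⟧ ^+ 2) zt =
      \sum_i Exn (fun z => cgrad w (x + s *: sgn z) ord0 i ^+ 2) zt.
    have := congr1 (@^~ zt) (Ex_sum (enum 'I_n) (index_enum 'I_n) xpredT
      (fun i z => cgrad w (x + s *: sgn z) ord0 i ^+ 2)) => /= <-.
    by congr Ex; apply/funext => z; rewrite enorm_sqr; apply: eq_bigr => i _.
  by apply: ler_sum => i _; rewrite mxE -expr2 Ex_jensen.
rewrite /step; have := congr1 (@^~ zt) (ExZ (enum 'I_n) (rho ^+ 2)
  (fun z => ⟦w (phi (x + s *: sgn z))⟧ ^+ 2)) => /= <-.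
apply: Ex_le => z; rewrite -exprMn ler_pXn2r ?nnegrE ?mulr_ge0 ?rho_ge0//.
exact: cgrad_le.
Qed.

Lemma sm_iter k L B f w : sm L B f w -> 0 <= L -> 0 <= B -> K * L <= B ->
  sm (rho ^+ k * L) B (iter k step f) (iter k step_grad w).
Proof.
move=> fw L0 B0 KLB; elim: k => [|k IH]; first by rewrite expr0 mul1r.
rewrite exprS -mulrA; apply: sm_step => //.
rewrite (le_trans _ KLB)// ler_wpM2l// ler_piMl// exprn_ile1 ?rho_ge0//.
exact: rho_le1.
Qed.

Lemma iter_step_le k (f1 f2 : E -> R) : (forall x, f1 x <= f2 x) ->
  forall x, iter k step f1 x <= iter k step f2 x.
Proof. by elim: k => [//|k IH] h x /=; apply: step_le; exact: IH. Qed.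

Lemma iter_stepD k (f1 f2 : E -> R) :
  iter k step (fun x => f1 x + f2 x) = (fun x => iter k step f1 x + iter k step f2 x).
Proof. by elim: k => [//|k IH] /=; rewrite IH stepD. Qed.

Lemma iter_stepB k (f1 f2 : E -> R) :
  iter k step (fun x => f1 x - f2 x) = (fun x => iter k step f1 x - iter k step f2 x).
Proof. by elim: k => [//|k IH] /=; rewrite IH stepB. Qed.

Lemma iter_stepZ k c (f : E -> R) :
  iter k step (fun x => c * f x) = (fun x => c * iter k step f x).
Proof. by elim: k => [//|k IH] /=; rewrite IH stepZ. Qed.

Lemma iter_step_cst k c : iter k step (fun=> c) = (fun=> c).
Proof. by elim: k => [//|k IH] /=; rewrite IH step_cst. Qed.

Lemma iter_step_sum k T (r : seq T) (P : pred T) (F : T -> E -> R) x :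
  iter k step (fun x => \sum_(t <- r | P t) F t x) x =
  \sum_(t <- r | P t) iter k step (F t) x.
Proof.
elim: r => [|t r IH].
  by under [X in iter _ _ X]eq_fun do rewrite big_nil; rewrite iter_step_cst big_nil.
under [X in iter _ _ X]eq_fun do rewrite big_cons.
by rewrite big_cons; case: (P t) => //; rewrite iter_stepD IH.
Qed.

Lemma iter_step_grad_sqr k w x : ⟦iter k step_grad w x⟧ ^+ 2 <=
  rho ^+ (2 * k) * iter k step (fun x => ⟦w x⟧ ^+ 2) x.
Proof.
elim: k x => [|k IH] x; first by rewrite muln0 expr0 mul1r.
rewrite /= (le_trans (step_grad_sqr _ _))// mulnS exprD -mulrA.
rewrite ler_wpM2l ?sqr_ge0// -[leRHS]/((fun x => rho ^+ (2 * k) * step _ x) x) -stepZ.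
exact: step_le.
Qed.

(* [noise_err] bounds the error made when the difference of a [B]-smooth
   function over a noise coordinate is replaced by its derivative. *)
Definition noise_err (B : R) : R := 4 * B * n%:R.

Lemma df_noise (I : eqType) (h : 'I_n -> I) L B f w x z i : injective h ->
  sm L B f w -> 0 <= B ->
  `|df (h i) (fun z => f (x + s *: signs h z)) z
    - s * w (x + s *: signs h z) ord0 i| <= 4 * B * s ^+ 2.
Proof.
move=> hi [_ hB] B0; rewrite /df.
set z1 := upd z _ true; set z2 := upd z _ false.
pose c (b : bool) := (-1) ^+ (~~ b) - (-1) ^+ (~~ z (h i)) : R.
have dif b : (x + s *: signs h (upd z (h i) b)) - (x + s *: signs h z) =
    (s * c b) *: delta_mx ord0 i.
  apply/rowP => j; rewrite !mxE eqxx/= /upd (inj_eq hi) /c.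
  have [->|ji] := eqVneq j i; first by rewrite mulr1; ring.
  by rewrite mulr0 subrr.
(* Resetting a coin moves its sign by 0 or 2 in absolute value; squared, this is the 4 of
   [noise_err]. *)
have c2 b : `|c b| <= 2.
  rewrite (le_trans (ler_normB _ _))// !normrX !normrN1 !expr1n; lra.
have key b : `|f (x + s *: signs h (upd z (h i) b)) - f (x + s *: signs h z)
    - s * c b * w (x + s *: signs h z) ord0 i| <= 4 * B * s ^+ 2.
  have := hB (x + s *: signs h z) (x + s *: signs h (upd z (h i) b)).
  rewrite dif dotrVZr dotrVC dotrV_delta => /le_trans; apply.
  rewrite enormZ exprMn enorm_sqr dotrV_delta mxE !eqxx mulr1 normrM exprMn.
  rewrite real_normK ?num_real//.
  have : `|c b| ^+ 2 <= 4.
    by rewrite (le_trans (_ : _ <= 2 ^+ 2))// ?ler_pXn2r ?nnegrE//; lra.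
  move=> h4; have : 0 <= (4 - `|c b| ^+ 2) * (B * s ^+ 2).
    by rewrite mulr_ge0 ?subr_ge0// mulr_ge0 ?sqr_ge0.
  lra.
have := key true; have := key false; rewrite -/z1 -/z2.
set A1 := f (x + s *: signs h z1); set A2 := f (x + s *: signs h z2).
set A := f _; set wi := w _ _ _; rewrite /c expr0 expr1.
set e := (-1) ^+ _; rewrite !ler_norml => /andP[p1 p2] /andP[p3 p4].
by apply/andP; split; lra.
Qed.

Lemma df_noise_vec (I : eqType) (h : 'I_n -> I) L B f w x z : injective h ->
  sm L B f w -> 0 <= B ->
  ⟦(\row_i df (h i) (fun z => f (x + s *: signs h z)) z)
    - s *: w (x + s *: signs h z)⟧ <= noise_err B * s ^+ 2.
Proof.
move=> hi hf B0; rewrite (le_trans (enorm_le_sum _))//.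
rewrite /noise_err (_ : _ * _ * s ^+ 2 = \sum_(i < n) 4 * B * s ^+ 2).
  by apply: ler_sum => i _; rewrite !mxE; exact: df_noise hf B0.
by rewrite sumr_const card_ord -mulr_natr; ring.
Qed.

Lemma sum_df_noise (I : eqType) (h : 'I_n -> I) L B f w x z : injective h ->
  sm L B f w -> 0 <= B ->
  \sum_i df (h i) (fun z => f (x + s *: signs h z)) z ^+ 2 <=
  (s * ⟦w (x + s *: signs h z)⟧ + noise_err B * s ^+ 2) ^+ 2.
Proof.
move=> hi hf B0; have := df_noise_vec x z hi hf B0; set D := \row_i _ => hD.
have -> : \sum_i df (h i) (fun z => f (x + s *: signs h z)) z ^+ 2 = ⟦D⟧ ^+ 2.
  by rewrite enorm_sqr; apply: eq_bigr => i _; rewrite mxE expr2.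
have e0 : 0 <= noise_err B * s ^+ 2 by rewrite (le_trans _ hD).
rewrite ler_pXn2r ?nnegrE ?addr_ge0 ?mulr_ge0 ?(ltW s0)//.
rewrite -[D](subrK (s *: w (x + s *: signs h z))) (le_trans (ler_enormD _ _))//.
by rewrite addrC lerD// enormZ gtr0_norm.
Qed.

(** This is the Poincare inequality on the cube of one noise. Coin derivatives equal [s] times a
    component of the gradient up to an error in [s^2]; squaring that sum produces the two error
    terms. *)
Lemma step_var L B f w x : sm L B f w -> 0 <= L -> 0 <= B -> K * L <= B ->
  step (fun x => f x ^+ 2) x - (step f x) ^+ 2 <=
  s ^+ 2 * rho ^+ 2 * step (fun x => ⟦w x⟧ ^+ 2) x
   + (2 * noise_err B * L * s ^+ 3 + noise_err B ^+ 2 * s ^+ 4).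
Proof.
move=> fw L0 B0 KLB; have hc := sm_cgrad fw B0 KLB; have [wL _] := fw.
have := poincare_cube (fun z => f (phi (x + s *: sgn z))) zt (enum_uniq 'I_n).
move=> /le_trans; apply.
have n0 : 0 <= noise_err B by rewrite !mulr_ge0.
set c0 := 2 * _ * _ * _ + _.
rewrite /step -[X in X * Ex _ _ _ + _]mulr1 mulr1.
have := congr1 (@^~ zt) (Ex_sum (enum 'I_n) (enum 'I_n) xpredT
  (fun i z => df i (fun z => f (phi (x + s *: sgn z))) z ^+ 2)) => /= <-.
have -> : s ^+ 2 * rho ^+ 2 * Exn (fun z => ⟦w (phi (x + s *: sgn z))⟧ ^+ 2) zt + c0 =
  Exn (fun z => s ^+ 2 * rho ^+ 2 * ⟦w (phi (x + s *: sgn z))⟧ ^+ 2 + c0) zt.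
  by rewrite ExD ExZ Ex_cst.
apply: Ex_le => z; rewrite big_enum/=.
have := sum_df_noise x z (@inj_id 'I_n) hc B0 => /le_trans; apply.
have a1 := cgrad_le w (x + s *: sgn z); have a2 := wL (phi (x + s *: sgn z)).
set u := ⟦cgrad _ _⟧ in a1 *; set v := ⟦w _⟧ in a1 a2 *.
have u0 : 0 <= u by exact: enorm_ge0.
have v0 : 0 <= v by exact: enorm_ge0.
have uv2 : u ^+ 2 <= rho ^+ 2 * v ^+ 2.
  by rewrite -exprMn ler_pXn2r ?nnegrE ?mulr_ge0 ?rho_ge0.
have uL : u <= L.
  rewrite (le_trans a1)// (le_trans _ a2)// ler_piMl//; exact: rho_le1.
have s3 : 0 <= noise_err B * s ^+ 3 by rewrite mulr_ge0// exprn_ge0// ltW.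
have h1 : (noise_err B * s ^+ 3) * u <= (noise_err B * s ^+ 3) * L by rewrite ler_wpM2l.
have h2 : s ^+ 2 * u ^+ 2 <= s ^+ 2 * (rho ^+ 2 * v ^+ 2) by rewrite ler_wpM2l ?sqr_ge0.
have -> : (s * u + noise_err B * s ^+ 2) ^+ 2 = s ^+ 2 * u ^+ 2 +
  2 * ((noise_err B * s ^+ 3) * u) + noise_err B ^+ 2 * s ^+ 4 by ring.
rewrite /c0; lra.
Qed.

(** * The path space of the Euler scheme *)

Local Notation pidx := (nat * 'I_n)%type.
Implicit Types (z : pidx -> bool).

(* The coin [z (k, i)] drives coordinate [i] of the noise at time [k]. *)
Fixpoint path_pos z k : E :=
  if k is k'.+1 then phi (path_pos z k' + s *: signs (pair k') z) else 0.

Fixpoint flow z k j (x : E) : E :=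
  if j is j'.+1 then flow z k.+1 j' (phi (x + s *: signs (pair k) z)) else x.

(** Times are listed in decreasing order: [Ex] averages the head of its list first, so integrating
    out a prefix is the conditional expectation given the past. *)
Fixpoint idxs N : seq pidx :=
  if N is k.+1 then map (pair k) (enum 'I_n) ++ idxs k else [::].

Lemma pair_inj (k : nat) : injective (@pair nat 'I_n k).
Proof. by move=> i j []. Qed.

Lemma mem_idxs N k i : ((k, i) \in idxs N) = (k < N)%N.
Proof.
elim: N => [//|N IH]; rewrite /= mem_cat IH [RHS]ltnS [RHS]leq_eqVlt; congr orb.
apply/mapP/eqP => [[j _ []]//|->]; by exists i => //; rewrite mem_enum.
Qed.

Lemma uniq_idxs N : uniq (idxs N).
Proof.
elim: N => [//|N IH] /=; rewrite cat_uniq IH andbT map_inj_uniq ?enum_uniq//=;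
  last exact: pair_inj.
by apply/hasPn => -[k i]; rewrite mem_idxs => kN; apply/mapP => -[j _ [kE _]];
  rewrite kE ltnn in kN.
Qed.

Lemma path_pos_flow z k j : path_pos z (k + j) = flow z k j (path_pos z k).
Proof. by elim: j k => [|j IH] k /=; rewrite ?addn0// -IH addSnnS. Qed.

Lemma path_pos_upd z k l i b : (k <= l)%N -> path_pos (upd z (l, i) b) k = path_pos z k.
Proof.
elim: k => [//|k IH] kl /=; rewrite IH ?(ltnW kl)//; congr (phi (_ + s *: _)).
by apply/rowP => j; rewrite !mxE /upd xpair_eqE (ltn_eqF kl).
Qed.

Lemma flow_upd z k j l i b x : (l < k)%N -> flow (upd z (l, i) b) k j x = flow z k j x.
Proof.
elim: j k x => [//|j IH] k x lk /=; rewrite IH ?ltnS ?(ltnW lk)//.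
congr (flow _ _ _ (phi (_ + s *: _))).
by apply/rowP => i'; rewrite !mxE /upd xpair_eqE (gtn_eqF lk).
Qed.

Lemma Ex_noise k (F : E -> R) z :
  Ex (map (pair k) (enum 'I_n)) (fun z => F (phi (path_pos z k + s *: signs (pair k) z))) z
  = step F (path_pos z k).
Proof.
rewrite (@Ex_reindex _ _ _ (pair k) (enum 'I_n) _ (fun z => path_pos z k) _
  (fun x y => F (phi (x + s *: sgn y))))//.
- by apply: Ex_full => i; rewrite mem_enum.
- exact: pair_inj.
- by move=> y i b; rewrite path_pos_upd.
Qed.

Lemma Ex_path N (F : E -> R) z : Ex (idxs N) (fun z => F (path_pos z N)) z = iter N step F 0.
Proof.
elim: N F z => [//|N IH] F z; rewrite [idxs _]/= Ex_cat iterSr -(IH _ z).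
by congr Ex; apply/funext => y; exact: Ex_noise.
Qed.

Lemma idxs_cat N k : (k <= N)%N ->
  exists2 t, idxs N = t ++ idxs k & forall l i, (l, i) \in t -> (k <= l)%N.
Proof.
elim: N => [|N IH]; first by rewrite leqn0 => /eqP ->; exists [::].
rewrite leq_eqVlt ltnS => /predU1P[->|kN]; first by exists [::].
have [t tE tk] := IH kN; exists (map (pair N) (enum 'I_n) ++ t) => [|l i].
  by rewrite /= tE catA.
by rewrite mem_cat => /orP[/mapP[j _ [-> _]]//|]; exact: tk.
Qed.

Lemma Ex_path_tail N k t (F : E -> R) z : (k <= N)%N -> idxs N = t ++ idxs k ->
  Ex t (fun z => F (path_pos z N)) z = iter (N - k) step F (path_pos z k).
Proof.
elim: N F z t => [|N IH] F z t.
  by rewrite leqn0 => /eqP ->; case: t.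
rewrite leq_eqVlt ltnS => /predU1P[->|kN] tE.
  rewrite subnn; case: t tE => [//|p t] /(congr1 size).
  by rewrite size_cat => /eqP; rewrite -{1}[size (idxs _)]add0n eqn_add2r.
have [t' tE' _] := idxs_cat kN.
have -> : t = map (pair N) (enum 'I_n) ++ t'.
  move: tE; rewrite /= tE' catA => /(congr1 rev); rewrite !rev_cat => /eqP.
  rewrite eqseq_cat// => /andP[_ /eqP h].
  by apply: (can_inj revK); rewrite -h rev_cat.
rewrite Ex_cat subSn// iterSr -(IH _ _ t')//.
by congr Ex; apply/funext => y; exact: Ex_noise.
Qed.

Section path_bounds.
Variables (L B : R) (F : E -> R) (w : E -> E).
Hypothesis Fw : sm L B F w.
Hypothesis L0 : 0 <= L.
Hypothesis B0 : 0 <= B.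
Hypothesis KLB : K * L <= B.

Lemma sm_flow z k j : exists w', sm (rho ^+ j * L) B (F \o flow z k j) w'.
Proof.
elim: j k => [|j IH] k; first by exists w; rewrite expr0 mul1r.
have [w' hw'] := IH k.+1.
have KLB' : K * (rho ^+ j * L) <= B.
  rewrite (le_trans _ KLB)// ler_wpM2l// ler_piMl// exprn_ile1 ?rho_ge0//.
  exact: rho_le1.
have h := sm_shift (s *: signs (pair k) z) (sm_cgrad hw' B0 KLB').
by eexists; rewrite exprS -mulrA; exact: h.
Qed.

Let G N z := F (path_pos z N).

(** A change of the noise at time [k] still passes through [N - k] applications of the contraction
    [phi], whence the factor [rho ^ (N - k)]. *)
Lemma path_df N k z : (k < N)%N ->
  \sum_i df (k, i) (G N) z ^+ 2 <= (s * (rho ^+ (N - k) * L) + noise_err B * s ^+ 2) ^+ 2.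
Proof.
move=> kN; have [w' hw'] := sm_flow z k.+1 (N - k.+1).
have KLB' : K * (rho ^+ (N - k.+1) * L) <= B.
  rewrite (le_trans _ KLB)// ler_wpM2l// ler_piMl// exprn_ile1 ?rho_ge0//.
  exact: rho_le1.
have hc := sm_cgrad hw' B0 KLB'; have [h1 _] := hc.
have -> : \sum_i df (k, i) (G N) z ^+ 2 = \sum_i df (k, i) (fun y =>
    ((F \o flow z k.+1 (N - k.+1)) \o phi) (path_pos z k + s *: signs (pair k) y)) z ^+ 2.
  apply: eq_bigr => i _; congr (_ ^+ 2).
  have e b : G N (upd z (k, i) b) = ((F \o flow z k.+1 (N - k.+1)) \o phi)
      (path_pos z k + s *: signs (pair k) (upd z (k, i) b)).
    rewrite /G -{1}(subnKC kN) path_pos_flow flow_upd//= path_pos_upd//.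
  by rewrite /df !e.
rewrite (le_trans (sum_df_noise _ _ (@pair_inj k) hc B0))//.
have n0 : 0 <= noise_err B by rewrite !mulr_ge0.
rewrite ler_pXn2r ?nnegrE ?addr_ge0 ?mulr_ge0 ?exprn_ge0 ?rho_ge0 ?(ltW s0)//.
rewrite lerD2r ler_wpM2l ?(ltW s0)// -(subnSK kN) exprS -mulrA; exact: h1.
Qed.

(* The mean increments along the noise of time [k] are those of the smooth
   function [step^(N-k) F] at the position at time [k]. *)
Lemma path_df_mean N k z : (k < N)%N ->
  ⟦(\row_i Ex (idxs N) (df (k, i) (G N)) z) -
    s *: (\row_i iter k step (fun x => iter (N - k) step_grad w x ord0 i) 0)⟧ <=
  noise_err B * s ^+ 2.
Proof.
move=> kN.
rewrite (le_trans (enorm_le_sum _))//.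
rewrite /noise_err (_ : _ * _ * s ^+ 2 = \sum_(i < n) 4 * B * s ^+ 2); last first.
  by rewrite sumr_const card_ord -mulr_natr; ring.
apply: ler_sum => i _; rewrite !mxE.
have [t tE tk] := idxs_cat kN.
have kit : (k, i) \notin t by apply/negP => /tk; rewrite ltnn.
rewrite tE Ex_cat -df_Ex//.
have -> : Ex t (G N) = (fun z => iter (N - k.+1) step F
    (phi (path_pos z k + s *: signs (pair k) z))).
  by apply/funext => y; rewrite (Ex_path_tail F y kN tE).
have hu := sm_iter (N - k.+1) Fw L0 B0 KLB.
have KLB' : K * (rho ^+ (N - k.+1) * L) <= B.
  rewrite (le_trans _ KLB)// ler_wpM2l// ler_piMl// exprn_ile1 ?rho_ge0//.
  exact: rho_le1.
have hc := sm_cgrad hu B0 KLB'.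
set u := iter (N - k.+1) step F in hu hc *; set wu := iter (N - k.+1) step_grad w in hu hc *.
have -> : s * iter k step (fun x => iter (N - k) step_grad w x ord0 i) 0 =
    Ex (idxs k.+1) (fun z => s * cgrad wu (path_pos z k + s *: signs (pair k) z) ord0 i) z.
  rewrite ExZ; congr (_ * _); rewrite -(Ex_path k _ z) /= Ex_cat.
  congr Ex; apply/funext => y; rewrite -(subnSK kN) iterS mxE -/wu.
  rewrite (@Ex_reindex _ _ _ (pair k) (enum 'I_n) _ (fun z => path_pos z k) _
    (fun x y => cgrad wu (x + s *: sgn y) ord0 i))//.
  - by apply: Ex_full => i'; rewrite mem_enum.
  - exact: pair_inj.
  - by move=> y' i' b; rewrite path_pos_upd.
have := congr1 (@^~ z) (ExB (idxs k.+1)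
  (df (k, i) (fun z => u (phi (path_pos z k + s *: signs (pair k) z))))
  (fun z => s * cgrad wu (path_pos z k + s *: signs (pair k) z) ord0 i)) => /= <-.
rewrite (le_trans (Ex_abs _ _ _))//; apply: Ex_ub => y.
have := df_noise (path_pos y k) y i (@pair_inj k) hc B0; apply: le_trans.
rewrite le_eqVlt; apply/orP; left; apply/eqP; congr (`|_ - _|).
by rewrite /df /= !path_pos_upd.
Qed.

Lemma path_improved N z :
  2 * (iter N step (fun x => F x ^+ 2) 0 - (iter N step F 0) ^+ 2) <=
  \sum_(k < N) ((s * (rho ^+ (N - k) * L) + noise_err B * s ^+ 2) ^+ 2 +
    ⟦\row_i Ex (idxs N) (df (nat_of_ord k, i) (G N)) z⟧ ^+ 2).
Proof.
have := improved_poincare_cube (G N) z (uniq_idxs N).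
rewrite (Ex_path N (fun x => F x ^+ 2)) (Ex_path N F) => /le_trans; apply.
have perm (Q : pidx -> R) : \sum_(p <- idxs N) Q p = \sum_(k < N) \sum_i Q (nat_of_ord k, i).
  elim: {+}N => [|M IH]; first by rewrite big_nil big_ord0.
  by rewrite /= big_cat /= big_map big_enum /= IH big_ord_recr /= addrC.
rewrite !perm -big_split/= ler_sum// => k _; apply: lerD.
  have := congr1 (@^~ z) (Ex_sum (idxs N) (index_enum 'I_n) xpredT
    (fun i z => df (nat_of_ord k, i) (G N) z ^+ 2)) => /= <-.
  by apply: Ex_ub => y; exact: path_df.
by rewrite enorm_sqr; apply: ler_sum => i _; rewrite mxE expr2.
Qed.

Lemma path_mean_le N (k : 'I_N) z :
  ⟦\row_i Ex (idxs N) (df (nat_of_ord k, i) (G N)) z⟧ ^+ 2 <=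
  (s * (rho ^+ (N - k) * L) + noise_err B * s ^+ 2) ^+ 2.
Proof.
rewrite enorm_sqr.
apply: (@le_trans _ _ (Ex (idxs N) (fun z => \sum_i df (nat_of_ord k, i) (G N) z ^+ 2) z)).
  rewrite Ex_sum; apply: ler_sum => i _; rewrite mxE -expr2; exact: Ex_jensen.
by apply: Ex_ub => y; exact: path_df.
Qed.

End path_bounds.

End chain.

(** * Integration on R^n *)

Section density.
Context d {T : measurableType d} {R : realType}.
Variables (m : {measure set T -> \bar R}) (r : T -> R).
Hypothesis mr : measurable_fun setT r.
Hypothesis r0 : forall x, 0 <= r x.
Local Open Scope ereal_scope.

Import HBNNSimple.

Section change.
Variable P : {measure set T -> \bar R}.
Hypothesis Pr : forall A, measurable A -> P A = \int[m]_(x in A) (r x)%:E.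

Lemma ge0_integral_density (f : T -> \bar R) : measurable_fun setT f ->
  (forall x, 0 <= f x) -> \int[P]_x f x = \int[m]_x (f x * (r x)%:E).
Proof.
move=> mf f0; pose h := nnsfun_approx measurableT mf.
have mre : measurable_fun setT (EFin \o r) by exact/measurable_EFinP.
have -> : \int[P]_x f x = limn (fun n => \int[P]_x (h n x)%:E).
  rewrite -monotone_convergence//.
  - apply: eq_integral => x _; apply/esym/cvg_lim => //.
    by apply: cvg_nnsfun_approx => //.
  - by move=> n; exact/measurable_EFinP/measurable_funP.
  - by move=> n x _; rewrite lee_fin.
  - by move=> x _ a b ab; rewrite lee_fin; exact/lefP/nd_nnsfun_approx.
have -> : \int[m]_x (f x * (r x)%:E) = limn (fun n => \int[m]_x ((h n x)%:E * (r x)%:E)).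
  rewrite -monotone_convergence//.
  - apply: eq_integral => x _; apply/esym/cvg_lim => //.
    by apply: cvgeZr => //; apply: cvg_nnsfun_approx.
  - by move=> n; apply: emeasurable_funM => //; exact/measurable_EFinP/measurable_funP.
  - by move=> n x _; rewrite mule_ge0 ?lee_fin.
  - by move=> x _ a b ab; rewrite lee_wpmul2r ?lee_fin//; exact/lefP/nd_nnsfun_approx.
congr (limn _); apply/funext => n.
transitivity (\sum_(k \in range (h n)) k%:E * P (h n @^-1` [set k])).
  rewrite integralT_nnsfun sintegralE.
  by apply: eq_fsbigr => k _.
transitivity (\int[m]_x (\sum_(k \in range (h n)) (k * \1_(h n @^-1` [set k]) x)%:E * (r x)%:E)).
  rewrite ge0_integral_fsum//; last 2 first.
  - by move=> k; apply: emeasurable_funM => //; exact/measurable_EFinP/measurable_funM.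
  - by move=> k x _; rewrite mule_ge0 ?nnfun_muleindic_ge0 ?lee_fin.
  apply: eq_fsbigr => k hk; have k0 : (0 <= k)%R by move/set_mem: hk => [x _ <-].
  rewrite Pr//.
  under [RHS]eq_integral do rewrite EFinM -muleA.
  rewrite ge0_integralZl//; last 2 first.
  - by apply: emeasurable_funM => //; exact/measurable_EFinP/measurable_indic.
  - by move=> x _; rewrite mule_ge0 ?lee_fin.
  congr (_ * _); rewrite integral_mkcond; apply: eq_integral => x _.
  by rewrite patchE indicE; case: ifPn; rewrite ?mul1e ?mul0e.
apply: eq_integral => x _; rewrite -ge0_mule_fsuml => [|k]; last exact: nnfun_muleindic_ge0.
by rewrite fsumEFin// -(fimfunE (h n) x).
Qed.

Lemma integrable_density (f : T -> R) : measurable_fun setT f ->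
  m.-integrable setT (fun x => (f x * r x)%:E) -> P.-integrable setT (EFin \o f).
Proof.
move=> mf /integrableP[_ h]; apply/integrableP; split; first exact/measurable_EFinP.
rewrite ge0_integral_density//; last exact/measurableT_comp/measurable_EFinP.
rewrite (le_lt_trans _ h)// le_eqVlt; apply/orP; left; apply/eqP.
by apply: eq_integral => x _ /=; rewrite normrM (ger0_norm (r0 x)).
Qed.

Lemma Rintegral_density (f : T -> R) : measurable_fun setT f ->
  m.-integrable setT (fun x => (f x * r x)%:E) ->
  (\int[P]_x f x = \int[m]_x (f x * r x))%R.
Proof.
move=> mf intf; rewrite /Rintegral; congr fine.
have pos (g : T -> R) : measurable_fun setT g -> (forall x, 0 <= g x)%R ->
    \int[P]_x (g x)%:E = \int[m]_x (g x * r x)%:E.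
  move=> mg g0; rewrite (ge0_integral_density (f := EFin \o g))//.
  exact/measurable_EFinP.
rewrite [LHS]integralE [RHS]integralE; congr (_ - _).
  transitivity (\int[P]_x (Num.max (f x) 0%R)%:E).
    by apply: eq_integral => x _; rewrite funeposE -EFin_max.
  rewrite (pos (f^\+)%R); [|exact: measurable_funrpos|by move=> x; rewrite le_max lexx orbT].
  by apply: eq_integral => x _; rewrite funeposE -EFin_max; congr _%:E;
    rewrite /funrpos maxr_pMl// mul0r.
transitivity (\int[P]_x (Num.max (- f x)%R 0%R)%:E).
  by apply: eq_integral => x _; rewrite funenegE -EFinN -EFin_max.
rewrite (pos (f^\-)%R); [|exact: measurable_funrneg|by move=> x; rewrite le_max lexx orbT].
by apply: eq_integral => x _; rewrite funenegE -EFinN -EFin_max; congr _%:E;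
  rewrite /funrneg maxr_pMl// mul0r mulNr.
Qed.

End change.

Definition density (A : set T) : \bar R := \int[m]_(x in A) (r x)%:E.

Let density0 : density set0 = 0. Proof. exact: integral_set0. Qed.

Let density_ge0 A : 0 <= density A.
Proof. by apply: integral_ge0 => x _; rewrite lee_fin. Qed.

Let density_sigma_additive : semi_sigma_additive density.
Proof.
move=> F mF tF mUF; rewrite /density ge0_integral_bigcup//; last 2 first.
- by apply: measurable_funTS; exact/measurable_EFinP.
- by move=> x _; rewrite lee_fin.
by apply: is_cvg_ereal_nneg_natsum_cond => k _ _; exact: density_ge0.
Qed.

HB.instance Definition _ := isMeasure.Build _ _ _ density
  density0 density_ge0 density_sigma_additive.

Lemma density_probability : \int[m]_x (r x)%:E = 1 ->
  exists P : probability T R, forall A, measurable A -> P A = \int[m]_(x in A) (r x)%:E.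
Proof.
move=> h1; have h : density setT = 1 by [].
pose Pm := Measure_isProbability.Build _ _ R density h.
pose P : probability T R := HB.pack density Pm.
by exists P.
Qed.

End density.

Section measurable_lip.
Context {R : realType} {n : nat}.
Local Notation E := 'rV[R]_n.

(** Enumerates the rational points with the origin first. Hence [ddist M x <= |x|], the bound for
    dominated convergence, and the tangent at the origin belongs to every finite family of
    tangents. *)
Definition pts (k : nat) : E :=
  if k is k'.+1 then (if unpickle k' is Some q then map_mx ratr (q : 'rV[rat]_n) else 0)
  else 0.

Lemma pts_dense (x : E) (e : R) : 0 < e -> exists k, ⟦x - pts k⟧ < e.
Proof.
move=> e0; pose e' := e / n.+1%:R; have e'0 : 0 < e' by rewrite divr_gt0.
have /choice[q hq] i : exists q : rat, `|x ord0 i - ratr q| < e'.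
  have h : x ord0 i < x ord0 i + e' by rewrite ltrDl.
  have [q /itvP qx] := rat_in_itvoo h.
  exists q; rewrite distrC ger0_norm ?subr_ge0 ?qx// ltrBlDl.
  by rewrite qx.
exists (pickle (\row_i q i : 'rV[rat]_n)).+1; rewrite /pts pickleK.
rewrite (le_lt_trans (enorm_le_sum _))//.
apply: (@le_lt_trans _ _ (\sum_(i < n) e')).
  by apply: ler_sum => i _; rewrite !mxE ltW.
by rewrite sumr_const card_ord /e' -[_ *+ n]mulr_natr mulrAC ltr_pdivrMr// ltr_pM2l// ltr_nat.
Qed.

Lemma measurable_enorm : measurable_fun setT (fun x : E => ⟦x⟧).
Proof.
rewrite (_ : (fun x => _) = Num.sqrt \o (fun x : E => dotrV x x))//.
apply: measurableT_comp.
  by apply: continuous_measurable_fun; exact: sqrt_continuous.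
apply: measurable_sum => i; apply: measurable_funM; exact: measurable_coord.
Qed.

(** The sigma-algebra being generated by the coordinates, [f] is written as the infimum of the
    countably many measurable cones [f (pts k) + L |x - pts k|]; density of the points makes the
    infimum exact. *)
Lemma measurable_lip L (f : E -> R) : lip L f -> measurable_fun setT f.
Proof.
move=> fL.
have L0 (x y : E) : 0 <= L * ⟦y - x⟧ by rewrite (le_trans _ (fL x y)).
pose h k x := f (pts k) + L * ⟦x - pts k⟧.
have fh k x : f x <= h k x.
  by have := fL (pts k) x; rewrite ler_norml /h => /andP[_]; lra.
have lb x : has_lbound (range (h ^~ x)) by exists (f x) => _ [k _ <-].
have -> : f = fun x => infs (h ^~ x) 0.
  apply/funext => x; apply/eqP; rewrite eq_le; apply/andP; split.
    apply: lb_le_inf; first by exists (h 0%N x), 0%N.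
    by move=> _ [k _ <-].
  rewrite leNgt; apply/negP => lt.
  pose e := (infs (h^~ x) 0 - f x) / (2 * (`|L| + 1)).
  have L1 : 0 < `|L| + 1 by rewrite ltr_wpDl.
  have e0 : 0 < e by rewrite divr_gt0 ?subr_gt0// mulr_gt0.
  have [k hk] := pts_dense x e0.
  have : infs (h^~ x) 0 <= h k x.
    apply: ge_inf; last by exists k.
    by have [M hM] := lb x; exists M => _ [j _ <-]; apply: hM; exists j.
  apply/negP; rewrite -ltNge.
  have h1 : `|f (pts k) - f x| <= `|L| * e.
    rewrite (le_trans (fL x (pts k)))// enormB (le_trans (ler_norm _))//.
    by rewrite normrM (ger0_norm (enorm_ge0 _)) ler_wpM2l ?(ltW hk).
  have h2 : L * ⟦x - pts k⟧ <= `|L| * e.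
    by rewrite (le_trans (ler_norm _))// normrM (ger0_norm (enorm_ge0 _)) ler_wpM2l ?(ltW hk).
  have h3 : 2 * (`|L| * e) < infs (h^~ x) 0 - f x.
    have -> : infs (h^~ x) 0 - f x = 2 * ((`|L| + 1) * e).
      by rewrite /e; field; rewrite gt_eqF.
    by rewrite ltr_pM2l// ltr_pM2r// ltrDl.
  move: h1; rewrite ler_norml /h => /andP[_ h1]; lra.
apply: measurable_fun_infs => [x _|k]; first exact: lb.
apply: measurable_funD => //; apply: measurable_funM => //.
apply: (@measurableT_comp _ _ _ _ _ _ enorm); first exact: measurable_enorm.
apply: measurable_fun_rVP => i; under eq_fun do rewrite !mxE.
by apply: measurable_funB => //; exact: measurable_coord.
Qed.

End measurable_lip.

Section lebesgue_rV_integral.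
Context {R : realType}.
Local Open Scope ereal_scope.

Lemma ge0_integral_rVS n (f : 'rV[R]_n.+1 -> \bar R) : measurable_fun setT f ->
  (forall x, 0 <= f x) ->
  \int[lebesgue_rV n.+1]_x f x =
  \int[@lebesgue_measure R]_t \int[lebesgue_rV n]_v f (cons_rV (t, v)).
Proof.
move=> mf f0.
have mc : @measurable_fun _ _ (measurableTypeR R * 'rV[R]_n)%type 'rV[R]_n.+1 setT
  (@cons_rV R n) := @measurable_cons_rV R n.
rewrite (@ge0_integral_pushforward _ _ _ _ R _ mc _ setT f)//.
rewrite preimage_setT fubini_tonelli1//=.
by apply: measurableT_comp => //; exact: measurable_cons_rV.
Qed.

Lemma integral_rV0 (f : 'rV[R]_0 -> \bar R) : measurable_fun setT f ->
  \int[lebesgue_rV 0]_x f x = f 0%R.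
Proof.
by move=> mf; rewrite [LHS](integral_dirac _ measurableT mf) diracT mul1e.
Qed.

Lemma measurable_cons_section n (f : 'rV[R]_n.+1 -> \bar R) (t : R) :
  measurable_fun setT f -> measurable_fun setT (fun v => f (cons_rV (t, v))).
Proof.
move=> mf; apply: (measurableT_comp mf).
apply: (measurableT_comp (@measurable_cons_rV R n)).
by apply: measurable_fun_pair => //; exact: measurable_cst.
Qed.

Lemma lebesgue_measure_shift (b : R) (A : set R) : measurable A ->
  pushforward (@lebesgue_measure R) (fun x : measurableTypeR R => (x + b)%R : measurableTypeR R) A = lebesgue_measure A.
Proof.
have mb : measurable_fun setT (fun x : measurableTypeR R => (x + b)%R : measurableTypeR R).
  exact: measurable_funD.
pose phi_mixin := isMeasurableFun.Build _ _ _ _ _ mb.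
pose phi : {mfun (measurableTypeR R) >-> (measurableTypeR R)} :=
  HB.pack (fun x : measurableTypeR R => (x + b)%R) phi_mixin.
move=> mA; apply/esym.
apply: (@lebesgue_measure_unique R (pushforward lebesgue_measure phi)) => // _ [[u v]] _ <-.
rewrite /pushforward.
rewrite [RHS](_ : _ = lebesgue_measure [set` `](u - b)%R, (v - b)%R]]); last first.
  congr (lebesgue_measure _); by apply/seteqP; split => x /=; rewrite !in_itv/= ltrBlDr lerBrDr.
rewrite !lebesgue_measure_itv/= !lte_fin ltrD2r; case: ifP => // _.
by rewrite -!EFinD; congr _%:E; ring.
Qed.

Lemma ge0_integral_shift (b : R) (f : R -> \bar R) : measurable_fun setT f ->
  (forall x, 0 <= f x) ->
  \int[@lebesgue_measure R]_x f (x + b)%R = \int[@lebesgue_measure R]_x f x.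
Proof.
move=> mf f0.
have mb : measurable_fun setT (fun x : measurableTypeR R => (x + b)%R : measurableTypeR R).
  exact: measurable_funD.
have := @ge0_integral_pushforward _ _ _ _ R _ mb (@lebesgue_measure R) setT f.
rewrite preimage_setT => <-//.
by apply: eq_measure_integral => A mA _; exact: lebesgue_measure_shift.
Qed.

Lemma measurable_rV_shift n (b : 'rV[R]_n) : measurable_fun setT (fun x : 'rV[R]_n => x + b)%R.
Proof.
apply: measurable_fun_rVP => i; under eq_fun do rewrite !mxE.
by apply: measurable_funD => //; exact: measurable_coord.
Qed.

Lemma ge0_integral_rV_shift n (b : 'rV[R]_n) (f : 'rV[R]_n -> \bar R) :
  measurable_fun setT f -> (forall x, 0 <= f x) ->
  \int[lebesgue_rV n]_x f (x + b)%R = \int[lebesgue_rV n]_x f x.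
Proof.
elim: n b f => [|n IH] b f mf f0.
  rewrite !integral_rV0//; last exact: (measurableT_comp mf (measurable_rV_shift b)).
  by congr f; apply/rowP => -[].
have mfb := measurableT_comp mf (measurable_rV_shift b).
rewrite (ge0_integral_rVS mf f0) (ge0_integral_rVS mfb (fun x => f0 _)).
pose b0 := b ord0 ord0; pose b1 : 'rV[R]_n := \row_i b ord0 (lift ord0 i).
have consD t v : (cons_rV (t, v) + b = cons_rV ((t + b0), (v + b1)))%R.
  apply/rowP => i; rewrite mxE; have [j ->|->] := unliftP ord0 i.
    by rewrite !cons_rVS/= !mxE.
  by rewrite !cons_rV0.
under eq_integral do under eq_integral do rewrite /comp consD.
under eq_integral => t _.
  rewrite (IH b1 (fun v => f (cons_rV ((t + b0)%R, v))))//; last exact: measurable_cons_section.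
  over.
rewrite (ge0_integral_shift b0 (f := fun t => \int[lebesgue_rV n]_v f (cons_rV (t, v))))//.
  apply: (measurable_fun_fubini_tonelli_F (fun z => f (cons_rV z))) => //.
  exact: (measurableT_comp mf (@measurable_cons_rV R n)).
by move=> t; apply: integral_ge0.
Qed.

End lebesgue_rV_integral.

Section gauss_weight.
Context {R : realType}.
Local Open Scope ereal_scope.

(* A Gaussian weight in product form; it dominates every function of the form
   [exp (c |x|) exp (- |x|^2 / 2)]. *)
Definition gw {n} (x : 'rV[R]_n) : R := \prod_i gauss_fun (x ord0 i / 2).

Lemma gw_ge0 n (x : 'rV[R]_n) : (0 <= gw x)%R.
Proof. by apply: prodr_ge0 => i _; exact: gauss_fun_ge0. Qed.

Lemma measurable_gw n : measurable_fun setT (@gw n).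
Proof.
apply: measurable_prod => i _.
apply: (measurableT_comp (@measurable_gauss_fun R)).
by apply: measurable_funM => //; exact: measurable_coord.
Qed.

Lemma gw_cons n t (v : 'rV[R]_n) : gw (cons_rV (t, v)) = (gauss_fun (t / 2) * gw v)%R.
Proof.
rewrite /gw big_ord_recl cons_rV0; congr (_ * _)%R.
by apply: eq_bigr => i _; rewrite cons_rVS.
Qed.

Lemma measurable_gauss_half :
  measurable_fun [set: measurableTypeR R] (fun t => (gauss_fun (t / 2))%:E).
Proof.
apply/measurable_EFinP; apply: (measurableT_comp (@measurable_gauss_fun R)).
exact: measurable_funM.
Qed.

Lemma gauss_half_lty : \int[@lebesgue_measure R]_t (gauss_fun (t / 2))%:E < +oo.
Proof.
have s0 : Num.sqrt 2 != 0%R :> R by rewrite sqrtr_eq0 -ltNge.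
(* Up to its peak, [exp (- t^2 / 4)] is the normal density of variance 2. *)
have := integral_normal_pdf (0%R : R) (Num.sqrt 2).
rewrite normal_pdfE//.
have k0 := normal_peak_gt0 s0.
have -> : \int[@lebesgue_measure R]_x (normal_peak (Num.sqrt 2) * normal_fun 0 (Num.sqrt 2) x)%:E
  = (normal_peak (Num.sqrt 2))%:E * \int[@lebesgue_measure R]_t (gauss_fun (t / 2))%:E.
  rewrite -(ge0_integralZl _ measurableT measurable_gauss_half)//;
    [|by move=> t _; rewrite lee_fin gauss_fun_ge0|by rewrite lee_fin ltW].
  apply: eq_integral => x _; rewrite -EFinM; congr (_ * _)%:E.
  rewrite /normal_fun /gauss_fun subr0 sqr_sqrtr//; congr expR.
  by rewrite -mulr_natr; field.
move=> h; rewrite ltNge leye_eq; apply/negP => /eqP hoo; move: h.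
by rewrite hoo gt0_muley ?lte_fin.
Qed.

Lemma gw_lty n : \int[lebesgue_rV n]_x (gw x)%:E < +oo.
Proof.
elim: n => [|n IH].
  by rewrite integral_rV0 ?ltry//; apply/measurable_EFinP; exact: measurable_gw.
rewrite (@ge0_integral_rVS _ _ (fun x => (gw x)%:E)); last 2 first.
- by apply/measurable_EFinP; exact: measurable_gw.
- by move=> x; rewrite lee_fin gw_ge0.
have gwI : 0 <= \int[lebesgue_rV n]_x (gw x)%:E.
  by apply: integral_ge0 => x _; rewrite lee_fin gw_ge0.
under eq_integral => t _.
  under eq_integral do rewrite gw_cons EFinM.
  rewrite (@ge0_integralZl _ _ _ _ setT _ (fun v => (gw v)%:E))//; last 3 first.
  - by apply/measurable_EFinP; exact: measurable_gw.
  - by move=> x _; rewrite lee_fin gw_ge0.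
  - by rewrite lee_fin gauss_fun_ge0.
  over.
rewrite (ge0_integralZr _ measurableT measurable_gauss_half)//; last first.
  by move=> t _; rewrite lee_fin gauss_fun_ge0.
rewrite lte_mul_pinfty ?gauss_half_lty//.
  by apply: integral_ge0 => t _; rewrite lee_fin gauss_fun_ge0.
by rewrite ge0_fin_numE ?gauss_half_lty//; apply: integral_ge0 => t _;
  rewrite lee_fin gauss_fun_ge0.
Qed.

Lemma expR_gw n (c : R) : exists C : R, forall x : 'rV[R]_n,
  (expR (c * ⟦x⟧ - ⟦x⟧ ^+ 2 / 2) <= C * gw x)%R.
Proof.
(* [c r - r^2/2 <= c^2 - r^2/4] amounts to [(c - r/2)^2 >= 0]. *)
exists (expR (c ^+ 2)) => x.
have -> : gw x = expR (- (⟦x⟧ ^+ 2 / 4)).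
  rewrite /gw /gauss_fun -expR_sum; congr expR.
  rewrite enorm_sqr /dotrV mulr_suml -sumrN; apply: eq_bigr => i _; by field.
rewrite -expRD ler_expR; have := sqr_ge0 (c - ⟦x⟧ / 2); nra.
Qed.

End gauss_weight.

(** * Measures with Gaussian tails *)

Section tame.
Context {R : realType} {n : nat}.
Local Notation E := 'rV[R]_n.
Implicit Types (f g : E -> R) (V : E -> R).

(** Growth at most exponential: an algebra stable under shifts, which contains the Lipschitz
    functions and, for regular potentials and small [b], the density ratios
    [exp (V x - V (x + b))]. *)
Definition tame f := measurable_fun setT f /\
  exists C c : R, [/\ 0 <= C, 0 <= c & forall x, `|f x| <= C * expR (c * ⟦x⟧)].

(* Measures [exp (- V) dx] with Gaussian tails, against which tame functions are
   integrable. *)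
Definition glc (mu : probability E R) V := [/\ measurable_fun setT V,
  exists a b : R, forall x, ⟦x⟧ ^+ 2 / 2 - a * ⟦x⟧ - b <= V x &
  forall A, measurable A -> mu A = (\int[lebesgue_rV n]_(x in A) (expR (- V x))%:E)%E].

Lemma tame_le f g : measurable_fun setT f -> tame g -> (forall x, `|f x| <= `|g x|) -> tame f.
Proof.
move=> mf [_ [C [c [C0 c0 h]]]] fg; split=> //; exists C, c; split=> // x.
by rewrite (le_trans (fg x)).
Qed.

Lemma tame_cst k : tame (fun=> k).
Proof.
split; first exact: measurable_cst.
by exists `|k|, 0; split=> // x; rewrite mul0r expR0 mulr1.
Qed.

Lemma tameD f g : tame f -> tame g -> tame (fun x => f x + g x).
Proof.
move=> [mf [C [c [C0 c0 h]]]] [mg [D [d [D0 d0 k]]]]; split.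
  exact: measurable_funD.
exists (C + D), (c + d); split; rewrite ?addr_ge0// => x.
rewrite (le_trans (ler_normD _ _))// mulrDl lerD//.
  by rewrite (le_trans (h x))// ler_wpM2l// ler_expR ler_wpM2r// lerDl.
by rewrite (le_trans (k x))// ler_wpM2l// ler_expR ler_wpM2r// lerDr.
Qed.

Lemma tameM f g : tame f -> tame g -> tame (fun x => f x * g x).
Proof.
move=> [mf [C [c [C0 c0 h]]]] [mg [D [d [D0 d0 k]]]]; split.
  exact: measurable_funM.
exists (C * D), (c + d); split; rewrite ?addr_ge0 ?mulr_ge0// => x.
by rewrite normrM mulrDl expRD mulrACA ler_pM.
Qed.

Lemma tameZ k f : tame f -> tame (fun x => k * f x).
Proof. exact/tameM/tame_cst. Qed.

Lemma tameN f : tame f -> tame (fun x => - f x).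
Proof. by move=> /(tameZ (-1)); under eq_fun do rewrite mulN1r. Qed.

Lemma tameB f g : tame f -> tame g -> tame (fun x => f x - g x).
Proof. by move=> tf tg; apply: tameD => //; exact: tameN. Qed.

Lemma tameX f k : tame f -> tame (fun x => f x ^+ k).
Proof.
move=> tf; elim: k => [|k IH]; first by under eq_fun do rewrite expr0; exact: tame_cst.
by under eq_fun do rewrite exprS; exact: tameM.
Qed.

Lemma tame_norm f : tame f -> tame (fun x => `|f x|).
Proof.
move=> [mf [C [c [C0 c0 h]]]]; split; first exact: measurableT_comp.
by exists C, c; split=> // x; rewrite normr_id.
Qed.

Lemma tame_sum I (r : seq I) (P : pred I) (F : I -> E -> R) :
  (forall i, P i -> tame (F i)) -> tame (fun x => \sum_(i <- r | P i) F i x).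
Proof.
move=> tF; elim: r => [|i r IH].
  by under eq_fun do rewrite big_nil; exact: tame_cst.
under eq_fun do rewrite big_cons.
by have [Pi|_] := boolP (P i); [apply: tameD => //; exact: tF|exact: IH].
Qed.

Lemma tame_enorm : tame (fun x => ⟦x⟧).
Proof.
split; first exact: measurable_enorm.
exists 1, 1; split=> // x; rewrite !mul1r ger0_norm//.
by rewrite (le_trans _ (expR_ge1Dx _))// lerDr.
Qed.

Lemma tame_expR k : tame (fun x => expR (k * ⟦x⟧)).
Proof.
split.
  apply: measurableT_comp => //; apply: measurable_funM => //; exact: measurable_enorm.
exists 1, `|k|; split=> // x; rewrite mul1r ger0_norm ?expR_ge0// ler_expR.
by rewrite ler_wpM2r// ler_norm.
Qed.

Lemma tame_lip L f : lip L f -> tame f.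
Proof.
move=> fL.
apply: (@tame_le _ (fun x => `|f 0| + `|L| * ⟦x⟧)); first exact: measurable_lip fL.
  by apply: tameD; [exact: tame_cst|exact/tameZ/tame_enorm].
move=> x; rewrite [leRHS]ger0_norm ?addr_ge0 ?mulr_ge0//.
rewrite -[X in `|X|](subrK (f 0)) addrC (le_trans (ler_normD _ _))// lerD2l.
by rewrite (le_trans (fL 0 x))// subr0 ler_wpM2r// ler_norm.
Qed.

Lemma tame_sm L B f w : sm L B f w -> tame f.
Proof. by move/sm_lip; exact: tame_lip. Qed.

Lemma lip_grad L B f w i : sm L B f w -> lip (6 * B) (fun x => w x ord0 i).
Proof.
move=> fw x y; rewrite (le_trans _ (sm_grad_lip fw y x))//.
by rewrite (le_trans _ (ler_coord_enorm _ i))// !mxE.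
Qed.

Lemma tame_coord i : tame (fun x => x ord0 i).
Proof.
apply: (@tame_lip 1) => x y; rewrite mul1r.
by rewrite (le_trans _ (ler_coord_enorm _ i))// !mxE.
Qed.

Lemma tame_grad L B f w i : sm L B f w -> tame (fun x => w x ord0 i).
Proof. by move=> /lip_grad h; exact: tame_lip (h i). Qed.

Lemma tame_dot (u v : E -> E) : (forall i, tame (fun x => u x ord0 i)) ->
  (forall i, tame (fun x => v x ord0 i)) -> tame (fun x => u x *d v x).
Proof. by move=> tu tv; apply: tame_sum => i _; apply: tameM. Qed.

Lemma tame_enorm_sqr (u : E -> E) : (forall i, tame (fun x => u x ord0 i)) ->
  tame (fun x => ⟦u x⟧ ^+ 2).
Proof. by move=> tu; under eq_fun do rewrite enorm_sqr; exact: tame_dot. Qed.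

Lemma tame_shift f b : tame f -> tame (fun x => f (x + b)).
Proof.
move=> [mf [C [c [C0 c0 h]]]]; split.
  exact: (measurableT_comp mf (measurable_rV_shift b)).
exists (C * expR (c * ⟦b⟧)), c; split=> [||x]; rewrite ?mulr_ge0 ?expR_ge0//.
rewrite (le_trans (h _))// -mulrA ler_wpM2l// -expRD ler_expR -mulrDr ler_wpM2l//.
by rewrite addrC ler_enormD.
Qed.

Section glc.
Variables (mu : probability E R) (V : E -> R).
Hypothesis muV : glc mu V.

Let mV : measurable_fun setT (fun x => expR (- V x)).
Proof. by case: muV => mV _ _; apply: measurableT_comp => //; exact: measurable_funN. Qed.

Let V0 x : 0 <= expR (- V x). Proof. exact: expR_ge0. Qed.

Lemma tame_int_leb f : tame f -> (lebesgue_rV n).-integrable setT (fun x => (f x * expR (- V x))%:E).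
Proof.
case: muV => _ [a [b hV]] _ [mf [C [c [C0 c0 h]]]].
have [C' hC'] := expR_gw n (c + a).
have intgw : (lebesgue_rV n).-integrable setT (fun x : E => (C * expR b * C')%:E * (gw x)%:E)%E.
  apply: integrableZl => //; apply/integrableP; split.
    by apply/measurable_EFinP; exact: measurable_gw.
  under eq_integral do rewrite /= ger0_norm ?gw_ge0//.
  exact: gw_lty.
apply: (le_integrable measurableT _ _ intgw).
  by apply/measurable_EFinP; exact: measurable_funM.
move=> x _ /=; rewrite lee_fin normrM (ger0_norm (V0 x)).
rewrite (le_trans _ (ler_norm _))//.
apply: (@le_trans _ _ (C * expR b * expR ((c + a) * ⟦x⟧ - ⟦x⟧ ^+ 2 / 2))); last first.
  by rewrite -[leRHS]mulrA ler_wpM2l ?mulr_ge0 ?expR_ge0.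
apply: (@le_trans _ _ (C * expR (c * ⟦x⟧) * expR (- V x))); first by rewrite ler_wpM2r.
rewrite -!mulrA ler_wpM2l// -!expRD ler_expR; have := hV x; lra.
Qed.

Lemma tame_int f : tame f -> mu.-integrable setT (EFin \o f).
Proof.
move=> tf; case: (muV) => _ _ h.
by apply: (integrable_density mV V0 h); [case: tf|exact: tame_int_leb].
Qed.

Lemma int_leb f : tame f ->
  \int[mu]_x f x = \int[lebesgue_rV n]_x (f x * expR (- V x)).
Proof.
move=> tf; case: (muV) => _ _ h.
by apply: (Rintegral_density mV V0 h); [case: tf|exact: tame_int_leb].
Qed.

Lemma intD f g : tame f -> tame g ->
  \int[mu]_x (f x + g x) = \int[mu]_x f x + \int[mu]_x g x.
Proof. by move=> tf tg; rewrite RintegralD//; exact: tame_int. Qed.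

Lemma intB f g : tame f -> tame g ->
  \int[mu]_x (f x - g x) = \int[mu]_x f x - \int[mu]_x g x.
Proof. by move=> tf tg; rewrite RintegralB//; exact: tame_int. Qed.

Lemma intZ k f : tame f -> \int[mu]_x (k * f x) = k * \int[mu]_x f x.
Proof. by move=> tf; rewrite RintegralZl//; exact: tame_int. Qed.

Lemma int_cst k : \int[mu]_x k = k.
Proof. rewrite Rintegral_cst// (_ : fine _ = 1) ?mulr1//.
by have := probability_setT mu => /(congr1 fine). Qed.

Lemma int_le f g : tame f -> tame g -> (forall x, f x <= g x) ->
  \int[mu]_x f x <= \int[mu]_x g x.
Proof. by move=> tf tg fg; apply: le_Rintegral => //; exact: tame_int. Qed.

Lemma int_sum I (r : seq I) (P : pred I) (F : I -> E -> R) :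
  (forall i, P i -> tame (F i)) ->
  \int[mu]_x (\sum_(i <- r | P i) F i x) = \sum_(i <- r | P i) \int[mu]_x F i x.
Proof.
move=> tF; elim: r => [|i r IH].
  by under eq_Rintegral do rewrite big_nil; rewrite big_nil int_cst.
under eq_Rintegral do rewrite big_cons.
rewrite big_cons; case: ifP => // Pi; rewrite intD ?IH//; first exact: tF.
exact: tame_sum.
Qed.

Lemma int_abs f : tame f -> `|\int[mu]_x f x| <= \int[mu]_x `|f x|.
Proof. by move=> tf; apply: le_normr_Rintegral => //; exact: tame_int. Qed.

Lemma int_Ex (I : eqType) (s : seq I) (G : (I -> bool) -> E -> R) z :
  (forall z, tame (G z)) ->
  \int[mu]_x Ex s (G^~ x) z = Ex s (fun z => \int[mu]_x G z x) z.
Proof.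
elim: s G => [//|i s IH] G tG /=.
rewrite (IH (fun z x => av i (G^~ x) z)); last first.
  move=> y; rewrite /av.
  by apply: (@tameM _ (fun=> 2^-1)); [exact: tameD|exact: tame_cst].
congr Ex; apply/funext => y; rewrite /av mulrC -intD//.
rewrite -intZ; last exact: tameD.
by apply: eq_Rintegral => x _; rewrite mulrC.
Qed.

End glc.
End tame.

Section shift_glc.
Context {R : realType} {n : nat}.
Local Notation E := 'rV[R]_n.

Lemma Rintegral_rV_shift (b : E) (f : E -> R) : measurable_fun setT f ->
  \int[lebesgue_rV n]_x f (x + b) = \int[lebesgue_rV n]_x f x.
Proof.
move=> mf; rewrite /Rintegral; congr fine.
rewrite [LHS]integralE [RHS]integralE; congr (_ - _)%E.
  rewrite -(ge0_integral_rV_shift b (f := (fun x => (f x)%:E)^\+%E))//.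
    by apply: eq_integral => x _; rewrite !funeposE.
  by apply: measurable_funepos; exact/measurable_EFinP.
rewrite -(ge0_integral_rV_shift b (f := (fun x => (f x)%:E)^\-%E))//.
  by apply: eq_integral => x _; rewrite !funenegE.
by apply: measurable_funeneg; exact/measurable_EFinP.
Qed.

Lemma int_shift (mu : probability E R) (V : E -> R) (b : E) (f : E -> R) :
  glc mu V -> tame f -> tame (fun x => expR (V x - V (x + b))) ->
  \int[mu]_x f (x - b) = \int[mu]_x (f x * expR (V x - V (x + b))).
Proof.
move=> muV tf te; have [mV _ _] := muV.
rewrite (int_leb muV); last exact: tame_shift.
rewrite (int_leb muV); last exact: tameM.
rewrite -(Rintegral_rV_shift b (f := fun x => f (x - b) * expR (- V x))).
  apply: eq_Rintegral => x _; rewrite addrK -mulrA -expRD; congr (_ * expR _); ring.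
apply: measurable_funM; first by case: (tame_shift (- b) tf).
by apply: measurableT_comp => //; exact: measurable_funN.
Qed.

End shift_glc.

Lemma expR_taylor2 {R : realType} (t : R) : `|expR t - 1 - t| <= 2 * t ^+ 2 * expR `|t|.
Proof.
have e1 : 1 <= expR `|t| by rewrite -expR0 ler_expR.
have [t1|t1] := leP `|t| 1.
  rewrite (le_trans (expR_sub1_le t1))// ler_peMr//.
  by rewrite mulr_ge0 ?sqr_ge0.
have h0 : 0 <= expR t - 1 - t by have := expR_ge1Dx t; lra.
have h1 : expR t - 1 - t <= expR `|t|.
  have [t0|t0] := leP 0 t; first by rewrite ger0_norm//; lra.
  have := expR_ge1Dx `|t|; have : expR t <= 1 by rewrite -expR0 ler_expR ltW.
  by rewrite ltr0_norm//; lra.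
rewrite ger0_norm// (le_trans h1)// ler_peMl ?expR_ge0//.
have : 1 <= `|t| ^+ 2 by rewrite exprn_ege1// ltW.
rewrite real_normK ?num_real//; lra.
Qed.

(** * Approximate invariance under one Euler step *)

Section signs_moment.
Context {R : realType} {n : nat}.
Local Notation sgn := (@signs R n 'I_n id).

Lemma Ex_sign_mul (I : eqType) (s : seq I) i (G : (I -> bool) -> R) z : i \in s ->
  (forall z b, G (upd z i b) = G z) ->
  Ex s (fun z => (-1) ^+ (~~ z i) * G z) z = 0.
Proof.
elim: s G => [//|c s IH] G; rewrite inE => /predU1P[<-|si] Gi /=.
  rewrite (_ : av i _ = fun=> 0) ?Ex_cst//; apply/funext => y.
  by rewrite /av !Gi /upd eqxx/= expr1; field.
have [ic|ic] := eqVneq i c.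
  rewrite -ic (_ : av i _ = fun=> 0) ?Ex_cst//; apply/funext => y.
  by rewrite /av !Gi /upd eqxx/= expr1; field.
have -> : av c (fun z => (-1) ^+ (~~ z i) * G z) = (fun z => (-1) ^+ (~~ z i) * av c G z).
  by apply/funext => y; rewrite /av /upd (negbTE ic); field.
apply: IH => // y b; rewrite /av; congr ((_ + _) / _);
  by rewrite updC// Gi.
Qed.

Lemma Ex_signs2 (u v : 'rV[R]_n) z :
  Ex (enum 'I_n) (fun z => (u *d sgn z) * (v *d sgn z)) z = u *d v.
Proof.
have -> : (fun z => (u *d sgn z) * (v *d sgn z)) =
    (fun z => \sum_i \sum_j (u ord0 i * v ord0 j) * ((-1) ^+ (~~ z i) * (-1) ^+ (~~ z j))).
  apply/funext => y; rewrite /dotrV mulr_suml; apply: eq_bigr => i _.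
  by rewrite mulr_sumr; apply: eq_bigr => j _; rewrite !mxE; ring.
rewrite Ex_sum; apply: eq_bigr => i _; rewrite Ex_sum (bigD1 i)//= big1 ?addr0.
  rewrite ExZ (_ : Ex _ _ _ = 1) ?mulr1//.
  rewrite (_ : (fun z => _) = fun=> 1) ?Ex_cst//; apply/funext => y.
  by rewrite -expr2 sqrr_sign.
move=> j ji; rewrite ExZ Ex_sign_mul ?mulr0 ?mem_enum// => y b.
by rewrite /upd (negbTE ji).
Qed.

Lemma Ex_neg (I : eqType) (s : seq I) (G : (I -> bool) -> R) z :
  Ex s (fun z => G (negb \o z)) z = Ex s G (negb \o z).
Proof.
elim: s G => [//|c s IH] G /=; rewrite -IH; congr Ex; apply/funext => y.
rewrite /av addrC; have e b : negb \o upd y c b = upd (negb \o y) c (~~ b).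
  by apply/funext => j; rewrite /upd/=; case: eqP.
by rewrite !e.
Qed.

Lemma Ex_signs_sym (F : 'rV[R]_n -> R) z :
  Ex (enum 'I_n) (fun z => F (sgn z)) z = Ex (enum 'I_n) (fun z => F (- sgn z)) z.
Proof.
rewrite -[LHS](@Ex_full _ _ _ _ (negb \o z)); last by move=> i; rewrite mem_enum.
rewrite -Ex_neg; congr Ex; apply/funext => y; congr F.
by apply/rowP => i; rewrite !mxE /=; case: (y i); rewrite /= ?expr1 ?expr0 ?opprK.
Qed.

(** Pairs each shift with its opposite, the form in which [shift_expand] cancels the first-order
    terms. *)
Lemma Ex_signs_half (F : 'rV[R]_n -> R) z :
  Ex (enum 'I_n) (fun z => F (sgn z)) z =
  Ex (enum 'I_n) (fun z => (F (sgn z) + F (- sgn z)) / 2) z.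
Proof.
have e (G G' : ('I_n -> bool) -> R) : Ex (enum 'I_n) (fun z => (G z + G' z) / 2) z =
    (Ex (enum 'I_n) G z + Ex (enum 'I_n) G' z) / 2.
  have -> : (fun z => (G z + G' z) / 2) = (fun z => 2^-1 * (G z + G' z)).
    by apply/funext => y; rewrite mulrC.
  by rewrite ExZ ExD mulrC.
by rewrite (e (fun z => F (sgn z)) (fun z => F (- sgn z))) -Ex_signs_sym; field.
Qed.

End signs_moment.

Section invariance.
Context {R : realType} {n : nat}.
Local Notation E := 'rV[R]_n.
Variables (K : R) (W : E -> R) (g : E -> E) (H : E -> E -> E).
Hypothesis reg : regular K W g H.
Definition qpot (W : E -> R) (x : E) : R := ⟦x⟧ ^+ 2 / 2 + W x.
Local Notation V := (qpot W).
Variable mu : probability E R.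
Hypothesis muV : glc mu V.

Let K1 : 1 <= K. Proof. by case: reg. Qed.
Let K0 : 0 <= K. Proof. exact: le_trans K1. Qed.

Let d (x : E) := x + g x.
(** [q] dominates the gradient [d] of the potential and its difference quotients over shifts of
    length at most 1; [Psi] dominates the quadratic remainder of the density ratio. *)
Let q (x : E) : R := ⟦x⟧ + 2 * K + 1.
Let Psi (x : E) : R := K + 1 + 2 * q x ^+ 2 * expR (q x).

Let q0 x : 0 <= q x.
Proof. by rewrite /q addr_ge0// addr_ge0// mulr_ge0. Qed.

Let Psi0 x : 0 <= Psi x.
Proof. by rewrite /Psi addr_ge0 ?addr_ge0// !mulr_ge0 ?expR_ge0. Qed.

Let tame_q : tame q.
Proof. by apply: tameD; [apply: tameD; [exact: tame_enorm|exact: tame_cst]|exact: tame_cst]. Qed.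

Let tame_eq : tame (fun x => expR (q x)).
Proof.
have -> : (fun x => expR (q x)) = (fun x => expR (1 * ⟦x⟧) * expR (2 * K + 1)).
  by apply/funext => x; rewrite -expRD; congr expR; rewrite /q; ring.
by apply: tameM; [exact: tame_expR|exact: tame_cst].
Qed.

Let tame_Psi : tame Psi.
Proof.
apply: tameD; first exact: tame_cst.
by apply: tameM => //; apply: tameZ; exact: tameX.
Qed.

Lemma regular_hess_le x v : ⟦H x v⟧ <= K * ⟦v⟧.
Proof.
apply: (@enorm_le_of_small _ _ _ x _ (K * ⟦v⟧)); last by rewrite mulr_ge0.
move=> y; have := reg_hess reg x y v; rewrite ler_norml => /andP[h _].
have h2 : v *d (g y - g x) <= K * ⟦v⟧ * ⟦y - x⟧.
  rewrite (le_trans (dotrV_le _ _))// -mulrA mulrCA ler_wpM2l//.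
  exact: reg_lip reg x y.
lra.
Qed.

Let qpotB x b : V (x + b) - V x = x *d b + ⟦b⟧ ^+ 2 / 2 + (W (x + b) - W x).
Proof.
by rewrite /qpot enorm_sqr !dotrVE -!enorm_sqr (dotrVC b x); field.
Qed.

Let xbx (x b : E) : x + b - x = b.
Proof. by rewrite addrAC subrr add0r. Qed.

Let qpotB_le x b : ⟦b⟧ <= 1 -> `|V (x + b) - V x| <= q x * ⟦b⟧.
Proof.
move=> b1; rewrite qpotB.
have h1 := normr_dotrV_le x b; have h2 := sm_lip (regW reg) x (x + b).
rewrite xbx in h2.
have h3 : `|⟦b⟧ ^+ 2 / 2| <= ⟦b⟧.
  rewrite ger0_norm ?divr_ge0 ?sqr_ge0//.
  have := enorm_ge0 b; nra.
rewrite (le_trans (ler_normD _ _))//.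
have h4 := ler_normD (x *d b) (⟦b⟧ ^+ 2 / 2).
have h5 : 0 <= K * ⟦b⟧ by rewrite mulr_ge0.
rewrite /q; lra.
Qed.

Let weight_diff x b : ⟦b⟧ <= 1 ->
  `|1 - expR (V x - V (x + b)) - d x *d b| <= ⟦b⟧ ^+ 2 * Psi x.
Proof.
move=> b1; have h1 := qpotB_le x b1.
pose a := V (x + b) - V x.
have -> : V x - V (x + b) = - a by rewrite opprB.
have h2 : `|a - d x *d b| <= (K + 1) * ⟦b⟧ ^+ 2.
  have [_ hW] := regW reg; have := hW x (x + b); rewrite xbx => hW'.
  rewrite /a qpotB /d dotrVDl.
  have -> : x *d b + ⟦b⟧ ^+ 2 / 2 + (W (x + b) - W x) - (x *d b + g x *d b) =
    ⟦b⟧ ^+ 2 / 2 + (W (x + b) - W x - g x *d b) by ring.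
  rewrite (le_trans (ler_normD _ _))// ger0_norm ?divr_ge0 ?sqr_ge0//.
  have := sqr_ge0 ⟦b⟧; lra.
have h3 : `|expR (- a) - 1 + a| <= ⟦b⟧ ^+ 2 * (2 * q x ^+ 2 * expR (q x)).
  have := expR_taylor2 (- a); rewrite opprK normrN sqrrN => /le_trans; apply.
  have a2 : a ^+ 2 <= (q x * ⟦b⟧) ^+ 2.
    by rewrite -[a ^+ 2]real_normK ?num_real// ler_pXn2r ?nnegrE ?mulr_ge0.
  have eb : expR `|a| <= expR (q x).
    by rewrite ler_expR (le_trans h1)// ler_piMr.
  have -> : ⟦b⟧ ^+ 2 * (2 * q x ^+ 2 * expR (q x)) = 2 * (q x * ⟦b⟧) ^+ 2 * expR (q x).
    by ring.
  have a0 : 0 <= 2 * a ^+ 2 by apply: mulr_ge0 => //; exact: sqr_ge0.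
  by apply: ler_pM => //; rewrite ?expR_ge0 ?ler_wpM2l.
have -> : 1 - expR (- a) - d x *d b = (a - d x *d b) - (expR (- a) - 1 + a) by ring.
rewrite (le_trans (ler_normB _ _))// /Psi; lra.
Qed.

Let tame_weight b : ⟦b⟧ <= 1 -> tame (fun x => expR (V x - V (x + b))).
Proof.
move=> b1; have [mV _ _] := muV; apply: (tame_le _ tame_eq).
  apply: measurableT_comp => //; apply: measurable_funB => //.
  exact: (measurableT_comp mV (measurable_rV_shift b)).
move=> x; rewrite !ger0_norm ?expR_ge0// ler_expR.
rewrite (le_trans (ler_norm _))// distrC (le_trans (qpotB_le x b1))//.
by rewrite ler_piMr.
Qed.

Let tame_d i : tame (fun x => d x ord0 i).
Proof.
rewrite /d; under eq_fun do rewrite !mxE.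
by apply: tameD; [exact: tame_coord|exact: tame_grad (regW reg)].
Qed.

Let tame_cvec (b : E) i : tame (fun _ : E => b ord0 i).
Proof. exact: tame_cst. Qed.

Let MM (L B : R) x := B * (q x + Psi x) + L * Psi x.

Let tame_MM L B : tame (MM L B).
Proof. by apply: tameD; apply: tameZ => //; exact: tameD. Qed.

(** Two changes of variables turn the integral of [f (x + b) + f (x - b) - 2 f x] into that of
    [(f (x + b) - f x) (1 - r x)], with [r] the density ratio. One difference thus falls on the
    density, and each factor needs only a first-order expansion, which is all that [sm] provides. *)
Let shift_expand L B f w b : sm L B f w -> 0 <= L -> 0 <= B -> ⟦b⟧ <= 1 ->
  `|(\int[mu]_x f (x + b) + \int[mu]_x f (x - b)) / 2 - \int[mu]_x f x
    - (\int[mu]_x ((w x *d b) * (d x *d b))) / 2| <=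
  ⟦b⟧ ^+ 3 * \int[mu]_x MM L B x.
Proof.
move=> fw L0 B0 b1; have tf := tame_sm fw; have tr := tame_weight b1.
have tfb := tame_shift b tf.
have tw : tame (fun x => w x *d b).
  by apply: tame_dot => // i; exact: tame_grad fw.
have td : tame (fun x => d x *d b) by exact: tame_dot.
set r := fun x => expR (V x - V (x + b)) in tr.
have e1 : \int[mu]_x f (x - b) = \int[mu]_x (f x * r x) by exact: int_shift muV tf tr.
have e2 : \int[mu]_x f x = \int[mu]_x (f (x + b) * r x).
  by rewrite -(int_shift muV tfb tr); apply: eq_Rintegral => x _; rewrite subrK.
pose D x := (f (x + b) - f x) * (1 - r x) - (w x *d b) * (d x *d b).
have t1r : tame (fun x => 1 - r x) by apply: tameB => //; exact: tame_cst.
have tfr : tame (fun x => f x * r x) by exact: tameM.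
have tfbr : tame (fun x => f (x + b) * r x) by exact: tameM.
have twd : tame (fun x => (w x *d b) * (d x *d b)) by exact: tameM.
have tD : tame D.
  by apply: tameB => //; apply: tameM => //; exact: tameB.
have -> : (\int[mu]_x f (x + b) + \int[mu]_x f (x - b)) / 2 - \int[mu]_x f x
    - (\int[mu]_x ((w x *d b) * (d x *d b))) / 2 = (\int[mu]_x D x) / 2.
  have -> : \int[mu]_x D x = \int[mu]_x f (x + b) + \int[mu]_x f (x - b) -
      \int[mu]_x f x - \int[mu]_x f x - \int[mu]_x ((w x *d b) * (d x *d b)).
    rewrite {2}e2 e1 -(intD muV)// -(intB muV)//; last exact: tameD.
    rewrite -(intB muV)//; last by apply: tameB => //; exact: tameD.
    rewrite -(intB muV)//; last by do 2 apply: tameB => //; exact: tameD.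
    by apply: eq_Rintegral => x _; rewrite /D; ring.
  by field.
have hD x : `|D x| <= ⟦b⟧ ^+ 3 * MM L B x.
  have [wL hf] := fw; have := hf x (x + b); rewrite xbx => h1.
  have h2 := weight_diff x b1; rewrite -/(r x) in h2.
  have h3 : `|w x *d b| <= L * ⟦b⟧.
    by rewrite (le_trans (normr_dotrV_le _ _))// ler_wpM2r.
  have h4 : `|d x *d b| <= q x * ⟦b⟧.
    rewrite (le_trans (normr_dotrV_le _ _))// ler_wpM2r// (le_trans (ler_enormD _ _))//.
    have [gK _] := regW reg.
    by rewrite /q -addrA lerD2l (le_trans (gK x))//; have := K0; lra.
  have h5 : `|1 - r x| <= (q x + Psi x) * ⟦b⟧.
    rewrite -[1 - r x](subrK (d x *d b)) (le_trans (ler_normD _ _))//.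
    rewrite addrC mulrDl lerD// (le_trans h2)// mulrC ler_wpM2l//.
    by rewrite expr2 ler_piMr.
  have -> : D x = (f (x + b) - f x - w x *d b) * (1 - r x) +
      (w x *d b) * (1 - r x - d x *d b) by rewrite /D; ring.
  rewrite (le_trans (ler_normD _ _))// !normrM.
  have -> : ⟦b⟧ ^+ 3 * MM L B x = (B * ⟦b⟧ ^+ 2) * ((q x + Psi x) * ⟦b⟧) +
    (L * ⟦b⟧) * (⟦b⟧ ^+ 2 * Psi x) by rewrite /MM; ring.
  by rewrite lerD// ler_pM.
rewrite normrM [`|2^-1|]ger0_norm ?invr_ge0//.
have h1 := int_abs muV tD.
have h2 : \int[mu]_x `|D x| <= \int[mu]_x (⟦b⟧ ^+ 3 * MM L B x).
  by apply: (int_le muV) => //; [exact: tame_norm|exact: tameZ].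
rewrite (intZ muV) // in h2.
have := normr_ge0 (\int[mu]_x D x); lra.
Qed.

(* Up to [O(eta^(3/2))], [mu] is invariant under the Euler scheme. *)
Lemma step_invariant (L B : R) : 0 <= L -> 0 <= B -> K * L <= B ->
  exists2 C : R, 0 <= C & forall (eta : R) f w, 0 < eta -> eta * (1 + K) ^+ 2 <= 1 ->
    n%:R * nstep eta <= 1 -> sm L B f w ->
    `|\int[mu]_x step g eta f x - \int[mu]_x f x| <= C * (eta * nstep eta).
Proof.
move=> L0 B0 KLB.
pose C1 := \int[mu]_x MM L B x.
pose C2 := \int[mu]_x ((L + K * L + 6 * B * q x) * q x + B * q x ^+ 2).
have tC2 : tame (fun x => (L + K * L + 6 * B * q x) * q x + B * q x ^+ 2).
  apply: tameD; last by apply: tameZ; exact: tameX.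
  by apply: tameM => //; apply: tameD; [exact: tame_cst|exact: tameZ].
have MM0 x : 0 <= MM L B x.
  exact: addr_ge0 (mulr_ge0 B0 (addr_ge0 (q0 x) (Psi0 x))) (mulr_ge0 L0 (Psi0 x)).
have LL0 x : 0 <= L + K * L + 6 * B * q x.
  apply: addr_ge0 (mulr_ge0 (mulr_ge0 _ B0) (q0 x)) => //.
  exact: addr_ge0 L0 (mulr_ge0 K0 L0).
have C2x x : 0 <= (L + K * L + 6 * B * q x) * q x + B * q x ^+ 2.
  exact: addr_ge0 (mulr_ge0 (LL0 x) (q0 x)) (mulr_ge0 B0 (exprn_ge0 2 (q0 x))).
have C10 : 0 <= C1 by apply: Rintegral_ge0.
have C20 : 0 <= C2.
  exact: Rintegral_ge0.
exists (2 * n%:R ^+ 2 * C1 + C2); first by rewrite addr_ge0 ?mulr_ge0.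
move=> eta f w eta0 eta1 ns1 fw.
set s := nstep eta in ns1 *; have s0 : 0 < s by exact: nstep_gt0.
have s2 : s ^+ 2 = 2 * eta by exact: nstep_sqr.
have hc := sm_cgrad reg eta0 eta1 fw B0 KLB.
set h := f \o phi g eta in hc *; set wt := cgrad g H eta w in hc *.
have rL : rho K eta * L <= L by rewrite ler_piMl// (rho_le1 reg).
have hc' := sm_weaken hc rL (lexx B).
have tf := tame_sm fw; have th := tame_sm hc.
pose sg (z : 'I_n -> bool) : E := s *: signs id z.
have bn z : ⟦sg z⟧ <= n%:R * s.
  rewrite (le_trans (enorm_le_sum _))//.
  rewrite (_ : n%:R * s = \sum_(i < n) s); last by rewrite sumr_const card_ord mulr_natl.
  by apply: ler_sum => i _; rewrite !mxE normrM normrX normrN1 expr1n mulr1 gtr0_norm.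
have b1 z : ⟦sg z⟧ <= 1 by rewrite (le_trans (bn z)).
have b2 z : ⟦sg z⟧ ^+ 2 = n%:R * s ^+ 2.
  by rewrite enormZ exprMn enorm_signs real_normK ?num_real// mulrC.
have b3 z : ⟦sg z⟧ ^+ 3 <= 2 * n%:R ^+ 2 * (eta * s).
  rewrite exprSr b2 s2 (_ : 2 * _ * _ = n%:R * (2 * eta) * (n%:R * s)); last by ring.
  by rewrite ler_wpM2l// !mulr_ge0// ltW.
pose zt : 'I_n -> bool := fun=> true.
pose Q z := (\int[mu]_x h (x + sg z) + \int[mu]_x h (x - sg z)) / 2.
pose T z := \int[mu]_x ((wt x *d sg z) * (d x *d sg z)).
have twt i : tame (fun x => wt x ord0 i) by exact: tame_grad hc.
have tw i : tame (fun x => w x ord0 i) by exact: tame_grad fw.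
have e1 : \int[mu]_x step g eta f x = Ex (enum 'I_n) Q zt.
  transitivity (Ex (enum 'I_n) (fun z => \int[mu]_x h (x + sg z)) zt).
    rewrite -(int_Ex muV (enum 'I_n) (G := fun z x => h (x + sg z)))// => z.
    exact: tame_shift.
  pose G v := \int[mu]_x h (x + s *: v).
  have GN z : G (- signs id z) = \int[mu]_x h (x - sg z).
    by apply: eq_Rintegral => x _; rewrite /sg scalerN.
  have QE : Q = (fun z => (G (signs id z) + G (- signs id z)) / 2).
    by apply/funext => z; rewrite GN.
  by rewrite QE -Ex_signs_half.
have e2 : Ex (enum 'I_n) T zt = 2 * eta * \int[mu]_x (wt x *d d x).
  rewrite /T -(int_Ex muV (enum 'I_n) (G := fun z x => (wt x *d sg z) * (d x *d sg z))); last first.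
    by move=> z; apply: tameM; exact: tame_dot.
  rewrite -(intZ muV); last exact: tame_dot.
  apply: eq_Rintegral => x _.
  rewrite -(Ex_signs2 (wt x) (d x) zt) -s2.
  have := congr1 (@^~ zt) (ExZ (enum 'I_n) (s ^+ 2)
    (fun z => (wt x *d signs id z) * (d x *d signs id z))) => /= <-.
  by congr Ex; apply/funext => z; rewrite /sg !dotrVZr; ring.
(* Noise: averaging [shift_expand] over signs of covariance [s^2 = 2 eta] yields [eta] times the
   integral of [wt . d], where [d] is the gradient of the potential. *)
have e3 : `|Ex (enum 'I_n) Q zt - \int[mu]_x h x - eta * \int[mu]_x (wt x *d d x)|
    <= 2 * n%:R ^+ 2 * C1 * (eta * s).
  have -> : Ex (enum 'I_n) Q zt - \int[mu]_x h x - eta * \int[mu]_x (wt x *d d x) =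
      Ex (enum 'I_n) (fun z => Q z - \int[mu]_x h x - 2^-1 * T z) zt.
    by rewrite !ExB ExZ Ex_cst e2; field.
  rewrite (le_trans (Ex_abs _ _ _))//; apply: Ex_ub => z.
  have h1 := shift_expand hc' L0 B0 (b1 z).
  rewrite [2^-1 * _]mulrC; apply: (le_trans h1).
  have -> : 2 * n%:R ^+ 2 * C1 * (eta * s) = 2 * n%:R ^+ 2 * (eta * s) * C1 by ring.
  exact: ler_wpM2r C10 _ _ (b3 z).
have tdd : tame (fun x => wt x *d d x) by exact: tame_dot.
(* Drift: [h] differs from [f] by [- eta (w . d)] to first order. This cancels the contribution of
   the noise, and that cancellation is the invariance. *)
have e4 : `|\int[mu]_x h x + eta * \int[mu]_x (wt x *d d x) - \int[mu]_x f x| <= C2 * (eta * s).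
  have -> : \int[mu]_x h x + eta * \int[mu]_x (wt x *d d x) - \int[mu]_x f x =
      \int[mu]_x (h x + eta * (wt x *d d x) - f x).
    by rewrite (intB muV)// ?(intD muV)// ?(intZ muV)//; [exact: tameZ|apply: tameD => //; exact: tameZ].
  have tl : tame (fun x => h x + eta * (wt x *d d x) - f x).
    by apply: tameB => //; apply: tameD => //; exact: tameZ.
  rewrite (le_trans (int_abs muV tl))// mulrC -(intZ muV)//.
  apply: (int_le muV); [exact: tame_norm|exact: tameZ|move=> x].
  have [wL hf] := fw.
  have dq : ⟦d x⟧ <= q x.
    rewrite (le_trans (ler_enormD _ _))//.
    have [gK _] := regW reg.
    by rewrite /q -addrA lerD2l (le_trans (gK x))//; have := K0; lra.
  have pE : phi g eta x - x = - (eta *: d x).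
    by rewrite /phi -/(d x) addrAC subrr add0r.
  have h1 : `|h x - f x + eta * (w x *d d x)| <= B * (eta * q x) ^+ 2.
    have := hf x (phi g eta x); rewrite pE dotrVNr dotrVZr opprK => /le_trans; apply.
    rewrite ler_wpM2l// ler_pXn2r ?nnegrE ?mulr_ge0 ?(ltW eta0)//.
    by rewrite enormN enormZ gtr0_norm// ler_wpM2l// ltW.
  have h2 : ⟦wt x - w x⟧ <= eta * (L + K * L + 6 * B * q x).
    have -> : wt x - w x = (w (phi g eta x) - w x) -
       eta *: (w (phi g eta x) + H x (w (phi g eta x))).
      by rewrite /wt /cgrad addrAC.
    rewrite (le_trans (ler_enormB _ _))//.
    have h3 : ⟦w (phi g eta x) - w x⟧ <= 6 * B * (eta * q x).
      rewrite (le_trans (sm_grad_lip fw _ _))// ler_wpM2l ?mulr_ge0//.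
      by rewrite pE enormN enormZ gtr0_norm// ler_wpM2l// ltW.
    have h4 : ⟦w (phi g eta x) + H x (w (phi g eta x))⟧ <= L + K * L.
      rewrite (le_trans (ler_enormD _ _))// lerD//.
      by rewrite (le_trans (regular_hess_le _ _))// ler_wpM2l.
    have h5 := ler_wpM2l (ltW eta0) h4.
    rewrite enormZ gtr0_norm//; lra.
  have -> : h x + eta * (wt x *d d x) - f x = (h x - f x + eta * (w x *d d x)) +
     eta * ((wt x - w x) *d d x) by rewrite dotrVDl dotrVNl; ring.
  have h6 : `|(wt x - w x) *d d x| <= eta * (L + K * L + 6 * B * q x) * q x.
    by rewrite (le_trans (normr_dotrV_le _ _))// ler_pM.
  have h7 : `|eta * ((wt x - w x) *d d x)| <= eta * (eta * (L + K * L + 6 * B * q x) * q x).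
    by rewrite normrM (gtr0_norm eta0) ler_wpM2l// ltW.
  rewrite (le_trans (ler_normD _ _))//.
  apply: (@le_trans _ _ (eta ^+ 2 * ((L + K * L + 6 * B * q x) * q x + B * q x ^+ 2))).
    by lra.
  apply: (ler_wpM2r (C2x x)); rewrite expr2.
  rewrite ler_wpM2l ?(ltW eta0)//.
  rewrite -(ler_pXn2r (n := 2)) ?nnegrE ?(ltW eta0) ?(ltW s0)// s2.
  have : eta <= 1 by have := K1; nra.
  nra.
rewrite e1.
have -> : Ex (enum 'I_n) Q zt - \int[mu]_x f x =
   (Ex (enum 'I_n) Q zt - \int[mu]_x h x - eta * \int[mu]_x (wt x *d d x)) +
   (\int[mu]_x h x + eta * \int[mu]_x (wt x *d d x) - \int[mu]_x f x) by ring.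
rewrite (le_trans (ler_normD _ _))//; lra.
Qed.

End invariance.

(** * Variances, approximations and convergence to equilibrium *)

Section truncation.
Context {R : realType} {n : nat}.
Local Notation E := 'rV[R]_n.

(** The map [a / (1 + a^2)] is bounded with slopes in [[-1, 1]], so truncation never increases the
    gradient. Bounded functions are wanted because the variance argument needs [f ^ 2] in the class
    [sm]. *)
Definition trunc (e : R) (f : E -> R) (x : E) : R := f x / (1 + (e * f x) ^+ 2).
Definition trunc_grad (e : R) (f : E -> R) (w : E -> E) (x : E) : E :=
  ((1 - (e * f x) ^+ 2) / (1 + (e * f x) ^+ 2) ^+ 2) *: w x.

Let p0 (a : R) : 0 < 1 + a ^+ 2.
Proof. by rewrite ltr_pwDl// sqr_ge0. Qed.

Lemma rat_taylor (a b : R) :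
  `|b / (1 + b ^+ 2) - a / (1 + a ^+ 2) - (1 - a ^+ 2) / (1 + a ^+ 2) ^+ 2 * (b - a)| <=
  2 * (b - a) ^+ 2.
Proof.
have a0 := p0 a; have b0 := p0 b.
have -> : b / (1 + b ^+ 2) - a / (1 + a ^+ 2) - (1 - a ^+ 2) / (1 + a ^+ 2) ^+ 2 * (b - a) =
   (b - a) ^+ 2 * ((a ^+ 2 * b - 2 * a - b) / ((1 + a ^+ 2) ^+ 2 * (1 + b ^+ 2))).
  by field; rewrite !gt_eqF.
rewrite normrM mulrC (ger0_norm (sqr_ge0 _)) ler_wpM2r ?sqr_ge0//.
rewrite normrM normfV [`|(_ ^+ 2) * _|]gtr0_norm ?mulr_gt0 ?exprn_gt0//.
rewrite ler_pdivrMr ?mulr_gt0 ?exprn_gt0//.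
have -> : 2 * ((1 + a ^+ 2) ^+ 2 * (1 + b ^+ 2)) =
   2 * (1 + b ^+ 2) + 4 * a ^+ 2 * (1 + b ^+ 2) + 2 * a ^+ 4 * (1 + b ^+ 2) by ring.
have a4 : 0 <= a ^+ 4 by rewrite -[4%N]/(2 * 2)%N exprM sqr_ge0.
have := sqr_ge0 a; have := sqr_ge0 b; have := sqr_ge0 (a - 1); have := sqr_ge0 (a + 1).
have := sqr_ge0 (b - 1); have := sqr_ge0 (b + 1) => h1 h2 h3 h4 h5 h6.
rewrite ler_norml; apply/andP; split; nra.
Qed.

Lemma rat_slope (a : R) : `|(1 - a ^+ 2) / (1 + a ^+ 2) ^+ 2| <= 1.
Proof.
have a0 := p0 a; rewrite normrM normfV [`|(_ ^+ 2)|]gtr0_norm ?exprn_gt0//.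
rewrite ler_pdivrMr ?exprn_gt0// mul1r.
by have := sqr_ge0 a; rewrite ler_norml => h; apply/andP; split; nra.
Qed.

Lemma sm_trunc L B e f w : sm L B f w -> 0 <= L -> 0 < e ->
  sm L (B + 2 * e * L ^+ 2) (trunc e f) (trunc_grad e f w).
Proof.
move=> fw L0 e0; have fl := sm_lip fw; have [wL fB] := fw; split=> [x|x y].
  by rewrite enormZ (le_trans _ (wL x))// ler_piMl// rat_slope.
set c := (1 - (e * f x) ^+ 2) / (1 + (e * f x) ^+ 2) ^+ 2.
have c1 : `|c| <= 1 by exact: rat_slope.
have h := rat_taylor (e * f x) (e * f y); rewrite -/c in h.
have -> : trunc e f y - trunc e f x - trunc_grad e f w x *d (y - x) =
  e^-1 * (e * f y / (1 + (e * f y) ^+ 2) - e * f x / (1 + (e * f x) ^+ 2) -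
     c * (e * f y - e * f x)) + c * (f y - f x - w x *d (y - x)).
  rewrite /trunc /trunc_grad dotrVZl -/c.
  have := gt_eqF (p0 (e * f x)); have := gt_eqF (p0 (e * f y)) => h1 h2.
  by clearbody c; field; rewrite h1 h2 gt_eqF.
clearbody c; rewrite (le_trans (ler_normD _ _))// !normrM mulrDl addrC lerD//.
  by rewrite (le_trans (ler_piMl _ c1)).
rewrite gtr0_norm ?invr_gt0// mulrC ler_pdivrMr// (le_trans h)//.
have := fl x y; have := normr_ge0 (f y - f x) => h3 h4.
have : (f y - f x) ^+ 2 <= (L * ⟦y - x⟧) ^+ 2.
  rewrite -[(f y - f x) ^+ 2]real_normK ?num_real// ler_pXn2r ?nnegrE//.
  exact: le_trans h4.
have : 0 <= e ^+ 2 by exact: sqr_ge0.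
by rewrite -mulrBr !exprMn; nra.
Qed.

Lemma trunc_grad_le e f w x : ⟦trunc_grad e f w x⟧ <= ⟦w x⟧.
Proof. by rewrite enormZ ler_piMl// rat_slope. Qed.

Lemma trunc_bound e f x : 0 < e -> `|trunc e f x| <= e^-1.
Proof.
move=> e0; have a0 := p0 (e * f x).
rewrite /trunc normrM normfV [`|1 + _|]gtr0_norm// ler_pdivrMr//.
rewrite mulrC ler_pdivlMr// -{1}(gtr0_norm e0) -normrM mulrC.
by rewrite ler_norml; apply/andP; split; have := sqr_ge0 (e * f x - 1);
  have := sqr_ge0 (e * f x + 1); nra.
Qed.

Lemma trunc_le e f x : `|trunc e f x| <= `|f x|.
Proof.
have a0 := p0 (e * f x).
rewrite /trunc normrM normfV [`|1 + _|]gtr0_norm// ler_pdivrMr//.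
by rewrite ler_peMr// lerDl sqr_ge0.
Qed.

Lemma trunc_approx e f x : 0 < e -> `|trunc e f x - f x| <= e * f x ^+ 2.
Proof.
move=> e0; have a0 := p0 (e * f x).
have -> : trunc e f x - f x = - (f x * ((e * f x) ^+ 2 / (1 + (e * f x) ^+ 2))).
  by rewrite /trunc; field; rewrite gt_eqF.
rewrite normrN normrM normrM normfV [`|1 + _|]gtr0_norm// mulrA ler_pdivrMr//.
rewrite [`|_ ^+ 2|]ger0_norm ?sqr_ge0//.
rewrite -[f x ^+ 2]real_normK ?num_real// exprMn -[f x ^+ 2]real_normK ?num_real//.
have := normr_ge0 (f x); set t := `|f x| => t0.
have -> : t * (e ^+ 2 * t ^+ 2) = (e * t ^+ 2) * (e * t) by ring.
rewrite ler_wpM2l ?mulr_ge0 ?sqr_ge0 ?(ltW e0)//.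
by have := sqr_ge0 (e * t - 1); nra.
Qed.

End truncation.

Section variance.
Context {R : realType} {n : nat}.
Local Notation E := 'rV[R]_n.
Variables (mu : probability E R) (V : E -> R).
Hypothesis muV : glc mu V.
Implicit Types f h : E -> R.

Definition cvr (mu : probability E R) f h : R :=
  \int[mu]_x (f x * h x) - (\int[mu]_x f x) * (\int[mu]_x h x).
Definition vr mu f : R := cvr mu f f.

Lemma int_ge0 f : (forall x, 0 <= f x) -> 0 <= \int[mu]_x f x.
Proof. by move=> f0; exact: Rintegral_ge0. Qed.

Lemma int_affine c k f : tame f -> \int[mu]_x (c + k * f x) = c + k * \int[mu]_x f x.
Proof. by move=> tf; rewrite (intD muV (tame_cst c) (tameZ k tf)) (int_cst mu) (intZ muV k tf). Qed.

Lemma cvrC f h : cvr mu f h = cvr mu h f.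
Proof.
rewrite /cvr [X in _ - X]mulrC; congr (_ - _).
by apply: eq_Rintegral => x _; rewrite mulrC.
Qed.

Lemma cvrDl f1 f2 h : tame f1 -> tame f2 -> tame h ->
  cvr mu (fun x => f1 x + f2 x) h = cvr mu f1 h + cvr mu f2 h.
Proof.
move=> t1 t2 th; rewrite /cvr (intD muV)//.
rewrite (_ : \int[mu]_x ((f1 x + f2 x) * h x) = \int[mu]_x (f1 x * h x) + \int[mu]_x (f2 x * h x)).
  ring.
by rewrite -(intD muV); [apply: eq_Rintegral => x _; rewrite mulrDl|exact: tameM|exact: tameM].
Qed.

Lemma cvrZl c f h : tame f -> tame h -> cvr mu (fun x => c * f x) h = c * cvr mu f h.
Proof.
move=> tf th; rewrite /cvr (intZ muV)//.
rewrite (_ : \int[mu]_x (c * f x * h x) = c * \int[mu]_x (f x * h x)); first ring.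
by rewrite -(intZ muV); [apply: eq_Rintegral => x _; rewrite mulrA|exact: tameM].
Qed.

Lemma cvrDr f1 f2 h : tame f1 -> tame f2 -> tame h ->
  cvr mu h (fun x => f1 x + f2 x) = cvr mu h f1 + cvr mu h f2.
Proof. by move=> *; rewrite cvrC cvrDl// !(cvrC h). Qed.

Lemma cvrZr c f h : tame f -> tame h -> cvr mu h (fun x => c * f x) = c * cvr mu h f.
Proof. by move=> *; rewrite cvrC cvrZl// (cvrC h). Qed.

Lemma cvr_cst c h : tame h -> cvr mu (fun=> c) h = 0.
Proof. by move=> th; rewrite /cvr (int_cst mu) (intZ muV)// subrr. Qed.

Lemma vrE f : vr mu f = \int[mu]_x (f x ^+ 2) - (\int[mu]_x f x) ^+ 2.
Proof. by rewrite /vr /cvr -expr2; congr (_ - _); apply: eq_Rintegral. Qed.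

Lemma vrZ c f : tame f -> vr mu (fun x => c * f x) = c ^+ 2 * vr mu f.
Proof. by move=> tf; rewrite /vr cvrZl ?cvrZr ?expr2 ?mulrA//; exact: tameZ. Qed.

Lemma vrD f h : tame f -> tame h ->
  vr mu (fun x => f x + h x) = vr mu f + vr mu h + 2 * cvr mu f h.
Proof.
move=> tf th; have tD := tameD tf th.
by rewrite /vr cvrDl// !cvrDr// (cvrC h f); ring.
Qed.

Lemma vr_shift c f : tame f -> vr mu (fun x => f x + c) = vr mu f.
Proof.
move=> tf; have tc := @tame_cst R n c.
by rewrite vrD// cvrC cvr_cst// /vr cvr_cst// mulr0 !addr0.
Qed.

Lemma int_sqrB c f : tame f ->
  \int[mu]_x ((f x - c) ^+ 2) = vr mu f + (\int[mu]_x f x - c) ^+ 2.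
Proof.
move=> tf; have tc := @tame_cst R n (- c).
have tfc : tame (fun x => f x - c) by exact: tameD.
rewrite -(vr_shift (- c) tf) vrE (intB muV) ?(int_cst mu); [ring|exact: tf|exact: tame_cst].
Qed.

Lemma vr_le c f : tame f -> vr mu f <= \int[mu]_x ((f x - c) ^+ 2).
Proof. by move=> tf; rewrite int_sqrB// lerDl sqr_ge0. Qed.

Lemma vr_ge0 f : tame f -> 0 <= vr mu f.
Proof.
move=> tf; have := int_sqrB (\int[mu]_x f x) tf; rewrite subrr expr0n/= addr0 => <-.
by apply: int_ge0 => x; exact: sqr_ge0.
Qed.

Lemma vr_approx f (G : E -> R) : tame f -> tame G -> (forall x, 0 <= G x) ->
  exists2 A : R, 0 <= A & forall e h, 0 <= e -> e <= 1 -> tame h ->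
    (forall x, `|h x - f x| <= e * G x) -> `|vr mu h - vr mu f| <= A * e.
Proof.
move=> tf tG G0; have tfn := tame_norm tf.
pose I1 := \int[mu]_x (G x * (2 * `|f x| + G x)).
pose I2 := (\int[mu]_x G x) * (2 * `|\int[mu]_x f x| + \int[mu]_x G x).
have IG0 : 0 <= \int[mu]_x G x by exact: int_ge0.
have t2 : tame (fun x => 2 * `|f x| + G x) by apply: tameD => //; exact: tameZ.
have I10 : 0 <= I1.
  by apply: int_ge0 => x; rewrite mulr_ge0// addr_ge0// mulr_ge0.
have I20 : 0 <= I2 by rewrite mulr_ge0// addr_ge0// mulr_ge0.
exists (I1 + I2) => [|e h e0 e1 th hf]; first exact: addr_ge0.
have sqrB (a b g : R) : 0 <= g -> `|a - b| <= e * g -> `|a ^+ 2 - b ^+ 2| <= e * (g * (2 * `|b| + g)).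
  move=> g0 ab; have -> : a ^+ 2 - b ^+ 2 = (a - b) * (2 * b + (a - b)) by ring.
  rewrite normrM mulrA ler_pM// (le_trans (ler_normD _ _))// normrM ger0_norm// lerD2l.
  by rewrite (le_trans ab)// ler_piMl.
have hB : `|\int[mu]_x h x - \int[mu]_x f x| <= e * \int[mu]_x G x.
  rewrite -(intB muV)// (le_trans (int_abs muV _))//; first exact: tameB.
  rewrite -(intZ muV)//; apply: (int_le muV) => //; last exact: tameZ.
  exact/tame_norm/tameB.
rewrite !vrE.
have -> : \int[mu]_x h x ^+ 2 - (\int[mu]_x h x) ^+ 2 - (\int[mu]_x f x ^+ 2 - (\int[mu]_x f x) ^+ 2) =
  \int[mu]_x (h x ^+ 2 - f x ^+ 2) - ((\int[mu]_x h x) ^+ 2 - (\int[mu]_x f x) ^+ 2).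
  by rewrite (intB muV); [ring|exact: tameX|exact: tameX].
have tB : tame (fun x => h x ^+ 2 - f x ^+ 2) by apply: tameB; exact: tameX.
rewrite (le_trans (ler_normB _ _))// mulrC mulrDr lerD//; last exact: sqrB.
rewrite (le_trans (int_abs muV _))// -(intZ muV); last exact: tameM.
apply: (int_le muV); [exact: tame_norm|by apply: tameZ; exact: tameM|].
by move=> x; exact: sqrB.
Qed.

Lemma int_cvg (F : nat -> E -> R) f G : (forall k, measurable_fun setT (F k)) ->
  (forall x, F k x @[k --> \oo] --> f x) -> tame G ->
  (forall k x, `|F k x| <= G x) ->
  tame f /\ \int[mu]_x F k x @[k --> \oo] --> \int[mu]_x f x.
Proof.
move=> mF Ff tG FG.
have mf : measurable_fun setT f.
  by apply: (measurable_fun_cvg mF) => x _; exact: Ff.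
have fG x : `|f x| <= G x.
  have hc : `|F k x| @[k --> \oo] --> `|f x| by apply: cvg_norm; exact: Ff.
  by apply: (ler_cvg_to hc (cvg_cst (G x))); near=> k; exact: FG.
have tf : tame f.
  apply: (tame_le mf tG) => x; rewrite (le_trans (fG x))// ler_norm//.
split=> //.
have h := @dominated_cvg _ _ _ mu setT measurableT (fun k => EFin \o F k) (EFin \o f)
  (EFin \o G).
have {}h : (\int[mu]_x (EFin \o F k) x)%E @[k --> \oo] --> (\int[mu]_x (EFin \o f) x)%E.
  refine (h _ _ _ (tame_int muV tG) _) => //.
  - by move=> k; apply/measurable_EFinP.
  - by move=> x _; apply: cvg_EFin; [near=> k|exact: Ff].
  - by move=> k x _; rewrite /= lee_fin.
apply: (@fine_cvg R nat \oo _ (fun k => \int[mu]_x (F k x)%:E)%E).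
by rewrite fineK//; exact: integrable_fin_num (tame_int muV tf).
Unshelve. all: by end_near. Qed.

End variance.

Lemma bernoulli_inv {R : realFieldType} (x : R) k : 0 <= x -> x <= 1 ->
  (1 - x) ^+ k * (1 + k%:R * x) <= 1.
Proof.
move=> x0 x1; elim: k => [|k IH]; first by rewrite mul0r addr0 mulr1.
rewrite (le_trans _ IH)// exprSr -mulrA ler_wpM2l ?exprn_ge0 ?subr_ge0//.
by rewrite -natr1; have := ler0n R k; nra.
Qed.

(** * Smooth approximation of Lipschitz functions by finitely many cones *)

Section dist_dense.
Context {R : realType} {n : nat}.
Local Notation E := 'rV[R]_n.

(* The distance to the first points of a dense sequence. *)
Fixpoint ddist (M : nat) (x : E) : R :=
  if M is M'.+1 then Num.min (ddist M' x) ⟦x - pts M⟧ else ⟦x - pts 0⟧.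

Lemma ddist_ge0 M x : 0 <= ddist M x.
Proof. by elim: M => [|M IH] /=; [exact: enorm_ge0|rewrite le_min IH enorm_ge0]. Qed.

Lemma ddist_le M k x : (k <= M)%N -> ddist M x <= ⟦x - pts k⟧.
Proof.
elim: M => [|M IH]; first by rewrite leqn0 => /eqP ->.
rewrite leq_eqVlt => /predU1P[->|kM] /=; first by rewrite ge_min lexx orbT.
by rewrite ge_min IH.
Qed.

Lemma ddist_attained M x : exists2 k, (k <= M)%N & ddist M x = ⟦x - pts k⟧.
Proof.
elim: M => [|M [k kM e]]; first by exists 0%N.
rewrite /=; case: leP => _; first by exists k; rewrite ?(leq_trans kM).
by exists M.+1.
Qed.

Lemma ddist_lip M : lip 1 (ddist M).
Proof.
have h M' x y : ddist M' y - ddist M' x <= ⟦y - x⟧.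
  have [k kM ->] := ddist_attained M' x.
  by rewrite lerBlDr (le_trans (ddist_le _ kM))// ler_enorm_dist.
by move=> x y; rewrite mul1r ler_norml h andbT lerNl opprB (le_trans (h M y x))// enormB.
Qed.

Lemma ddist_le_enorm M x : ddist M x <= ⟦x⟧.
Proof. by have := ddist_le x (leq0n M); rewrite subr0. Qed.

Lemma ddist_cvg x : ddist M x @[M --> \oo] --> 0.
Proof.
apply/cvgrPdist_le => e e0; have [k hk] := pts_dense x e0.
near=> M; rewrite sub0r normrN ger0_norm ?ddist_ge0//.
rewrite (le_trans _ (ltW hk))// ddist_le//; near: M; exact: nbhs_infty_ge.
Unshelve. all: by end_near. Qed.

Lemma int_ddist (mu : probability E R) V (k : R) : glc mu V -> 0 < k ->
  exists M, \int[mu]_x ddist M x <= k.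
Proof.
move=> muV k0.
have [_ h] := @int_cvg _ _ mu V muV ddist (fun=> 0) (fun x => ⟦x⟧)
  (fun M => measurable_lip (@ddist_lip M)) ddist_cvg tame_enorm
  (fun M x => ltac:(by rewrite ger0_norm ?ddist_ge0 ?ddist_le_enorm)).
move: h; rewrite (int_cst mu) => /cvgrPdist_le /(_ _ k0) [M _ /(_ M (leqnn M))] /=.
by rewrite sub0r normrN => h; exists M; exact: le_trans (ler_norm _) h.
Qed.

(* Smooth minimum of the cones [q (pts j) + L |x - pts j|]. *)
Definition softcone (M : nat) (L s beta : R) (q : E -> R) (x : E) : R :=
  - lse beta (fun (j : 'I_M.+1) x =>
      - (L * Num.sqrt (⟦x - pts j⟧ ^+ 2 + s ^+ 2) + q (pts j))) x.

Lemma sm_softcone M L s beta q : 0 <= L -> 0 < s -> 0 < beta ->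
  exists w, sm L (L * s^-1 + 8 * beta * L ^+ 2) (softcone M L s beta q) w.
Proof.
move=> L0 s0 b0.
have h (j : 'I_M.+1) := sm_opp (sm_add (sm_scale L (sm_sqrt (pts j) s0))
   (@sm_lin R n 0 (q (pts j)))).
have h' (j : 'I_M.+1) := sm_weaken (h j) (_ : _ <= L) (_ : _ <= L * s^-1).
eexists; apply/sm_opp; apply: (@sm_lse _ _ M beta L (L * s^-1)) => // j.
have -> : (fun x : E => - (L * Num.sqrt (⟦x - pts j⟧ ^+ 2 + s ^+ 2) + q (pts j))) =
  (fun x => - (L * Num.sqrt (⟦x - pts j⟧ ^+ 2 + s ^+ 2) + (0 *d x + q (pts j)))).
  by apply/funext => x; rewrite dotrV0l add0r.
apply: h'; first by rewrite enorm0 addr0 mulr1 ger0_norm.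
by rewrite addr0 ger0_norm.
Qed.

(** Every cone lies above the [L]-Lipschitz [q], and the cone at the nearest point exceeds it by at
    most [2 L ddist]. Rounding the cones costs [L s], the soft minimum [ln (M + 1) / beta]. *)
Lemma softcone_approx M L s beta q x : 0 <= L -> 0 < s -> 0 < beta -> lip L q ->
  - (ln M.+1%:R / beta) <= softcone M L s beta q x - q x <=
  2 * L * ddist M x + L * s.
Proof.
move=> L0 s0 b0 ql.
have s1 y : ⟦y⟧ <= Num.sqrt (⟦y : E⟧ ^+ 2 + s ^+ 2).
  by rewrite -[leLHS]ger0_norm// -sqrtr_sqr ler_wsqrtr// lerDl sqr_ge0.
have s2 y : Num.sqrt (⟦y : E⟧ ^+ 2 + s ^+ 2) <= ⟦y⟧ + s.
  rewrite -[leRHS]ger0_norm ?addr_ge0 ?(ltW s0)// -sqrtr_sqr ler_wsqrtr//.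
  by rewrite sqrrD lerD2r lerDl mulrn_wge0// mulr_ge0// ltW.
apply/andP; split; rewrite /softcone.
  rewrite lerBrDr lerNr opprD opprK addrC.
  apply: lse_le => // j; rewrite lerN2.
  have := ql (pts j) x; rewrite ler_norml => /andP[_ h].
  have := ler_wpM2l L0 (s1 (x - pts j)); lra.
have [k kM ->] := ddist_attained M x.
have := lse_ge (fun (j : 'I_M.+1) x =>
      - (L * Num.sqrt (⟦x - pts j⟧ ^+ 2 + s ^+ 2) + q (pts j))) b0
      (Ordinal (kM : (k < M.+1)%N)) x => /= h.
have := ql x (pts k); rewrite ler_norml enormB => /andP[_ h1].
have := ler_wpM2l L0 (s2 (x - pts k)); rewrite mulrDr.
move: h; set l := lse _ _ _; lra.
Qed.

End dist_dense.

(** * Choice of the time step and convergence to equilibrium *)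

Section regular_mu.
Context {R : realType} {n : nat}.
Local Notation E := 'rV[R]_n.
Variables (K : R) (W : E -> R) (g : E -> E) (H : E -> E -> E).
Hypothesis reg : regular K W g H.
Variable mu : probability E R.
Hypothesis muV : glc mu (qpot W).

Let K1 : 1 <= K. Proof. by case: reg. Qed.
Let K0 : 0 <= K. Proof. exact: le_trans K1. Qed.

(** Calibration: [m ^ 5] steps are a Langevin time [m / 4], long enough to forget the starting
    point, while errors of size [eta s] per step add up over [2 m ^ 5] steps to at most [1 / m]. A
    window of [m ^ 4] steps has duration [1 / 4]. *)
Definition etam (m : nat) : R := (4 * m%:R ^+ 4)^-1.
Definition good (m : nat) := [/\ (0 < m)%N, 1 + K <= m%:R & (n <= m)%N].
Local Notation s m := (nstep (etam m)).
Local Notation P m := (step g (etam m)).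
Local Notation G m := (step_grad g H (etam m)).
Local Notation r m := (rho K (etam m)).

Lemma good_ge1 m : good m -> 1 <= m%:R :> R.
Proof. by case=> h _ _; rewrite ler1n. Qed.

Lemma good_gt0 m : good m -> 0 < m%:R :> R.
Proof. by case=> h _ _; rewrite ltr0n. Qed.

Lemma etam_gt0 m : good m -> 0 < etam m.
Proof. by move=> gm; rewrite invr_gt0 mulr_gt0// exprn_gt0// good_gt0. Qed.

Lemma etam_pow4 m : good m -> etam m * m%:R ^+ 4 = 4^-1.
Proof. by move=> gm; rewrite /etam; field; rewrite gt_eqF ?good_gt0. Qed.

Lemma etam_le m : good m -> etam m * (1 + K) ^+ 2 <= 1.
Proof.
move=> gm; have e0 := etam_gt0 gm; have eE := etam_pow4 gm; have h1 := good_ge1 gm.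
have [_ Km _] := gm.
have h2 : (1 + K) ^+ 2 <= m%:R ^+ 2 by rewrite ler_pXn2r ?nnegrE ?addr_ge0//; exact: le_trans Km.
have h3 : m%:R ^+ 2 <= m%:R ^+ 4 :> R by rewrite ler_weXn2l.
have := ler_wpM2l (ltW e0) (le_trans h2 h3); rewrite eE; lra.
Qed.

Lemma nstep_etam_le2 m : good m -> s m <= (m%:R ^+ 2)^-1.
Proof.
move=> gm; have h0 := good_gt0 gm.
have h2 : 0 <= (m%:R ^+ 2)^-1 :> R by rewrite invr_ge0 sqr_ge0.
rewrite -(ler_pXn2r (n := 2)) ?nnegrE//; last by exact/ltW/nstep_gt0/etam_gt0.
rewrite nstep_sqr ?etam_gt0// /etam exprVn -exprM.
rewrite [leLHS](_ : _ = 2^-1 * (m%:R ^+ (2 * 2))^-1); last by field; rewrite gt_eqF.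
by rewrite ler_piMl// ?invr_ge0 ?exprn_ge0 ?(ltW h0)//; lra.
Qed.

Lemma nstep_etam_gt0 m : good m -> 0 < s m.
Proof. by move=> gm; apply: nstep_gt0; exact: etam_gt0. Qed.

Lemma nstep_etam_leV m : good m -> s m <= m%:R^-1.
Proof.
move=> gm; rewrite (le_trans (nstep_etam_le2 gm))// lef_pV2 ?posrE ?exprn_gt0 ?good_gt0//.
by rewrite ler_eXnr// good_ge1.
Qed.

Lemma n_nstep_etam_le1 m : good m -> n%:R * s m <= 1.
Proof.
move=> gm; have [_ _ nm] := gm; have h := nstep_etam_leV gm; have h0 := good_gt0 gm.
rewrite (@le_trans _ _ (m%:R * m%:R^-1))//; last by rewrite divff ?gt_eqF.
by rewrite ler_pM// ?ler_nat// ltW// nstep_etam_gt0.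
Qed.

Lemma etam_nstep_le m k : good m -> (k <= 2 * m ^ 5)%N -> k%:R * (etam m * s m) <= m%:R^-1.
Proof.
move=> gm km; have h0 := good_gt0 gm; have eE := etam_pow4 gm; have e0 := etam_gt0 gm.
have h : k%:R <= 2 * m%:R ^+ 5 :> R by rewrite -natrX -natrM ler_nat.
have h1 := nstep_etam_le2 gm; have h2 := nstep_etam_gt0 gm.
apply: (@le_trans _ _ (2 * m%:R ^+ 5 * (etam m * (m%:R ^+ 2)^-1))).
  by apply: ler_pM => //; [exact: mulr_ge0 (ltW e0) (ltW h2)|exact: ler_wpM2l (ltW e0) _ _ h1].
have -> : 2 * m%:R ^+ 5 * (etam m / m%:R ^+ 2) = 2^-1 * m%:R^-1.
  by rewrite /etam; field; rewrite gt_eqF.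
by rewrite ler_piMl// ?invr_ge0 ?(ltW h0)//; lra.
Qed.

Lemma rho_exp_small m k : good m -> (m ^ 5 <= k)%N -> r m ^+ k <= 8 * m%:R^-1.
Proof.
move=> gm mk; have h0 := good_gt0 gm; have e0 := etam_gt0 gm; have e1 := etam_le gm.
have h1 : r m <= 1 - etam m / 2 by exact: (rho_le reg e0 e1).
have h2 : etam m <= 1 by move: e1; have := K1; nra.
have h3 : r m ^+ k <= (1 - etam m / 2) ^+ k.
  by apply: lerXn2r h1; rewrite ?nnegrE ?rho_ge0//; lra.
have h4 := @bernoulli_inv R (etam m / 2) k (ltac:(lra)) (ltac:(lra)).
have kk : m%:R ^+ 5 <= k%:R :> R by rewrite -natrX ler_nat.
have h5 : m%:R / 8 <= k%:R * (etam m / 2).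
  have -> : m%:R / 8 = m%:R ^+ 5 * (etam m / 2) by rewrite /etam; field; rewrite gt_eqF.
  by rewrite ler_wpM2r//; lra.
have h6 : 0 <= (1 - etam m / 2) ^+ k by rewrite exprn_ge0//; lra.
rewrite (le_trans h3)// -(ler_pM2r (_ : 0 < m%:R / 8)) ?divr_gt0//.
have -> : 8 * m%:R^-1 * (m%:R / 8) = 1 :> R by field; rewrite gt_eqF.
by rewrite (le_trans _ h4)// ler_wpM2l//; lra.
Qed.

Lemma rho_etam01 m : good m -> 0 <= r m <= 1.
Proof. by move=> gm; rewrite rho_ge0 (rho_le1 reg (etam_gt0 gm) (etam_le gm)). Qed.

Lemma sm_iter_etam m k (L B : R) f w : good m -> 0 <= L -> 0 <= B -> K * L <= B -> sm L B f w ->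
  sm L B (iter k (P m) f) (iter k (G m) w).
Proof.
move=> gm L0 B0 KLB fw; apply: sm_weaken (sm_iter reg (etam_gt0 gm) (etam_le gm) k fw L0 B0 KLB) _ (lexx _).
by have /andP[h1 h2] := rho_etam01 gm; rewrite ler_piMl// exprn_ile1.
Qed.

(** The invariance errors add up to [C / m]. After [m ^ 5] steps the Lipschitz constant is at most
    [8 L / m]: the iterate is nearly constant, and its value at 0, where the paths start, is close
    to its mean. *)
Lemma conv_sm (L B : R) : 0 <= L -> 0 <= B -> K * L <= B ->
  exists2 A : R, 0 <= A & forall m k f w, good m -> (k <= 2 * m ^ 5)%N -> sm L B f w ->
    `|\int[mu]_x iter k (P m) f x - \int[mu]_x f x| <= A / m%:R /\
    ((m ^ 5 <= k)%N -> `|iter k (P m) f 0 - \int[mu]_x f x| <= A / m%:R).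
Proof.
move=> L0 B0 KLB; have [C C0 hC] := step_invariant reg muV L0 B0 KLB.
pose X := \int[mu]_x ⟦x⟧; have X0 : 0 <= X by exact: int_ge0.
exists (C + 8 * L * X) => [|m k f w gm km fw]; first by rewrite addr_ge0// !mulr_ge0.
have h0 := good_gt0 gm.
have h1 : `|\int[mu]_x iter k (P m) f x - \int[mu]_x f x| <= C / m%:R.
  apply: (@le_trans _ _ (k%:R * (C * (etam m * s m)))); last first.
    by rewrite mulrCA ler_wpM2l// etam_nstep_le.
  elim: k {km} => [|k IH]; first by rewrite subrr normr0 mul0r.
  have -> : \int[mu]_x iter k.+1 (P m) f x - \int[mu]_x f x =
    (\int[mu]_x P m (iter k (P m) f) x - \int[mu]_x iter k (P m) f x) +
    (\int[mu]_x iter k (P m) f x - \int[mu]_x f x) by rewrite addrA subrK.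
  rewrite (le_trans (ler_normD _ _))// -natr1 mulrDl mul1r addrC lerD//.
  exact: (hC _ _ _ (etam_gt0 gm) (etam_le gm) (n_nstep_etam_le1 gm) (sm_iter_etam k gm L0 B0 KLB fw)).
have m0' : 0 <= m%:R^-1 :> R by rewrite invr_ge0 ltW.
split=> [|mk]; first by rewrite (le_trans h1)// ler_wpM2r// lerDl !mulr_ge0.
have hk := sm_iter reg (etam_gt0 gm) (etam_le gm) k fw L0 B0 KLB.
have tk := tame_sm hk.
have h2 : `|iter k (P m) f 0 - \int[mu]_x iter k (P m) f x| <= 8 * L * X / m%:R.
  have t1 := tameB (@tame_cst R n (iter k (P m) f 0)) tk.
  rewrite -{1}(int_cst mu (iter k (P m) f 0)) -(intB muV) ?(le_trans (int_abs muV _))//;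
    last exact: tame_cst.
  have -> : 8 * L * X / m%:R = (8 * m%:R^-1 * L) * X by ring.
  rewrite -(intZ muV); last exact: tame_enorm.
  apply: (int_le muV); [exact: tame_norm|apply: tameZ; exact: tame_enorm|move=> x].
  rewrite (le_trans (sm_lip hk _ _))// sub0r enormN ler_wpM2r// ler_wpM2r//.
  exact: rho_exp_small.
have -> : iter k (P m) f 0 - \int[mu]_x f x =
  (iter k (P m) f 0 - \int[mu]_x iter k (P m) f x) +
  (\int[mu]_x iter k (P m) f x - \int[mu]_x f x) by rewrite addrA subrK.
by rewrite (le_trans (ler_normD _ _))// mulrDl addrC lerD.
Qed.

Lemma lip_step m L f : good m -> 0 <= L -> lip L f -> lip L (P m f).
Proof.
move=> gm L0 fL x y; rewrite /step.
set F := fun z => f (phi g (etam m) (y + s m *: signs id z)).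
set F' := fun z => f (phi g (etam m) (x + s m *: signs id z)).
have e := congr1 (@^~ (fun=> true)) (ExB (enum 'I_n) F F').
rewrite /= in e; rewrite -e (le_trans (Ex_abs _ _ _))//; apply: Ex_ub => z.
rewrite (le_trans (fL _ _))// ler_wpM2l//.
rewrite (le_trans (phi_lip reg (etam_gt0 gm) (etam_le gm) _ _))//.
have -> : y + s m *: signs id z - (x + s m *: signs id z) = y - x.
  by rewrite opprD addrACA subrr addr0.
by rewrite ler_piMl//; have /andP[] := rho_etam01 gm.
Qed.

Lemma lip_iter m k L f : good m -> 0 <= L -> lip L f -> lip L (iter k (P m) f).
Proof. by move=> gm L0 fL; elim: k => [//|k IH]; exact: lip_step. Qed.

Lemma div_nat_small (a b : R) : 0 < b -> exists m1, forall m, (m1 <= m)%N -> a / m%:R <= b.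
Proof.
move=> b0; pose N := (Num.truncn (`|a| / b)).+1; exists N => m mm.
have h : `|a| / b < N%:R by exact: truncnS_gt.
have h1 : `|a| / b <= m%:R by rewrite (le_trans (ltW h))// ler_nat.
have mp : 0 < m%:R :> R by rewrite ltr0n (leq_trans _ mm).
rewrite ler_pdivrMr//; move: h1; rewrite ler_pdivrMr// mulrC.
exact: le_trans (ler_norm a).
Qed.

(** Squared gradients are only Lipschitz. A soft cone [q'] approximates [q] within [c + 2 L D],
    where [D], a smoothing of [ddist], is itself in [sm]; so [conv_sm] controls both [q'] and the
    propagated error. The threshold [m1] is uniform in [q], because the lemma is applied to
    functions that depend on [m]. *)
Lemma conv_lip (L k0 : R) : 0 <= L -> 0 < k0 ->
  exists m1, forall m k q, (m1 <= m)%N -> good m -> (k <= 2 * m ^ 5)%N -> lip L q ->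
    `|\int[mu]_x iter k (P m) q x - \int[mu]_x q x| <= k0 /\
    ((m ^ 5 <= k)%N -> `|iter k (P m) q 0 - \int[mu]_x q x| <= k0).
Proof.
(* The errors below total [3 e + 24 L e]; 27 covers them. *)
move=> L0 k00; pose e := k0 / (27 * (1 + L)).
have e0 : 0 < e by rewrite divr_gt0// mulr_gt0// ltr_pwDl.
have Le0 : 0 <= L * e by exact: mulr_ge0 L0 (ltW e0).
pose c := e + L * e + 2 * L * e.
have k0E : k0 = 27 * e + 27 * (L * e) by rewrite /e; field; rewrite gt_eqF// ltr_pwDl.
have ar1 (x : R) : x <= e -> e + 3 * x <= 4 * e by lra.
have ar2 (x : R) : L * x <= L * (4 * e) -> c + 2 * L * x <= e + 11 * (L * e).
  by rewrite /c; lra.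
have ar3 (x y z u : R) : x <= c + 2 * (L * (5 * e)) -> y <= u -> u <= e ->
  z <= e + 11 * (L * e) -> x + y + z <= k0 by rewrite /c; lra.
have ar4 (x y u : R) : `|x - y| <= u -> u <= e -> y <= 4 * e -> x <= 5 * e.
  by rewrite ler_norml; lra.
have ar5 (x : R) : L * x <= L * (5 * e) -> c + 2 * L * x <= c + 2 * (L * (5 * e)) by lra.
have ar6 (a x y z : R) : a <= e -> - a <= y - z -> y - z <= 2 * L * x + L * e -> 0 <= x ->
    forall D, x - a <= D -> `|z - y| <= c + 2 * L * D.
  move=> ae h1 h2 x0 D h3; rewrite distrC ler_norml /c.
  have := ler_wpM2l L0 h3; have := ler_wpM2l L0 ae; have := mulr_ge0 L0 x0.
  by move=> h4 h5 h6; apply/andP; split; lra.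
have ar7 (a x D : R) : - a <= D - x -> D - x <= 2 * 1 * x + 1 * e -> x - a <= D <= 3 * x + e.
  by move=> h1 h2; apply/andP; split; lra.
clearbody c.
have [M hM] := int_ddist muV e0.
pose l : R := ln M.+1%:R; have l0 : 0 <= l by rewrite ln_ge0// ler1n.
pose b := (l + 1) / e; have b0 : 0 < b by rewrite divr_gt0// ltr_pwDr.
have lb : l / b <= e.
  rewrite ler_pdivrMr// /b mulrCA divff ?gt_eqF// mulr1; lra.
have lb0 : 0 <= l / b by rewrite divr_ge0// ltW.
pose B1 := 1 * e^-1 + 8 * b * 1 ^+ 2 + K * 1.
have hb (L' : R) : 0 <= L' -> 0 <= L' * e^-1 + 8 * b * L' ^+ 2.
  have b8 : 0 <= 8 * b by lra.
  have ei : 0 <= e^-1 by rewrite invr_ge0 ltW.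
  move=> L'0; exact: (addr_ge0 (mulr_ge0 L'0 ei) (mulr_ge0 b8 (sqr_ge0 L'))).
have B10 : 0 <= B1 by rewrite addr_ge0 ?hb// mulr1.
have [AD AD0 hAD] := @conv_sm 1 B1 (@ler01 R) B10 (ltac:(by rewrite lerDr hb)).
pose BL := L * e^-1 + 8 * b * L ^+ 2 + K * L.
have BL0 : 0 <= BL by rewrite addr_ge0 ?hb// mulr_ge0.
have [A A0 hA] := @conv_sm L BL L0 BL0 (ltac:(by rewrite lerDr hb)).
have [m1' hm1] := div_nat_small AD e0; have [m2 hm2] := div_nat_small A e0.
exists (maxn m1' m2) => m k q; rewrite geq_max => /andP[/hm1 AD1 /hm2 A1] gm km ql.
have [wD] := @sm_softcone R n M 1 e b (ddist M) ler01 e0 b0.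
set D := softcone _ _ _ _ _ => smD.
have {}smD : sm 1 B1 D wD by apply: sm_weaken smD (lexx _) _; rewrite lerDl mulr_ge0.
have [wq] := @sm_softcone R n M L e b q L0 e0 b0.
set q' := softcone _ _ _ _ _ => smq.
have {}smq : sm L BL q' wq by apply: sm_weaken smq (lexx _) _; rewrite lerDl mulr_ge0.
have hD x : ddist M x - l / b <= D x <= 3 * ddist M x + e.
  have /andP[] := softcone_approx M x (@ler01 R) e0 b0 (@ddist_lip _ _ M).
  exact: ar7.
pose Er x := c + 2 * L * D x.
have hq x : `|q x - q' x| <= Er x.
  have /andP[h1 h2] := softcone_approx M x L0 e0 b0 ql; have /andP[h3 _] := hD x.
  exact: ar6 lb h1 h2 (ddist_ge0 M x) _ h3.
have tq := tame_lip ql; have tq' := tame_sm smq; have tD := tame_sm smD.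
have tEr : tame Er by apply: tameD; [exact: tame_cst|exact: tameZ].
have [hD1 hD2] := hAD m k D wD gm km smD; have [hq1 hq2] := hA m k q' wq gm km smq.
have iD : \int[mu]_x D x <= 4 * e.
  have td := tame_lip (@ddist_lip R n M).
  apply: (@le_trans _ _ (\int[mu]_x (e + 3 * ddist M x))).
    apply: (int_le muV tD) => [|x]; first exact: tameD (tame_cst e) (tameZ 3 td).
    by have /andP[_] := hD x; rewrite addrC.
  rewrite (int_affine muV e 3 td); exact: ar1.
have stepE x : `|iter k (P m) q x - iter k (P m) q' x| <= iter k (P m) Er x.
  have eB := congr1 (@^~ x) (iter_stepB g (etam m) k q q'); rewrite /= in eB.
  have eB' := congr1 (@^~ x) (iter_stepB g (etam m) k q' q); rewrite /= in eB'.
  rewrite ler_norml lerNl opprB -eB -eB'; apply/andP; split; apply: iter_step_le => y.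
    by rewrite (le_trans _ (hq y))// -normrN opprB ler_norm.
  by rewrite (le_trans _ (hq y))// ler_norm.
have ErE x : iter k (P m) Er x = c + 2 * L * iter k (P m) D x.
  by rewrite /Er iter_stepD iter_step_cst iter_stepZ.
have tkD : tame (iter k (P m) D) := tame_sm (sm_iter_etam k gm ler01 B10 (ltac:(by rewrite lerDr hb)) smD).
have tkq' : tame (iter k (P m) q') := tame_sm (sm_iter_etam k gm L0 BL0 (ltac:(by rewrite lerDr hb)) smq).
have tkq : tame (iter k (P m) q) := tame_lip (lip_iter k gm L0 ql).
have LD : L * \int[mu]_x D x <= L * (4 * e) by exact: ler_wpM2l.
have iq : `|\int[mu]_x q' x - \int[mu]_x q x| <= e + 11 * (L * e).
  rewrite -(intB muV)// (le_trans (int_abs muV (tameB tq' tq)))//.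
  rewrite (@le_trans _ _ (\int[mu]_x Er x))//.
    apply: (int_le muV) => // [|x]; first exact/tame_norm/tameB.
    by rewrite distrC.
  by rewrite /Er (int_affine muV _ _ tD); exact: ar2.
have fin (a a' : R) : `|a - a'| <= c + 2 * (L * (5 * e)) -> `|a' - \int[mu]_x q' x| <= A / m%:R ->
    `|a - \int[mu]_x q x| <= k0.
  move=> h1 h2.
  have -> : a - \int[mu]_x q x = (a - a') + (a' - \int[mu]_x q' x) +
    (\int[mu]_x q' x - \int[mu]_x q x) by ring.
  rewrite (le_trans (ler_normD _ _))// (le_trans (lerD (ler_normD _ _) (lexx _)))//.
  exact: ar3 h1 h2 A1 iq.
split=> [|mk].
  apply: fin hq1; rewrite -(intB muV)// (le_trans (int_abs muV (tameB tkq tkq')))//.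
  have tE : tame (iter k (P m) Er).
    have -> : iter k (P m) Er = (fun x => c + 2 * L * iter k (P m) D x) by apply/funext.
    by apply: tameD; [exact: tame_cst|exact: tameZ].
  apply: le_trans (int_le muV (tame_norm (tameB tkq tkq')) tE stepE) _.
  under eq_Rintegral do rewrite ErE.
  rewrite (int_affine muV _ _ tkD).
  exact/ar5/(ler_wpM2l L0)/(ar4 _ _ _ hD1 AD1 iD).
apply: fin (hq2 mk); rewrite (le_trans (stepE 0))// ErE.
exact/ar5/(ler_wpM2l L0)/(ar4 _ _ _ (hD2 mk) AD1 iD).
Qed.

End regular_mu.

Lemma lip_grad_sqr {R : realType} {n : nat} (L B : R) (f : 'rV[R]_n -> R) w :
  sm L B f w -> lip (12 * B * L) (fun x => ⟦w x⟧ ^+ 2).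
Proof.
move=> fw x y; rewrite subr_sqr normrM.
have -> : 12 * B * L * ⟦y - x⟧ = (6 * B * ⟦y - x⟧) * (L + L) by ring.
rewrite ler_pM//; first by rewrite (le_trans (ler_dist_enorm _ _))// (sm_grad_lip fw).
by have [wL _] := fw; rewrite ger0_norm ?addr_ge0// lerD.
Qed.

Lemma iter_step_bound {R : realType} {n : nat} g (eta : R) k (M : R) (f : 'rV[R]_n -> R) :
  (forall x, `|f x| <= M) -> forall x, `|iter k (step g eta) f x| <= M.
Proof.
move=> fM x.
have e c : iter k (step g eta) (fun=> c) x = c by rewrite iter_step_cst.
have h1 : iter k (step g eta) (fun=> - M) x <= iter k (step g eta) f x.
  by apply: iter_step_le => y; have := fM y; rewrite ler_norml => /andP[].
have h2 : iter k (step g eta) f x <= iter k (step g eta) (fun=> M) x.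
  by apply: iter_step_le => y; have := fM y; rewrite ler_norml => /andP[].
by rewrite ler_norml; move: h1 h2; rewrite !e => -> ->.
Qed.

(** * Poincare inequality and near-extremal directions, regular case *)

Section regular_poincare.
Context {R : realType} {n : nat}.
Local Notation E := 'rV[R]_n.
Variables (K : R) (W : E -> R) (g : E -> E) (H : E -> E -> E).
Hypothesis reg : regular K W g H.
Variable mu : probability E R.
Hypothesis muV : glc mu (qpot W).

Let K1 : 1 <= K. Proof. by case: reg. Qed.
Let K0 : 0 <= K. Proof. exact: le_trans K1. Qed.

Local Notation good := (@good R n K).
Local Notation s m := (@nstep R (etam m)).
Local Notation P m := (step g (etam m)).
Local Notation G m := (step_grad g H (etam m)).
Local Notation r m := (@rho R K (etam m)).

Lemma good_ex m1 : exists2 m, (m1 <= m)%N & good m.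
Proof.
pose m := maxn m1 (maxn 1 (maxn n (Num.truncn (1 + K)).+1)); exists m; first exact: leq_maxl.
split; first by rewrite leq_max (leq_max 1) leqnn !orbT.
  have : 1 + K < (Num.truncn (1 + K)).+1%:R by exact: truncnS_gt.
  move=> /ltW /le_trans; apply; rewrite ler_nat.
  by rewrite leq_max (leq_max _ 1) (leq_max _ n) leqnn !orbT.
by rewrite leq_max (leq_max _ 1) (leq_max _ n) leqnn !orbT.
Qed.

(* One Euler step loses [s^2 rho^2 |w|^2] of variance, up to [O(eta s)]. *)
Lemma step_sqr_loss (L B M : R) : 0 <= L -> 0 <= B -> K * L <= B -> 0 <= M ->
  exists2 C : R, 0 <= C & forall m f w, good m -> sm L B f w -> (forall x, `|f x| <= M) ->
    \int[mu]_x f x ^+ 2 - \int[mu]_x P m f x ^+ 2 <=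
    s m ^+ 2 * r m ^+ 2 * \int[mu]_x P m (fun x => ⟦w x⟧ ^+ 2) x + C * (etam m * s m).
Proof.
move=> L0 B0 KLB M0.
have L20 : 0 <= 2 * M * L by rewrite !mulr_ge0.
have B20 : 0 <= 2 * M * B + L ^+ 2 by rewrite addr_ge0 ?sqr_ge0// !mulr_ge0.
have KLB2 : K * (2 * M * L) <= 2 * M * B + L ^+ 2.
  have -> : K * (2 * M * L) = 2 * M * (K * L) by ring.
  by rewrite (@le_trans _ _ (2 * M * B)) ?lerDl ?sqr_ge0// ler_wpM2l// mulr_ge0.
have [C C0 hC] := step_invariant reg muV L20 B20 KLB2.
pose e := noise_err (n := n) B; have e0 : 0 <= e by rewrite /e /noise_err !mulr_ge0.
exists (C + (4 * e * L + 2 * e ^+ 2)) => [|m f w gm fw fM].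
  by rewrite addr_ge0// addr_ge0 ?mulr_ge0 ?sqr_ge0.
have eta0 := etam_gt0 gm; have eta1 := etam_le reg gm; have s0 := nstep_etam_gt0 gm.
have s1 : s m <= 1.
  by rewrite (le_trans (nstep_etam_leV gm))// invf_le1 ?(good_gt0 gm)// (good_ge1 gm).
have s2 : s m ^+ 2 = 2 * etam m by exact: nstep_sqr.
have err : 2 * e * L * s m ^+ 3 + e ^+ 2 * s m ^+ 4 <=
    (4 * e * L + 2 * e ^+ 2) * (etam m * s m).
  have -> : s m ^+ 3 = 2 * etam m * s m by rewrite exprSr s2.
  have -> : s m ^+ 4 = 2 * etam m * s m * s m by rewrite !exprSr -s2; ring.
  have h : 0 <= e ^+ 2 * (2 * etam m * s m) * (1 - s m).
    by rewrite mulr_ge0 ?subr_ge0// !mulr_ge0 ?sqr_ge0// ltW.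
  have -> : (4 * e * L + 2 * e ^+ 2) * (etam m * s m) =
    2 * e * L * (2 * etam m * s m) + e ^+ 2 * (2 * etam m * s m * s m) +
    e ^+ 2 * (2 * etam m * s m) * (1 - s m) by ring.
  by rewrite lerDl.
have fsq := sm_sqr L0 fM fw.
have h1 := hC _ _ _ eta0 eta1 (n_nstep_etam_le1 gm) fsq.
have lipw := lip_grad_sqr fw.
have L12 : 0 <= 12 * B * L by rewrite !mulr_ge0.
have tPw := tame_lip (lip_step reg gm L12 lipw).
have tPf2 := tame_lip (lip_step reg gm L20 (sm_lip fsq)).
have tPf := tame_lip (lip_step reg gm L0 (sm_lip fw)).
have h2 : \int[mu]_x P m (fun x => f x ^+ 2) x - \int[mu]_x P m f x ^+ 2 <=
   s m ^+ 2 * r m ^+ 2 * \int[mu]_x P m (fun x => ⟦w x⟧ ^+ 2) x +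
   (2 * e * L * s m ^+ 3 + e ^+ 2 * s m ^+ 4).
  rewrite -(intB muV tPf2 (tameX 2 tPf)) [leRHS]addrC -(int_affine muV _ _ tPw).
  apply: (int_le muV) => [||x]; first exact: tameB tPf2 (tameX 2 tPf).
    exact: tameD (tame_cst _) (tameZ _ tPw).
  by rewrite [leRHS]addrC; exact: (step_var reg eta0 eta1 x fw L0 B0 KLB).
have := lerD h1 h2; have := h1; rewrite ler_norml => /andP[h3 _] _.
have -> : \int[mu]_x f x ^+ 2 - \int[mu]_x P m f x ^+ 2 =
  - (\int[mu]_x P m (fun x => f x ^+ 2) x - \int[mu]_x f x ^+ 2) +
  (\int[mu]_x P m (fun x => f x ^+ 2) x - \int[mu]_x P m f x ^+ 2) by rewrite opprB addrA subrK.
rewrite lerNl in h3.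
apply: (le_trans (lerD h3 (le_trans h2 (lerD (lexx _) err)))).
by rewrite [X in X <= _]addrCA [X in _ <= _ + X]mulrDl.
Qed.

(** Since [s^2 = 2 eta] equals [1 - rho^2] up to [O(eta^2)], the weights of the successive variance
    losses telescope. *)
Lemma step_weight m i : good m -> s m ^+ 2 * (r m ^+ 2) ^+ i.+1 <=
  ((r m ^+ 2) ^+ i - (r m ^+ 2) ^+ i.+1) + (1 + K) ^+ 2 * (etam m * s m).
Proof.
move=> gm.
have eta0 := etam_gt0 gm; have eta1 := etam_le reg gm; have s0 := nstep_etam_gt0 gm.
have s2 : s m ^+ 2 = 2 * etam m by exact: nstep_sqr.
have s1 : s m <= 1.
  by rewrite (le_trans (nstep_etam_leV gm))// invf_le1 ?(good_gt0 gm)// (good_ge1 gm).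
pose a := r m ^+ 2; have aE : a = 1 - 2 * etam m + etam m ^+ 2 * (1 + K) ^+ 2.
  exact: (rho_sqr reg eta1).
have /andP[r0 r1] := rho_etam01 reg gm.
have a0 : 0 <= a by exact: sqr_ge0.
have a1 : a <= 1 by rewrite exprn_ile1.
rewrite -/a.
have h1 : s m ^+ 2 * a <= (1 - a) + (1 + K) ^+ 2 * (etam m * s m).
  have h2 : etam m ^+ 2 * (1 + K) ^+ 2 <= (1 + K) ^+ 2 * (etam m * s m).
    rewrite mulrC ler_wpM2l ?sqr_ge0// expr2 ler_wpM2l ?(ltW eta0)//.
    have : s m * s m <= s m * 1 by rewrite ler_wpM2l// ltW.
    by rewrite -expr2 s2; lra.
  by rewrite s2; nra.
have ai0 : 0 <= a ^+ i by exact: exprn_ge0.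
have ai1 : a ^+ i <= 1 by exact: exprn_ile1.
rewrite [a ^+ i.+1]exprSr [X in X <= _]mulrCA; apply: (le_trans (ler_wpM2l ai0 h1)).
rewrite mulrDr mulrBr mulr1 lerD2l ler_piMl//.
exact: (mulr_ge0 (sqr_ge0 _) (mulr_ge0 (ltW eta0) (ltW s0))).
Qed.

(** Discrete form of [d/dt Var (P_t f) = - 2 int |grad P_t f|^2] combined with the decay of
    gradients: up to errors absorbed in [k0], step [i] loses at most [rho ^ (2 i) - rho ^ (2 i + 2)]
    times [int |w|^2], and these weights sum to [1 - rho ^ (2 k)]. *)
Lemma iter_var_loss (L B M k0 : R) f w : 0 <= L -> 0 <= B -> K * L <= B -> 0 <= M ->
  0 < k0 -> sm L B f w -> (forall x, `|f x| <= M) ->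
  exists m1, forall m k, (m1 <= m)%N -> good m -> (k <= 2 * m ^ 5)%N ->
    vr mu f - vr mu (iter k (P m) f) <=
    (1 - r m ^+ (2 * k)) * \int[mu]_x ⟦w x⟧ ^+ 2 + k0.
Proof.
move=> L0 B0 KLB M0 k00 fw fM; have [wL _] := fw.
pose W2 := \int[mu]_x ⟦w x⟧ ^+ 2.
have W20 : 0 <= W2 by apply: int_ge0 => x; exact: sqr_ge0.
have [C C0 hC] := step_sqr_loss L0 B0 KLB M0.
have [A A0 hA] := conv_sm reg muV L0 B0 KLB.
have L12 : 0 <= 12 * B * L by rewrite !mulr_ge0.
have k20 : 0 < k0 / 2 by rewrite divr_gt0.
have [m1 hm1] := conv_lip reg muV L12 k20.
pose D := C + (1 + K) ^+ 2 * (W2 + k0 / 2).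
have [m2 hm2] := div_nat_small (D + 2 * M * A) k20.
have lipw := lip_grad_sqr fw.
exists (maxn m1 m2) => m k; rewrite geq_max => /andP[mm1 /hm2 D1] gm km.
have eta0 := etam_gt0 gm; have eta1 := etam_le reg gm; have s0 := nstep_etam_gt0 gm.
have s2 : s m ^+ 2 = 2 * etam m by exact: nstep_sqr.
have s1 : s m <= 1.
  by rewrite (le_trans (nstep_etam_leV gm))// invf_le1 ?(good_gt0 gm)// (good_ge1 gm).
pose a := r m ^+ 2; have aE : a = 1 - 2 * etam m + etam m ^+ 2 * (1 + K) ^+ 2.
  exact: (rho_sqr reg eta1).
have /andP[r0 r1] := rho_etam01 reg gm.
have a0 : 0 <= a by exact: sqr_ge0.
have a1 : a <= 1 by rewrite exprn_ile1.
have es0 : 0 <= etam m * s m by rewrite mulr_ge0 ?ltW.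
have sa i := step_weight i gm; rewrite -/a in sa.
have fkM i x := iter_step_bound g (etam m) i fM x.
have loss i : (i <= 2 * m ^ 5)%N ->
    \int[mu]_x f x ^+ 2 - \int[mu]_x iter i (P m) f x ^+ 2 <=
    (1 - a ^+ i) * (W2 + k0 / 2) + i%:R * (D * (etam m * s m)).
  elim: i => [|i IH] im; first by rewrite expr0 !subrr !mul0r addr0.
  have {}IH := IH (ltnW im).
  have fi := sm_iter_etam reg i gm L0 B0 KLB fw.
  have h1 := hC m _ _ gm fi (fkM i).
  have li := lip_iter reg i.+1 gm L12 lipw.
  have h2 : \int[mu]_x P m (fun x => ⟦iter i (G m) w x⟧ ^+ 2) x <= a ^+ i * (W2 + k0 / 2).
    have [h3 _] := hm1 m i.+1 _ mm1 gm im lipw.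
    have h4 : \int[mu]_x iter i.+1 (P m) (fun x => ⟦w x⟧ ^+ 2) x <= W2 + k0 / 2.
      by move: h3; rewrite ler_norml => /andP[_]; rewrite lerBlDl.
    apply: (@le_trans _ _ (\int[mu]_x (a ^+ i * iter i.+1 (P m) (fun x => ⟦w x⟧ ^+ 2) x))).
      apply: (int_le muV) => [||x].
      - exact: tame_lip (lip_step reg gm L12 (lip_grad_sqr fi)).
      - exact: tameZ (tame_lip li).
      - have <- := congr1 (@^~ x) (stepZ g (etam m) (a ^+ i) (iter i (P m) (fun x => ⟦w x⟧ ^+ 2))).
        apply: step_le => y; rewrite -exprM; exact: (iter_step_grad_sqr reg eta0 eta1).
    rewrite (intZ muV _ (tame_lip li)); apply: ler_wpM2l h4; exact: exprn_ge0.
  have h5 : s m ^+ 2 * r m ^+ 2 * \int[mu]_x P m (fun x => ⟦iter i (G m) w x⟧ ^+ 2) x <=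
     (a ^+ i - a ^+ i.+1 + (1 + K) ^+ 2 * (etam m * s m)) * (W2 + k0 / 2).
    apply: (@le_trans _ _ (s m ^+ 2 * r m ^+ 2 * (a ^+ i * (W2 + k0 / 2)))).
      by rewrite ler_wpM2l// mulr_ge0 ?sqr_ge0.
    rewrite mulrA ler_wpM2r ?addr_ge0 ?(ltW k20)// -mulrA -/a -exprS; exact: sa.
  have h6 := lerD IH (le_trans h1 (lerD h5 (lexx _))).
  rewrite addrA subrK in h6; apply: (le_trans h6).
  by rewrite -natr1 /D le_eqVlt; apply/orP; left; apply/eqP; ring.
have [h1 _] := hA m k f w gm km fw.
have intM (h : E -> R) : tame h -> (forall x, `|h x| <= M) -> `|\int[mu]_x h x| <= M.
  move=> th hM; rewrite (le_trans (int_abs muV th))// -(int_cst mu M).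
  by apply: (int_le muV) => //; [exact: tame_norm|exact: tame_cst].
have h2 : `|(\int[mu]_x iter k (P m) f x) ^+ 2 - (\int[mu]_x f x) ^+ 2| <= 2 * M * A / m%:R.
  rewrite subr_sqr normrM (_ : 2 * M * A / m%:R = A / m%:R * (M + M)); last by ring.
  rewrite ler_pM// (le_trans (ler_normD _ _))// lerD// intM//; last exact: tame_sm fw.
  exact: tame_sm (sm_iter_etam reg k gm L0 B0 KLB fw).
have h3 := loss k km.
have h4 : k%:R * (D * (etam m * s m)) <= D / m%:R.
  have D0 : 0 <= D by rewrite addr_ge0// mulr_ge0 ?sqr_ge0// addr_ge0// ltW.
  by rewrite mulrCA; apply: ler_wpM2l (etam_nstep_le gm km).
rewrite !vrE.
have h5 : (1 - a ^+ k) * (W2 + k0 / 2) <= (1 - a ^+ k) * W2 + k0 / 2.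
  rewrite mulrDr lerD2l ler_piMl ?(ltW k20)//.
  by rewrite lerBlDr lerDl exprn_ge0.
have h6 : (\int[mu]_x iter k (P m) f x) ^+ 2 - (\int[mu]_x f x) ^+ 2 <= 2 * M * A / m%:R.
  exact: le_trans (ler_norm _) h2.
have h7 := lerD (le_trans h3 (lerD h5 h4)) h6.
rewrite exprM -/a -/W2.
have -> : \int[mu]_x f x ^+ 2 - (\int[mu]_x f x) ^+ 2 -
   (\int[mu]_x iter k (P m) f x ^+ 2 - (\int[mu]_x iter k (P m) f x) ^+ 2) =
   \int[mu]_x f x ^+ 2 - \int[mu]_x iter k (P m) f x ^+ 2 +
   ((\int[mu]_x iter k (P m) f x) ^+ 2 - (\int[mu]_x f x) ^+ 2) by ring.
apply: (le_trans h7).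
have -> : (1 - a ^+ k) * W2 + k0 / 2 + D / m%:R + 2 * M * A / m%:R =
  (1 - a ^+ k) * W2 + (k0 / 2 + (D + 2 * M * A) / m%:R) by ring.
rewrite lerD2l [leRHS](_ : _ = k0 / 2 + k0 / 2); last by field.
by rewrite lerD2l.
Qed.

(** Let the dynamics run for [m ^ 5] steps: the final function has Lipschitz constant [O(1/m)],
    hence negligible variance, and the variance lost on the way is at most [int |w|^2] up to a small
    error. *)
Lemma poincare_bounded (L B M : R) f w : 0 <= L -> 0 <= B -> 0 <= M ->
  sm L B f w -> (forall x, `|f x| <= M) -> vr mu f <= \int[mu]_x ⟦w x⟧ ^+ 2.
Proof.
move=> L0 B0 M0 fw0 fM.
have fw : sm L (B + K * L) f w by apply: sm_weaken fw0 (lexx _) _; rewrite lerDl mulr_ge0.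
have KLB : K * L <= B + K * L by rewrite lerDr.
have B'0 : 0 <= B + K * L by rewrite addr_ge0// mulr_ge0.
pose W2 := \int[mu]_x ⟦w x⟧ ^+ 2.
have W20 : 0 <= W2 by apply: int_ge0 => x; exact: sqr_ge0.
pose X2 := \int[mu]_x ⟦x⟧ ^+ 2.
have tX2 : tame (fun x : E => ⟦x⟧ ^+ 2) by apply: tameX; exact: tame_enorm.
have X20 : 0 <= X2 by apply: int_ge0 => x; exact: sqr_ge0.
apply/ler_addgt0Pr => e e0; have e20 : 0 < e / 2 by rewrite divr_gt0.
have [m1 hm1] := iter_var_loss L0 B'0 KLB M0 e20 fw fM.
have [m2 hm2] := div_nat_small (64 * L ^+ 2 * X2) e20.
have [m] := good_ex (maxn m1 m2); rewrite geq_max => /andP[mm1 /hm2 h2] gm.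
have km : (m ^ 5 <= 2 * m ^ 5)%N by rewrite leq_pmull.
have h1 := hm1 m _ mm1 gm km.
have /andP[r0 r1] := rho_etam01 reg gm.
have fk := sm_iter reg (etam_gt0 gm) (etam_le reg gm) (m ^ 5) fw L0 B'0 KLB.
have tk := tame_sm fk; have mp := good_gt0 gm.
have h3 : vr mu (iter (m ^ 5) (P m) f) <= 64 * L ^+ 2 * X2 / m%:R.
  apply: le_trans (vr_le muV (iter (m ^ 5) (P m) f 0) tk) _.
  have -> : 64 * L ^+ 2 * X2 / m%:R = (64 * L ^+ 2 / m%:R) * X2 by ring.
  rewrite -(intZ muV _ tX2).
  apply: (int_le muV) => [||x].
  - by apply: tameX; exact: tameB tk (tame_cst _).
  - exact: tameZ tX2.
  have rk := rho_exp_small reg gm (leqnn _).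
  have : `|iter (m ^ 5) (P m) f x - iter (m ^ 5) (P m) f 0| <= 8 * m%:R^-1 * L * ⟦x⟧.
    by rewrite (le_trans (sm_lip fk _ _))// subr0 ler_wpM2r// ler_wpM2r.
  rewrite -(ler_pXn2r (n := 2)) ?nnegrE ?mulr_ge0 ?invr_ge0 ?(ltW mp)//.
  rewrite real_normK ?num_real// => /le_trans; apply.
  rewrite !exprMn ler_wpM2r ?sqr_ge0//.
  have -> : 64 * L ^+ 2 / m%:R = 8 ^+ 2 * m%:R^-1 * L ^+ 2 by ring.
  rewrite ler_wpM2r ?sqr_ge0// ler_wpM2l ?sqr_ge0// expr2 ler_piMl ?invr_ge0 ?(ltW mp)//.
  by rewrite invf_le1// (good_ge1 gm).
have h4 : (1 - r m ^+ (2 * m ^ 5)) * W2 <= W2.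
  by rewrite ler_piMl// lerBlDr lerDl exprn_ge0.
rewrite lerBlDr in h1; apply: (le_trans h1); rewrite -/W2.
have -> : W2 + e = W2 + e / 2 + e / 2 by field.
by apply: lerD; [exact: lerD|exact: le_trans h2].
Qed.

Lemma poincare (L B : R) f w : 0 <= L -> 0 <= B -> sm L B f w ->
  vr mu f <= \int[mu]_x ⟦w x⟧ ^+ 2.
Proof.
move=> L0 B0 fw; have tf := tame_sm fw.
have [A A0 hA] := vr_approx muV tf (tameX 2 tf) (fun x => sqr_ge0 (f x)).
apply/ler_addgt0Pr => e e0.
pose d := Num.min 1 (e / (A + 1)).
have A1 : 0 < A + 1 by rewrite ltr_pwDr.
have d0 : 0 < d by rewrite lt_min ltr01 divr_gt0.
have d1 : d <= 1 by rewrite ge_min lexx.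
have Ad : A * d <= e.
  have : d <= e / (A + 1) by rewrite ge_min lexx orbT.
  rewrite ler_pdivlMr// mulrDr mulr1 mulrC; apply: le_trans; by rewrite lerDl ltW.
have ht := sm_trunc fw L0 d0.
have h1 := hA d (trunc d f) (ltW d0) d1 (tame_sm ht) (fun x => trunc_approx f x d0).
have h2 : vr mu (trunc d f) <= \int[mu]_x ⟦trunc_grad d f w x⟧ ^+ 2.
  apply: poincare_bounded ht (fun x => trunc_bound f x d0) => //.
    by rewrite addr_ge0 ?mulr_ge0 ?sqr_ge0// ltW.
  by rewrite invr_ge0 ltW.
have h3 : \int[mu]_x ⟦trunc_grad d f w x⟧ ^+ 2 <= \int[mu]_x ⟦w x⟧ ^+ 2.
  apply: (int_le muV) => [||x].
  - by apply: tame_enorm_sqr => i; exact: tame_grad ht.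
  - by apply: tame_enorm_sqr => i; exact: tame_grad fw.
  - by rewrite lerXn2r ?nnegrE// trunc_grad_le.
move: h1; rewrite ler_norml => /andP[h1 _].
rewrite -lerBlDr in h1; rewrite opprK addrC in h1.
rewrite (le_trans (_ : _ <= vr mu (trunc d f) + A * d))//; last exact: lerD (le_trans h2 h3) Ad.
by rewrite -lerBlDr; move: h1; rewrite addrC -lerBrDr.
Qed.

Lemma bernoulli_ge (x : R) k : 0 <= x -> x <= 1 -> 1 - k%:R * x <= (1 - x) ^+ k.
Proof.
move=> x0 x1; elim: k => [|k IH]; first by rewrite mul0r subr0.
have x10 : 0 <= 1 - x by rewrite subr_ge0.
rewrite exprSr; apply: le_trans (ler_wpM2r x10 IH).
have kx : 0 <= k%:R * x ^+ 2 by rewrite mulr_ge0 ?sqr_ge0.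
by rewrite -natr1; nra.
Qed.

Lemma iter_step_mean m k (w : E -> E) :
  iter k (P m) (fun x => ⟦w x - \row_i iter k (P m) (fun x => w x ord0 i) 0⟧ ^+ 2) 0 =
  iter k (P m) (fun x => ⟦w x⟧ ^+ 2) 0 - ⟦\row_i iter k (P m) (fun x => w x ord0 i) 0⟧ ^+ 2.
Proof.
set a := \row_i _.
have -> : (fun x => ⟦w x - a⟧ ^+ 2) =
    (fun x => (⟦w x⟧ ^+ 2 - \sum_i (2 * a ord0 i) * w x ord0 i) + ⟦a⟧ ^+ 2).
  apply/funext => x; rewrite !enorm_sqr !dotrVE (dotrVC a (w x)).
  have -> : \sum_i (2 * a ord0 i) * w x ord0 i = 2 * (w x *d a).
    by rewrite /dotrV mulr_sumr; apply: eq_bigr => i _; ring.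
  ring.
rewrite iter_stepD iter_step_cst iter_stepB iter_step_sum.
have -> : \sum_i iter k (P m) (fun x => 2 * a ord0 i * w x ord0 i) 0 = 2 * ⟦a⟧ ^+ 2.
  rewrite enorm_sqr /dotrV mulr_sumr; apply: eq_bigr => i _.
  by rewrite iter_stepZ [in RHS]mulrA {3}/a !mxE.
ring.
Qed.

Lemma sum_nat_min (a J : nat) (t : nat -> R) : (0 < J)%N ->
  exists2 k, (a <= k < a + J)%N & J%:R * t k <= \sum_(a <= k < a + J) t k.
Proof.
case: J => // J _; elim: J => [|J [k /andP[k1 k2] IH]].
  by exists a; rewrite addn1 ?leqnn//= mul1r big_nat1.
rewrite addnS big_nat_recr ?leq_addr//=.
have [h|h] := leP (t k) (t (a + J.+1)%N).
  exists k; first by rewrite k1 ltnW//= ltnS.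
  by rewrite -natr1 mulrDl mul1r lerD.
exists (a + J.+1)%N; first by rewrite leq_addr/=.
rewrite -natr1 mulrDl mul1r lerD2r; apply: le_trans IH.
by rewrite ler_wpM2l// ltW.
Qed.

(** Arithmetic of the pigeonhole: dividing a bound on [m^4] times one term by [m^4 s^2 = 1/2]
    doubles it, and replacing the mean increment by [s |a|] costs a multiple of [1/m]. *)
Let mean_arith (m4 s' rj al mn e' T0 iv : R) : m4 * s' ^+ 2 = 2^-1 -> 0 < m4 -> 0 < s' ->
  s' <= 1 -> s' <= iv -> 0 <= rj ->
  0 <= e' -> 0 <= al -> al <= 1 -> 0 <= mn -> mn <= s' * al + e' * s' ^+ 2 ->
  m4 * ((s' * (rj * 1) + e' * s' ^+ 2) ^+ 2 - mn ^+ 2) <= T0 ->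
  rj ^+ 2 - al ^+ 2 <= 2 * T0 + (2 * e' + e' ^+ 2) * iv.
Proof.
move=> ms m40 s0 s1 si rj0 e0 al0 al1 mn0 mnle h.
have e2 : 0 <= e' ^+ 2 by exact: sqr_ge0.
have s20 : 0 <= s' ^+ 2 by exact: sqr_ge0.
have h1 : s' ^+ 2 * rj ^+ 2 <= (s' * (rj * 1) + e' * s' ^+ 2) ^+ 2.
  rewrite mulr1 -exprMn lerXn2r ?nnegrE ?addr_ge0 ?mulr_ge0 ?(ltW s0)//.
  by rewrite lerDl mulr_ge0.
have h2 : mn ^+ 2 <= s' ^+ 2 * (al ^+ 2 + (2 * e' + e' ^+ 2) * iv).
  apply: (@le_trans _ _ ((s' * al + e' * s' ^+ 2) ^+ 2)).
    by rewrite lerXn2r ?nnegrE ?addr_ge0 ?mulr_ge0// ltW.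
  have -> : (s' * al + e' * s' ^+ 2) ^+ 2 =
     s' ^+ 2 * (al ^+ 2 + 2 * e' * (s' * al) + e' ^+ 2 * (s' * s')) by ring.
  have g1 : 2 * e' * (s' * al) <= 2 * e' * iv.
    by rewrite ler_wpM2l ?mulr_ge0//; apply: le_trans si; rewrite ler_piMr// ltW.
  have g2 : e' ^+ 2 * (s' * s') <= e' ^+ 2 * iv.
    by rewrite ler_wpM2l//; apply: le_trans si; rewrite ler_piMr// ltW.
  apply: ler_wpM2l => //; lra.
have h3 : m4 * (s' ^+ 2 * rj ^+ 2 - s' ^+ 2 * (al ^+ 2 + (2 * e' + e' ^+ 2) * iv)) <= T0.
  by rewrite (le_trans _ h)// ler_wpM2l ?(ltW m40)// lerB.
rewrite -mulrBr mulrA ms in h3; lra.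
Qed.

(* The improved Poincare inequality bounds the sum over the times [k] of
   [b_k ^ 2 - |mean_k| ^ 2], whose terms are nonnegative; one of the last
   [m ^ 4] times has a small term. *)
Lemma path_pigeonhole (B M : R) F w : 0 <= B -> K <= B -> 0 <= M ->
  sm 1 B F w -> (forall x, `|F x| <= M) ->
  exists2 A : R, 0 <= A & forall m, good m -> exists j k : nat,
    [/\ (j <= m ^ 4)%N, (m ^ 5 <= k <= 2 * m ^ 5)%N &
      r m ^+ (2 * j) -
        ⟦\row_i iter k (P m) (fun x => iter j (G m) w x ord0 i) 0⟧ ^+ 2 <=
      4 * (1 - vr mu F) + A / m%:R].
Proof.
move=> B0 KB M0 Fw FM.
have KB1 : K * 1 <= B by rewrite mulr1.
have [A1 A10 hA1] := conv_sm reg muV ler01 B0 KB1.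
have Fsq := sm_sqr ler01 FM Fw.
have L20 : 0 <= 2 * M * 1 by rewrite !mulr_ge0.
have B20 : 0 <= 2 * M * B + 1 ^+ 2 by rewrite addr_ge0 ?sqr_ge0// !mulr_ge0.
have KLB2 : K * (2 * M * 1) <= 2 * M * B + 1 ^+ 2.
  have : 2 * M * K <= 2 * M * B by rewrite ler_wpM2l// mulr_ge0.
  by lra.
have [A2 A20 hA2] := conv_sm reg muV L20 B20 KLB2.
pose e := noise_err (n := n) B; have e0 : 0 <= e by rewrite /e /noise_err !mulr_ge0.
pose D := (1 + K) ^+ 2 + 4 * e + 2 * e ^+ 2.
have D0 : 0 <= D by rewrite addr_ge0 ?mulr_ge0 ?sqr_ge0// addr_ge0 ?sqr_ge0// mulr_ge0.
pose A := 4 * (D + A2 + 2 * M * A1) + 2 * e + e ^+ 2.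
have A0 : 0 <= A.
  have MA : 0 <= 2 * M * A1 by rewrite !mulr_ge0.
  by rewrite /A; have := sqr_ge0 e; lra.
exists A => // m gm.
have eta0 := etam_gt0 gm; have eta1 := etam_le reg gm; have s0 := nstep_etam_gt0 gm.
have mp := good_gt0 gm; have mp1 := good_ge1 gm.
have s1 : s m <= 1.
  by rewrite (le_trans (nstep_etam_leV gm))// invf_le1.
have s2 : s m ^+ 2 = 2 * etam m by exact: nstep_sqr.
have es0 : 0 <= etam m * s m by rewrite mulr_ge0 ?ltW.
have /andP[r0 r1] := rho_etam01 reg gm.
have m45 : (m ^ 4 <= m ^ 5)%N by rewrite leq_pexp2l//; case: gm.
(* The last [m ^ 4] times come after at least [m ^ 5] steps, so that the position is nearly
   distributed as [mu], and leave at most [m ^ 4] steps to go, so that [rho ^ (2 j)] stays away from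
   0. *)
pose N := (m ^ 5 + m ^ 4)%N.
have N2 : (N <= 2 * m ^ 5)%N by rewrite mul2n -addnn leq_add2l.
have N5 : (m ^ 5 <= N)%N by exact: leq_addr.
pose b j := s m * (r m ^+ j * 1) + e * s m ^+ 2.
have b2 j : b j.+1 ^+ 2 <= (r m ^+ (2 * j) - r m ^+ (2 * j.+1)) + D * (etam m * s m).
  have h := step_weight j gm; rewrite -!exprM in h.
  have p0 : 0 <= r m ^+ j.+1 by exact: exprn_ge0.
  have p1 : r m ^+ j.+1 <= 1 by exact: exprn_ile1.
  have -> : b j.+1 ^+ 2 = s m ^+ 2 * r m ^+ (2 * j.+1) +
      2 * e * (2 * (etam m * s m)) * r m ^+ j.+1 + e ^+ 2 * (2 * (etam m * s m)) * s m.
    rewrite (_ : 2 * (etam m * s m) = s m ^+ 2 * s m); last by rewrite s2 mulrA.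
    by rewrite /b mulnC exprM; ring.
  have h1 : 2 * e * (2 * (etam m * s m)) * r m ^+ j.+1 <= 4 * e * (etam m * s m).
    rewrite (_ : 4 * e * _ = 2 * e * (2 * (etam m * s m))); last by ring.
    exact: ler_piMr (mulr_ge0 (mulr_ge0 (ler0n _ 2) e0) (mulr_ge0 (ler0n _ 2) es0)) p1.
  have h2 : e ^+ 2 * (2 * (etam m * s m)) * s m <= 2 * e ^+ 2 * (etam m * s m).
    rewrite (_ : 2 * e ^+ 2 * _ = e ^+ 2 * (2 * (etam m * s m))); last by ring.
    exact: ler_piMr (mulr_ge0 (sqr_ge0 e) (mulr_ge0 (ler0n _ 2) es0)) s1.
  apply: (le_trans (lerD (lerD h h1) h2)); rewrite /D le_eqVlt; apply/orP; left; apply/eqP; ring.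
have sumb : \sum_(k < N) b (N - k)%N ^+ 2 <= 1 + D / m%:R.
  rewrite (reindex_inj rev_ord_inj)/=.
  have h k : \sum_(i < k) b i.+1 ^+ 2 <= (1 - r m ^+ (2 * k)) + k%:R * (D * (etam m * s m)).
    elim: k => [|k IH]; first by rewrite big_ord0 muln0 expr0 subrr mul0r addr0.
    rewrite big_ord_recr/=; apply: (le_trans (lerD IH (b2 k))).
    by rewrite -natr1 le_eqVlt; apply/orP; left; apply/eqP; ring.
  have -> : \sum_(j < N) b (N - (N - j.+1))%N ^+ 2 = \sum_(i < N) b i.+1 ^+ 2.
    by apply: eq_bigr => i _; rewrite subKn.
  apply: (le_trans (h N)); apply: lerD; first by rewrite lerBlDr lerDl exprn_ge0.
  by rewrite mulrCA; apply: ler_wpM2l D0 _ _ (etam_nstep_le gm N2).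
pose zt : nat * 'I_n -> bool := fun=> true.
pose mean k : E := \row_i Ex (idxs N) (df (k, i) (fun z => F (path_pos g (etam m) z N))) zt.
have h1 : 2 * (iter N (P m) (fun x => F x ^+ 2) 0 - iter N (P m) F 0 ^+ 2) <=
    \sum_(k < N) (b (N - k)%N ^+ 2 + ⟦mean k⟧ ^+ 2).
  exact: (path_improved reg eta0 eta1 Fw ler01 B0 KB1).
have h2 (k : 'I_N) : ⟦mean k⟧ ^+ 2 <= b (N - k)%N ^+ 2.
  exact: (path_mean_le reg eta0 eta1 Fw ler01 B0 KB1).
have h3 : vr mu F - (A2 + 2 * M * A1) / m%:R <=
    iter N (P m) (fun x => F x ^+ 2) 0 - iter N (P m) F 0 ^+ 2.
  have [_ /(_ N5) g1] := hA1 m N F w gm N2 Fw.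
  have [_ /(_ N5) g2] := hA2 m N _ _ gm N2 Fsq.
  have g3 : `|\int[mu]_x F x| <= M.
    have tF := tame_sm Fw.
    rewrite (le_trans (int_abs muV tF))// -(int_cst mu M).
    by apply: (int_le muV) => //; [exact: tame_norm|exact: tame_cst].
  have g4 : `|iter N (P m) F 0| <= M by exact: iter_step_bound.
  have g5 : `|iter N (P m) F 0 ^+ 2 - (\int[mu]_x F x) ^+ 2| <= 2 * M * A1 / m%:R.
    rewrite subr_sqr normrM (_ : 2 * M * A1 / m%:R = A1 / m%:R * (M + M)); last by ring.
    by rewrite ler_pM// (le_trans (ler_normD _ _))// lerD.
  have g6 : \int[mu]_x F x ^+ 2 - A2 / m%:R <= iter N (P m) (fun x => F x ^+ 2) 0.
    by move: g2; rewrite ler_norml => /andP[g2 _]; rewrite lerBlDr addrC -lerBlDr -opprB lerNl.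
  have g7 : iter N (P m) F 0 ^+ 2 <= (\int[mu]_x F x) ^+ 2 + 2 * M * A1 / m%:R.
    by rewrite -lerBlDl (le_trans (ler_norm _)).
  have := lerB g6 g7; rewrite vrE; apply: le_trans.
  by rewrite le_eqVlt; apply/orP; left; apply/eqP; ring.
pose t k := b (N - k)%N ^+ 2 - ⟦mean k⟧ ^+ 2.
have t0 k : (k < N)%N -> 0 <= t k by move=> kN; rewrite subr_ge0; exact: (h2 (Ordinal kN)).
(* [S1 - S2 = 2 S1 - (S1 + S2)], where [S1] is at most 1 and [S1 + S2] at least twice the variance,
   both up to [O(1/m)]. *)
have h4 : \sum_(0 <= k < N) t k <= 2 * (1 - vr mu F) + 2 * (D + A2 + 2 * M * A1) / m%:R.
  rewrite big_mkord sumrB; rewrite big_split/= in h1.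
  move: h1 sumb h3; set S1 := \sum_(_ < N) _ ^+ 2; set S2 := \sum_(_ < N) ⟦_⟧ ^+ 2.
  move=> h1 h5 h3; rewrite -(ler_pM2l (_ : 0 < 2 :> R))// in h3.
  have := lerB (lerD h5 h5) (le_trans h3 h1); move: (m%:R^-1) => im; lra.
have [k /andP[k1 k2] hk] : exists2 k, (m ^ 5 <= k < N)%N &
   m%:R ^+ 4 * t k <= 2 * (1 - vr mu F) + 2 * (D + A2 + 2 * M * A1) / m%:R.
  have J0 : (0 < m ^ 4)%N by rewrite expn_gt0; case: gm => ->.
  have [k hk1 hk2] := sum_nat_min (m ^ 5) t J0.
  exists k => //; rewrite -natrX; apply: (le_trans hk2); apply: le_trans h4.
  rewrite (big_cat_nat (leq0n (m ^ 5)%N) N5)/= lerDr big_nat sumr_ge0// => i /andP[_ im].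
  by apply: t0; rewrite (leq_trans im).
exists (N - k)%N, k; split.
- by rewrite leq_subLR leq_add2r.
- by rewrite k1 (leq_trans (ltnW k2)).
set a := \row_i _.
have h5 : ⟦mean k - s m *: a⟧ <= e * s m ^+ 2.
  exact: (path_df_mean reg eta0 eta1 Fw ler01 B0 KB1 zt k2).
have [wj _] := sm_iter reg eta0 eta1 (N - k) Fw ler01 B0 KB1.
have a1 : ⟦a⟧ <= 1.
  rewrite -(ler_pXn2r (n := 2)) ?nnegrE// expr1n.
  have h : 0 <= iter k (P m) (fun x => ⟦iter (N - k) (G m) w x - a⟧ ^+ 2) 0.
    have <- : iter k (P m) (fun=> 0) 0 = 0 by rewrite iter_step_cst.
    by apply: iter_step_le => x; exact: sqr_ge0.
  rewrite iter_step_mean subr_ge0 in h; apply: (le_trans h).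
  have <- : iter k (P m) (fun=> 1) 0 = 1 by rewrite iter_step_cst.
  apply: iter_step_le => x; rewrite exprn_ile1//.
  by rewrite (le_trans (wj x))// mulr1 exprn_ile1.
have h6 : ⟦mean k⟧ <= s m * ⟦a⟧ + e * s m ^+ 2.
  rewrite -[mean k](subrK (s m *: a)) (le_trans (ler_enormD _ _))// addrC lerD//.
  by rewrite enormZ gtr0_norm.
have ms : m%:R ^+ 4 * s m ^+ 2 = 2^-1.
  by rewrite s2 mulrCA [_ * etam m]mulrC (etam_pow4 gm); field.
have m40 : 0 < m%:R ^+ 4 :> R by exact: exprn_gt0.
have := mean_arith ms m40 s0 s1 (nstep_etam_leV gm) (exprn_ge0 _ r0) e0 (enorm_ge0 _) a1
  (enorm_ge0 _) h6 hk.
rewrite mulnC exprM => /le_trans; apply; rewrite le_eqVlt; apply/orP; left; apply/eqP.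
by rewrite /A; ring.
Qed.

Lemma unit_vector : (0 < n)%N -> exists sigma : E, ⟦sigma⟧ = 1.
Proof.
move=> n0; pose sg : E := delta_mx ord0 (Ordinal n0); exists sg.
by apply/eqP; rewrite -(eqrXn2 (n := 2))// expr1n enorm_sqr dotrV_delta mxE !eqxx.
Qed.

Lemma tame_lin (v : E) : tame (fun x => v *d x).
Proof. by apply: tame_dot => i; [exact: tame_cst|exact: tame_coord]. Qed.

(* With [Q f := int |grad f|^2 - vr f >= 0], a quadratic form, a point [u] of
   the semigroup orbit of [F] with small [Q u] and almost constant gradient
   [a] yields [Q (a . x) <= 2 Q u + 2 Q (a . x - u)]. *)
Lemma almost_constant_gradient (B c d : R) u w a : 0 <= B ->
  sm 1 B u w -> ⟦a⟧ <= 1 -> \int[mu]_x ⟦w x⟧ ^+ 2 - vr mu u <= c ->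
  \int[mu]_x ⟦w x - a⟧ ^+ 2 <= d ->
  ⟦a⟧ ^+ 2 - vr mu (fun x => a *d x) <= 2 * c + 2 * d.
Proof.
move=> B0 uw a1 hc hd.
(* Parallelogram law for [Q]: [a . x] and [2 u - a . x] are the sum and the difference of [u] and
   [a . x - u]. The Poincare inequality for [2 u - a . x] discards its term. *)
have ua : sm 3 (2 * B) (fun x => 2 * u x + (-1) * (a *d x + 0)) (fun x => 2 *: w x + (-1) *: a).
  apply: sm_weaken (sm_add (sm_scale 2 uw) (sm_scale (-1) (sm_lin a 0))) _ _.
    by rewrite normrN normr1 ger0_norm// mul1r mulr1; lra.
  by rewrite normrN normr1 ger0_norm// mulr0 addr0.
have tu := tame_sm uw; have ta := tame_lin a.
have tw i : tame (fun x => w x ord0 i) by exact: tame_grad uw.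
have tca i : tame (fun _ : E => a ord0 i) by exact: tame_cst.
have h1 := poincare (ler0n _ 3) (mulr_ge0 (ler0n _ 2) B0) ua.
have e1 : vr mu (fun x => 2 * u x + (-1) * (a *d x + 0)) =
   4 * vr mu u + vr mu (fun x => a *d x) - 4 * cvr mu u (fun x => a *d x).
  rewrite (_ : (fun x => _) = (fun x => 2 * u x + (-1) * (a *d x))); last first.
    by apply/funext => x; rewrite addr0.
  rewrite (vrD muV (tameZ 2 tu) (tameZ (-1) ta)) (vrZ muV _ tu) (vrZ muV _ ta).
  rewrite (cvrZl muV _ tu (tameZ _ ta)) (cvrZr muV _ ta tu); ring.
have t1 := tame_enorm_sqr tw; have t2 := tame_dot tw tca.
have e2 : \int[mu]_x ⟦2 *: w x + (-1) *: a⟧ ^+ 2 =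
    ⟦a⟧ ^+ 2 + (4 * \int[mu]_x ⟦w x⟧ ^+ 2 + (-4) * \int[mu]_x (w x *d a)).
  rewrite -(intZ muV 4 t1) -(intZ muV (-4) t2) -(intD muV (tameZ 4 t1) (tameZ (-4) t2)).
  rewrite -{1}(int_cst mu (⟦a⟧ ^+ 2)).
  rewrite -(intD muV (tame_cst _) (tameD (tameZ 4 t1) (tameZ (-4) t2))).
  apply: eq_Rintegral => x _; rewrite !enorm_sqr !dotrVE (dotrVC a (w x)); ring.
have e3 : \int[mu]_x ⟦w x - a⟧ ^+ 2 =
    ⟦a⟧ ^+ 2 + (1 * \int[mu]_x ⟦w x⟧ ^+ 2 + (-2) * \int[mu]_x (w x *d a)).
  rewrite -(intZ muV 1 t1) -(intZ muV (-2) t2) -(intD muV (tameZ 1 t1) (tameZ (-2) t2)).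
  rewrite -{1}(int_cst mu (⟦a⟧ ^+ 2)).
  rewrite -(intD muV (tame_cst _) (tameD (tameZ 1 t1) (tameZ (-2) t2))).
  apply: eq_Rintegral => x _; rewrite !enorm_sqr !dotrVE (dotrVC a (w x)); ring.
have au : sm 2 B (fun x => (a *d x + 0) + (-1) * u x) (fun x => a + (-1) *: w x).
  apply: sm_weaken (sm_add (sm_lin a 0) (sm_scale (-1) uw)) _ _.
    by rewrite normrN normr1 mul1r; have := lerD a1 (lexx (1 : R)); rewrite -[1 + 1]/2.
  by rewrite normrN normr1 add0r mul1r.
have e4 : 0 <= vr mu (fun x => (-1) * u x + a *d x) by apply: (vr_ge0 muV); exact: tameD (tameZ _ tu) ta.
rewrite (vrD muV (tameZ _ tu) ta) (vrZ muV _ tu) (cvrZl muV _ tu ta) in e4.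
rewrite e1 e2 in h1; rewrite e3 in hd.
move: h1 hc hd e4; move: (\int[mu]_x ⟦w x⟧ ^+ 2) (\int[mu]_x (w x *d a)) (vr mu u)
  (vr mu (fun x => a *d x)) (cvr mu u (fun x => a *d x)) => I1 I2 v1 v2 v3 g1 g2 g3 g4.
lra.
Qed.

Lemma direction_regular (B M k0 : R) F w : (0 < n)%N -> 0 <= B -> 0 <= M ->
  sm 1 B F w -> (forall x, `|F x| <= M) -> 0 < k0 ->
  exists2 sigma : E, ⟦sigma⟧ = 1 &
    1 - vr mu (fun x => sigma *d x) <= 40 * (1 - vr mu F + k0).
Proof.
move=> n0 B0 M0 Fw0 FM k00.
pose d := 1 - vr mu F.
have vF1 : vr mu F <= 1.
  apply: (le_trans (poincare ler01 B0 Fw0)); rewrite -[leRHS](int_cst mu).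
  apply: (int_le muV) => [||x].
  - by apply: tame_enorm_sqr => i; exact: tame_grad Fw0.
  - exact: tame_cst.
  - by rewrite exprn_ile1//; have [] := Fw0.
have d0 : 0 <= d by rewrite subr_ge0.
(* For [d >= 1/32] the right-hand side exceeds 1 and any unit vector will do; a small [d] keeps [a]
   away from 0. *)
have [dbig|dsmall] := leP (32^-1) d.
  have [sg sg1] := unit_vector n0; exists sg => //.
  have := vr_ge0 muV (tame_lin sg); rewrite -/d.
  by move: (vr mu (fun x => sg *d x)) => v v0; lra.
pose B' := B + K; have B'0 : 0 <= B' by rewrite addr_ge0.
have KB' : K <= B' by rewrite lerDr.
have Fw : sm 1 B' F w by apply: sm_weaken Fw0 (lexx _) _; rewrite lerDl.
have KB1 : K * 1 <= B' by rewrite mulr1.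
have [A A0 hA] := path_pigeonhole B'0 KB' M0 Fw FM.
pose k1 := Num.min k0 (8^-1) / 8.
have k10 : 0 < k1 by rewrite divr_gt0// lt_min k00/=; lra.
have k1k0 : 8 * k1 <= k0 by rewrite /k1 mulrCA divff// mulr1 ge_min lexx.
have k1e : 8 * k1 <= 8^-1 by rewrite /k1 mulrCA divff// mulr1 ge_min lexx orbT.
have [m1 hm1] := div_nat_small A k10.
have [m2 hm2] := iter_var_loss ler01 B'0 KB1 M0 k10 Fw FM.
have L24 : 0 <= 12 * B' * 2 by rewrite !mulr_ge0.
have [m3 hm3] := conv_lip reg muV L24 k10.
have [m] := good_ex (maxn m1 (maxn m2 m3)); rewrite !geq_max => /and3P[/hm1 mm1 mm2 mm3] gm.
have [j [k [jm /andP[k1m k2m]]]] := hA m gm.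
set a := \row_i _ => ha.
have eta0 := etam_gt0 gm; have eta1 := etam_le reg gm.
have /andP[r0 r1] := rho_etam01 reg gm.
have jm2 : (j <= 2 * m ^ 5)%N.
  rewrite (leq_trans jm)// (@leq_trans (m ^ 5))//; last by rewrite leq_pmull.
  by rewrite leq_pexp2l//; case: gm.
pose p := r m ^+ (2 * j).
have p1 : p <= 1 by rewrite exprn_ile1.
(* [j <= m ^ 4] and [eta m ^ 4 = 1/4], so Bernoulli's inequality gives
   [rho ^ (2 j) >= 1 - 2 j eta >= 1/2]. *)
have p0 : 2^-1 <= p.
  have h1 := rho_sqr_ge reg eta1.
  have h2 : etam m <= 4^-1 :> R.
    rewrite /etam lef_pV2 ?posrE ?mulr_gt0 ?exprn_gt0 ?(good_gt0 gm)//.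
    by rewrite ler_peMr// exprn_ege1// (good_ge1 gm).
  have h3 : 0 <= 1 - 2 * etam m :> R by lra.
  have h4 := @bernoulli_ge (2 * etam m) j (ltac:(lra)) (ltac:(lra)).
  have h5 : j%:R * (2 * etam m) <= 2^-1 :> R.
    have : j%:R <= m%:R ^+ 4 :> R by rewrite -natrX ler_nat.
    move=> /(ler_wpM2l (ltW eta0)); rewrite (etam_pow4 gm); lra.
  have h6 : (1 - 2 * etam m) ^+ j <= p.
    by rewrite /p exprM lerXn2r// nnegrE// exprn_ge0.
  lra.
pose u := iter j (P m) F; pose wu := iter j (G m) w.
have uw : sm 1 B' u wu by exact: (sm_iter_etam reg j gm ler01 B'0 KB1 Fw).
have [wu1 _] := sm_iter reg eta0 eta1 j Fw ler01 B'0 KB1.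
have wup x : ⟦wu x⟧ ^+ 2 <= p.
  by rewrite /p mulnC exprM lerXn2r ?nnegrE ?exprn_ge0// (le_trans (wu1 x)) ?mulr1.
have pa : iter k (P m) (fun x => ⟦wu x - a⟧ ^+ 2) 0 <= p - ⟦a⟧ ^+ 2.
  rewrite /a (iter_step_mean m k wu) lerB//.
  have <- : iter k (P m) (fun=> p) 0 = p by rewrite iter_step_cst.
  exact: iter_step_le.
have pa0 : 0 <= iter k (P m) (fun x => ⟦wu x - a⟧ ^+ 2) 0.
  have <- : iter k (P m) (fun=> 0) 0 = 0 by rewrite iter_step_cst.
  by apply: iter_step_le => x; exact: sqr_ge0.
have a1 : ⟦a⟧ <= 1.
  rewrite -(ler_pXn2r (n := 2)) ?nnegrE// expr1n; apply: le_trans p1.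
  by rewrite -subr_ge0; apply: le_trans pa.
have lw : lip (12 * B' * 2) (fun x => ⟦wu x - a⟧ ^+ 2).
  have h : sm 2 B' (fun x => u x + (- a *d x + 0)) (fun x => wu x + (- a)).
    apply: sm_weaken (sm_add uw (sm_lin (- a) 0)) _ _; last by rewrite addr0.
    by rewrite enormN; lra.
  exact: lip_grad_sqr h.
have [_ /(_ k1m)] := hm3 m k _ mm3 gm k2m lw.
rewrite ler_norml => /andP[cl _].
have hd : \int[mu]_x ⟦wu x - a⟧ ^+ 2 <= 4 * d + 2 * k1.
  have : \int[mu]_x ⟦wu x - a⟧ ^+ 2 <= p - ⟦a⟧ ^+ 2 + k1.
    by move: cl pa; move: (\int[mu]_x ⟦wu x - a⟧ ^+ 2) => I1; lra.
  move: (\int[mu]_x ⟦wu x - a⟧ ^+ 2) => I1; move: ha; rewrite -/p -/d; lra.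
have hv := hm2 m j mm2 gm jm2; rewrite -/p -/u in hv.
have hw1 : \int[mu]_x ⟦w x⟧ ^+ 2 <= 1.
  rewrite -[leRHS](int_cst mu); apply: (int_le muV) => [||x].
  - by apply: tame_enorm_sqr => i; exact: tame_grad Fw0.
  - exact: tame_cst.
  - by rewrite exprn_ile1//; have [] := Fw0.
have hwu : \int[mu]_x ⟦wu x⟧ ^+ 2 <= p.
  rewrite -[leRHS](int_cst mu); apply: (int_le muV) => //.
  - by apply: tame_enorm_sqr => i; exact: tame_grad uw.
  - exact: tame_cst.
(* The variance loss over [j] steps gives [vr u >= vr F - (1 - p) - k1 = p - d - k1], while
   [int |wu|^2 <= p]. *)
have hc : \int[mu]_x ⟦wu x⟧ ^+ 2 - vr mu u <= d + k1.
  have p10 : 0 <= 1 - p by lra.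
  have := ler_wpM2l p10 hw1; move: hv hwu; rewrite /d.
  move: (vr mu F) (vr mu u) (\int[mu]_x ⟦wu x⟧ ^+ 2) (\int[mu]_x ⟦w x⟧ ^+ 2) => v1 v2 I1 I2.
  lra.
have hq := almost_constant_gradient B'0 uw a1 hc hd.
(* [1/2 - 4/32 - 1/64 >= 1/4]. Dividing the defect [2 (d + k1) + 2 (4 d + 2 k1)] by [|a|^2 >= 1/4]
   gives at most [40 d + 24 k1]. *)
have a4 : 4^-1 <= ⟦a⟧ ^+ 2 by move: ha; rewrite -/p -/d; lra.
have a0 : 0 < ⟦a⟧.
  by rewrite lt0r enorm_ge0 andbT; apply: contraTneq a4 => ->; rewrite expr0n/= -ltNge invr_gt0.
exists (⟦a⟧^-1 *: a); first by rewrite enormZ gtr0_norm ?invr_gt0// mulVf ?gt_eqF.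
rewrite -/d (_ : (fun x => _ *d x) = (fun x => ⟦a⟧^-1 * (a *d x))); last first.
  by apply/funext => x; rewrite dotrVZl.
rewrite (vrZ muV _ (tame_lin a)) exprVn.
move: hq a4; move: (vr mu (fun x => a *d x)) => v hq a4.
have -> : 1 - (⟦a⟧ ^+ 2)^-1 * v = (⟦a⟧ ^+ 2 - v) / ⟦a⟧ ^+ 2.
  by field; rewrite gt_eqF.
rewrite ler_pdivrMr ?exprn_gt0//.
have dk : 0 <= d + k0 by rewrite addr_ge0// ltW.
have := ler_wpM2l dk a4; lra.
Qed.

End regular_poincare.

(** * Approximation of a uniformly log-concave measure by regular ones *)

Section cvg_rV.
Context {R : realType} {n : nat}.
Local Notation E := 'rV[R]_n.

Lemma cvg_bigsum T (F : set_system T) (I : Type) (r : seq I) (f : I -> T -> R) (l : I -> R) :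
  Filter F -> (forall i, f i x @[x --> F] --> l i) ->
  \sum_(i <- r) f i x @[x --> F] --> \sum_(i <- r) l i.
Proof.
move=> FF h; elim: r => [|i r IH].
  by rewrite big_nil; under eq_cvg do rewrite big_nil; exact: cvg_cst.
by rewrite big_cons; under eq_cvg do rewrite big_cons; exact: cvgD.
Qed.

Lemma cvg_dot T (F : set_system T) (u v : T -> E) (a b : E) : Filter F ->
  (forall i, u x ord0 i @[x --> F] --> a ord0 i) ->
  (forall i, v x ord0 i @[x --> F] --> b ord0 i) ->
  u x *d v x @[x --> F] --> a *d b.
Proof. by move=> FF hu hv; apply: cvg_bigsum => i; exact: cvgM. Qed.

Lemma normr_le_enorm (x : E) : `|x| <= ⟦x⟧.
Proof.
rewrite /Num.norm/= mx_normrE; apply: bigmax_le => // -[i j] _ /=.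
by rewrite (ord1 i) ler_coord_enorm.
Qed.

End cvg_rV.

Section Rintegral_cvg.
Context d (T : measurableType d) (R : realType) (m : {measure set T -> \bar R}).

Lemma Rintegral_cvg (F : nat -> T -> R) f (G : T -> R) :
  (forall k, measurable_fun setT (F k)) ->
  (forall x, F k x @[k --> \oo] --> f x) -> m.-integrable setT (EFin \o G) ->
  (forall k x, `|F k x| <= G x) ->
  \int[m]_x F k x @[k --> \oo] --> \int[m]_x f x.
Proof.
move=> mF Ff iG FG.
have mf : measurable_fun setT f by apply: (measurable_fun_cvg mF) => x _; exact: Ff.
have fG x : `|f x| <= G x.
  have hc : `|F k x| @[k --> \oo] --> `|f x| by apply: cvg_norm; exact: Ff.
  by apply: (ler_cvg_to hc (cvg_cst (G x))); near=> k; exact: FG.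
have h := @dominated_cvg _ _ _ m setT measurableT (fun k => EFin \o F k) (EFin \o f)
  (EFin \o G).
have {}h : (\int[m]_x (EFin \o F k) x)%E @[k --> \oo] --> (\int[m]_x (EFin \o f) x)%E.
  refine (h _ _ _ iG _) => //.
  - by move=> k; apply/measurable_EFinP.
  - by move=> x _; apply: cvg_EFin; [near=> k|exact: Ff].
  - by move=> k x _; rewrite /= lee_fin.
apply: (@fine_cvg R nat \oo _ (fun k => \int[m]_x (F k x)%:E)%E).
rewrite fineK//; apply: integrable_fin_num => //.
apply: (le_integrable measurableT _ _ iG); first exact/measurable_EFinP.
by move=> x _; rewrite lee_fin (le_trans (fG x))// ler_norm.
Unshelve. all: by end_near. Qed.

End Rintegral_cvg.

Section regular_glc.
Context {R : realType} {n : nat}.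
Local Notation E := 'rV[R]_n.

Lemma regular_addc K (W : E -> R) g H c : regular K W g H ->
  regular K (fun x => W x + c) g H.
Proof.
case=> K1 [h1 h2] h3 h4 h5; split=> //; split=> // x y.
by rewrite opprD addrACA subrr addr0.
Qed.

Lemma measurable_qpot L (W : E -> R) : lip L W -> measurable_fun setT (qpot W).
Proof.
move=> WL; apply: measurable_funD; last exact: measurable_lip WL.
by apply: measurable_funM => //; apply: measurable_funX; exact: measurable_enorm.
Qed.

Lemma glc_lip (mu : probability E R) L (W : E -> R) : lip L W ->
  (forall A, measurable A -> mu A = (\int[lebesgue_rV n]_(x in A) (expR (- qpot W x))%:E)%E) ->
  glc mu (qpot W).
Proof.
move=> WL h; split=> //; first exact: measurable_qpot WL.
exists L, `|W 0| => x; rewrite /qpot -!addrA lerD2l.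
have := WL 0 x; rewrite subr0 ler_norml => /andP[h1 _].
have := ler_norm (- W 0); rewrite normrN; lra.
Qed.

Lemma integrable_gauss_exp (C c : R) : 0 <= C -> (lebesgue_rV n).-integrable setT
  (EFin \o (fun x : E => C * expR (c * ⟦x⟧ - ⟦x⟧ ^+ 2 / 2))).
Proof.
move=> C0; have [C' hC'] := expR_gw n c.
have intgw : (lebesgue_rV n).-integrable setT (fun x : E => (C * C')%:E * (gw x)%:E)%E.
  apply: integrableZl => //; apply/integrableP; split.
    by apply/measurable_EFinP; exact: measurable_gw.
  under eq_integral do rewrite /= ger0_norm ?gw_ge0//.
  exact: gw_lty.
apply: (le_integrable measurableT _ _ intgw).
  apply/measurable_EFinP; apply: measurable_funM => //; apply: measurableT_comp => //.
  apply: measurable_funB; first by apply: measurable_funM => //; exact: measurable_enorm.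
  by apply: measurable_funM => //; apply: measurable_funX; exact: measurable_enorm.
move=> x _ /=; rewrite lee_fin (le_trans _ (ler_norm _))//.
rewrite ger0_norm ?mulr_ge0 ?expR_ge0// -[leRHS]mulrA; exact: ler_wpM2l (hC' x).
Qed.

End regular_glc.

Section convexity.
Context {R : realType} {n : nat}.
Local Notation E := 'rV[R]_n.
Variable V : E -> R.
Hypothesis V2 : twice_differentiable V.

Definition grad (x : E) : E := \row_i partial i V x.

Lemma derive_lineE (f : E -> R) (x d : E) (t : R) : differentiable f (x + t *: d) ->
  is_derive t 1 (fun t : R => f (x + t *: d)) ('D_d f (x + t *: d)).
Proof.
move=> df.
have e : (fun h : R => h^-1 *: (((fun t : R => f (x + t *: d)) \o shift t) (h *: 1) -
      f (x + t *: d))) =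
    (fun h : R => h^-1 *: ((f \o shift (x + t *: d)) (h *: d) - f (x + t *: d))).
  apply/funext => h; congr (_ *: (f _ - _)).
  by rewrite /= [h *: 1]mulr1 /= scalerDl addrCA.
split; last by rewrite /derive e.
by rewrite /derivable e; exact: diff_derivable.
Qed.

Lemma derive_sum (f : E -> R) (x d : E) : differentiable f x ->
  'D_d f x = \sum_i d ord0 i * 'D_(delta_mx ord0 i) f x.
Proof.
move=> df; rewrite deriveE// {1}(row_sum_delta d) linear_sum.
by apply: eq_bigr => i _; rewrite linearZ deriveE.
Qed.

Lemma derive_line (x d : E) (t : R) :
  is_derive t 1 (fun t : R => V (x + t *: d)) (grad (x + t *: d) *d d).
Proof.
have [dV _] := V2; apply: is_derive_eq (derive_lineE (dV _)) _.
rewrite derive_sum// /dotrV; apply: eq_bigr => i _.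
by rewrite mxE mulrC.
Qed.

Lemma derive2_line (x d : E) (t : R) :
  is_derive t 1 (fun t : R => grad (x + t *: d) *d d)
    ((d *m hessian V (x + t *: d) *m d^T) ord0 ord0).
Proof.
have [_ dV] := V2.
pose f i : R -> R := d ord0 i *: (fun t : R => partial i V (x + t *: d)).
have -> : (fun t : R => grad (x + t *: d) *d d) = \sum_i f i.
  apply/funext => s; rewrite fct_sumE; apply: eq_bigr => i _.
  by rewrite mxE mulrC.
have hf i : is_derive t 1 (f i) (d ord0 i * 'D_d (partial i V) (x + t *: d)).
  have h := derive_lineE (dV i (x + t *: d)).
  exact: is_deriveZ.
apply: is_derive_eq (is_derive_sum _) _.
rewrite mxE; apply: eq_bigr => j _; rewrite !mxE mulrC; congr (_ * _).
by rewrite derive_sum//; apply: eq_bigr => i _; rewrite mxE.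
Qed.

Hypothesis hessV : forall x, loewner_le 1%:M (hessian V x).

Let hess_ge (x d : E) : ⟦d⟧ ^+ 2 <= (d *m hessian V x *m d^T) ord0 ord0.
Proof.
apply: le_trans (hessV x d); rewrite mulmx1 enorm_sqr mxE le_eqVlt; apply/orP; left.
by apply/eqP; apply: eq_bigr => i _; rewrite mxE.
Qed.

(** As the Hessian may be discontinuous, the remainder is controlled by two mean value theorems: one
    for the slope along the segment, one for [V] minus the expected quadratic minorant. *)
Lemma tangent_ge (x y : E) : V x + grad x *d (y - x) + ⟦y - x⟧ ^+ 2 / 2 <= V y.
Proof.
set d := y - x; pose D (t : R) := grad (x + t *: d) *d d.
have Dc (a b : R) : {within `[a, b], continuous D}.
  by apply: derivable_within_continuous => t _; have [] := derive2_line x d t.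
have Dge t : 0 < t -> t * ⟦d⟧ ^+ 2 <= D t - D 0.
  move=> t0; have [c _ ->] := MVT t0 (fun s _ => derive2_line x d s) (Dc 0 t).
  by rewrite subr0 mulrC ler_wpM2r ?(ltW t0).
pose k := ⟦d⟧ ^+ 2.
pose psi : R -> R := (fun t : R => V (x + t *: d)) - (D 0 *: id) - ((k / 2) *: (id ^+ 2)).
have dpsi (t : R) : is_derive t 1 psi (D t - D 0 - k * t).
  have h := derive_line x d t.
  apply: is_derive_eq; rewrite /D /=.
  rewrite [_ *: (1 : R)]mulr1 [_ *: (1 : R)]mulr1 [_ *: (2 * _)]mulrA divfK//.
have psic : {within `[0, 1], continuous psi}.
  by apply: derivable_within_continuous => t _; have [] := dpsi t.
have [c] := MVT ltr01 (fun s _ => dpsi s) psic.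
rewrite in_itv/= => /andP[c0 _]; rewrite subr0 mulr1 => hc.
have : 0 <= psi 1 - psi 0 by rewrite hc subr_ge0 mulrC; exact: Dge.
have psiE t : psi t = V (x + t *: d) - D 0 * t - k / 2 * (t * t) by [].
have xd : x + d = y by rewrite /d addrC subrK.
rewrite !psiE scale1r scale0r xd addr0 /D scale0r addr0 /k.
lra.
Qed.

(* [V = |x|^2/2 + cvx V] with [cvx V] convex of subgradient [grad x - x]. *)
Definition cvx (x : E) : R := V x - ⟦x⟧ ^+ 2 / 2.
Definition tangent (x y : E) : R := cvx x + (grad x - x) *d (y - x).

Lemma qpot_cvx x : qpot cvx x = V x.
Proof. by rewrite /qpot /cvx addrCA subrr addr0. Qed.

Lemma tangent_le x y : tangent x y <= cvx y.
Proof.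
have := tangent_ge x y; rewrite /tangent /cvx.
have -> : ⟦y - x⟧ ^+ 2 = ⟦y⟧ ^+ 2 - ⟦x⟧ ^+ 2 - 2 * (x *d (y - x)).
  by rewrite !enorm_sqr !dotrVE (dotrVC y x); ring.
by rewrite dotrVDl dotrVNl; lra.
Qed.

(** [tangent x y] is continuous in its base point at [x = y], where its value is [cvx y]; hence
    countably many tangents already have supremum [cvx]. *)
Lemma tangent_dense (y : E) (e : R) : 0 < e -> exists k, cvx y - e <= tangent (pts k) y.
Proof.
move=> e0; have [dV dV2] := V2.
have key (F : set_system E) : Filter F -> V x @[x --> F] --> V y ->
    (forall i, grad x ord0 i @[x --> F] --> grad y ord0 i) ->
    (forall i, (x : E) ord0 i @[x --> F] --> y ord0 i) ->
    tangent x y @[x --> F] --> tangent y y.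
  move=> FF Vc gc xc; rewrite /tangent /cvx; apply: cvgD.
    apply: cvgB => //; rewrite !enorm_sqr; under eq_cvg do rewrite enorm_sqr.
    by apply: cvgMl; exact: cvg_dot.
  apply: cvg_dot => i.
    have -> : (grad y - y) ord0 i = grad y ord0 i - y ord0 i by rewrite !mxE.
    have -> : (fun x : E => (grad x - x) ord0 i) = (fun x => grad x ord0 i - x ord0 i).
      by apply/funext => x; rewrite !mxE.
    exact: cvgB.
  have -> : (y - y) ord0 i = y ord0 i - y ord0 i by rewrite !mxE.
  have -> : (fun x : E => (y - x) ord0 i) = (fun x => y ord0 i - x ord0 i).
    by apply/funext => x; rewrite !mxE.
  by apply: cvgB => //; exact: cvg_cst.
have hc : tangent x y @[x --> y] --> tangent y y.
  apply: (key (nbhs y) _ (differentiable_continuous (dV y))) => i.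
    have -> : (fun x => grad x ord0 i) = partial i V by apply/funext => x; rewrite mxE.
    by rewrite mxE; exact: differentiable_continuous (dV2 i y).
  exact: coord_continuous.
move/cvgrPdist_le/(_ _ e0) : hc; rewrite near_nbhs => /nbhs_ballP [d /= d0 hd].
have [k hk] := pts_dense y d0; exists k.
have yy : tangent y y = cvx y by rewrite /tangent subrr dotrV0r addr0.
have := hd (pts k); rewrite yy ler_norml => h.
have /andP[_] : - e <= cvx y - tangent (pts k) y <= e.
  apply: h; rewrite -ball_normE /=.
  exact: le_lt_trans (normr_le_enorm _) hk.
by rewrite lerBlDr => h2; rewrite lerBlDr addrC.
Qed.

(** The square in the inverse temperature makes the error of the soft maximum,
    [ln (k + 1) / (k + 1)^2], at most [1 / (k + 1)]. *)
Definition cvx_appr (k : nat) : E -> R :=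
  lse (k.+1%:R ^+ 2) (fun (j : 'I_k.+1) => tangent (pts j)).

Let beta0 k : 0 < k.+1%:R ^+ 2 :> R. Proof. by rewrite exprn_gt0. Qed.

Lemma cvx_appr_regular k : exists K g H, regular K (cvx_appr k) g H.
Proof.
have -> : cvx_appr k = lse (k.+1%:R ^+ 2) (fun (j : 'I_k.+1) x =>
    (grad (pts j) - pts j) *d x + (cvx (pts j) - (grad (pts j) - pts j) *d pts j)).
  congr lse; apply/funext => j; apply/funext => x.
  by rewrite /tangent [(_ - _) *d (_ - _)]dotrVDr dotrVNr; ring.
exact: regular_lse.
Qed.

Lemma cvx_appr_ge k j x : (j <= k)%N -> tangent (pts j) x <= cvx_appr k x.
Proof.
move=> jk; exact: (lse_ge (fun (j : 'I_k.+1) => tangent (pts j)) (beta0 k) (Ordinal (jk : (j < k.+1)%N))).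
Qed.

Lemma cvx_appr_le k x : cvx_appr k x <= cvx x + k.+1%:R^-1.
Proof.
apply: le_trans (lse_le (beta0 k) (fun j => tangent_le (pts j) x)) _.
rewrite lerD2l ler_pdivrMr// expr2 mulrA mulVf ?pnatr_eq0// mul1r ltW//.
exact: ln_sublinear.
Qed.

Lemma cvx_appr_cvg x : cvx_appr k x @[k --> \oo] --> cvx x.
Proof.
apply/cvgrPdist_le => e e0; have [j hj] := tangent_dense x e0.
near=> k; rewrite ler_norml; apply/andP; split.
  rewrite lerNl opprB lerBlDl (le_trans (cvx_appr_le k x))// lerD2l.
  apply/ltW; near: k; exact: (near_infty_natSinv_lt (PosNum e0)).
rewrite lerBlDl -lerBlDr (le_trans hj)// cvx_appr_ge//.
by near: k; exact: nbhs_infty_ge.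
Unshelve. all: by end_near. Qed.

Lemma cvx_appr_lip k : exists L, lip L (cvx_appr k).
Proof. by have [K [g [H [_ h _ _ _]]]] := cvx_appr_regular k; exists K; exact: sm_lip h. Qed.

Lemma measurable_pot : measurable_fun setT V.
Proof.
have mk k : measurable_fun setT (qpot (cvx_appr k)).
  by have [L h] := cvx_appr_lip k; exact: measurable_qpot h.
apply: (measurable_fun_cvg mk) => x _; rewrite -qpot_cvx /qpot.
by apply: cvgD; [exact: cvg_cst|exact: cvx_appr_cvg].
Qed.

Lemma cvx_ge_affine : exists a b : R, [/\ 0 <= a, forall x, - (a * ⟦x⟧) - b <= cvx x &
  forall k x, - (a * ⟦x⟧) - b <= cvx_appr k x].
Proof.
pose p := grad (pts 0) - pts 0.
have h x : - (⟦p⟧ * ⟦x⟧) - `|cvx 0| <= tangent (pts 0) x.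
  rewrite /tangent -/p /= subr0.
  have := normr_dotrV_le p x; rewrite ler_norml => /andP[h _].
  have := ler_norm (- cvx 0); rewrite normrN; lra.
exists ⟦p⟧, `|cvx 0|; split=> // [x|k x]; first exact: le_trans (h x) (tangent_le _ _).
exact: le_trans (h x) (cvx_appr_ge _ (leq0n k)).
Qed.

Variable mu : probability E R.
Hypothesis muV : forall A, measurable A ->
  mu A = (\int[lebesgue_rV n]_(x in A) (expR (- V x))%:E)%E.

Lemma glc_pot : glc mu V.
Proof.
split=> //; first exact: measurable_pot.
have [a [b [_ h _]]] := cvx_ge_affine; exists a, b => x.
by have := h x; rewrite -(qpot_cvx x) /qpot; lra.
Qed.

(** The densities [exp (- |x|^2/2 - cvx_appr k)], normalized. All families contain the tangent at
    the origin, so these densities share one Gaussian-type upper bound, and dominated convergence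
    applies to tame integrands. *)
Lemma regular_approx : exists (nu : nat -> probability E R) (W : nat -> E -> R),
  (forall k, exists K g H, regular K (W k) g H /\ glc (nu k) (qpot (W k))) /\
  (forall f, tame f -> \int[nu k]_x f x @[k --> \oo] --> \int[mu]_x f x).
Proof.
have ar (A B B' : R) : B' <= B + 1 -> -1 - (A + B) <= - (A + B') by lra.
pose w k x := expR (- qpot (cvx_appr k) x).
have mw k : measurable_fun setT (w k).
  have [L h] := cvx_appr_lip k; apply: measurableT_comp => //.
  by apply: measurable_funN; exact: measurable_qpot h.
have [a [b [a0 hV hk]]] := cvx_ge_affine.
have w_le k x : w k x <= expR b * expR (a * ⟦x⟧ - ⟦x⟧ ^+ 2 / 2).
  by rewrite -expRD ler_expR /qpot; have := hk k x; lra.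
have wc x : w k x @[k --> \oo] --> expR (- V x).
  rewrite -qpot_cvx /w; apply: (@continuous_cvg _ _ _ _ _ _ expR); first exact: continuous_expR.
  by apply: cvgN; apply: cvgD; [exact: cvg_cst|exact: cvx_appr_cvg].
have iw k : (lebesgue_rV n).-integrable setT (EFin \o w k).
  apply: (le_integrable measurableT _ _ (integrable_gauss_exp a (expR_ge0 b))).
    exact/measurable_EFinP.
  move=> x _; rewrite lee_fin ger0_norm ?expR_ge0// (le_trans (w_le k x))//.
  exact: ler_norm.
have fw_le (f : E -> R) C c k x : 0 <= C -> `|f x| <= C * expR (c * ⟦x⟧) ->
    `|f x * w k x| <= C * expR b * expR ((c + a) * ⟦x⟧ - ⟦x⟧ ^+ 2 / 2).
  move=> C0 fC; rewrite normrM [`|w k x|]ger0_norm ?expR_ge0//.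
  have -> : C * expR b * expR ((c + a) * ⟦x⟧ - ⟦x⟧ ^+ 2 / 2) =
      (C * expR (c * ⟦x⟧)) * (expR b * expR (a * ⟦x⟧ - ⟦x⟧ ^+ 2 / 2)).
    by rewrite mulrDl -addrA [expR (c * _ + _)]expRD; ring.
  by apply: ler_pM => //; exact: expR_ge0.
pose Z k := \int[lebesgue_rV n]_x w k x.
have Zf f : tame f ->
    \int[lebesgue_rV n]_x (f x * w k x) @[k --> \oo] --> \int[mu]_x f x.
  move=> tf; rewrite (int_leb glc_pot tf); case: tf => mf [C [c [C0 c0 fC]]].
  apply: (Rintegral_cvg _ _ (integrable_gauss_exp (c + a) (mulr_ge0 C0 (expR_ge0 b)))).
  - by move=> k; exact: measurable_funM.
  - by move=> x; apply: cvgMr.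
  - by move=> k x; exact: fw_le.
have Z1 : Z k @[k --> \oo] --> (1 : R).
  have := Zf _ (tame_cst 1); rewrite (int_cst mu).
  by under eq_cvg do under eq_Rintegral do rewrite mul1r.
(* Every [Z k] is inverted, not only those of large index: [cvx_appr k <= cvx + 1] bounds [w k]
   below by [exp (- 1) exp (- V)]. *)
have Z0 k : 0 < Z k.
  apply: (@lt_le_trans _ _ (expR (- 1))); first exact: expR_gt0.
  have i1 := tame_int_leb glc_pot (tame_cst 1).
  have <- : \int[lebesgue_rV n]_x (expR (-1) * (1 * expR (- V x))) = expR (-1).
    rewrite RintegralZl// -(int_leb glc_pot (tame_cst 1)) (int_cst mu) mulr1//.
  apply: le_Rintegral => //.
    by apply: (@integrableZl _ _ _ _ _ measurableT (expR (-1)) _ i1).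
  move=> x _; rewrite mul1r -expRD ler_expR -qpot_cvx /qpot.
  have h1 : k.+1%:R^-1 <= 1 :> R by rewrite invf_le1 ?ler1n.
  have : cvx_appr k x <= cvx x + 1 by rewrite (le_trans (cvx_appr_le k x))// lerD2l.
  exact: ar.
pose W k x := cvx_appr k x + ln (Z k).
have WE k x : expR (- qpot (W k) x) = (Z k)^-1 * w k x.
  rewrite /W /w /qpot addrA opprD expRD [expR (- ln _)]expRN lnK ?posrE//.
  by rewrite mulrC.
have nu_ex k : exists nu : probability E R, forall A, measurable A ->
    nu A = (\int[lebesgue_rV n]_(x in A) (expR (- qpot (W k) x))%:E)%E.
  have [L h] := cvx_appr_lip k.
  have WL : lip L (W k) by move=> x y; rewrite /W opprD addrACA subrr addr0.
  apply: density_probability.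
  - apply: measurableT_comp => //.
    by apply: measurable_funN; exact: measurable_qpot WL.
  - by move=> x; exact: expR_ge0.
  - under eq_integral do rewrite WE EFinM.
    rewrite integralZl//; last exact: iw.
    have := iw k => /(integrable_fin_num measurableT) /fineK <-.
    by rewrite -EFinM mulVf// gt_eqF// Z0.
have [nu hnu] := choice nu_ex.
have gk k : glc (nu k) (qpot (W k)).
  have [L h] := cvx_appr_lip k.
  have WL : lip L (W k) by move=> x y; rewrite /W opprD addrACA subrr addr0.
  exact: glc_lip WL (hnu k).
exists nu, W; split=> [k|f tf].
  have [K [g [H hr]]] := cvx_appr_regular k.
  by exists K, g, H; split => //; exact: regular_addc.
have e k : \int[nu k]_x f x = (Z k)^-1 * \int[lebesgue_rV n]_x (f x * w k x).
  rewrite (int_leb (gk k) tf) -RintegralZl//.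
    by apply: eq_Rintegral => x _; rewrite WE; ring.
  case: tf => mf [C [c [C0 c0 fC]]].
  apply: (le_integrable measurableT _ _ (integrable_gauss_exp (c + a) (mulr_ge0 C0 (expR_ge0 b)))).
    by apply/measurable_EFinP; exact: measurable_funM.
  by move=> x _; rewrite lee_fin (le_trans _ (ler_norm _))// fw_le.
under eq_cvg do rewrite e.
rewrite -[\int[mu]_x f x]mul1r -{1}[1]invr1; apply: cvgM; last exact: Zf.
by apply: cvgV => //; exact: oner_neq0.
Qed.

End convexity.

(** * Bounded smooth approximation of 1-Lipschitz functions *)

Section lip_appr.
Context {R : realType} {n : nat}.
Local Notation E := 'rV[R]_n.
Implicit Types F : E -> R.

(** Soft minimum and truncation both preserve the Lipschitz constant, so every approximant is still
    exactly 1-Lipschitz; the parameters are chosen to make the smoothing and truncation errors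
    vanish. *)
Definition lip_appr F (k : nat) : E -> R :=
  trunc k.+1%:R^-1 (softcone k 1 k.+1%:R^-1 (k.+1%:R ^+ 2) F).

Let e0 k : 0 < k.+1%:R^-1 :> R. Proof. by rewrite invr_gt0. Qed.
Let e1 k : k.+1%:R^-1 <= 1 :> R. Proof. by rewrite invf_le1 ?ler1n. Qed.
Let b0 k : 0 < k.+1%:R ^+ 2 :> R. Proof. by rewrite exprn_gt0. Qed.

Lemma lip_appr_sm F k : exists B w, 0 <= B /\ sm 1 B (lip_appr F k) w.
Proof.
have [w h] := @sm_softcone R n k 1 _ _ F ler01 (e0 k) (b0 k).
eexists; eexists; split; last exact: sm_trunc h ler01 (e0 k).
apply: addr_ge0; last exact: mulr_ge0 (mulr_ge0 (ler0n _ 2) (ltW (e0 k))) (sqr_ge0 1).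
apply: addr_ge0; first by rewrite mulr_ge0// invr_ge0 ltW.
by rewrite !mulr_ge0 ?sqr_ge0.
Qed.

Lemma lip_appr_bounded F k x : `|lip_appr F k x| <= k.+1%:R.
Proof. by rewrite -[leRHS]invrK; exact: trunc_bound. Qed.

Let softcone_dist F k x : lip 1 F ->
  `|softcone k 1 k.+1%:R^-1 (k.+1%:R ^+ 2) F x - F x| <= 2 * ddist k x + k.+1%:R^-1.
Proof.
have ar (a b f c d : R) : - a <= b - f -> b - f <= 2 * 1 * c + 1 * d -> a <= d ->
    0 <= c -> `|b - f| <= 2 * c + d.
  by move=> g1 g2 g3 g4; rewrite ler_norml; apply/andP; split; lra.
move=> F1; have /andP[h1 h2] := softcone_approx k x ler01 (e0 k) (b0 k) F1.
have h3 : ln k.+1%:R / k.+1%:R ^+ 2 <= k.+1%:R^-1 :> R.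
  rewrite ler_pdivrMr// expr2 mulrA mulVf ?pnatr_eq0// mul1r ltW//.
  exact: ln_sublinear.
exact: ar h1 h2 h3 (ddist_ge0 k x).
Qed.

Lemma lip_appr_le F k x : lip 1 F -> `|lip_appr F k x| <= `|F x| + 2 * ⟦x⟧ + 1.
Proof.
move=> F1; rewrite (le_trans (trunc_le _ _ _))//.
rewrite -[softcone _ _ _ _ _ _](subrK (F x)) (le_trans (ler_normD _ _))// addrC -addrA lerD2l.
rewrite (le_trans (softcone_dist k x F1))// lerD// ler_wpM2l//; exact: ddist_le_enorm.
Qed.

Lemma lip_appr_cvg F x : lip 1 F -> lip_appr F k x @[k --> \oo] --> F x.
Proof.
move=> F1; pose c := (`|F x| + 2 * ⟦x⟧ + 1) ^+ 2.
pose u k := 2 * ddist k x + k.+1%:R^-1 * (1 + c).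
have hu k : `|lip_appr F k x - F x| <= u k.
  have h1 := softcone_dist k x F1.
  have h2 := trunc_approx (softcone k 1 k.+1%:R^-1 (k.+1%:R ^+ 2) F) x (e0 k).
  rewrite -/(lip_appr F k x) in h2.
  have h3 : softcone k 1 k.+1%:R^-1 (k.+1%:R ^+ 2) F x ^+ 2 <= c.
    rewrite -real_normK ?num_real// lerXn2r ?nnegrE ?addr_ge0 ?mulr_ge0//.
    rewrite -[softcone _ _ _ _ _ _](subrK (F x)) (le_trans (ler_normD _ _))// addrC -addrA lerD2l.
    by rewrite (le_trans h1)// lerD// ler_wpM2l//; exact: ddist_le_enorm.
  have h4 := ler_wpM2l (ltW (e0 k)) h3.
  have -> : lip_appr F k x - F x =
      (softcone k 1 k.+1%:R^-1 (k.+1%:R ^+ 2) F x - F x) +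
      (lip_appr F k x - softcone k 1 k.+1%:R^-1 (k.+1%:R ^+ 2) F x).
    by ring.
  rewrite (le_trans (ler_normD _ _))// /u mulrDr mulr1 addrA.
  exact: lerD h1 (le_trans h2 h4).
have u0 : u k @[k --> \oo] --> (0 : R).
  have -> : (0 : R) = 2 * 0 + 0 * (1 + c) by rewrite mulr0 mul0r addr0.
  apply: cvgD; first by apply: cvgMr; exact: ddist_cvg.
  by apply: cvgMl; exact: cvg_harmonic.
have h : `|lip_appr F k x - F x| @[k --> \oo] --> 0.
  by apply: (squeeze_cvgr _ (cvg_cst 0) u0); near=> k; rewrite normr_ge0 hu.
by apply/subr_cvg0; exact: norm_cvg0.
Unshelve. all: by end_near. Qed.

End lip_appr.

(** * Passage to the limit: the Poincare inequality and the optimal direction *)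

Section logconcave.
Context {R : realType} {n : nat}.
Local Notation E := 'rV[R]_n.
Variable V : E -> R.
Hypothesis V2 : twice_differentiable V.
Hypothesis hessV : forall x, loewner_le 1%:M (hessian V x).
Variable mu : probability E R.
Hypothesis muD : forall A, measurable A ->
  mu A = (\int[lebesgue_rV n]_(x in A) (expR (- V x))%:E)%E.

Let muV : glc mu V := glc_pot V2 hessV muD.

Lemma cvr_cvg (nu : nat -> probability E R) f h : tame f -> tame h ->
  (forall f, tame f -> \int[nu k]_x f x @[k --> \oo] --> \int[mu]_x f x) ->
  cvr (nu k) f h @[k --> \oo] --> cvr mu f h.
Proof.
move=> tf th hc; apply: cvgB; first by apply: hc; exact: tameM.
by apply: cvgM; exact: hc.
Qed.

Lemma poincare_lc (L B : R) f w : 0 <= L -> 0 <= B -> sm L B f w ->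
  vr mu f <= \int[mu]_x ⟦w x⟧ ^+ 2.
Proof.
move=> L0 B0 fw; have [nu [W [hr hc]]] := regular_approx V2 hessV muD.
have tf := tame_sm fw.
have tw : tame (fun x => ⟦w x⟧ ^+ 2) by apply: tame_enorm_sqr => i; exact: tame_grad fw.
apply: (ler_cvg_to (cvr_cvg tf tf hc) (hc _ tw)); near=> k.
by have [K [g [H [reg nk]]]] := hr k; exact: (poincare reg nk L0 B0 fw).
Unshelve. all: by end_near. Qed.

Lemma cvr_suml (m : probability E R) U (I : Type) (r : seq I) (c : I -> R) (f : I -> E -> R) h :
  glc m U -> (forall i, tame (f i)) -> tame h ->
  cvr m (fun x => \sum_(i <- r) c i * f i x) h = \sum_(i <- r) c i * cvr m (f i) h.
Proof.
move=> mU tf th; elim: r => [|i r IH].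
  rewrite big_nil; apply: etrans (cvr_cst mU 0 th); congr cvr.
  by apply/funext => x; rewrite big_nil.
rewrite big_cons -IH -(cvrZl mU _ (tf i) th) -(cvrDl mU) //; last 2 first.
- exact: tameZ.
- by apply: tame_sum => j _; exact: tameZ.
by congr cvr; apply/funext => x; rewrite big_cons.
Qed.

Definition cov (m : probability E R) i j := cvr m (fun x => x ord0 i) (fun x => x ord0 j).

(** The direction found for an approximating measure varies with it. Going through the covariance
    matrix makes the convergence of the variances uniform over unit vectors. *)
Lemma vr_lin (m : probability E R) U (v : E) : glc m U ->
  vr m (fun x => v *d x) = \sum_i v ord0 i * \sum_j v ord0 j * cov m j i.
Proof.
move=> mU; have tc i : tame (fun x : E => x ord0 i) by exact: tame_coord.
rewrite /vr {1}/dotrV (cvr_suml _ _ mU tc (tame_lin v)); apply: eq_bigr => i _.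
by congr (_ * _); rewrite cvrC (cvr_suml _ _ mU tc (tc i)).
Qed.

Lemma direction_sm (B M e : R) F w : (0 < n)%N -> 0 <= B -> 0 <= M ->
  sm 1 B F w -> (forall x, `|F x| <= M) -> 0 < e ->
  exists2 sigma : E, ⟦sigma⟧ = 1 &
    1 - vr mu (fun x => sigma *d x) <= 40 * (1 - vr mu F) + e.
Proof.
move=> n0 B0 M0 Fw FM e0; have [nu [W [hr hc]]] := regular_approx V2 hessV muD.
have tF := tame_sm Fw.
(* [40 e / 160] is spent twice, on [vr F] and on the slack in [direction_regular], and [e / 4] on
   the covariances. *)
have e160 : 0 < e / 160 by rewrite divr_gt0.
have e4 : 0 < e / 4 by rewrite divr_gt0.
have cF := cvr_cvg tF tF hc.
have cC : \sum_i \sum_j `|cov (nu k) j i - cov mu j i| @[k --> \oo] --> (0 : R).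
  have z : \sum_i \sum_j `|cov mu j i - cov mu j i| = 0 :> R.
    by rewrite big1// => i _; rewrite big1// => j _; rewrite subrr normr0.
  rewrite -[X in _ --> X]z.
  apply: cvg_bigsum => i; apply: cvg_bigsum => j; apply: cvg_norm; apply: cvgB; last exact: cvg_cst.
  by apply: cvr_cvg => //; exact: tame_coord.
move/cvgrPdist_le/(_ _ e160) : cF => [k1 _ hk1].
move/cvgrPdist_le/(_ _ e4) : cC => [k2 _ hk2].
pose k := maxn k1 k2.
have := hk1 k (leq_maxl _ _); have := hk2 k (leq_maxr _ _) => /=.
rewrite sub0r normrN => g2 g1.
have [K [g [H [reg nk]]]] := hr k.
have [sg sg1 hsg] := direction_regular reg nk n0 B0 M0 Fw FM e160.
exists sg => //.
have g3 : `|vr (nu k) (fun x => sg *d x) - vr mu (fun x => sg *d x)| <= e / 4.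
  apply: le_trans (le_trans (ler_norm _) g2); rewrite (vr_lin sg nk) (vr_lin sg muV) -sumrB.
  have s1 i : `|sg ord0 i| <= 1 by rewrite -sg1 ler_coord_enorm.
  rewrite (le_trans (ler_norm_sum _ _ _))// ler_sum// => i _.
  rewrite -mulrBr normrM (le_trans (ler_piMl _ (s1 i)))//.
  rewrite -sumrB (le_trans (ler_norm_sum _ _ _))// ler_sum// => j _.
  by rewrite -mulrBr normrM ler_piMl.
move: g1 g3 hsg; rewrite !ler_norml /vr.
move: (cvr mu F F) (cvr (nu k) F F) (cvr mu _ _) (cvr (nu k) _ _) => a b c d.
by move=> /andP[h1 h2] /andP[h3 h4] h5; lra.
Qed.

(** [sigma] maximizes the variance of [v . x], a continuous quadratic form, over the compact unit
    sphere. It does at least as well as the direction found for any particular test function, so a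
    single [sigma] serves all [F] and the limit over [lip_appr F k] involves no choice of
    directions. *)
Lemma direction : (0 < n)%N -> exists2 sigma : E, ⟦sigma⟧ = 1 &
  forall F, lip 1 F -> 1 - vr mu (fun x => sigma *d x) <= 40 * (1 - vr mu F).
Proof.
move=> n0; pose S : set E := [set v | v *d v = 1].
have SE v : S v -> ⟦v⟧ = 1.
  by move=> h; apply/eqP; rewrite -(eqrXn2 (n := 2))// expr1n enorm_sqr h.
have dotc : continuous (fun v : E => v *d v).
  move=> v; apply: (@cvg_dot _ _ _ (nbhs v) id id v v) => i; exact: coord_continuous.
have Sc : compact S.
  apply: bounded_closed_compact.
    exists 1; split; first exact: num_real.
    by move=> M M1 v /SE h /=; apply: (le_trans (normr_le_enorm v)); rewrite h ltW.
  have -> : S = (fun v : E => v *d v) @^-1` [set 1] by apply/seteqP; split.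
  by apply: closed_comp => [v _|]; [exact: dotc|exact: closed_eq].
have S0 : S !=set0.
  have [v v1] := @unit_vector R n n0; exists v.
  by rewrite /S /= -enorm_sqr v1 expr1n.
pose f (v : E) := vr mu (fun x => v *d x).
have fc : continuous f.
  have fE : f = fun v => \sum_i v ord0 i * \sum_j v ord0 j * cov mu j i.
    by apply/funext => v; exact: vr_lin muV.
  have key v (G : set_system E) : Filter G ->
      (forall i, (x : E) ord0 i @[x --> G] --> (v : E) ord0 i) -> f x @[x --> G] --> f v.
    move=> GF hv; rewrite fE; apply: cvg_bigsum => i; apply: cvgM => //.
    by apply: cvg_bigsum => j; exact: cvgMl.
  by move=> v; apply: (key v (nbhs v)) => i; exact: coord_continuous.
have [sg sgS hmax] := EVT_max_rV S0 Sc (continuous_subspaceT fc).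
rewrite inE in sgS; exists sg; first exact: SE.
move=> F F1.
have tF := tame_lip F1.
have key k : 1 - vr mu (fun x => sg *d x) <= 40 * (1 - vr mu (lip_appr F k)).
  apply/ler_addgt0Pr => e e0.
  have [B [w [B0 h]]] := lip_appr_sm F k.
  have [s s1 hs] := direction_sm n0 B0 (ler0n R k.+1) h (lip_appr_bounded F k) e0.
  apply: le_trans hs; rewrite lerD2l lerN2; apply: hmax.
  by rewrite inE /S /= -enorm_sqr s1 expr1n.
have tG : tame (fun x => `|F x| + 2 * ⟦x⟧ + 1).
  by apply: tameD (tame_cst 1); apply: tameD; [exact: tame_norm|apply: tameZ; exact: tame_enorm].
have mk k : tame (lip_appr F k) by have [B [w [_ h]]] := lip_appr_sm F k; exact: tame_sm h.
have c1 : \int[mu]_x lip_appr F k x @[k --> \oo] --> \int[mu]_x F x.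
  have [] // := @int_cvg _ _ mu V muV (lip_appr F) F (fun x => `|F x| + 2 * ⟦x⟧ + 1)
    (fun k => (mk k).1) _ tG _.
  - by move=> x; exact: lip_appr_cvg.
  - by move=> k x; exact: lip_appr_le.
have c2 : \int[mu]_x (lip_appr F k x ^+ 2) @[k --> \oo] --> \int[mu]_x (F x ^+ 2).
  have [] // := @int_cvg _ _ mu V muV (fun k x => lip_appr F k x ^+ 2) (fun x => F x ^+ 2)
    (fun x => (`|F x| + 2 * ⟦x⟧ + 1) ^+ 2) _ _ (tameX 2 tG) _.
  - by move=> k; apply: (tameX 2 (mk k)).1.
  - by move=> x; apply: cvgM; exact: lip_appr_cvg.
  - move=> k x; rewrite normrX lerXn2r ?nnegrE ?lip_appr_le// ?addr_ge0// mulr_ge0//.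
apply: (ler_cvg_to (cvg_cst _) _ (_ : \forall k \near \oo, _ <= 40 * (1 - vr mu (lip_appr F k)))).
  apply: cvgMr; apply: cvgB; first exact: cvg_cst.
  rewrite vrE; under eq_cvg do rewrite vrE.
  by apply: cvgB => //; apply: cvgM.
by near=> k; exact: key.
Unshelve. all: by end_near. Qed.

End logconcave.

(** * Gaussian integration by parts and the rotation argument *)

Section gauss_ibp.
Context {R : realType} {n : nat}.
Local Notation E := 'rV[R]_n.
Variables (c : R) (mu : probability E R).
Hypothesis muG : glc mu (qpot (fun=> c)).

Let G (x : E) : R := 2 * (⟦x⟧ + 1) ^+ 2 * (expR 1 * expR (1 * ⟦x⟧)) + 1.

Let tG : tame G.
Proof.
apply: tameD (tame_cst 1).
apply: tameM; last by apply: tameZ; exact: tame_expR.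
by apply: tameZ; apply: tameX; exact: tameD tame_enorm (tame_cst 1).
Qed.

Let G0 x : 0 <= G x.
Proof.
apply: addr_ge0 => //; apply: mulr_ge0; last by rewrite mulr_ge0 ?expR_ge0.
by rewrite mulr_ge0 ?sqr_ge0.
Qed.

Let qpotD (x b : E) : qpot (fun=> c) x - qpot (fun=> c) (x + b) = - (x *d b) - ⟦b⟧ ^+ 2 / 2.
Proof. by rewrite /qpot !enorm_sqr !dotrVE (dotrVC b x); field. Qed.

Let weight (x b : E) : ⟦b⟧ <= 1 ->
  `|expR (- (x *d b) - ⟦b⟧ ^+ 2 / 2) - 1 + x *d b| <= ⟦b⟧ ^+ 2 * G x.
Proof.
move=> b1; set u := - (x *d b) - ⟦b⟧ ^+ 2 / 2.
have b0 := enorm_ge0 b; have x0 := enorm_ge0 x.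
have bb : ⟦b⟧ ^+ 2 <= ⟦b⟧ by rewrite expr2 ler_piMr.
have u1 : `|u| <= ⟦b⟧ * (⟦x⟧ + 1).
  have := normr_dotrV_le x b; rewrite /u !ler_norml => /andP[h1 h2].
  have := sqr_ge0 ⟦b⟧ => h3.
  by apply/andP; split; nra.
have u2 : `|u| <= ⟦x⟧ + 1.
  by rewrite (le_trans u1)// ler_piMl// addr_ge0.
have h1 := expR_taylor2 u.
have h2 : 2 * u ^+ 2 * expR `|u| <= ⟦b⟧ ^+ 2 * (2 * (⟦x⟧ + 1) ^+ 2 * (expR 1 * expR (1 * ⟦x⟧))).
  rewrite -expRD mul1r [leRHS](_ : _ = 2 * (⟦b⟧ * (⟦x⟧ + 1)) ^+ 2 * expR (1 + ⟦x⟧)); last first.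
    by ring.
  apply: ler_pM; rewrite ?expR_ge0//; last by rewrite ler_expR addrC.
    exact: mulr_ge0 (sqr_ge0 _).
  rewrite ler_wpM2l// -[u ^+ 2]real_normK ?num_real// lerXn2r ?nnegrE//.
  by rewrite mulr_ge0// addr_ge0.
have -> : expR u - 1 + x *d b = (expR u - 1 - u) - ⟦b⟧ ^+ 2 / 2 by rewrite /u; ring.
rewrite (le_trans (ler_normB _ _))// /G mulrDr mulr1 lerD//; first exact: le_trans h2.
rewrite ger0_norm ?mulr_ge0 ?invr_ge0 ?sqr_ge0//.
by rewrite ler_pdivrMr// ler_peMr ?sqr_ge0// ler1n.
Qed.

(* The first order in [b] of the invariance of [mu] under the shift by [b],
   whose density is [exp (- x . b - |b|^2/2)]. *)
Lemma gauss_ibp (L B : R) q w (b : E) : 0 <= B -> sm L B q w ->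
  \int[mu]_x ((x *d b) * q x) = \int[mu]_x (w x *d b).
Proof.
move=> B0 qw; have tq := tame_sm qw.
have tc i : tame (fun x : E => x ord0 i) by exact: tame_coord.
have tw i : tame (fun x => w x ord0 i) by exact: tame_grad qw.
have tb (b' : E) i : tame (fun _ : E => b' ord0 i) by exact: tame_cst.
have txb (b' : E) : tame (fun x => x *d b') by exact: tame_dot.
have twb (b' : E) : tame (fun x => w x *d b') by exact: tame_dot.
pose D (b' x : E) := (x *d b') * q x - w x *d b'.
have tD b' : tame (D b') by apply: tameB => //; exact: tameM.
have tqG : tame (fun x => `|q x| * G x) by apply: tameM => //; exact: tame_norm.
pose C := \int[mu]_x (B + `|q x| * G x).
have key b' : ⟦b'⟧ <= 1 -> `|\int[mu]_x D b' x| <= ⟦b'⟧ ^+ 2 * C.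
  move=> b1; pose r x := expR (qpot (fun=> c) x - qpot (fun=> c) (x + b')).
  have rE x : r x = expR (- (x *d b') - ⟦b'⟧ ^+ 2 / 2) by rewrite /r qpotD.
  have wr x : `|r x - 1 + x *d b'| <= ⟦b'⟧ ^+ 2 * G x by rewrite rE; exact: weight.
  have tr : tame r.
    have tT : tame (fun x => ⟦b'⟧ ^+ 2 * G x + 1 + `|x *d b'|).
      apply: tameD; last exact: tame_norm.
      by apply: tameD (tame_cst 1); exact: tameZ.
    apply: tame_le tT _ => [|x].
      apply: measurableT_comp => //; under eq_fun do rewrite qpotD.
      by apply: measurable_funB => //; apply: measurable_funN; case: (txb b').
    rewrite [leRHS]ger0_norm ?addr_ge0//; last first.
      exact: le_trans (wr x).
    have -> : r x = (r x - 1 + x *d b') + 1 - x *d b' by ring.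
    rewrite (le_trans (ler_normB _ _))// lerD2r (le_trans (ler_normD _ _))//.
    by rewrite normr1 lerD2r.
  have e := int_shift muG tq tr; rewrite -/(r _) in e.
  have tqs : tame (fun x => q (x - b')) by exact: tame_shift.
  have tqr : tame (fun x => q x * r x) by exact: tameM.
  have -> : \int[mu]_x D b' x = \int[mu]_x (D b' x - (q (x - b') - q x * r x)).
    by rewrite (intB muG (tD b') (tameB tqs tqr)) (intB muG tqs tqr) e subrr subr0.
  have tS := tameB (tD b') (tameB tqs tqr).
  have tBG := tameD (tame_cst B) tqG.
  rewrite (le_trans (int_abs muG tS))// /C -(intZ muG _ tBG).
  apply: (int_le muG (tame_norm tS) (tameZ _ tBG)) => x.
  have [_ hq] := qw; have h1 := hq x (x - b').
  have xbx : x - b' - x = - b' by rewrite addrAC subrr add0r.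
  rewrite xbx dotrVNr opprK enormN in h1.
  have -> : D b' x - (q (x - b') - q x * r x) =
     q x * (r x - 1 + x *d b') - (q (x - b') - q x + w x *d b') by rewrite /D; ring.
  have h2 : `|q x * (r x - 1 + x *d b')| <= ⟦b'⟧ ^+ 2 * (`|q x| * G x).
    by rewrite normrM [leRHS]mulrCA ler_wpM2l.
  rewrite (le_trans (ler_normB _ _))// [leRHS]mulrDr [leRHS]addrC [_ * B]mulrC; exact: lerD.
have C0 : 0 <= C by apply: int_ge0 => x; exact: addr_ge0 B0 (mulr_ge0 (normr_ge0 _) (G0 x)).
apply/eqP; rewrite -subr_eq0 -(intB muG (tameM (txb b) tq) (twb b)) -normr_le0.
(* [D b] is linear in [b] while its integral is quadratically small: apply [key] to [d *: b], divide
   by [d] and let [d] tend to 0. *)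
apply/ler_addgt0Pr => e e0; rewrite add0r.
pose k := ⟦b⟧ ^+ 2 * C; have k0 : 0 <= k by rewrite mulr_ge0 ?sqr_ge0.
pose d := Num.min (⟦b⟧ + 1)^-1 (e / (k + 1)).
have b1 : 0 < ⟦b⟧ + 1 by rewrite ltr_pwDr.
have k1 : 0 < k + 1 by rewrite ltr_pwDr.
have d0 : 0 < d by rewrite lt_min invr_gt0 b1 divr_gt0.
have db : ⟦d *: b⟧ <= 1.
  rewrite enormZ gtr0_norm//; have : d <= (⟦b⟧ + 1)^-1 by rewrite ge_min lexx.
  rewrite -(ler_pM2r b1) mulVf ?gt_eqF//; apply: le_trans.
  by rewrite ler_wpM2l ?(ltW d0)// lerDl.
have dk : d * k <= e.
  have : d <= e / (k + 1) by rewrite ge_min lexx orbT.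
  rewrite ler_pdivlMr//; apply: le_trans; by rewrite ler_wpM2l ?(ltW d0)// lerDl.
have := key _ db.
have -> : \int[mu]_x D (d *: b) x = d * \int[mu]_x D b x.
  rewrite -(intZ muG _ (tD b)); apply: eq_Rintegral => x _.
  by rewrite /D !dotrVZr; ring.
rewrite normrM enormZ (gtr0_norm d0) exprMn -mulrA -/k expr2 -mulrA ler_pM2l//.
by move=> h; exact: le_trans h dk.
Qed.

End gauss_ibp.

Section gauss_line1.
Context {R : realType}.
Local Notation E1 := 'rV[R]_1.

(** Carries the Gaussian of the line over to row vectors of length 1, where the calculus of [tame],
    [sm] and [glc] applies. *)
Definition row1 (t : measurableTypeR R) : E1 := \row__ t.

Lemma measurable_row1 : measurable_fun setT row1.
Proof. by apply: measurable_fun_rVP => i; under eq_fun do rewrite mxE; exact: measurable_id. Qed.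

HB.instance Definition _ := @isMeasurableFun.Build _ _ _ _ row1 measurable_row1.

Definition gauss1 : probability E1 R := distribution (normal_prob 0 1) row1.

Lemma gauss1_glc : glc gauss1 (qpot (fun=> ln (Num.sqrt (pi *+ 2)))).
Proof.
apply: (@glc_lip _ _ _ 0) => [x y|A mA]; first by rewrite subrr normr0 mul0r.
set F := fun x : E1 => (expR (- qpot (fun=> ln (Num.sqrt (pi *+ 2))) x))%:E.
have mF : measurable_fun setT F.
  apply/measurable_EFinP; apply: measurableT_comp => //; apply: measurable_funN.
  by apply: (@measurable_qpot _ _ 0) => x y; rewrite subrr normr0 mul0r.
have p2 : 0 < Num.sqrt (pi *+ 2) :> R.
  by rewrite sqrtr_gt0 mulrn_wgt0// pi_gt0.
have FE t : F (row1 t) = (normal_pdf 0 1 t)%:E.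
  rewrite normal_pdfE// /F /normal_peak /normal_fun /qpot enorm_sqr /dotrV big_ord1 !mxE.
  rewrite subr0 expr1n mul1r opprD expRD [expR (- ln _)]expRN lnK ?posrE//.
  by rewrite mulrC -expr2 mulNr.
have cE t : cons_rV (t, 0 : 'rV[R]_0) = row1 t.
  by apply/rowP => i; rewrite (ord1 i) cons_rV0 mxE.
have F0 x : (0 <= (F \_ A) x)%E by rewrite erestrict_ge0// => y _; rewrite lee_fin expR_ge0.
have mFA : measurable_fun setT (F \_ A).
  by apply/(measurable_restrictT _ mA); exact: measurable_funTS.
rewrite [RHS]integral_mkcond (ge0_integral_rVS mFA F0).
rewrite /gauss1 /distribution /pushforward /= /normal_prob [LHS]integral_mkcond.
apply: eq_integral => t _; rewrite integral_rV0; last exact: measurable_cons_section.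
rewrite cE /patch -FE.
have -> : (t \in row1 @^-1` A) = (row1 t \in A) by apply/idP/idP; rewrite !inE.
by [].
Qed.

Definition unit1 : E1 := row1 1.

Lemma dot_unit1 v : v *d unit1 = v ord0 ord0.
Proof. by rewrite /dotrV big_ord1 mxE mulr1. Qed.

Lemma enorm_unit1 : ⟦unit1⟧ = 1.
Proof. by apply/eqP; rewrite -(eqrXn2 (n := 2))// expr1n enorm_sqr dot_unit1 mxE. Qed.

Lemma gauss1_ibp (L B : R) q w : 0 <= B -> sm L B q w ->
  \int[gauss1]_v (v ord0 ord0 * q v) = \int[gauss1]_v w v ord0 ord0.
Proof.
move=> B0 qw; have := gauss_ibp gauss1_glc unit1 B0 qw.
by under eq_Rintegral do rewrite dot_unit1; under [in RHS]eq_Rintegral do rewrite dot_unit1.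
Qed.

Lemma gauss1_sqr : \int[gauss1]_v v ord0 ord0 ^+ 2 = 1.
Proof.
have := gauss1_ibp (lexx 0) (sm_lin unit1 0).
under eq_Rintegral do rewrite dotrVC dot_unit1 addr0 -expr2.
by move=> ->; under eq_Rintegral do rewrite mxE; rewrite (int_cst gauss1).
Qed.

Lemma gauss1_abs : \int[gauss1]_v `|v ord0 ord0| <= 1.
Proof.
have tt := @tame_coord R 1 ord0; have ta := tame_norm tt.
have := vr_ge0 gauss1_glc ta; rewrite vrE.
under eq_Rintegral do rewrite real_normK ?num_real//.
rewrite gauss1_sqr subr_ge0 -[leRHS](expr1n _ 2) ler_pXn2r ?nnegrE//.
by apply: int_ge0.
Qed.

End gauss_line1.

Section trig.
Context {R : realType}.

Lemma derivable_lip (f f' : R -> R) (K : R) : (forall x : R, is_derive x 1 f (f' x)) ->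
  (forall x, `|f' x| <= K) -> forall x y, `|f y - f x| <= K * `|y - x|.
Proof.
move=> df fK x y.
have h a b : a < b -> `|f b - f a| <= K * `|b - a|.
  move=> ab; have fc : {within `[a, b], continuous f}.
    by apply: derivable_within_continuous => t _; have [] := df t.
  have [c _ ->] := MVT ab (fun t _ => df t) fc.
  by rewrite normrM ler_wpM2r.
have [xy|xy|->] := ltgtP x y; first exact: h.
  by rewrite distrC [`|y - x|]distrC; exact: h.
by rewrite !subrr !normr0 mulr0.
Qed.

Lemma derivable_taylor (f f' : R -> R) : (forall x : R, is_derive x 1 f (f' x)) ->
  (forall x y, `|f' y - f' x| <= `|y - x|) ->
  forall x y, `|f y - f x - f' x * (y - x)| <= (y - x) ^+ 2.
Proof.
move=> df fL x y; rewrite -real_normK ?num_real//.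
have h a b : a < b -> exists2 c, a < c < b & f b - f a = f' c * (b - a).
  move=> ab; have fc : {within `[a, b], continuous f}.
    by apply: derivable_within_continuous => t _; have [] := df t.
  by have [c cab ->] := MVT ab (fun t _ => df t) fc; exists c; rewrite // -in_itv.
have [xy|xy|->] := ltgtP x y; last by rewrite !subrr mulr0 subrr normr0 expr0n.
  have [c /andP[c1 c2] ->] := h _ _ xy.
  rewrite -mulrBl normrM expr2 ler_wpM2r// (le_trans (fL _ _))//.
  by rewrite !ger0_norm ?subr_ge0 ?(ltW xy) ?(ltW c1)// lerD2r ltW.
have [c /andP[c1 c2] e] := h _ _ xy.
have -> : f y - f x - f' x * (y - x) = (f' x - f' c) * (x - y).
  by rewrite mulrBl -e; ring.
rewrite normrM expr2 [`|x - y|]distrC ler_wpM2r// (le_trans (fL _ _))//.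
rewrite [leRHS]distrC ger0_norm ?subr_ge0 ?(ltW c2)// ger0_norm ?subr_ge0 ?(ltW xy)//.
by rewrite lerD2l lerN2 ltW.
Qed.

Lemma sin_lip (x y : R) : `|sin y - sin x| <= `|y - x|.
Proof.
rewrite -[leRHS]mul1r; apply: (derivable_lip (f' := cos)) => // t; exact: cos_max.
Qed.

Lemma cos_lip (x y : R) : `|cos y - cos x| <= `|y - x|.
Proof.
rewrite -[leRHS]mul1r; apply: (derivable_lip (f' := fun t => - sin t)) => // t.
by rewrite normrN; exact: sin_max.
Qed.

Lemma sin_taylor (x y : R) : `|sin y - sin x - cos x * (y - x)| <= (y - x) ^+ 2.
Proof. by apply: (derivable_taylor (f' := cos)) => // *; exact: cos_lip. Qed.

Lemma cos_taylor (x y : R) : `|cos y - cos x + sin x * (y - x)| <= (y - x) ^+ 2.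
Proof.
have := @derivable_taylor cos (fun t => - sin t) (fun t => is_derive_cos t) _ x y.
rewrite mulNr opprK; apply => a b.
by rewrite opprK addrC distrC; exact: sin_lip.
Qed.

End trig.

Section stein.
Context {R : realType} {n : nat}.
Local Notation E := 'rV[R]_n.
Local Notation E1 := 'rV[R]_1.
Variables (mu : probability E R) (V : E -> R).
Hypothesis muV : glc mu V.
Hypothesis poinc : forall (L B : R) f w, 0 <= L -> 0 <= B -> sm L B f w ->
  vr mu f <= \int[mu]_x ⟦w x⟧ ^+ 2.
Variable sigma : E.
Hypothesis sigma1 : ⟦sigma⟧ = 1.

Let c := \int[mu]_x (sigma *d x).
Let tau (x : E) := sigma *d x - c.
Let d := 1 - vr mu (fun x => sigma *d x).
Local Notation g1 := (@gauss1 R).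
Let g1V := @gauss1_glc R.
Let t (v : E1) := v ord0 ord0.

Let tt : tame t. Proof. exact: tame_coord. Qed.
Let tta : tame (fun v => `|t v|). Proof. exact: tame_norm. Qed.

Let sigma2 : sigma *d sigma = 1. Proof. by rewrite -enorm_sqr sigma1 expr1n. Qed.

(* [zr (cos th) (sin th) x v] rotates the pair (component of [x] along [sigma],
   centered; independent Gaussian [v]) by the angle [th]. *)
Definition zr (p q : R) (x : E) (v : E1) : E := x + ((p - 1) * tau x + q * t v) *: sigma.

(** Linear part of [zr p q] in [x]: it scales the component along [sigma] by [p] and is
    self-adjoint, so it transports gradients as well. *)
Definition contr (p : R) (u : E) : E := u + ((p - 1) * (u *d sigma)) *: sigma.

Let contrB p u u' : contr p u - contr p u' = contr p (u - u').
Proof. by rewrite /contr dotrVDl dotrVNl; apply/rowP => i; rewrite !mxE; ring. Qed.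

Let contr_dot p u u' : contr p u *d u' = u *d contr p u'.
Proof. by rewrite /contr !dotrVE (dotrVC u' sigma); ring. Qed.

Let contr_sigma p u : contr p u *d sigma = p * (u *d sigma).
Proof. by rewrite /contr !dotrVE sigma2; ring. Qed.

Lemma contr_le p u : p ^+ 2 <= 1 -> ⟦contr p u⟧ <= ⟦u⟧.
Proof.
move=> p1; rewrite -(ler_pXn2r (n := 2)) ?nnegrE// !enorm_sqr /contr !dotrVE sigma2.
rewrite (dotrVC sigma u); set a := u *d sigma.
have : 0 <= (1 - p ^+ 2) * a ^+ 2 by rewrite mulr_ge0 ?sqr_ge0// subr_ge0.
by move: (u *d u) => b; clearbody a; lra.
Qed.

Let zrB p q x y v : zr p q y v - zr p q x v = contr p (y - x).
Proof.
rewrite /zr /contr /tau dotrVDl dotrVNl (dotrVC y) (dotrVC x).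
by apply/rowP => i; rewrite !mxE; ring.
Qed.

Definition avg (p q : R) (a : E1 -> R) (f : E -> R) (x : E) : R :=
  \int[g1]_v (a v * f (zr p q x v)).

Lemma lip_zr L p q f x : 0 <= L -> lip L f -> lip (L * `|q|) (fun v => f (zr p q x v)).
Proof.
move=> L0 fL u v; rewrite (le_trans (fL _ _))// -mulrA ler_wpM2l//.
have -> : zr p q x v - zr p q x u = (q * (t v - t u)) *: sigma.
  by apply/rowP => i; rewrite /zr !mxE; ring.
rewrite enormZ sigma1 mulr1 normrM ler_wpM2l//.
by rewrite (le_trans _ (ler_coord_enorm _ ord0))// /t !mxE.
Qed.

Lemma tame_zr L p q a f x : 0 <= L -> lip L f -> tame a -> tame (fun v => a v * f (zr p q x v)).
Proof. by move=> L0 fL ta; apply: tameM => //; exact: tame_lip (lip_zr p q x L0 fL). Qed.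

Lemma avg_lip L p q a f : 0 <= L -> p ^+ 2 <= 1 -> lip L f -> tame a ->
  lip (L * \int[g1]_v `|a v|) (avg p q a f).
Proof.
move=> L0 p1 fL ta x y; have tn := tame_norm ta.
have tz x := tame_zr p q x L0 fL ta.
rewrite /avg -(intB g1V (tz y) (tz x)) (le_trans (int_abs g1V (tameB (tz y) (tz x))))//.
have -> : L * \int[g1]_v `|a v| * ⟦y - x⟧ = (L * ⟦y - x⟧) * \int[g1]_v `|a v| by ring.
rewrite -(intZ g1V _ tn); apply: (int_le g1V) => [||v].
- exact/tame_norm/tameB.
- exact: tameZ.
rewrite -mulrBr normrM mulrC ler_wpM2r// (le_trans (fL _ _))// ler_wpM2l// zrB.
exact: contr_le.
Qed.

Lemma tame_avg L p q a f : 0 <= L -> p ^+ 2 <= 1 -> lip L f -> tame a -> tame (avg p q a f).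
Proof. by move=> L0 p1 fL ta; exact: tame_lip (avg_lip q L0 p1 fL ta). Qed.

Section smooth_test.
Variables (B : R) (f : E -> R) (w : E -> E).
Hypothesis B0 : 0 <= B.
Hypothesis fw : sm 1 B f w.

Let f1 : lip 1 f. Proof. exact: sm_lip fw. Qed.
Let B60 : 0 <= 6 * B. Proof. by rewrite mulr_ge0. Qed.
Let df (x : E) := w x *d sigma.

Let df_le x : `|df x| <= 1.
Proof.
by rewrite (le_trans (normr_dotrV_le _ _))// sigma1 mulr1; case: fw.
Qed.

Let df_lip : lip (6 * B) df.
Proof.
move=> x y; rewrite /df -dotrVNl -dotrVDl (le_trans (normr_dotrV_le _ _))// sigma1 mulr1.
exact: sm_grad_lip fw _ _.
Qed.

Section angle.
Variables p q : R.
Hypothesis p1 : p ^+ 2 <= 1.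

(** The test function of the perturbed Poincare inequality: the mean of [v f (zr p q x v)] over the
    Gaussian [v]. As [E |v| <= 1], it inherits from [f] the Lipschitz constant 1 and the remainder
    constant [B], with gradient [wh]. *)
Let h := avg p q t f.
Let Aw i (x : E) := contr p (w x) ord0 i.
Let wh (x : E) : E := \row_i avg p q t (Aw i) x.

Let Aw_lip i : lip (6 * B) (Aw i).
Proof.
move=> x y; have -> : Aw i y - Aw i x = (contr p (w y) - contr p (w x)) ord0 i by rewrite /Aw !mxE.
rewrite contrB (le_trans (ler_coord_enorm _ _))// (le_trans (contr_le _ p1))//.
exact: sm_grad_lip fw _ _.
Qed.

Let tAw x u : tame (fun v => t v * (contr p (w (zr p q x v)) *d u)).
Proof.
have -> : (fun v => t v * (contr p (w (zr p q x v)) *d u)) =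
    (fun v => \sum_i (t v * Aw i (zr p q x v)) * u ord0 i).
  by apply/funext => v; rewrite mulr_sumr; apply: eq_bigr => i _; rewrite mulrA.
apply: tame_sum => i _; apply: tameM; last exact: tame_cst.
exact: tame_zr B60 (Aw_lip i) tt.
Qed.

Let wh_dot x u : wh x *d u = \int[g1]_v (t v * (contr p (w (zr p q x v)) *d u)).
Proof.
rewrite /dotrV.
under [RHS]eq_Rintegral do rewrite mulr_sumr.
have tz i : tame (fun v => t v * Aw i (zr p q x v)) by exact: tame_zr B60 (Aw_lip i) tt.
have tz' i : tame (fun v => t v * (contr p (w (zr p q x v)) ord0 i * u ord0 i)).
  have := tameM (tz i) (tame_cst (u ord0 i)).
  by under eq_fun do rewrite -mulrA.
rewrite (int_sum g1V (index_enum 'I_n) (P := xpredT) (F := fun i v =>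
  t v * (contr p (w (zr p q x v)) ord0 i * u ord0 i)))//.
apply: eq_bigr => i _; rewrite mxE mulrC -(intZ g1V _ (tz i)).
by apply: eq_Rintegral => v _; rewrite /Aw; ring.
Qed.

(** Testing [wh x] against itself gives [|wh|^2 <= |wh| E |v|], which reduces the vector-valued
    bound to a scalar integral. *)
Let wh_le x : ⟦wh x⟧ <= 1.
Proof.
have h1 : ⟦wh x⟧ ^+ 2 <= ⟦wh x⟧.
  rewrite enorm_sqr wh_dot.
  apply: (@le_trans _ _ (\int[g1]_v (⟦wh x⟧ * `|t v|))).
    apply: (int_le g1V) => [||v]; [exact: tAw|exact: tameZ|].
    rewrite (le_trans (ler_norm _))// normrM mulrC ler_wpM2r//.
    rewrite (le_trans (normr_dotrV_le _ _))// ler_piMl// (le_trans (contr_le _ p1))//.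
    by case: fw.
  by rewrite (intZ g1V _ tta) ler_piMr// gauss1_abs.
have [->|w0] := eqVneq ⟦wh x⟧ 0 => //.
have w1 : 0 < ⟦wh x⟧ by rewrite lt0r w0 enorm_ge0.
by rewrite -(ler_pM2l w1) mulr1 -expr2.
Qed.

Let h_sm : sm 1 B h wh.
Proof.
split=> // x y; have tz x := tame_zr p q x ler01 f1 tt.
have tA := tAw x (y - x).
rewrite wh_dot /h /avg -(intB g1V (tz y) (tz x)) -(intB g1V (tameB (tz y) (tz x)) tA).
rewrite (le_trans (int_abs g1V (tameB (tameB (tz y) (tz x)) tA)))//.
apply: (@le_trans _ _ (\int[g1]_v (B * ⟦y - x⟧ ^+ 2 * `|t v|))); last first.
  by rewrite (intZ g1V _ tta) ler_piMr ?gauss1_abs// mulr_ge0 ?sqr_ge0.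
apply: (int_le g1V) => [||v]; [exact/tame_norm/tameB/tA/tameB|exact: tameZ|].
rewrite -!mulrBr normrM mulrC ler_wpM2r//.
have [_ hf] := fw; have := hf (zr p q x v) (zr p q y v).
rewrite zrB contr_dot => /le_trans; apply.
by rewrite ler_wpM2l// lerXn2r ?nnegrE// contr_le.
Qed.

Let wh_sigma x : wh x *d sigma = p * avg p q t df x.
Proof.
rewrite wh_dot /avg -(intZ g1V _ (tame_zr p q x B60 df_lip tt)).
by apply: eq_Rintegral => v _; rewrite contr_sigma /df; ring.
Qed.

(** Integration by parts in [v]: [f (zr p q x v)] has derivative [q] times that of [f] along
    [sigma]. With [wh_sigma], it expresses both terms of [slope] through the single function [h]. *)
Let h_ibp x : h x = q * avg p q (fun=> 1) df x.
Proof.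
pose wq (v : E1) : E1 := \row__ (q * df (zr p q x v)).
have qw : sm `|q| (B * q ^+ 2) (fun v => f (zr p q x v)) wq.
  split=> [v|u v].
    have -> : wq v = (q * df (zr p q x v)) *: unit1.
      by apply/rowP => i; rewrite !mxE mulr1.
    by rewrite enormZ enorm_unit1 mulr1 normrM ler_piMr.
  have zE : zr p q x v - zr p q x u = (q * (t v - t u)) *: sigma.
    by apply/rowP => i; rewrite /zr !mxE; ring.
  have [_ hf] := fw; have := hf (zr p q x u) (zr p q x v); rewrite zE.
  have -> : wq u *d (v - u) = w (zr p q x u) *d ((q * (t v - t u)) *: sigma).
    by rewrite dotrVZr -/(df _) /dotrV big_ord1 !mxE /t; ring.
  move=> /le_trans; apply; rewrite -mulrA ler_wpM2l// enormZ sigma1 mulr1.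
  rewrite normrM exprMn real_normK ?num_real// ler_wpM2l ?sqr_ge0//.
  by rewrite lerXn2r ?nnegrE// (le_trans _ (ler_coord_enorm _ ord0))// /t !mxE.
have t1 : tame (fun v => 1 * df (zr p q x v)) := tame_zr p q x B60 df_lip (tame_cst 1).
rewrite /h /avg (gauss1_ibp (mulr_ge0 B0 (sqr_ge0 q)) qw) -(intZ g1V _ t1).
by apply: eq_Rintegral => v _; rewrite mxE mul1r.
Qed.

(* The derivative in the angle of the expectation of [f] at [p = cos th],
   [q = sin th]. *)
Definition slope := \int[mu]_x (p * avg p q t df x - q * tau x * avg p q (fun=> 1) df x).

Lemma slope_le : `|slope| <= Num.sqrt d.
Proof.
have ar1 (vs v I X Y s : R) : 0 <= s ^+ 2 * v -> s ^+ 2 * I <= s ^+ 2 * 1 ->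
    vs + s ^+ 2 * v + 2 * (s * Y) <= 1 + (2 * s * X + s ^+ 2 * I) ->
    2 * s * (Y - X) <= 1 - vs + s ^+ 2 by lra.
have ar2 (X Y a : R) : 2 * (Y - X) * (Y - X) <= a + (Y - X) ^+ 2 -> (X - Y) ^+ 2 <= a by lra.
have th := tame_sm h_sm; have ts := tame_lin sigma.
have twh : tame (fun x => wh x *d sigma).
  by apply: tame_dot => i; [exact: tame_grad h_sm|exact: tame_cst].
have ttau : tame tau by exact: tameB ts (tame_cst c).
pose X := \int[mu]_x (wh x *d sigma).
pose Y := cvr mu (fun x => sigma *d x) h.
have slopeE : slope = X - Y.
  have -> : Y = \int[mu]_x (tau x * h x).
    have -> : \int[mu]_x (tau x * h x) = \int[mu]_x (sigma *d x * h x - c * h x).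
      by apply: eq_Rintegral => x _; rewrite /tau mulrBl.
    by rewrite (intB muV (tameM ts th) (tameZ c th)) (intZ muV c th).
  rewrite /slope -(intB muV twh (tameM ttau th)).
  by apply: eq_Rintegral => x _; rewrite wh_sigma h_ibp; ring.
(* Poincare inequality for [sigma . x + s h], using [int |wh|^2 <= 1] and dropping the variance of
   [h]. The choice [s = Y - X] turns it into [(Y - X)^2 <= d]. *)
have key s : 2 * s * (Y - X) <= d + s ^+ 2.
  have hs := sm_add (sm_lin sigma 0) (sm_scale s h_sm).
  have L0 : 0 <= ⟦sigma⟧ + `|s| * 1 by rewrite addr_ge0// mulr1.
  have Bs : 0 <= 0 + `|s| * B by rewrite add0r mulr_ge0.
  have := poinc L0 Bs hs.
  have -> : vr mu (fun x => sigma *d x + 0 + s * h x) =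
      vr mu (fun x => sigma *d x) + s ^+ 2 * vr mu h + 2 * (s * Y).
    rewrite (_ : (fun x => _) = (fun x => sigma *d x + s * h x)); last first.
      by apply/funext => x; rewrite addr0.
    by rewrite (vrD muV ts (tameZ s th)) (vrZ muV _ th) (cvrZr muV _ th ts).
  have tw2 : tame (fun x => ⟦wh x⟧ ^+ 2) by apply: tame_enorm_sqr => i; exact: tame_grad h_sm.
  have -> : \int[mu]_x ⟦sigma + s *: wh x⟧ ^+ 2 = 1 + (2 * s * X + s ^+ 2 * \int[mu]_x ⟦wh x⟧ ^+ 2).
    rewrite -(intZ muV _ twh) -(intZ muV _ tw2) -(intD muV (tameZ _ twh) (tameZ _ tw2)).
    rewrite -{1}(int_cst mu 1) -(intD muV (tame_cst 1) (tameD (tameZ _ twh) (tameZ _ tw2))).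
    by apply: eq_Rintegral => x _; rewrite !enorm_sqr !dotrVE sigma2 (dotrVC sigma); ring.
  have w1 : \int[mu]_x ⟦wh x⟧ ^+ 2 <= 1.
    rewrite -[leRHS](int_cst mu); apply: (int_le muV tw2 (tame_cst 1)) => x.
    by rewrite exprn_ile1.
  have vh := vr_ge0 muV th.
  have := ler_wpM2l (sqr_ge0 s) w1; have := mulr_ge0 (sqr_ge0 s) vh.
  exact: ar1.
have h2 : slope ^+ 2 <= d.
  by rewrite slopeE; exact: ar2.
by rewrite -sqrtr_sqr ler_wsqrtr.
Qed.

End angle.

Let Theta (u : E1) := \int[mu]_x avg (cos (t u)) (sin (t u)) (fun=> 1) f x.
Let slope_row (u : E1) : E1 := \row__ slope (cos (t u)) (sin (t u)).

Let cos1 (u : R) : cos u ^+ 2 <= 1.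
Proof. by rewrite -(cos2Dsin2 u) lerDl sqr_ge0. Qed.

Let one_tame : tame (fun _ : E1 => 1 : R). Proof. exact: tame_cst. Qed.

Let rot_step (p q p' q' h tx : R) x v : (p' - p) ^+ 2 <= h ^+ 2 -> (q' - q) ^+ 2 <= h ^+ 2 ->
  `|p' - p + q * h| <= h ^+ 2 -> `|q' - q - p * h| <= h ^+ 2 -> tx = tau x ->
  `|f (zr p' q' x v) - f (zr p q x v) - h * (p * (t v * df (zr p q x v)) - q * tx * df (zr p q x v))|
  <= h ^+ 2 * (2 * B * (tx ^+ 2 + t v ^+ 2) + (`|tx| + `|t v|)).
Proof.
move=> hp hq hp2 hq2 ->.
have zE : zr p' q' x v - zr p q x v = ((p' - p) * tau x + (q' - q) * t v) *: sigma.
  by apply/rowP => i; rewrite /zr !mxE; ring.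
move: zE; set z := zr p q x v; set y := t v; set ta := tau x => zE.
have [_ hf] := fw; have := hf z (zr p' q' x v); rewrite zE dotrVZr -/(df z) enormZ sigma1 mulr1.
rewrite real_normK ?num_real// => h1.
have h2 : ((p' - p) * ta + (q' - q) * y) ^+ 2 <= h ^+ 2 * (2 * (ta ^+ 2 + y ^+ 2)).
  have e1 : 0 <= ((p' - p) * ta - (q' - q) * y) ^+ 2 by exact: sqr_ge0.
  have e2 := ler_wpM2r (sqr_ge0 ta) hp; have e3 := ler_wpM2r (sqr_ge0 y) hq.
  rewrite -exprMn in e2; rewrite -exprMn in e3.
  by move: e1 e2 e3; set A := _ * ta; set D := _ * y => e1 e2 e3; lra.
have h3 : `|((p' - p + q * h) * ta + (q' - q - p * h) * y) * df z| <= h ^+ 2 * (`|ta| + `|y|).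
  rewrite normrM (le_trans (ler_piMr _ (df_le z)))// (le_trans (ler_normD _ _))//.
  by rewrite [leRHS]mulrDr !normrM lerD// ler_wpM2r.
have -> : f (zr p' q' x v) - f z - h * (p * (y * df z) - q * ta * df z) =
  (f (zr p' q' x v) - f z - ((p' - p) * ta + (q' - q) * y) * df z) +
  ((p' - p + q * h) * ta + (q' - q - p * h) * y) * df z by ring.
rewrite (le_trans (ler_normD _ _))// [leRHS]mulrDr lerD// (le_trans h1)//.
have -> : h ^+ 2 * (2 * B * (ta ^+ 2 + y ^+ 2)) = B * (h ^+ 2 * (2 * (ta ^+ 2 + y ^+ 2))) by ring.
exact: ler_wpM2l.
Qed.

Let avg_step (p q p' q' h : R) x : p ^+ 2 <= 1 -> p' ^+ 2 <= 1 ->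
  (p' - p) ^+ 2 <= h ^+ 2 -> (q' - q) ^+ 2 <= h ^+ 2 ->
  `|p' - p + q * h| <= h ^+ 2 -> `|q' - q - p * h| <= h ^+ 2 ->
  `|avg p' q' (fun=> 1) f x - avg p q (fun=> 1) f x -
     h * (p * avg p q t df x - q * tau x * avg p q (fun=> 1) df x)|
  <= h ^+ 2 * (2 * B * (tau x ^+ 2 + 1) + (`|tau x| + 1)).
Proof.
move=> p1 p'1 hp hq hp2 hq2.
pose tx := tau x.
have tf := tame_zr p q x ler01 f1 one_tame.
have tf' := tame_zr p' q' x ler01 f1 one_tame.
have td1 := tame_zr p q x B60 df_lip one_tame.
have tdt := tame_zr p q x B60 df_lip tt.
pose D v := 1 * f (zr p' q' x v) - 1 * f (zr p q x v) -
  h * (p * (t v * df (zr p q x v)) - q * tx * (1 * df (zr p q x v))).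
have tD : tame D.
  by apply: tameB; [exact: tameB|apply: tameZ; apply: tameB; exact: tameZ].
have -> : avg p' q' (fun=> 1) f x - avg p q (fun=> 1) f x -
     h * (p * avg p q t df x - q * tau x * avg p q (fun=> 1) df x) = \int[g1]_v D v.
  rewrite /avg -/tx -(intZ g1V p tdt) -(intZ g1V (q * tx) td1).
  rewrite -(intB g1V (tameZ p tdt) (tameZ _ td1)) -(intZ g1V h (tameB (tameZ p tdt) (tameZ _ td1))).
  by rewrite -(intB g1V tf' tf) -(intB g1V (tameB tf' tf) (tameZ h (tameB (tameZ p tdt) (tameZ _ td1)))).
have t2 : tame (fun v => t v ^+ 2) by exact: tameX.
rewrite (le_trans (int_abs g1V tD))//.
pose k1 := h ^+ 2 * (2 * B); pose k0 := h ^+ 2 * (2 * B * tx ^+ 2 + `|tx|).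
have tM : tame (fun v => k0 + (k1 * t v ^+ 2 + h ^+ 2 * `|t v|)).
  by apply: tameD (tame_cst k0) _; apply: tameD; exact: tameZ.
apply: (@le_trans _ _ (\int[g1]_v (k0 + (k1 * t v ^+ 2 + h ^+ 2 * `|t v|)))).
  apply: (int_le g1V (tame_norm tD) tM) => v.
  have := rot_step v hp hq hp2 hq2 (erefl (tau x)); rewrite /D !mul1r -/tx => /le_trans; apply.
  by rewrite /k0 /k1 le_eqVlt; apply/orP; left; apply/eqP; ring.
rewrite (intD g1V (tame_cst k0) (tameD (tameZ k1 t2) (tameZ (h ^+ 2) tta))) (int_cst g1).
rewrite (intD g1V (tameZ k1 t2) (tameZ (h ^+ 2) tta)) (intZ g1V _ t2) (intZ g1V _ tta).
rewrite gauss1_sqr.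
have h2 := ler_wpM2l (sqr_ge0 h) (@gauss1_abs R); rewrite mulr1 in h2.
have -> : h ^+ 2 * (2 * B * (tau x ^+ 2 + 1) + (`|tau x| + 1)) = k0 + (k1 * 1 + h ^+ 2).
  by rewrite /k0 /k1 /tx; ring.
by rewrite lerD2l lerD2l.
Qed.

Let sqr_le_abs (a b : R) : `|a| <= `|b| -> a ^+ 2 <= b ^+ 2.
Proof.
move=> h; rewrite -[a ^+ 2]real_normK ?num_real// -[b ^+ 2]real_normK ?num_real//.
by rewrite lerXn2r ?nnegrE.
Qed.

(** The angle is encoded as a row vector of length 1, so that [sm_lip] integrates the bound on the
    slope; the error of [avg_step] is quadratic in the angle, with a factor integrable against
    [mu]. *)
Let Theta_sm : exists B', sm (Num.sqrt d) B' Theta slope_row.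
Proof.
have ttau : tame tau by exact: tameB (tame_lin sigma) (tame_cst c).
pose M x := 2 * B * (tau x ^+ 2 + 1) + (`|tau x| + 1).
have tM : tame M.
  apply: tameD; last exact: tameD (tame_norm ttau) (tame_cst 1).
  by apply: tameZ; exact: tameD (tameX 2 ttau) (tame_cst 1).
exists (\int[mu]_x M x); split=> [u|u u'].
  have -> : slope_row u = slope (cos (t u)) (sin (t u)) *: unit1.
    by apply/rowP => i; rewrite !mxE mulr1.
  by rewrite enormZ enorm_unit1 mulr1 slope_le.
set p := cos (t u); set q := sin (t u); set p' := cos (t u'); set q' := sin (t u').
pose h := t u' - t u.
have M0 : 0 <= \int[mu]_x M x.
  apply: int_ge0 => x; apply: addr_ge0; last exact: addr_ge0.
  by apply: mulr_ge0; [exact: mulr_ge0|exact: addr_ge0 (sqr_ge0 _) ler01].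
apply: (@le_trans _ _ (h ^+ 2 * \int[mu]_x M x)); last first.
  rewrite mulrC ler_wpM2l// -[h ^+ 2]real_normK ?num_real// lerXn2r ?nnegrE//.
  by rewrite (le_trans _ (ler_coord_enorm _ ord0))// /h /t !mxE.
have -> : slope_row u *d (u' - u) = h * slope p q.
  by rewrite /dotrV big_ord1 !mxE /h /t mulrC.
have ta1 := tame_avg q ler01 (cos1 _ : p ^+ 2 <= 1) f1 one_tame.
have ta2 := tame_avg q' ler01 (cos1 _ : p' ^+ 2 <= 1) f1 one_tame.
have ta3 := tame_avg q B60 (cos1 _ : p ^+ 2 <= 1) df_lip tt.
have ta4 := tame_avg q B60 (cos1 _ : p ^+ 2 <= 1) df_lip one_tame.
have ta5 : tame (fun x => p * avg p q t df x - q * tau x * avg p q (fun=> 1) df x).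
  by apply: tameB; [exact: tameZ|apply: tameM => //; exact: tameZ].
rewrite /Theta -/p -/q -/p' -/q' /slope.
rewrite -(intZ muV h ta5) -(intB muV ta2 ta1) -(intB muV (tameB ta2 ta1) (tameZ h ta5)).
rewrite (le_trans (int_abs muV (tameB (tameB ta2 ta1) (tameZ h ta5))))// -(intZ muV _ tM).
apply: (int_le muV (tame_norm (tameB (tameB ta2 ta1) (tameZ h ta5))) (tameZ _ tM)) => x.
apply: avg_step; rewrite ?cos1//.
- by apply: sqr_le_abs; exact: cos_lip.
- by apply: sqr_le_abs; exact: sin_lip.
- exact: cos_taylor.
- exact: sin_taylor.
Qed.

(** At angle 0 the Gaussian variable has no effect; at [pi / 2] the component along [sigma] has
    become [c + v]. The factor 2 bounds the length [pi / 2] of the path. *)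
Lemma stein_sm : \int[mu]_x f x - \int[mu]_x avg 0 1 (fun=> 1) f x <= 2 * Num.sqrt d.
Proof.
have [B' h] := Theta_sm; have := sm_lip h (\row__ (pi / 2)) 0.
have -> : Theta 0 = \int[mu]_x f x.
  rewrite /Theta /t mxE cos0 sin0; apply: eq_Rintegral => x _.
  rewrite /avg -[RHS](int_cst g1); apply: eq_Rintegral => v _.
  by rewrite /zr subrr !mul0r addr0 scale0r addr0 mul1r.
have -> : Theta (\row__ (pi / 2)) = \int[mu]_x avg 0 1 (fun=> 1) f x.
  by rewrite /Theta /t mxE cos_pihalf sin_pihalf.
move=> h1; apply: le_trans (le_trans (ler_norm _) h1) _.
rewrite mulrC ler_wpM2r ?sqrtr_ge0// sub0r enormN.
have -> : (\row__ (pi / 2) : E1) = (pi / 2) *: unit1 by apply/rowP => i; rewrite !mxE mulr1.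
rewrite enormZ enorm_unit1 mulr1 ger0_norm ?divr_ge0 ?pi_ge0//.
exact: ltW (pihalf_lt2 R).
Qed.

End smooth_test.

Lemma stein_lip F : lip 1 F ->
  \int[mu]_x F x - \int[mu]_x avg 0 1 (fun=> 1) F x <= 2 * Num.sqrt d.
Proof.
move=> F1; pose G x := `|F x| + 2 * ⟦x⟧ + 1.
have G3 : lip 3 G.
  move=> x y; have h1 := F1 x y; have h2 := ler_dist_enorm y x.
  have -> : G y - G x = (`|F y| - `|F x|) + 2 * (⟦y⟧ - ⟦x⟧) by rewrite /G; ring.
  rewrite (le_trans (ler_normD _ _))// (_ : 3 * ⟦y - x⟧ = 1 * ⟦y - x⟧ + 2 * ⟦y - x⟧); last by ring.
  rewrite lerD//; first exact: le_trans (ler_dist_dist _ _) h1.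
  by rewrite normrM ger0_norm// ler_wpM2l.
have G0 x : 0 <= G x by rewrite addr_ge0// addr_ge0// mulr_ge0.
have tG : tame G := tame_lip G3.
have l1 k : lip 1 (lip_appr F k) by have [B [w [_ h]]] := lip_appr_sm F k; exact: sm_lip h.
have p01 : (0 : R) ^+ 2 <= 1 by rewrite expr0n/=.
have one_tame : tame (fun _ : E1 => 1 : R) by exact: tame_cst.
have l3 : (0 : R) <= 3 by [].
have c1 : \int[mu]_x lip_appr F k x @[k --> \oo] --> \int[mu]_x F x.
  have [] // := @int_cvg _ _ mu V muV (lip_appr F) F G _ _ tG _.
  - by move=> k; exact: measurable_lip (l1 k).
  - by move=> x; exact: lip_appr_cvg.
  - by move=> k x; exact: lip_appr_le.
have c2 : \int[mu]_x avg 0 1 (fun=> 1) (lip_appr F k) x @[k --> \oo] -->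
    \int[mu]_x avg 0 1 (fun=> 1) F x.
  have [] // := @int_cvg _ _ mu V muV (fun k => avg 0 1 (fun=> 1) (lip_appr F k))
     (avg 0 1 (fun=> 1) F) (avg 0 1 (fun=> 1) G) _ _ (tame_avg 1 l3 p01 G3 one_tame) _.
  - by move=> k; have [] := tame_avg 1 ler01 p01 (l1 k) one_tame.
  - move=> x; rewrite /avg.
    have tz k := tame_zr 0 1 x ler01 (l1 k) one_tame.
    have [] // := @int_cvg _ _ g1 _ g1V (fun k v => 1 * lip_appr F k (zr 0 1 x v))
      (fun v => 1 * F (zr 0 1 x v)) (fun v => 1 * G (zr 0 1 x v)) _ _
      (tame_zr 0 1 x l3 G3 one_tame) _.
    + by move=> k; have [] := tz k.
    + by move=> v; rewrite !mul1r; under eq_cvg do rewrite mul1r; exact: lip_appr_cvg.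
    + by move=> k v; rewrite !mul1r; exact: lip_appr_le.
  - move=> k x; have tz := tame_zr 0 1 x ler01 (l1 k) one_tame.
    rewrite /avg (le_trans (int_abs g1V tz))//.
    apply: (int_le g1V (tame_norm tz) (tame_zr 0 1 x l3 G3 one_tame)) => v.
    by rewrite !mul1r; exact: lip_appr_le.
apply: (ler_cvg_to (cvgB c1 c2) (cvg_cst _)); near=> k.
by have [B [w [B0 h]]] := lip_appr_sm F k; exact: stein_sm B0 h.
Unshelve. all: by end_near. Qed.

Lemma integral_tame (m : probability E R) U f : glc m U -> tame f ->
  (\int[m]_x (f x)%:E = (\int[m]_x f x)%:E)%E.
Proof.
move=> mU tf; rewrite /Rintegral fineK//.
exact: integrable_fin_num (tame_int mU tf).
Qed.

(** [zr 0 1 x v] is [(c + v) sigma] plus the projection of [x] onto the orthogonal complement, so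
    averaging over [v] and [x] is integrating over the product measure. Nonnegativity of [f] allows
    Tonelli's theorem, and the duality below is phrased accordingly. *)
Lemma int_tensor L f : 0 <= L -> lip L f -> (forall x, 0 <= f x) ->
  (\int[tensor_sum (gauss_line sigma (c *: sigma)) (marginal_perp sigma mu)]_x (f x)%:E =
   (\int[mu]_x avg 0 1 (fun=> 1) f x)%:E)%E.
Proof.
move=> L0 fL f0.
have mf : measurable_fun setT (EFin \o f) by apply/measurable_EFinP; exact: measurable_lip fL.
have ef0 x : (0 <= (EFin \o f) x)%E by rewrite lee_fin.
have p01 : (0 : R) ^+ 2 <= 1 by rewrite expr0n/=.
have one_tame : tame (fun _ : E1 => 1 : R) by exact: tame_cst.
rewrite [LHS](ge0_integral_distribution _ mf ef0).
have madd : measurable_fun setT ((EFin \o f) \o @add_rV R n).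
  by apply: measurableT_comp => //; exact: measurable_add_rV.
have add0 z : (0 <= ((EFin \o f) \o @add_rV R n) z)%E by exact: ef0.
rewrite (fubini_tonelli2 _ madd add0).
have mG := @measurable_fun_fubini_tonelli_G _ _ _ _ _ (gauss_line sigma (c *: sigma)) _ madd add0.
rewrite [LHS](ge0_integral_distribution _ mG); last by move=> y; exact: integral_ge0.
have inner x : (\int[gauss_line sigma (c *: sigma)]_u (f (u + proj_perp sigma x))%:E =
    (avg 0 1 (fun=> 1) f x)%:E)%E.
  have lz := lip_zr 0 1 x L0 fL.
  have -> : avg 0 1 (fun=> 1) f x = \int[g1]_v f (zr 0 1 x v).
    by apply: eq_Rintegral => v _; rewrite mul1r.
  rewrite /Rintegral fineK; last exact: integrable_fin_num (tame_int g1V (tame_lip lz)).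
  have mz : measurable_fun setT (EFin \o (fun v => f (zr 0 1 x v))).
    by apply/measurable_EFinP; exact: measurable_lip lz.
  rewrite [RHS](ge0_integral_distribution _ mz); last by move=> v; rewrite lee_fin.
  have mp : measurable_fun setT (EFin \o (fun u => f (u + proj_perp sigma x))).
    apply/measurable_EFinP; apply: measurableT_comp; first exact: measurable_lip fL.
    exact: measurable_rV_shift.
  rewrite [LHS](ge0_integral_distribution _ mp); last by move=> v; rewrite lee_fin.
  apply: eq_integral => s _ /=; congr (f _)%:E.
  apply/rowP => i; rewrite /line /proj_perp /zr /tau /t !mxE (dotrVC x); ring.
rewrite /Rintegral fineK; last first.
  exact: integrable_fin_num (tame_int muV (tame_avg 1 L0 p01 fL one_tame)).
by apply: eq_integral => x _; rewrite -inner.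
Qed.

End stein.

(** * Kantorovich-Rubinstein duality *)

Section gordan.
Context {R : realType}.

Let first_order (A Q : R) : (forall t, 0 < t -> t <= 1 -> 0 <= 2 * t * A + t ^+ 2 * Q) -> 0 <= A.
Proof.
move=> h; rewrite leNgt; apply/negP => A0.
pose Q1 := `|Q| + 1; have Q10 : 0 < Q1 by rewrite ltr_pwDr.
pose t := Num.min 1 (- A / Q1).
have t0 : 0 < t by rewrite lt_min ltr01 divr_gt0// oppr_gt0.
have t1 : t <= 1 by rewrite ge_min lexx.
have tQ : t * Q <= - A.
  have : t <= - A / Q1 by rewrite ge_min lexx orbT.
  rewrite ler_pdivlMr//; apply: le_trans; rewrite ler_wpM2l ?(ltW t0)//.
  by rewrite (le_trans (ler_norm Q))// lerDl.
have := h t t0 t1.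
have -> : 2 * t * A + t ^+ 2 * Q = t * (2 * A + t * Q) by ring.
by rewrite pmulr_rge0//; lra.
Qed.

(* Gordan's alternative, from the point of minimal norm of a polytope. *)
Lemma gordan (J K : finType) (p : J -> K -> R) (j0 : J) :
  (exists l : J -> R, [/\ forall j, 0 <= l j, \sum_j l j = 1 &
     forall k, \sum_j l j * p j k = 0]) \/
  (exists v : K -> R, forall j, 0 < \sum_k v k * p j k).
Proof.
pose N := #|J|; pose l (x : 'rV[R]_N) j := x ord0 (enum_rank j).
have suml (F : J -> R) (x : 'rV[R]_N) :
    \sum_j l x j * F j = \sum_i x ord0 i * F (enum_val i).
  rewrite (reindex (enum_val : 'I_N -> J)); last first.
    by exists enum_rank => i _; rewrite ?enum_valK ?enum_rankK.
  by apply: eq_bigr => i _; rewrite /l enum_valK.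
pose S : set 'rV[R]_N := [set x | (forall i, 0 <= x ord0 i) /\ \sum_i x ord0 i = 1].
pose y (x : 'rV[R]_N) k := \sum_i x ord0 i * p (enum_val i) k.
pose Phi (x : 'rV[R]_N) := - \sum_k y x k ^+ 2.
have Sx1 x i : S x -> `|x ord0 i| <= 1.
  move=> [x0 <-]; rewrite ger0_norm//.
  by rewrite (bigD1 i)//= lerDl sumr_ge0.
have Sc : compact S.
  apply: bounded_closed_compact.
    exists 1; split; first exact: num_real.
    move=> M M1 x Sx /=; apply: (@le_trans _ _ 1); last exact: ltW.
    rewrite /Num.norm/= mx_normrE; apply: bigmax_le => // -[i j] _ /=.
    by rewrite (ord1 i); exact: Sx1.
  have -> : S = (\bigcap_(i in setT) [set x : 'rV[R]_N | 0 <= x ord0 i]) `&`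
      ((fun x : 'rV[R]_N => \sum_i x ord0 i) @^-1` [set 1]).
    by apply/seteqP; split => x /= [h1 h2]; split => // i; [move=> _|]; exact: h1.
  apply: closedI.
    apply: closed_bigI => i _.
    rewrite (_ : [set x : 'rV[R]_N | _] = (fun x : 'rV[R]_N => x ord0 i) @^-1` [set r | 0 <= r])//.
    apply: closed_comp => [x _|]; [exact: coord_continuous|exact: closed_ge].
  apply: closed_comp => [x _|]; last exact: closed_eq.
  apply: (@cvg_bigsum R _ (nbhs x)) => i; exact: coord_continuous.
have S0 : S !=set0.
  exists (delta_mx ord0 (enum_rank j0)); split => [i|]; first by rewrite mxE.
  rewrite (bigD1 (enum_rank j0))//= mxE !eqxx big1 ?addr0// => i ij.
  by rewrite mxE (negbTE ij) andbF.
have Phic : continuous Phi.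
  have key x (F : set_system 'rV[R]_N) : Filter F ->
      (forall i, (z : 'rV[R]_N) ord0 i @[z --> F] --> (x : 'rV[R]_N) ord0 i) ->
      Phi z @[z --> F] --> Phi x.
    move=> FF hx; apply: cvgN; apply: cvg_bigsum => k.
    have yc : y z k @[z --> F] --> y x k by apply: cvg_bigsum => i; exact: cvgMl.
    exact: cvgM.
  by move=> x; apply: (key x (nbhs x)) => i; exact: coord_continuous.
have [x xS xmax] := EVT_max_rV S0 Sc (continuous_subspaceT Phic).
rewrite inE in xS; case: (xS) => x0 x1.
have [y0|/eqP y0] := eqVneq (\sum_k y x k ^+ 2) 0.
  left; exists (l x); split=> [j||k]; first exact: x0.
    by rewrite -x1 -[RHS](eq_bigr _ (fun i _ => mulr1 _)) -(suml (fun=> 1)); apply: eq_bigr => j _; rewrite mulr1.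
  rewrite suml; apply/eqP; rewrite -sqrf_eq0; apply/eqP.
  apply: (psumr_eq0P _ y0) => // i _; exact: sqr_ge0.
right; exists (y x) => j.
have ypos : 0 < \sum_k y x k ^+ 2.
  by rewrite lt0r sumr_ge0 ?andbT//; [exact/eqP|move=> k _; exact: sqr_ge0].
apply: (lt_le_trans ypos); rewrite -subr_ge0 -sumrB.
(* Moving [x] towards the vertex [j] cannot decrease the norm of [y]; the term of order [t] gives
   [y . (p j - y) >= 0]. *)
apply: (@first_order _ (\sum_k (p j k - y x k) ^+ 2)) => t t0 t1.
pose xt : 'rV[R]_N := (1 - t) *: x + t *: delta_mx ord0 (enum_rank j).
have St : S xt.
  split=> [i|]; first by rewrite !mxE addr_ge0 ?mulr_ge0 ?subr_ge0// ltW.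
  under eq_bigr do rewrite !mxE; rewrite big_split/= -!mulr_sumr x1 mulr1.
  rewrite (bigD1 (enum_rank j))//= eqxx big1 ?addr0 ?mulr1 ?subrK// => i ij.
  by rewrite (negbTE ij).
have yt k : y xt k = y x k + t * (p j k - y x k).
  rewrite /y; under eq_bigr do rewrite !mxE mulrDl -!mulrA.
  rewrite big_split/= -!mulr_sumr.
  have -> : \sum_i ((ord0 == ord0 :> 'I_1) && (i == enum_rank j))%:R * p (enum_val i) k = p j k.
    rewrite (bigD1 (enum_rank j))//= eqxx big1 ?addr0 ?mul1r ?enum_rankK// => i ij.
    by rewrite (negbTE ij) mul0r.
  ring.
have := xmax xt; rewrite inE => /(_ St); rewrite /Phi lerN2 -subr_ge0 -sumrB.
have -> : \sum_k (y xt k ^+ 2 - y x k ^+ 2) =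
    \sum_k (2 * t * (y x k * p j k - y x k ^+ 2) + t ^+ 2 * (p j k - y x k) ^+ 2).
  by apply: eq_bigr => k _; rewrite yt; ring.
by rewrite big_split/= -!mulr_sumr.
Qed.

End gordan.

Section duality.
Context {R : realType} {I : finType}.
Variables (a b : I -> R) (d : I -> I -> R) (c : R) (i0 : I).
Hypothesis a0 : forall i, 0 <= a i.
Hypothesis b0 : forall i, 0 <= b i.
Hypothesis a1 : \sum_i a i = 1.
Hypothesis d0 : forall i, d i i = 0.
Hypothesis dT : forall i j k, d i k <= d i j + d j k.
Hypothesis dual : forall phi : I -> R, (forall i j, phi i - phi j <= d i j) ->
  \sum_i phi i * (a i - b i) <= c.

(* Apply Gordan's alternative to the vectors formed by the row and column sums of
   the unit mass at [(k, l)], less [a] and [b], and of its cost, less [c], together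
   with a slack vector for the cost.  The second alternative is a pair of
   potentials [r], [s]; the transform [u k = min_l (e d k l + s l)] turns it into
   one [d]-Lipschitz potential. *)
Lemma finite_kantorovich : exists pi : I -> I -> R,
  [/\ forall k l, 0 <= pi k l, forall k, \sum_l pi k l = a k,
      forall l, \sum_k pi k l = b l & \sum_k \sum_l pi k l * d k l <= c].
Proof.
pose p (j : (I * I) + 'I_1) (q : (I + I) + 'I_1) : R := match j, q with
  | inl (k, l), inl (inl i) => (k == i)%:R - a i
  | inl (k, l), inl (inr i) => (l == i)%:R - b i
  | inl (k, l), inr _ => d k l - c
  | inr _, inl _ => 0
  | inr _, inr _ => 1
  end.
have sumJ (F : (I * I) + 'I_1 -> R) :
    \sum_j F j = \sum_k \sum_l F (inl (k, l)) + F (inr ord0).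
  by rewrite big_sumType/= big_ord1 pair_bigA/=; congr (_ + _); apply: eq_bigr => -[].
have pick (F : I -> R) (k : I) : \sum_i (k == i)%:R * F i = F k.
  rewrite (bigD1 k)//= eqxx mul1r big1 ?addr0// => i ik.
  by rewrite eq_sym (negbTE ik) mul0r.
have [[l [l0 l1 lp]]|[v hv]] := gordan p (inr ord0).
  pose m k i := l (inl (k, i)); pose th := l (inr ord0).
  pose w := \sum_k \sum_i m k i.
  have w0 : 0 <= w by apply: sumr_ge0 => k _; apply: sumr_ge0 => i _; exact: l0.
  have wth : w + th = 1 by rewrite -l1 sumJ.
  have wE (x : R) : w * x = \sum_k \sum_j m k j * x.
    by rewrite /w mulr_suml; apply: eq_bigr => k _; rewrite mulr_suml.
  have hr i : \sum_j m i j = w * a i.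
    have h := lp (inl (inl i)); rewrite sumJ/= mulr0 addr0 in h.
    rewrite wE; apply/esym/subr0_eq.
    have <- : \sum_k \sum_j m k j * (k == i)%:R = \sum_j m i j.
      rewrite (bigD1 i)//= eqxx [X in _ + X]big1 => [|k ki].
        by rewrite addr0; apply: eq_bigr => j _; rewrite mulr1.
      by rewrite big1// => j _; rewrite (negbTE ki) mulr0.
    apply: oppr_inj; rewrite oppr0 opprB -[RHS]h -sumrB; apply: eq_bigr => k _.
    by rewrite -sumrB; apply: eq_bigr => j _; rewrite mulrBr.
  have hc i : \sum_k m k i = w * b i.
    have h := lp (inl (inr i)); rewrite sumJ/= mulr0 addr0 in h.
    rewrite wE; apply/esym/subr0_eq.
    have <- : \sum_k \sum_j m k j * (j == i)%:R = \sum_k m k i.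
      apply: eq_bigr => k _; rewrite (bigD1 i)//= eqxx mulr1 big1 ?addr0// => j ji.
      by rewrite (negbTE ji) mulr0.
    apply: oppr_inj; rewrite oppr0 opprB -[RHS]h -sumrB; apply: eq_bigr => k _.
    by rewrite -sumrB; apply: eq_bigr => j _; rewrite mulrBr.
  have hd : \sum_k \sum_i m k i * d k i + th = w * c.
    have h := lp (inr ord0); rewrite sumJ/= mulr1 in h.
    rewrite wE; apply: subr0_eq; rewrite -[RHS]h addrAC -/th; congr (_ + _).
    rewrite -sumrB; apply: eq_bigr => k _; rewrite -sumrB; apply: eq_bigr => j _.
    by rewrite mulrBr.
  (* If the plan had no mass, the cost equation would give [th = 0], against [w + th = 1]. *)
  have wp : 0 < w.
    rewrite lt0r w0 andbT; apply/eqP => w00.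
    have mk0 k i : m k i = 0.
      have h1 := psumr_eq0P (fun k _ => sumr_ge0 _ (fun i _ => l0 (inl (k, i)))) w00.
      exact: (psumr_eq0P (fun i _ => l0 (inl (k, i))) (h1 k isT)).
    move: hd wth; rewrite w00 mul0r add0r big1 ?add0r => [->/eqP|k _].
      by rewrite eq_sym oner_eq0.
    by rewrite big1// => i _; rewrite mk0 mul0r.
  exists (fun k i => m k i / w); split.
  - by move=> k i; apply: divr_ge0 => //; exact: l0.
  - by move=> k; rewrite -mulr_suml hr mulrAC divff ?gt_eqF// mul1r.
  - by move=> i; rewrite -mulr_suml hc mulrAC divff ?gt_eqF// mul1r.
  - have -> : \sum_k \sum_i m k i / w * d k i = (\sum_k \sum_i m k i * d k i) / w.
      rewrite mulr_suml; apply: eq_bigr => k _; rewrite mulr_suml.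
      by apply: eq_bigr => i _; rewrite mulrAC.
    by rewrite ler_pdivrMr// [leRHS]mulrC -hd lerDl; exact: l0.
exfalso.
pose r k := v (inl (inl k)); pose s k := v (inl (inr k)); pose e := v (inr ord0).
have sumK (F : (I + I) + 'I_1 -> R) : \sum_q F q =
    \sum_i F (inl (inl i)) + \sum_i F (inl (inr i)) + F (inr ord0).
  by rewrite !big_sumType/= big_ord1.
have e0 : 0 < e.
  have := hv (inr ord0); rewrite sumK/= mulr1 big1 ?add0r; last by move=> i _; rewrite mulr0.
  by rewrite big1 ?add0r// => i _; rewrite mulr0.
pose m := \sum_i r i * a i + \sum_i s i * b i + e * c.
have hkl k i : m < r k + s i + e * d k i.
  have := hv (inl (k, i)); rewrite sumK/=.
  under eq_bigr do rewrite mulrBr [v _ * _%:R]mulrC.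
  under [X in _ + X + _]eq_bigr do rewrite mulrBr [v _ * _%:R]mulrC.
  by rewrite !sumrB !pick -/e -/(r k) -/(s i) /m; move: (\sum_i _) (\sum_i _) => x y; lra.
have /choice[L hL] k : exists i, forall i', e * d k i + s i <= e * d k i' + s i'.
  case: (@arg_minP _ R I i0 xpredT (fun i => e * d k i + s i) isT) => i _ hi.
  by exists i => i'; exact: hi.
pose u k := e * d k (L k) + s (L k).
have uL i j : u i - u j <= e * d i j.
  have h1 := hL i (L j); rewrite -/(u i) in h1.
  have := ler_wpM2l (ltW e0) (dT i j (L j)); rewrite mulrDr; move: h1; rewrite /u; lra.
have udual : \sum_i u i * (a i - b i) <= e * c.
  have := dual (phi := fun i => e^-1 * u i).
  have -> : \sum_i e^-1 * u i * (a i - b i) = e^-1 * \sum_i u i * (a i - b i).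
    by rewrite mulr_sumr; apply: eq_bigr => i _; rewrite mulrA.
  rewrite mulrC ler_pdivrMr// mulrC; apply => i j.
  by rewrite -mulrBr mulrC ler_pdivrMr// mulrC.
have su k : u k <= s k by have := hL k k; rewrite d0 mulr0 add0r.
have ru k : 0 < r k - m + u k by have := hkl k (L k); rewrite /u; lra.
have h1 : 0 < \sum_k (r k - m + u k) * a k.
  rewrite lt0r sumr_ge0 ?andbT; last by move=> k _; rewrite mulr_ge0// ltW.
  apply/eqP => h; have ak k : a k = 0.
    have := psumr_eq0P (fun k _ => mulr_ge0 (ltW (ru k)) (a0 k)) h (i := k) isT.
    by move/eqP; rewrite mulf_eq0 gt_eqF//= => /eqP.
  by have := a1; rewrite big1// => /eqP; rewrite eq_sym oner_eq0.
have h2 : 0 <= \sum_k (s k - u k) * b k.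
  by rewrite sumr_ge0// => k _; rewrite mulr_ge0// subr_ge0.
have h3 : \sum_k (r k - m + u k) * a k = \sum_k r k * a k - m + \sum_k u k * a k.
  have ha (x : R) : \sum_k x * a k = x by rewrite -mulr_sumr a1 mulr1.
  by rewrite -[X in _ - X + _]ha -sumrB -big_split/=; apply: eq_bigr => k _; ring.
have h4 : \sum_k (s k - u k) * b k = \sum_k s k * b k - \sum_k u k * b k.
  by rewrite -sumrB; apply: eq_bigr => k _; ring.
have h5 : \sum_i u i * (a i - b i) = \sum_k u k * a k - \sum_k u k * b k.
  by rewrite -sumrB; apply: eq_bigr => k _; ring.
move: h1 h2 udual; rewrite h3 h4 h5 /m.
move: (\sum_k u k * a k) (\sum_k u k * b k) (\sum_i r i * a i) (\sum_i s i * b i).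
by move=> x1 x2 x3 x4; lra.
Qed.

End duality.

(** * Couplings assembled from finite transport plans *)

Section simple_integral.
Context d (T : measurableType d) (R : realType) (m : {measure set T -> \bar R}).
Context (J : finType) (g : T -> J).
Hypothesis mg : forall j, measurable (g @^-1` [set j]).
Local Open Scope ereal_scope.

Lemma measurable_fun_fin (h : J -> R) : measurable_fun setT (h \o g).
Proof.
rewrite (_ : h \o g = fun x => \sum_j h j * \1_(g @^-1` [set j]) x)%R.
  apply: measurable_sum => j; apply: measurable_funM; first exact: measurable_cst.
  exact: measurable_indic.
apply/funext => x /=; rewrite (bigD1 (g x))//= indicE mem_set// mulr1.
by rewrite big1 ?addr0// => j jx; rewrite indicE memNset ?mulr0//= => gj; move: jx; rewrite gj eqxx.
Qed.

Lemma ge0_integral_fin (D : set T) (h : J -> R) : measurable D ->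
  (forall j, (0 <= h j)%R) ->
  \int[m]_(x in D) (h (g x))%:E = \sum_j (h j)%:E * m (g @^-1` [set j] `&` D).
Proof.
move=> mD h0.
have -> : \int[m]_(x in D) (h (g x))%:E =
    \int[m]_(x in D) \sum_j (h j)%:E * (\1_(g @^-1` [set j]) x)%:E.
  apply: eq_integral => x _; rewrite (bigD1 (g x))//= indicE mem_set// mule1.
  by rewrite big1 ?adde0// => j jx; rewrite indicE memNset ?mule0//= => gj; move: jx; rewrite gj eqxx.
rewrite ge0_integral_sum//.
- apply: eq_bigr => j _; rewrite ge0_integralZl_EFin//.
  + by rewrite integral_indic.
  + by apply/measurable_EFinP; exact: measurable_indic.
- move=> j; apply/measurable_EFinP; apply: measurable_funM; first exact: measurable_cst.
  exact: measurable_indic.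
- by move=> j x _; rewrite -EFinM lee_fin mulr_ge0.
Qed.

Lemma sum_measure_fin (D : set T) : measurable D -> \sum_j m (g @^-1` [set j] `&` D) = m D.
Proof.
move=> mD; have := @ge0_integral_fin D (fun=> 1%R) mD (fun=> ler01).
by rewrite integral_cst// mul1e => ->; apply: eq_bigr => j _; rewrite mul1e.
Qed.

End simple_integral.

Section glue.
Context d1 d2 (T1 : measurableType d1) (T2 : measurableType d2) (R : realType).
Variables (mu : probability T1 R) (nu : probability T2 R).
Context (I : finType) (g1 : T1 -> I) (g2 : T2 -> I).
Hypothesis mg1 : forall i, measurable (g1 @^-1` [set i]).
Hypothesis mg2 : forall i, measurable (g2 @^-1` [set i]).
Variable q : I -> I -> R.
Hypothesis q0 : forall i j, 0 <= q i j.
Let a i := fine (mu (g1 @^-1` [set i])).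
Let b i := fine (nu (g2 @^-1` [set i])).
Hypothesis qa : forall i, \sum_j q i j = a i.
Hypothesis qb : forall j, \sum_i q i j = b j.

(** Density of the coupling with respect to [mu \x nu]. On null cells the quotient is 0 by
    convention, in agreement with [q i j], which the marginal conditions force to vanish there. *)
Let c i j := q i j / (a i * b j).

Let a0 i : 0 <= a i. Proof. exact: fine_ge0. Qed.
Let b0 i : 0 <= b i. Proof. exact: fine_ge0. Qed.
Let c0 i j : 0 <= c i j. Proof. exact: (divr_ge0 (q0 i j) (mulr_ge0 (a0 i) (b0 j))). Qed.

Let qa0 i j : a i = 0 -> q i j = 0.
Proof. by rewrite -qa => h; exact: (psumr_eq0P (fun j _ => q0 i j) h (i := j) isT). Qed.

Let qb0 i j : b j = 0 -> q i j = 0.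
Proof. by rewrite -qb => h; exact: (psumr_eq0P (fun i _ => q0 i j) h (i := i) isT). Qed.

Let cab i j : c i j * a i * b j = q i j.
Proof.
rewrite /c; have [h|ha] := eqVneq (a i) 0; first by rewrite (qa0 j h) !mul0r.
have [h|hb] := eqVneq (b j) 0; first by rewrite (qb0 i h) !mul0r.
by rewrite -mulrA divfK// mulf_neq0.
Qed.

Let ca (x : I -> R) : (forall i, 0 <= x i <= a i) ->
  \sum_i \sum_j c i j * x i * b j = \sum_i x i.
Proof.
move=> xa; apply: eq_bigr => i _; have [h|ha] := eqVneq (a i) 0.
  have := xa i; rewrite h => /le_anti <-; rewrite big1// => j _; by rewrite mulr0 mul0r.
have e j : c i j * x i * b j = x i / a i * q i j by rewrite -cab; field.
rewrite (eq_bigr _ (fun j _ => e j)) -mulr_sumr qa divfK//.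
Qed.

Let cb (x : I -> R) : (forall i, 0 <= x i <= b i) ->
  \sum_i \sum_j c i j * a i * x j = \sum_j x j.
Proof.
move=> xb; rewrite exchange_big/=; apply: eq_bigr => j _; have [h|hb] := eqVneq (b j) 0.
  have := xb j; rewrite h => /le_anti <-; rewrite big1// => i _; by rewrite mulr0.
have -> : x j = x j / b j * b j by rewrite divfK.
under eq_bigr => i _ do rewrite mulrCA cab.
by rewrite -mulr_sumr qb.
Qed.

Let G (z : T1 * T2) := (g1 z.1, g2 z.2).

Let GE i j : G @^-1` [set (i, j)] = (g1 @^-1` [set i]) `*` (g2 @^-1` [set j]).
Proof. by apply/seteqP; split => -[x y] /=; [case=> <- <-|case=> <- <-]. Qed.

Let mG p : measurable (G @^-1` [set p]).
Proof. by case: p => i j; rewrite GE; exact: measurableX. Qed.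

Let aE i : mu (g1 @^-1` [set i]) = (a i)%:E.
Proof. by rewrite /a fineK// fin_num_measure. Qed.

Let rect (B : set T1) (B' : set T2) (h : I -> I -> R) : measurable B -> measurable B' ->
  (forall i j, 0 <= h i j) ->
  (\int[mu \x nu]_(z in B `*` B') (h (g1 z.1) (g2 z.2))%:E =
  (\sum_i \sum_j h i j * fine (mu (g1 @^-1` [set i] `&` B)) *
     fine (nu (g2 @^-1` [set j] `&` B')))%:E)%E.
Proof.
move=> mB mB' h0.
rewrite (@ge0_integral_fin _ _ _ (mu \x nu)%E _ G mG _ (fun p => h p.1 p.2) (measurableX mB mB'))//.
rewrite pair_bigA/= -sumEFin; apply: eq_bigr => -[i j] _ /=.
rewrite GE -setXI product_measure1E; [|exact: measurableI|exact: measurableI].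
by rewrite !EFinM !fineK ?muleA// fin_num_measure//; exact: measurableI.
Qed.

Let rectT (h : I -> I -> R) : (forall i j, 0 <= h i j) ->
  (\int[mu \x nu]_z (h (g1 z.1) (g2 z.2))%:E = (\sum_i \sum_j h i j * a i * b j)%:E)%E.
Proof.
move=> h0; rewrite -setXTT rect//; congr EFin.
by apply: eq_bigr => i _; apply: eq_bigr => j _; rewrite !setIT.
Qed.

Let fineI1 (B : set T1) i : measurable B -> 0 <= fine (mu (g1 @^-1` [set i] `&` B)) <= a i.
Proof.
move=> mB; rewrite fine_ge0//=; apply: fine_le; rewrite ?fin_num_measure//.
- exact: measurableI.
- exact: measureIl.
Qed.

Let fineI2 (B : set T2) i : measurable B -> 0 <= fine (nu (g2 @^-1` [set i] `&` B)) <= b i.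
Proof.
move=> mB; rewrite fine_ge0//=; apply: fine_le; rewrite ?fin_num_measure//.
- exact: measurableI.
- exact: measureIl.
Qed.

(* The coupling is the mixture, with weights [q i j], of the products of the
   conditionings of [mu] and [nu] to the cells [i] and [j]. *)
Lemma glue_coupling : exists P : probability (T1 * T2)%type R,
  [/\ forall B, measurable B -> P (fst @^-1` B) = mu B,
      forall B, measurable B -> P (snd @^-1` B) = nu B &
      forall h : I -> I -> R, (forall i j, 0 <= h i j) ->
        (\int[P]_z (h (g1 z.1) (g2 z.2))%:E = (\sum_i \sum_j q i j * h i j)%:E)%E].
Proof.
pose r (z : T1 * T2) := c (g1 z.1) (g2 z.2).
have mr : measurable_fun setT r.
  exact: (@measurable_fun_fin _ _ R _ G mG (fun p => c p.1 p.2)).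
have r0 z : 0 <= r z by exact: c0.
have sumq : \sum_i \sum_j q i j = 1.
  under eq_bigr do rewrite qa.
  have h := etrans (@sum_measure_fin _ _ R mu _ g1 mg1 setT measurableT) (probability_setT mu).
  apply: EFin_inj; rewrite -h -sumEFin.
  by apply: eq_bigr => i _; rewrite setIT; exact: esym (aE i).
have [|P PE] := @density_probability _ _ R (mu \x nu)%E r mr r0.
  rewrite rectT//; congr EFin; rewrite -sumq.
  by apply: eq_bigr => i _; apply: eq_bigr => j _; rewrite cab.
exists P; split=> [B mB|B mB|h h0].
- have -> : fst @^-1` B = B `*` [set: T2] by apply/seteqP; split => -[x y] //= [].
  rewrite PE; last exact: measurableX.
  rewrite rect//; under eq_bigr => i _ do under eq_bigr => j _ do rewrite setIT -/(b j).
  rewrite ca; last by move=> i; exact: fineI1.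
  rewrite -(sum_measure_fin mu mg1 mB) -sumEFin; apply: eq_bigr => i _.
  by rewrite fineK// fin_num_measure//; exact: measurableI.
- have -> : snd @^-1` B = [set: T1] `*` B by apply/seteqP; split => -[x y] //= [].
  rewrite PE; last exact: measurableX.
  rewrite rect//; under eq_bigr => i _ do under eq_bigr => j _ do rewrite setIT -/(a i).
  rewrite cb; last by move=> i; exact: fineI2.
  rewrite -(sum_measure_fin nu mg2 mB) -sumEFin; apply: eq_bigr => i _.
  by rewrite fineK// fin_num_measure//; exact: measurableI.
- rewrite (ge0_integral_density mr r0 PE); last 2 first.
  + by apply/measurable_EFinP; exact: (@measurable_fun_fin _ _ R _ G mG (fun p => h p.1 p.2)).
  + by move=> z; rewrite lee_fin.
  under eq_integral => z _ do rewrite -EFinM.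
  rewrite (rectT (h := fun i j => h i j * c i j)); last by move=> i j; exact: (mulr_ge0 (h0 i j) (c0 i j)).
  congr EFin; apply: eq_bigr => i _; apply: eq_bigr => j _.
  by rewrite -[in RHS]cab; ring.
Qed.

End glue.

Section kantorovich_rubinstein.
Context {R : realType} {n : nat}.
Local Notation E := 'rV[R]_n.
Variables (mu nu : probability E R) (c : R).
Hypothesis dual : forall f : E -> R, lip 1 f -> (forall x, 0 <= f x) ->
  (\int[mu]_x (f x)%:E <= \int[nu]_x (f x)%:E + c%:E)%E.

(** McShane's extension [min_i (phi i + |x - p i|)], raised by [K] to be nonnegative as [dual]
    demands; the constant cancels between two probability measures. *)
Lemma mcshane (I : finType) (i0 : I) (p : I -> E) (phi : I -> R) :
  (forall i j, phi i - phi j <= ⟦p i - p j⟧) ->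
  exists (f : E -> R) (K : R), [/\ lip 1 f, forall x, 0 <= f x & forall i, f (p i) = phi i + K].
Proof.
move=> phiL; pose K := \sum_i `|phi i|.
have K0 i : 0 <= phi i + K.
  rewrite addrC /K (bigD1 i)//= addrAC addr_ge0 ?sumr_ge0//.
  by have := ler_norm (- phi i); rewrite normrN; lra.
have /choice[L hL] (x : E) : exists i, forall j, phi i + K + ⟦x - p i⟧ <= phi j + K + ⟦x - p j⟧.
  case: (@arg_minP _ R I i0 xpredT (fun i => phi i + K + ⟦x - p i⟧) isT) => i _ hi.
  by exists i => j; exact: hi.
exists (fun x => phi (L x) + K + ⟦x - p (L x)⟧), K; split=> [x y|x|i].
- have h (x' y' : E) : phi (L y') + K + ⟦y' - p (L y')⟧ - (phi (L x') + K + ⟦x' - p (L x')⟧) <= ⟦y' - x'⟧.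
    have := hL y' (L x'); have := ler_enorm_dist y' x' (p (L x')); lra.
  by rewrite mul1r ler_norml h andbT lerNl opprB (le_trans (h y x))// enormB.
- by rewrite addr_ge0 ?enorm_ge0.
- have := hL (p i) i; rewrite subrr enorm0 addr0; have := phiL i (L (p i)); lra.
Qed.

(** Passing between a potential on the points and its extension costs [k] under each of [mu] and
    [nu]; spreading the finite plan over the cells costs [2 k] more. Only the mean distance to the
    points is controlled, as the cells may be unbounded. *)
Lemma W1_le_discretization (I : finType) (i0 : I) (p : I -> E) (g : E -> I) (D : E -> R) (k : R) :
  (forall i, measurable (g @^-1` [set i])) -> measurable_fun setT D ->
  (forall x, ⟦x - p (g x)⟧ <= D x) -> 0 <= k ->
  (\int[mu]_x (D x)%:E <= k%:E)%E -> (\int[nu]_x (D x)%:E <= k%:E)%E ->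
  (W1 mu nu <= (c + 4 * k)%:E)%E.
Proof.
move=> mg mD gD k0 Dmu Dnu.
have D0 x : 0 <= D x by rewrite (le_trans _ (gD x))// enorm_ge0.
pose a i := fine (mu (g @^-1` [set i])); pose b i := fine (nu (g @^-1` [set i])).
have sumf (m : probability E R) (h : I -> R) : (forall i, 0 <= h i) ->
    (\int[m]_x (h (g x))%:E = (\sum_i h i * fine (m (g @^-1` [set i])))%:E)%E.
  move=> h0; rewrite (ge0_integral_fin m mg measurableT h0) -sumEFin.
  by apply: eq_bigr => i _; rewrite setIT EFinM fineK// fin_num_measure.
have sum1 (m : probability E R) : \sum_i fine (m (g @^-1` [set i])) = 1.
  have h := etrans (sum_measure_fin m mg measurableT) (probability_setT m).
  apply: EFin_inj; rewrite -h -sumEFin.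
  by apply: eq_bigr => i _; rewrite setIT fineK// fin_num_measure.
have mED : measurable_fun setT (EFin \o D) by exact/measurable_EFinP.
have mh (h : I -> R) : measurable_fun setT (EFin \o (h \o g)).
  by apply/measurable_EFinP; exact: measurable_fun_fin.
have [|||||phi phiL|q [q0 qa qb qc]] :=
  @finite_kantorovich R I a b (fun i j => ⟦p i - p j⟧) (c + 2 * k) i0.
- by move=> i; exact: fine_ge0.
- by move=> i; exact: fine_ge0.
- exact: sum1.
- by move=> i; rewrite subrr enorm0.
- by move=> i j l; exact: ler_enorm_dist.
- have [f [K [fL f0 fp]]] := mcshane i0 phiL.
  have mf : measurable_fun setT (EFin \o f) by apply/measurable_EFinP; exact: measurable_lip fL.
  have fpD x : `|f (p (g x)) - f x| <= D x.
    by rewrite (le_trans (fL _ _))// mul1r enormB.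
  have fp1 x : f (p (g x)) <= f x + D x by rewrite -lerBlDl (le_trans (ler_norm _)).
  have fp2 x : f x <= f (p (g x)) + D x by rewrite -lerBlDl (le_trans (ler_norm _))// distrC.
  have intD (m : probability E R) (u v : E -> R) : measurable_fun setT (EFin \o u) ->
      measurable_fun setT (EFin \o v) -> (forall x, 0 <= u x) -> (forall x, 0 <= v x) ->
      (forall x, u x <= v x + D x) ->
      (\int[m]_x (u x)%:E <= \int[m]_x (v x)%:E + \int[m]_x (D x)%:E)%E.
    move=> mu' mv u0 v0 uv; rewrite -ge0_integralD//; try by move=> x _; rewrite lee_fin.
    apply: ge0_le_integral => //; try by move=> x _; rewrite ?lee_fin ?adde_ge0 ?lee_fin.
    exact: emeasurable_funD.
  have h1 := intD mu (fun x => f (p (g x))) f (mh (f \o p)) mf (fun x => f0 _) f0 fp1.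
  have h2 := intD nu f (fun x => f (p (g x))) mf (mh (f \o p)) f0 (fun x => f0 _) fp2.
  rewrite (sumf mu (f \o p) (fun i => f0 _)) in h1.
  rewrite (sumf nu (f \o p) (fun i => f0 _)) in h2.
  have {h1 h2} : ((\sum_i (f \o p) i * a i)%:E <=
      (\sum_i (f \o p) i * b i)%:E + k%:E + c%:E + k%:E)%E.
    apply: le_trans h1 _; apply: leeD Dmu.
    apply: (le_trans (dual fL f0)); apply: leeD; last exact: lexx.
    by apply: le_trans h2 _; exact: leeD2l.
  rewrite -!EFinD lee_fin.
  have sE (x : I -> R) : \sum_i x i = 1 -> \sum_i (f \o p) i * x i = \sum_i phi i * x i + K.
    move=> x1; rewrite -[K in RHS]mulr1 -x1 mulr_sumr -big_split/=.
    by apply: eq_bigr => i _; rewrite fp mulrDl.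
  rewrite (sE a (sum1 mu)) (sE b (sum1 nu)).
  have -> : \sum_i phi i * (a i - b i) = \sum_i phi i * a i - \sum_i phi i * b i.
    by rewrite -sumrB; apply: eq_bigr => i _; rewrite mulrBr.
  move: (\sum_i phi i * a i) (\sum_i phi i * b i) => x y; lra.
have [P [P1 P2 Ph]] := glue_coupling mg mg q0 qa qb.
apply: (@le_trans _ _ (\int[P]_z (⟦z.1 - z.2⟧)%:E)%E).
  by apply: ereal_inf_lbound; exists P => // A mA; split; [exact: P1|exact: P2].
pose h i j := ⟦p i - p j⟧.
have m1 : measurable_fun setT (fun z : E * E => (D z.1)%:E).
  exact: (measurableT_comp mED measurable_fst).
have m2 : measurable_fun setT (fun z : E * E => (D z.2)%:E).
  exact: (measurableT_comp mED measurable_snd).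
have mhh : measurable_fun setT (fun z : E * E => (h (g z.1) (g z.2))%:E).
  apply/measurable_EFinP.
  apply: (@measurable_fun_fin _ _ R _ (fun z : E * E => (g z.1, g z.2)) _ (fun q => h q.1 q.2)).
  move=> [i j]; rewrite (_ : _ @^-1` _ = (g @^-1` [set i]) `*` (g @^-1` [set j])); first exact: measurableX.
  by apply/seteqP; split => -[x y] /=; [case=> <- <-|case=> <- <-].
have h0 i j : 0 <= h i j by exact: enorm_ge0.
apply: (@le_trans _ _ (\int[P]_z ((h (g z.1) (g z.2))%:E + (D z.1)%:E + (D z.2)%:E))%E).
  apply: ge0_le_integral => //.
  - by move=> z _; rewrite lee_fin enorm_ge0.
  - apply/measurable_EFinP; apply: (measurableT_comp measurable_enorm).
    apply: measurable_fun_rVP => i; under eq_fun do rewrite !mxE.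
    have mc := @measurable_coord _ R n i.
    by apply: measurable_funB; [exact: (measurableT_comp mc measurable_fst)|
      exact: (measurableT_comp mc measurable_snd)].
  - by apply: emeasurable_funD => //; exact: emeasurable_funD.
  - move=> [x y] _ /=; rewrite -!EFinD lee_fin /h.
    have := ler_enorm_dist x (p (g x)) y; have := ler_enorm_dist (p (g x)) (p (g y)) y.
    have := gD x; have := gD y; rewrite (enormB y); lra.
rewrite ge0_integralD//; last 3 first.
- by move=> z _; rewrite adde_ge0// lee_fin.
- exact: emeasurable_funD.
- by move=> z _; rewrite lee_fin.
rewrite ge0_integralD//; last 2 first.
- by move=> z _; rewrite lee_fin.
- by move=> z _; rewrite lee_fin.
rewrite Ph//.
have -> : (\int[P]_z (D z.1)%:E = \int[mu]_x (D x)%:E)%E.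
  rewrite -(@eq_measure_integral _ _ _ _ mu (pushforward P fst)); last by move=> A mA _; exact: P1.
  by rewrite ge0_integral_pushforward// => x _; rewrite lee_fin.
have -> : (\int[P]_z (D z.2)%:E = \int[nu]_x (D x)%:E)%E.
  rewrite -(@eq_measure_integral _ _ _ _ nu (pushforward P snd)); last by move=> A mA _; exact: P2.
  by rewrite ge0_integral_pushforward// => x _; rewrite lee_fin.
apply: (@le_trans _ _ ((c + 2 * k)%:E + k%:E + k%:E)%E).
  by apply: leeD => //; apply: leeD => //; rewrite lee_fin.
by rewrite -!EFinD lee_fin; lra.
Qed.

Fixpoint cell (M : nat) (x : E) : nat :=
  if M is M'.+1 then if ⟦x - pts M⟧ < ddist M' x then M else cell M' x else 0.

Lemma cell_le M x : (cell M x < M.+1)%N.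
Proof. by elim: M => [//|M IH] /=; case: ifP => // _; rewrite ltnW. Qed.

Lemma enorm_cell M x : ⟦x - pts (cell M x)⟧ = ddist M x.
Proof. by elim: M => [//|M IH]; rewrite /cell -/cell /ddist -/ddist; case: ltP. Qed.

Lemma measurable_cell M : measurable_fun setT (cell M).
Proof.
elim: M => [|M IH] /=; first exact: measurable_cst.
apply: measurable_fun_ifT => //; apply: measurable_fun_ltr.
  apply: (@measurable_lip R n 1) => x y.
  by rewrite mul1r (le_trans (ler_dist_enorm _ _))// opprB addrA subrK.
exact: measurable_lip (@ddist_lip _ _ M).
Qed.

Lemma W1_dual : mu.-integrable setT (EFin \o enorm) -> nu.-integrable setT (EFin \o enorm) ->
  (W1 mu nu <= c%:E)%E.
Proof.
move=> imu inu; apply/lee_addgt0Pr => e e0.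
have e4 : 0 < e / 4 by rewrite divr_gt0.
have hm (m : probability E R) : m.-integrable setT (EFin \o enorm) ->
    \forall M \near \oo, (\int[m]_x (ddist M x)%:E <= (e / 4)%:E)%E.
  move=> im.
  have iD M : m.-integrable setT (EFin \o ddist M).
    apply: (le_integrable measurableT _ _ im).
      by apply/measurable_EFinP; exact: measurable_lip (@ddist_lip _ _ M).
    by move=> x _; rewrite lee_fin !ger0_norm ?ddist_ge0 ?enorm_ge0 ?ddist_le_enorm.
  have := @Rintegral_cvg _ _ R m (@ddist R n) (fun=> 0) enorm
    (fun M => measurable_lip (@ddist_lip _ _ M)) (@ddist_cvg _ _) im
    (fun M x => ltac:(by rewrite ger0_norm ?ddist_ge0 ?ddist_le_enorm)).
  rewrite int_cst => /cvgrPdist_le /(_ _ e4); apply: filterS => M.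
  rewrite sub0r normrN => h; rewrite -[leLHS]fineK; last exact: integrable_fin_num (iD M).
  by rewrite lee_fin (le_trans _ h)// ler_norm.
have : \forall M \near \oo, (\int[mu]_x (ddist M x)%:E <= (e / 4)%:E)%E /\
    (\int[nu]_x (ddist M x)%:E <= (e / 4)%:E)%E.
  by apply: filterI; exact: hm.
case=> M _ /(_ M (leqnn M)) [h1 h2].
have -> : (c%:E + e%:E = (c + 4 * (e / 4))%:E)%E by rewrite -EFinD; congr EFin; field.
apply: (@W1_le_discretization 'I_M.+1 ord0 (fun i => pts i)
  (fun x => Ordinal (cell_le M x)) (ddist M)) => //.
- move=> i; rewrite (_ : _ @^-1` _ = cell M @^-1` [set nat_of_ord i]).
    by rewrite -[X in measurable X]setTI; exact: measurable_cell.
  by apply/seteqP; split=> x /=; [move=> <-|move=> h; exact/val_inj].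
- exact: measurable_lip (@ddist_lip _ _ M).
- by move=> x; rewrite enorm_cell.
- exact: ltW.
Qed.

End kantorovich_rubinstein.

(** * Conclusion *)

Section corollary.
Context {R : realType} {n : nat}.
Local Notation E := 'rV[R]_n.

Lemma variance_vr (mu : probability E R) V (F : E -> R) : glc mu V -> lip 1 F ->
  'V_mu[F] = (vr mu F)%:E.
Proof.
move=> muV FL; have tF := tame_lip FL.
have tG : tame (fun x => (F x - \int[mu]_y F y) ^+ 2).
  by apply: tameX; apply: tameB => //; exact: tame_cst.
rewrite /variance covariance.unlock unlock.
have h := integral_tame muV tG.
rewrite (int_sqrB muV _ tF) subrr expr0n addr0 in h.
by rewrite -h.
Qed.

End corollary.

Local Open Scope ereal_scope.

Theorem corollary1p4 (R : realType) :
  exists2 C : R, (0 < C)%R &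
    forall (n : nat) (V : 'rV[R]_n -> R) (mu : probability 'rV[R]_n R)
      (F : 'rV[R]_n -> R),
    (0 < n)%N ->
    twice_differentiable V ->
    (forall x, loewner_le 1%:M (hessian V x)) ->
    (forall A, measurable A ->
      mu A = \int[lebesgue_rV n]_(x in A) (expR (- V x))%:E) ->
    lipschitz1 F ->
    exists sigma p : 'rV[R]_n,
      [/\ enorm sigma = 1%R, (p <= sigma)%MS &
          W1 mu (tensor_sum (gauss_line sigma p) (marginal_perp sigma mu))
          <= C%:E * sqrte (('V_mu[F])^-1 - 1)].
Proof.
(* The 2 is the bound on the length of the rotation, the 40 the loss in [direction]. *)
have s0 : (0 < 2 * Num.sqrt 40 :> R)%R by rewrite mulr_gt0// sqrtr_gt0.
exists (2 * Num.sqrt 40)%R => // n V mu F n0 V2 hessV muD F1.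
have muV := glc_pot V2 hessV muD.
have FL : lip 1 F by move=> x y; rewrite mul1r; exact: F1.
have [sigma sigma1 hs] := direction V2 hessV muD n0.
(* [c *: sigma] is the projection of the mean of [mu] onto the line. *)
pose c := (\int[mu]_x dotrV sigma x)%R.
exists sigma, (c *: sigma); split => //; first exact: scalemx_sub.
pose d := (1 - vr mu (dotrV sigma))%R.
have d0 : (0 <= d)%R.
  have h := sm_lin sigma (0 : R); rewrite sigma1 in h.
  have := poincare_lc V2 hessV muD ler01 (lexx _) h; rewrite int_cst sigma1 expr1n.
  have -> : (fun x => dotrV sigma x + 0)%R = dotrV sigma by apply/funext => x; rewrite addr0.
  by rewrite /d subr_ge0.
have hW : W1 mu (tensor_sum (gauss_line sigma (c *: sigma)) (marginal_perp sigma mu))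
    <= (2 * Num.sqrt d)%:E.
  apply: W1_dual => [f fL f0||].
  - rewrite (int_tensor muV sigma1 ler01 fL f0) (integral_tame muV (tame_lip fL)).
    rewrite -EFinD lee_fin -lerBlDl.
    exact: (stein_lip muV (fun L B f w => @poincare_lc R n V V2 hessV mu muD L B f w) sigma1 fL).
  - exact: (tame_int muV (@tame_enorm R n)).
  - apply/integrableP; split; first by apply/measurable_EFinP; exact: measurable_enorm.
    under eq_integral => x _ do rewrite /= ger0_norm ?enorm_ge0//.
    have eL : lip 1 (@enorm R n) by move=> x y; rewrite mul1r; exact: ler_dist_enorm.
    rewrite (int_tensor muV sigma1 ler01 eL (@enorm_ge0 _ _)); exact: ltry.
apply: (le_trans hW); rewrite (variance_vr muV FL).
have dv := hs F FL; rewrite -/d in dv.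
have v0 := vr_ge0 muV (tame_lip FL).
clear hW hs; move: (vr mu F) d d0 dv v0 => v d d0 dv v0.
(* For zero variance the extended inverse is [+oo], and so is the bound. *)
have [->|v_neq0] := eqVneq v 0%R; first by rewrite inve0 /= gt0_muley// leey.
have vgt0 : (0 < v)%R by rewrite lt0r v_neq0.
rewrite inver (negbTE v_neq0) -EFinB /= -EFinM lee_fin -mulrA -sqrtrM//.
rewrite ler_wpM2l// ler_wsqrtr// (le_trans dv)// ler_wpM2l//.
have -> : (v^-1 - 1 = (1 - v) / v)%R by field.
have v1 : (0 <= 1 - v)%R by have := le_trans d0 dv; rewrite pmulr_rge0.
by rewrite ler_pdivlMr// ler_piMr// -subr_ge0.
Qed.
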